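(* Let $m>0$. The function $$t^{TM}(k,p):=\frac12\left(1+\frac{m^2+kp}{\epsilon(k)\epsilon(p)}\right)$$ is the kernel of the finite POL with causal time evolution (CT) $$T^{TM}=\frac12E^{NW}+\frac{m}{\sqrt2H}E^{NW}\frac{m}{\sqrt2H}+\sum_{i=1}^3\frac{P_i}{\sqrt2H}E^{NW}\frac{P_i}{\sqrt2H}$$ for the massive scalar boson of mass $m$.
   Context: Put $\epsilon(p)=\sqrt{m^2+|p|^2}$, $kp$ the Euclidean scalar product. The massive scalar boson (particle case) is described on $L^2(\mathbb{R}^3)$ (momentum space), on which $\tilde{\mathcal E}=ISU(2)$, the covering group of the Euclidean group, acts by $(U^{(0)}(b,B)\phi)(p)=e^{-ibp}\phi(B^{-1}\cdot p)$ and time translations act by $(V(t)\phi)(p)=e^{it\epsilon(p)}\phi(p)$. $H$ and $P_i$ are the multiplication operators by $\epsilon(p)$ and $p_i$. $E^{NW}=\mathcal{F}E^{can}\mathcal{F}^{-1}$ is the Newton-Wigner localization, $E^{can}(\Delta)$ being multiplication by $1_\Delta$ and $\mathcal{F}$ the unitary Fourier transformation with kernel $(2\pi)^{-3/2}e^{-ixy}$. A POL is a normalized positive operator valued measure $T$ on the Borel (equivalently Lebesgue measurable) sets of $\mathbb{R}^3$ ($T(\mathbb{R}^3)=I$) with $U^{(0)}(g)T(\Delta)U^{(0)}(g)^{-1}=T(g\cdot\Delta)$ for all $g\in\tilde{\mathcal E}$. A function $t$ on $(\mathbb{R}^3\setminus\{0\})^2$ is its kernel if for $\phi\in L^1\cap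 L^2$ and measurable $\Delta$ $$\langle\phi,T(\Delta)\phi\rangle=(2\pi)^{-3}\int_\Delta\int\int t(k,p)e^{i(p-k)x}\overline{\phi(k)}\phi(p)\,d^3k\,d^3p\,d^3x$$ (here $t$ measurable, positive definite, rotation invariant, $t(p,p)=1$). $T$ is finite if there are a finite dimensional unitary representation $D$ of $SU(2)$ on a Hilbert space $\mathcal{S}^{fin}$ and an isometry $j:L^2(\mathbb{R}^3)\to L^2(\mathbb{R}^3,\mathcal{S}^{fin})$ intertwining $U^{(0)}$ with $(D_{\tilde{\mathcal E}}(b,B)\varphi)(p)=e^{-ibp}D(B)\varphi(B^{-1}\cdot p)$ such that $T=j^*\mathcal{F}E^{can}\mathcal{F}^{-1}j$. $T$ has causal time evolution (CT) if $V(t)T(\Delta)V(t)^{-1}\le T(\Delta_t)$ for all measurable $\Delta\subset\mathbb{R}^3$ and all $t\in\mathbb{R}$, where $\Delta_t=\{y\in\mathbb{R}^3:\exists\,x\in\Delta,\ |y-x|\le|t|\}$. *)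

(* Defs.v *)
From HB Require Import structures.
From mathcomp Require Import all_boot all_order all_algebra.
From mathcomp Require Import sesquilinear spectral complex.
From mathcomp Require Import all_classical all_reals all_analysis.

Set Implicit Arguments.
Unset Strict Implicit.
Unset Printing Implicit Defensive.
Import Order.TTheory GRing.Theory Num.Theory.
Import numFieldNormedType.Exports.

Local Open Scope classical_set_scope.
Local Open Scope ring_scope.
Local Open Scope complex_scope.
Local Open Scope sesquilinear_scope.

(* Conventions. A vector of L^2 is represented by a measurable function, two
   representatives being identified when they are equal almost everywhere; an
   operator is a function on representatives, constrained on square-integrable
   ones only. Scalar products are antilinear in the first argument. *)

Section Lebesgue3.
Variable R : realType.

Definition borel_lebesgue3 :=
  (@lebesgue_measure R \x @lebesgue_measure R \x @lebesgue_measure R)%E.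

HB.instance Definition _ := Measure.on borel_lebesgue3.

End Lebesgue3.

(* R^3 with the sigma-algebra of all Lebesgue measurable sets. Borel sets would
   not do for causality: the neighbourhood Delta_t of a Borel set Delta need not
   be Borel, but it is always Lebesgue measurable. *)
Definition R3 (R : realType) : Type :=
  caratheodory_type (mu_ext (@borel_lebesgue3 R)).

(* A display of our own, as the one of caratheodory_type is a huge term. *)
Definition R3_display : measure_display. Proof. exact. Qed.

HB.instance Definition _ (R : realType) := Pointed.on (R3 R).
HB.instance Definition _ (R : realType) :=
  let K : measurableType _ := caratheodory_type (mu_ext (@borel_lebesgue3 R)) in
  @isMeasurable.Build R3_display (R3 R) (@measurable _ K)
    (@measurable0 _ K) (@measurableC _ K) (@bigcupT_measurable _ K).

Definition lebesgue3 (R : realType) : set (R3 R) -> \bar R :=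
  @completed_measure_extension _ _ _ (@borel_lebesgue3 R).

Section Lebesgue3Measure.
Local Open Scope ereal_scope.
Variable R : realType.

Let lebesgue3_0 : @lebesgue3 R set0 = 0.
Proof. exact: mu_ext0. Qed.

Let lebesgue3_ge0 (A : set (R3 R)) : 0 <= lebesgue3 A.
Proof. exact: mu_ext_ge0. Qed.

Let lebesgue3_semi_sigma_additive : semi_sigma_additive (@lebesgue3 R).
Proof.
move=> F mF tF mUF.
exact: (@caratheodory_measure_sigma_additive _ _
          (mu_ext (@borel_lebesgue3 R)) F mF tF mUF).
Qed.

HB.instance Definition _ := isMeasure.Build _ _ _ (@lebesgue3 R)
  lebesgue3_0 lebesgue3_ge0 lebesgue3_semi_sigma_additive.

End Lebesgue3Measure.

Section Geometry.
Variable R : realType.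
Local Notation C := R[i].
Implicit Types (p k b x : R * R * R) (B : 'M[C]_2).

Definition coord3 (i : 'I_3) p : R := tnth [tuple p.1.1; p.1.2; p.2] i.

Definition dot3 k p : R := \sum_(i < 3) coord3 i k * coord3 i p.

Definition norm3 p : R := Num.sqrt (dot3 p p).

Definition SU2 : set 'M[C]_2 := [set B | B \is unitarymx /\ \det B = 1].

(* x . sigma for the Pauli matrices sigma *)
Definition pauli x : 'M[C]_2 := \matrix_(i, j)
  (if i == 0 then if j == 0 then x.2%:C else x.1.1 -i* x.1.2
   else if j == 0 then x.1.1 +i* x.1.2 else (- x.2)%:C).

(* The covering SU(2) -> SO(3): rot3 B x is the y such that
   B (pauli x) B^* = pauli y, its coordinates being read off the entries. *)
Definition rot3 B x : R * R * R :=
  let M := B *m pauli x *m B^t* in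
  (complex.Re (M 1 0), complex.Im (M 1 0), complex.Re (M 0 0)).

Definition euclid3 b B x : R * R * R := b + rot3 B x.

(* Delta_t *)
Definition causal_nbhd (t : R) (D : set (R3 R)) : set (R3 R) :=
  [set y | exists2 x, D x & norm3 (y - x) <= `|t|].

End Geometry.

Section ComplexIntegration.
Context d (T : measurableType d) (R : realType).
Variable mu : {measure set T -> \bar R}.
Local Notation C := R[i].
Implicit Types (D : set T) (f g : T -> C).

Definition cmeasurable D f :=
  measurable_fun D (fun x => complex.Re (f x)) /\
  measurable_fun D (fun x => complex.Im (f x)).

Definition cintegrable D f :=
  mu.-integrable D (fun x => (complex.Re (f x))%:E) /\
  mu.-integrable D (fun x => (complex.Im (f x))%:E).

Definition cint D f : C :=
  (\int[mu]_(x in D) complex.Re (f x)) +i* (\int[mu]_(x in D) complex.Im (f x)).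

(* |f|^p is integrable iff the real and imaginary parts of f are in L^p *)
Definition LC (p : \bar R) f : Prop :=
  (fun x => complex.Re (f x)) \in Lfun mu p /\
  (fun x => complex.Im (f x)) \in Lfun mu p.

Definition inner f g : C := cint setT (fun x => (f x)^* * g x).

(* L^2(T, C^n) with C^n = 'cV[C]_n *)
Definition LCv n (p : \bar R) (f : T -> 'cV[C]_n) : Prop :=
  forall i, LC p (fun x => f x i 0).

Definition innerv n (f g : T -> 'cV[C]_n) : C :=
  \sum_(i < n) inner (fun x => f x i 0) (fun x => g x i 0).

End ComplexIntegration.

Section HilbertSpace.
Variable R : realType.
Local Notation C := R[i].
Local Notation leb := (@lebesgue3 R).
Local Notation wave := (R3 R -> C).
Local Notation op := (wave -> wave).
Implicit Types (phi psi : wave) (A : op).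

Definition L1 phi := LC leb 1%:E phi.
Definition L2 phi := LC leb 2%:E phi.
Definition ip phi psi : C := inner leb phi psi.

Definition L2v n (phi : R3 R -> 'cV[C]_n) := LCv leb 2%:E phi.
Definition ipv n (phi psi : R3 R -> 'cV[C]_n) : C := innerv leb phi psi.

Definition linear_op A := [/\
  forall phi, L2 phi -> L2 (A phi),
  forall phi psi, L2 phi -> L2 psi ->
    phi = psi %[ae leb] -> A phi = A psi %[ae leb] &
  forall (c : C) phi psi, L2 phi -> L2 psi ->
    A (fun p => c * phi p + psi p) = (fun p => c * A phi p + A psi p)
      %[ae leb]].

Definition bounded_op A := linear_op A /\
  exists M : R, forall phi, L2 phi ->
    ip (A phi) (A phi) <= M%:C * ip phi phi.

(* the order of R[i]: both sides have the same imaginary part *)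
Definition op_le A A' := forall phi, L2 phi -> ip phi (A phi) <= ip phi (A' phi).

Definition op_eq A A' := forall phi, L2 phi -> A phi = A' phi %[ae leb].

Definition unitary_op A := [/\ linear_op A,
  forall phi psi, L2 phi -> L2 psi -> ip (A phi) (A psi) = ip phi psi &
  forall psi, L2 psi -> exists2 phi, L2 phi & A phi = psi %[ae leb]].

(* A^-1, for A bijective on L^2 up to a.e. equality *)
Definition op_inv A : op := fun psi =>
  xget (fun=> 0) [set phi | L2 phi /\ A phi = psi %[ae leb]].

Definition mul_op (f : R3 R -> R) : op := fun phi p => (f p)%:C * phi p.

Definition expi (x : R) : C := cos x +i* sin x.

Definition is_fourier (F : op) := unitary_op F /\
  forall phi, L1 phi -> L2 phi ->
    F phi = (fun x => ((2 * pi) `^ (- (3 / 2)))%:C *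
               cint leb setT (fun y => expi (- dot3 x y) * phi y)) %[ae leb].

(* By Plancherel, is_fourier determines F on L^2 up to a.e. equality. *)
Definition fourier : op := xget (id : op) is_fourier.

Definition Ecan (D : set (R3 R)) : op := mul_op (\1_D).

Definition ENW (D : set (R3 R)) : op :=
  fourier \o Ecan D \o op_inv fourier.

Definition U0 (b : R3 R) (B : 'M[C]_2) : op := fun phi p =>
  expi (- dot3 b p) * phi (rot3 (invmx B) p).

Definition eps (m : R) (p : R3 R) : R := Num.sqrt (m ^+ 2 + norm3 p ^+ 2).

Definition V (m t : R) : op := fun phi p => expi (t * eps m p) * phi p.

Definition POVM (T : set (R3 R) -> op) := [/\
  forall D, measurable D -> bounded_op (T D),
  forall D, measurable D -> op_le (fun=> fun=> 0) (T D),
  op_eq (T setT) id &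
  forall D : nat -> set (R3 R), (forall n, measurable (D n)) ->
    trivIset setT D -> forall phi, L2 phi ->
    (fun n => \sum_(i < n) ip phi (T (D i) phi) : C^o) @ \oo -->
      (ip phi (T (\bigcup_n D n) phi) : C^o)].

Definition POL (T : set (R3 R) -> op) := POVM T /\
  forall b B, SU2 B -> forall D, measurable D ->
    op_eq (U0 b B \o T D \o op_inv (U0 b B)) (T (euclid3 b B @` D)).

(* The triple integral of the defining formula is an iterated one. For phi in
   L^1, its two inner integrals are absolutely convergent, as |t| <= 1 by
   positive definiteness. *)
Definition is_kernel (T : set (R3 R) -> op) (t : R3 R -> R3 R -> C) := [/\
  cmeasurable [set kp : R3 R * R3 R | kp.1 <> 0 /\ kp.2 <> 0]
    (fun kp => t kp.1 kp.2),
  forall n (p : 'I_n -> R3 R) (c : 'I_n -> C), (forall i, p i <> 0) ->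
    0 <= \sum_(i < n) \sum_(j < n) (c i)^* * c j * t (p i) (p j),
  forall B, SU2 B -> forall k p, k <> 0 -> p <> 0 ->
    t (rot3 B k) (rot3 B p) = t k p,
  forall p, p <> 0 -> t p p = 1 &
  forall phi, L1 phi -> L2 phi -> forall D, measurable D ->
    let density (x : R3 R) := cint leb setT (fun p => cint leb setT (fun k =>
      t k p * expi (dot3 (p - k) x) * (phi k)^* * phi p)) in
    cintegrable leb D density /\
    ip phi (T D phi) = ((2 * pi) ^- 3)%:C * cint leb D density].

(* Finite dimensional unitary representations, on C^n without loss of
   generality; C^o carries the topology of C. *)
Definition unitary_rep n (rho : 'M[C]_2 -> 'M[C]_n) := [/\
  forall B, SU2 B -> rho B \is unitarymx,
  rho 1%:M = 1%:M,
  forall B B', SU2 B -> SU2 B' -> rho (B *m B') = rho B *m rho B' &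
  {within (@SU2 R : set 'M[C^o]_2),
    continuous (rho : 'M[C^o]_2 -> 'M[C^o]_n)}].

Definition Urep n (rho : 'M[C]_2 -> 'M[C]_n) (b : R3 R) (B : 'M[C]_2)
    (phi : R3 R -> 'cV[C]_n) : R3 R -> 'cV[C]_n := fun p =>
  expi (- dot3 b p) *: (rho B *m phi (rot3 (invmx B) p)).

(* A (x) 1 on L^2(R^3, C^n) *)
Definition lift_op n A (phi : R3 R -> 'cV[C]_n) : R3 R -> 'cV[C]_n :=
  fun p => \col_i A (fun q => phi q i 0) p.

Definition isometry_op n (j : wave -> R3 R -> 'cV[C]_n) := [/\
  forall phi, L2 phi -> L2v (j phi),
  forall phi psi, L2 phi -> L2 psi ->
    phi = psi %[ae leb] -> j phi = j psi %[ae leb],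
  forall (c : C) phi psi, L2 phi -> L2 psi ->
    j (fun p => c * phi p + psi p) = (fun p => c *: j phi p + j psi p)
      %[ae leb] &
  forall phi psi, L2 phi -> L2 psi -> ipv (j phi) (j psi) = ip phi psi].

Definition adjoint n (j : wave -> R3 R -> 'cV[C]_n)
    (j' : (R3 R -> 'cV[C]_n) -> wave) :=
  forall chi, L2v chi -> L2 (j' chi) /\
    forall phi, L2 phi -> ip (j' chi) phi = ipv chi (j phi).

Definition finite_POL (T : set (R3 R) -> op) :=
  exists (n : nat) (rho : 'M[C]_2 -> 'M[C]_n)
    (j : wave -> R3 R -> 'cV[C]_n) (j' : (R3 R -> 'cV[C]_n) -> wave),
  [/\ unitary_rep rho, isometry_op j, adjoint j j',
    forall b B, SU2 B -> forall phi, L2 phi ->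
      j (U0 b B phi) = Urep rho b B (j phi) %[ae leb] &
    forall D, measurable D -> op_eq (T D)
      (j' \o lift_op fourier \o lift_op (Ecan D) \o lift_op (op_inv fourier)
       \o j)].

Definition causal_time_evolution (m : R) (T : set (R3 R) -> op) :=
  forall D, measurable D -> forall t : R,
    op_le (V m t \o T D \o op_inv (V m t)) (T (causal_nbhd t D)).

(* m / (sqrt 2 H) and P_i / (sqrt 2 H) *)
Definition mH (m : R) : op := mul_op (fun p => m / (Num.sqrt 2 * eps m p)).
Definition PH (m : R) (i : 'I_3) : op :=
  mul_op (fun p => coord3 i p / (Num.sqrt 2 * eps m p)).

Definition T_TM (m : R) (D : set (R3 R)) : op := fun phi p =>
  2^-1 * ENW D phi p + (mH m \o ENW D \o mH m) phi p
  + \sum_(i < 3) (PH m i \o ENW D \o PH m i) phi p.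

Definition t_TM (m : R) (k p : R3 R) : C :=
  (2^-1 * (1 + (m ^+ 2 + dot3 k p) / (eps m k * eps m p)))%:C.

End HilbertSpace.

(* Main.v *)
Require Import Defs.
From HB Require Import structures.
From mathcomp Require Import all_boot all_order all_algebra.
From mathcomp Require Import sesquilinear spectral complex.
From mathcomp Require Import all_classical all_reals all_analysis.
From mathcomp Require Import measurable_realfun.
From mathcomp Require Import ring lra zify.

Set Implicit Arguments.
Unset Strict Implicit.
Unset Printing Implicit Defensive.
Import Order.TTheory GRing.Theory Num.Theory.
Import numFieldNormedType.Exports.

Local Open Scope classical_set_scope.
Local Open Scope ring_scope.
Local Open Scope complex_scope.
Local Open Scope sesquilinear_scope.

(* Let F^-1 be the inverse Fourier transformation and v(p) the unit vector
   (1, m / eps(p), p / eps(p)) / sqrt 2 of R^5. Then <phi, T(D) phi> is the integral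
   of |F^-1 (v phi)|^2 over D, which gives the POVM, its covariance (v is
   rotation covariant), its finiteness (j phi = v phi) and its kernel
   t(k, p) = v(k) . v(p). The Plancherel theorem is obtained from the Poisson
   kernel.

   Causality. As v(p) is an eigenvector of the symmetric matrix A(p) with first
   row and column (0, m, p) and zeroes elsewhere, for the eigenvalue eps(p), the
   field F^-1 (v exp(i t eps) phi) is the solution at time t of the symmetric
   hyperbolic system with symbol A(p), of propagation speed 1. No derivative of the
   field is taken: exp(i t A) v is approximated by the n-th power of an average of
   four exactly solvable evolutions for the time t / n, one for each entry m, p_i
   of A, which act in position space by translations. Each step moves a weight
   w_tau, a smoothed step function of dist(x, D) + tau, to w_(tau + |t| / n) up to
   O(n^-2). In the limit the mass of the field at distance > |t| from D at time t
   is at most its mass outside D at time 0. This is the claim as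
   {x | dist(x, D) = |t|} is a null set. *)

(** * Complex-valued integrals *)

(** An average replaces the sum of the four generators, so each exactly solvable evolution runs four
    times too fast, and supports alone would show speed 4 along the axes. The speed 1 appears only
    in the terms of first order in t / n: those of the three directions add up to the scalar product
    of the gradient of the weight with the flux, which Cauchy-Schwarz bounds as a whole. Hence
    smooth weights instead of indicators, and an error that must be O(n^-2) in each of the n steps.
    For an arbitrary set D the distance is merely Lipschitz. The second-order estimate survives
    because the weight need only be bounded from above, and the distance, regularized near D, is
    semiconcave. Convexity of the squared modulus makes the average convenient: it gives the
    contraction in momentum space and starts the energy estimate in position space. The Poisson
    kernel serves for Plancherel since it and its transform exp(-dl |x|) have elementary primitives
    and factor over the coordinates. The completed Lebesgue measure is handled through its outer
    measure, so that invariance is first proved for Borel sets. *)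

Section ComplexParts.
Variable R : realType.
Local Notation C := R[i].
Implicit Types x y z : C.

Lemma cReD x y : complex.Re (x + y) = complex.Re x + complex.Re y.
Proof. by case: x y => [a b] [c d]. Qed.
Lemma cImD x y : complex.Im (x + y) = complex.Im x + complex.Im y.
Proof. by case: x y => [a b] [c d]. Qed.
Lemma cReN x : complex.Re (- x) = - complex.Re x.
Proof. by case: x. Qed.
Lemma cImN x : complex.Im (- x) = - complex.Im x.
Proof. by case: x. Qed.
Lemma cReM x y : complex.Re (x * y) =
  complex.Re x * complex.Re y - complex.Im x * complex.Im y.
Proof. by case: x y => [a b] [c d]. Qed.
Lemma cImM x y : complex.Im (x * y) =
  complex.Re x * complex.Im y + complex.Im x * complex.Re y.
Proof. by case: x y => [a b] [c d]. Qed.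
Lemma cReJ x : complex.Re (Num.conj x) = complex.Re x.
Proof. by case: x. Qed.
Lemma cImJ x : complex.Im (Num.conj x) = - complex.Im x.
Proof. by case: x. Qed.
Lemma cRe0 : complex.Re (0 : C) = 0. Proof. by []. Qed.
Lemma cIm0 : complex.Im (0 : C) = 0. Proof. by []. Qed.
Lemma cRe1 : complex.Re (1 : C) = 1. Proof. by []. Qed.
Lemma cIm1 : complex.Im (1 : C) = 0. Proof. by []. Qed.

Definition cE := (cReD, cImD, cReN, cImN, cReM, cImM, cReJ, cImJ,
  cRe0, cIm0, cRe1, cIm1).

Lemma cplx_eq x y :
  complex.Re x = complex.Re y -> complex.Im x = complex.Im y -> x = y.
Proof. by case: x y => [a b] [c d] /= -> ->. Qed.

Lemma cRe_sum (I : Type) (s : seq I) (P : pred I) (F : I -> C) :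
  complex.Re (\sum_(i <- s | P i) F i) = \sum_(i <- s | P i) complex.Re (F i).
Proof. by apply: (big_morph _ cReD). Qed.
Lemma cIm_sum (I : Type) (s : seq I) (P : pred I) (F : I -> C) :
  complex.Im (\sum_(i <- s | P i) F i) = \sum_(i <- s | P i) complex.Im (F i).
Proof. by apply: (big_morph _ cImD). Qed.

(** The squared modulus as an element of [R]: the norm of [R[i]] takes values in [R[i]] and is not a
    real integrand. *)
Definition csq x : R := complex.Re x ^+ 2 + complex.Im x ^+ 2.

Lemma csq_ge0 x : 0 <= csq x.
Proof. by rewrite addr_ge0 ?sqr_ge0. Qed.
Lemma csq0 : csq 0 = 0.
Proof. by rewrite /csq /= !expr0n addr0. Qed.
Lemma csqM x y : csq (x * y) = csq x * csq y.
Proof. rewrite /csq !cE; ring. Qed.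
Lemma csqN x : csq (- x) = csq x.
Proof. by rewrite /csq !cE !sqrrN. Qed.
Lemma csqJ x : csq (Num.conj x) = csq x.
Proof. by rewrite /csq !cE sqrrN. Qed.
Lemma csq_real (a : R) : csq a%:C = a ^+ 2.
Proof. by rewrite /csq /= expr0n addr0. Qed.
Lemma csqD_le x y : csq (x + y) <= 2 * (csq x + csq y).
Proof.
rewrite /csq !cE.
set a := complex.Re x; set b := complex.Im x.
set c := complex.Re y; set d := complex.Im y.
have := sqr_ge0 (a - c); have := sqr_ge0 (b - d); nra.
Qed.
Lemma csqB_le x y : csq (x - y) <= 2 * (csq x + csq y).
Proof. by rewrite (le_trans (csqD_le _ _))// csqN. Qed.
Lemma csq_eq0 x : csq x = 0 -> x = 0.
Proof.
move/eqP; rewrite paddr_eq0 ?sqr_ge0// !sqrf_eq0 => /andP[/eqP a /eqP b].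
exact: cplx_eq.
Qed.
Lemma conjM_csq x : Num.conj x * x = (csq x)%:C.
Proof. by apply: cplx_eq; rewrite !cE /csq /=; ring. Qed.
Lemma normRe_sq x : complex.Re x ^+ 2 <= csq x.
Proof. by rewrite lerDl sqr_ge0. Qed.
Lemma normIm_sq x : complex.Im x ^+ 2 <= csq x.
Proof. by rewrite lerDr sqr_ge0. Qed.
Lemma csq_expi (t : R) : csq (expi t) = 1.
Proof. by rewrite /csq /= cos2Dsin2. Qed.
Lemma expiD (s t : R) : expi (s + t) = expi s * expi t.
Proof. by apply: cplx_eq; rewrite !cE /= ?cosD ?sinD; ring. Qed.
Lemma expi0 : expi 0 = 1 :> C.
Proof. by apply: cplx_eq; rewrite /= ?cos0 ?sin0. Qed.
Lemma expiN (t : R) : expi (- t) = Num.conj (expi t).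
Proof. by apply: cplx_eq; rewrite !cE /= ?cosN ?sinN. Qed.
Lemma expiNM (t : R) : expi (- t) * expi t = 1.
Proof. by rewrite -expiD addNr expi0. Qed.

End ComplexParts.

Lemma limn_le_bound (R : realType) (u : nat -> R) : (forall n, 0 <= u n) ->
  (forall e, 0 < e -> \forall n \near \oo, u n <= e) -> u @ \oo --> (0 : R).
Proof.
move=> u0 H; apply/cvgrPdist_le => e e0.
apply: filterS (H _ e0) => n; by rewrite sub0r normrN ger0_norm.
Qed.

Section ComplexMeasurable.
Context d (T : measurableType d) (R : realType).
Local Notation C := R[i].
Implicit Types (D : set T) (f g : T -> C).

Lemma cmeasD D f g : cmeasurable D f -> cmeasurable D g ->
  cmeasurable D (fun x => f x + g x).
Proof.
move=> [f1 f2] [g1 g2]; split.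
  under eq_fun do rewrite cReD; exact: measurable_funD.
under eq_fun do rewrite cImD; exact: measurable_funD.
Qed.

Lemma cmeasN D f : cmeasurable D f -> cmeasurable D (fun x => - f x).
Proof.
move=> [f1 f2]; split.
  under eq_fun do rewrite cReN; exact: measurableT_comp.
under eq_fun do rewrite cImN; exact: measurableT_comp.
Qed.

Lemma cmeasB D f g : cmeasurable D f -> cmeasurable D g ->
  cmeasurable D (fun x => f x - g x).
Proof. by move=> mf mg; apply: cmeasD => //; exact: cmeasN. Qed.

Lemma cmeasJ D f : cmeasurable D f -> cmeasurable D (fun x => Num.conj (f x)).
Proof.
move=> [f1 f2]; split.
  by under eq_fun do rewrite cReJ.
under eq_fun do rewrite cImJ; exact: measurableT_comp.
Qed.

Lemma cmeasM D f g : cmeasurable D f -> cmeasurable D g ->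
  cmeasurable D (fun x => f x * g x).
Proof.
move=> [f1 f2] [g1 g2]; split.
  under eq_fun do rewrite cReM.
  by apply: measurable_funB; exact: measurable_funM.
under eq_fun do rewrite cImM.
by apply: measurable_funD; exact: measurable_funM.
Qed.

Lemma cmeas_cst D (c : C) : cmeasurable D (fun=> c).
Proof. by split; exact: measurable_cst. Qed.

Lemma cmeas_real D (f : T -> R) : measurable_fun D f ->
  cmeasurable D (fun x => (f x)%:C).
Proof. by move=> mf; split => //; exact: measurable_cst. Qed.

Lemma cmeasZ D (c : C) f : cmeasurable D f -> cmeasurable D (fun x => c * f x).
Proof. by move=> mf; apply: cmeasM => //; exact: cmeas_cst. Qed.

Lemma cmeas_sum D (I : Type) (s : seq I) (h : I -> T -> C) :
  (forall i, cmeasurable D (h i)) ->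
  cmeasurable D (fun x => \sum_(i <- s) h i x).
Proof.
move=> mh; elim: s => [|i s IH].
  under eq_fun do rewrite big_nil; exact: cmeas_cst.
under eq_fun do rewrite big_cons; exact: cmeasD.
Qed.

Lemma measurable_cos_fun : measurable_fun [set: R] (@cos R).
Proof. apply: continuous_measurable_fun; exact: continuous_cos. Qed.

Lemma measurable_sin_fun : measurable_fun [set: R] (@sin R).
Proof. apply: continuous_measurable_fun; exact: continuous_sin. Qed.

Lemma cmeas_expi D (f : T -> R) : measurable_fun D f ->
  cmeasurable D (fun x => expi (f x)).
Proof.
move=> mf; split => /=.
  exact: (measurableT_comp measurable_cos_fun).
exact: (measurableT_comp measurable_sin_fun).
Qed.

Lemma measurable_csq D f : cmeasurable D f ->
  measurable_fun D (fun x => csq (f x)).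
Proof.
by move=> [f1 f2]; apply: measurable_funD; exact: measurable_funX.
Qed.

Lemma cmeas_comp d2 (T2 : measurableType d2) (h : T2 -> T) f :
  measurable_fun setT h -> cmeasurable setT f ->
  cmeasurable setT (fun x => f (h x)).
Proof.
by move=> mh [f1 f2]; split;
  [exact: (measurableT_comp f1 mh)|exact: (measurableT_comp f2 mh)].
Qed.

End ComplexMeasurable.

Section SquareIntegrable.
Context d (T : measurableType d) (R : realType).
Variable mu : {measure set T -> \bar R}.
Local Notation C := R[i].
Implicit Types (D : set T) (f g h : T -> C).
Local Notation L2 := (LC mu 2%:E).

(** Trades the real powers in the norm behind [Lfun] for a plain square; the later criterion [L2P]
    rests on this form. *)
Lemma Lfun2P (u : T -> R) : u \in Lfun mu 2%:E <->
  measurable_fun setT u /\ (\int[mu]_x (u x ^+ 2)%:E < +oo)%E.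
Proof.
split=> [uL|[mu' h]].
  split; first by move: uL; rewrite inE => /andP[/[!inE]].
  have /integrableP[_] := Lfun2_integrable_sqr uL.
  rewrite (eq_integral (fun x => (u x ^+ 2)%:E))// => x _.
  by rewrite /= ger0_norm// sqr_ge0.
rewrite inE; apply/andP; split; rewrite inE//=.
rewrite /finite_norm unlock.
apply: poweR_lty.
apply: le_lt_trans h.
apply: ge0_le_integral => //=.
- apply/measurable_EFinP.
  apply/(@measurableT_comp _ _ _ _ _ _ (fun x : R => x `^ 2)%R) => //.
  exact/measurableT_comp.
- by apply/measurable_EFinP; exact: measurable_funX.
- by move=> x _; rewrite /= lee_fin powR_mulrn// real_normK// num_real.
Qed.

End SquareIntegrable.

Definition cabs (R : realType) (z : R[i]) : R := Num.sqrt (csq z).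

Section CAbs.
Variable R : realType.
Implicit Types z : R[i].
Lemma cabs_ge0 z : 0 <= cabs z. Proof. exact: sqrtr_ge0. Qed.
Lemma cabsM y z : cabs (y * z) = cabs y * cabs z.
Proof. by rewrite /cabs csqM sqrtrM// csq_ge0. Qed.
Lemma cabsJ z : cabs (Num.conj z) = cabs z.
Proof. by rewrite /cabs csqJ. Qed.
Lemma sqr_cabs z : cabs z ^+ 2 = csq z.
Proof. by rewrite sqr_sqrtr// csq_ge0. Qed.
Lemma Re_cabs z : `|complex.Re z| <= cabs z.
Proof. by rewrite -sqrtr_sqr ler_sqrt ?csq_ge0// normRe_sq. Qed.
Lemma Im_cabs z : `|complex.Im z| <= cabs z.
Proof. by rewrite -sqrtr_sqr ler_sqrt ?csq_ge0// normIm_sq. Qed.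
Lemma cabs_le z : cabs z <= `|complex.Re z| + `|complex.Im z|.
Proof.
rewrite -(@ler_pXn2r _ 2)// ?nnegrE ?cabs_ge0 ?addr_ge0// sqr_cabs sqrrD.
by rewrite !real_normK ?num_real// /csq lerD2r lerDl mulrn_wge0// mulr_ge0.
Qed.
Lemma cabs_expi (t : R) : cabs (expi t) = 1.
Proof. by rewrite /cabs csq_expi sqrtr1. Qed.
End CAbs.

Section RealIntegrable.
Context d (T : measurableType d) (R : realType).
Variable mu : {measure set T -> \bar R}.

Lemma integrable_dom (u v : T -> R) : measurable_fun setT u ->
  mu.-integrable setT (EFin \o v) -> (forall x, `|u x| <= v x) ->
  mu.-integrable setT (EFin \o u).
Proof.
move=> mU iv uv; apply: (le_integrable measurableT _ _ iv).
  exact/measurable_EFinP.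
move=> x _ /=; rewrite lee_fin (le_trans (uv x))// ler_norm//.
Qed.

Lemma EFin_Rintegral D (u : T -> R) : measurable D ->
  mu.-integrable D (EFin \o u) ->
  (\int[mu]_(x in D) u x)%:E = (\int[mu]_(x in D) (u x)%:E)%E.
Proof. by move=> mD iu; rewrite fineK// integrable_fin_num. Qed.

Lemma ae_eq_Rintegral D (u v : T -> R) : measurable D ->
  measurable_fun D u -> measurable_fun D v ->
  (\forall x \ae mu, D x -> u x = v x) ->
  \int[mu]_(x in D) u x = \int[mu]_(x in D) v x.
Proof.
move=> mD m1 m2 uv; congr fine; apply: ae_eq_integral => //;
  [exact/measurable_EFinP|exact/measurable_EFinP|].
by apply: filterS uv => x + Dx => /(_ Dx) ->.
Qed.

Lemma RintegralN D (u : T -> R) : measurable D ->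
  mu.-integrable D (EFin \o u) ->
  \int[mu]_(x in D) (- u x) = - \int[mu]_(x in D) u x.
Proof.
move=> mD iu; under eq_Rintegral do rewrite -mulN1r.
by rewrite RintegralZl// mulN1r.
Qed.

End RealIntegrable.

Section ComplexIntegral.
Context d (T : measurableType d) (R : realType).
Variable mu : {measure set T -> \bar R}.
Local Notation C := R[i].
Implicit Types (f g h : T -> C).
Local Notation L2 := (LC mu 2%:E).

(** Each part of f is bounded by [cabs], which is at most the sum of their absolute values. A single
    real dominating function then suffices in domination arguments. *)
Lemma cintegrableP f : cintegrable mu setT f <->
  cmeasurable setT f /\ mu.-integrable setT (EFin \o (fun x => cabs (f x))).
Proof.
split=> [[i1 i2]|[[m1 m2] i]].
  have mf : cmeasurable setT f.
    by split; apply/measurable_EFinP;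
      [case/integrableP : i1|case/integrableP : i2].
  split => //; apply: (@integrable_dom _ _ _ _ _
    (fun x => `|complex.Re (f x)| + `|complex.Im (f x)|)).
  - apply: (@measurableT_comp _ _ _ _ _ _ (@Num.sqrt R)); last exact: measurable_csq.
    by apply: continuous_measurable_fun; exact: sqrt_continuous.
  - rewrite (_ : _ \o _ = (EFin \o ((@Num.norm R R) \o (fun x => complex.Re (f x)))) \+
      (EFin \o ((@Num.norm R R) \o (fun x => complex.Im (f x)))))%E//.
    apply: integrableD => //; exact: integrable_norm.
  - by move=> x; rewrite ger0_norm ?cabs_ge0// cabs_le.
split; apply: (integrable_dom _ i) => // x; [exact: Re_cabs|exact: Im_cabs].
Qed.

Lemma L1P f : LC mu 1%:E f <-> cintegrable mu setT f.
Proof. by split=> -[/Lfun1_integrable a /Lfun1_integrable b]. Qed.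

Lemma cintegrable_meas f : cintegrable mu setT f -> cmeasurable setT f.
Proof. by case/cintegrableP. Qed.

Lemma cintegrable_dom f (v : T -> R) : cmeasurable setT f ->
  mu.-integrable setT (EFin \o v) -> (forall x, cabs (f x) <= v x) ->
  cintegrable mu setT f.
Proof.
move=> [m1 m2] iv fv; split; apply: (integrable_dom _ iv) => // x.
  exact: le_trans (Re_cabs _) (fv x).
exact: le_trans (Im_cabs _) (fv x).
Qed.

Lemma cintegrableD f g : cintegrable mu setT f -> cintegrable mu setT g ->
  cintegrable mu setT (fun x => f x + g x).
Proof.
move=> [f1 f2] [g1 g2]; split.
  rewrite (_ : (fun x => _) = (fun x => (complex.Re (f x))%:E) \+
    (fun x => (complex.Re (g x))%:E))%E; first exact: integrableD.
  by apply/funext => x; rewrite cReD.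
rewrite (_ : (fun x => _) = (fun x => (complex.Im (f x))%:E) \+
  (fun x => (complex.Im (g x))%:E))%E; first exact: integrableD.
by apply/funext => x; rewrite cImD.
Qed.

Lemma cintegrableMb (k : R) g f : cmeasurable setT g ->
  (forall x, cabs (g x) <= k) -> cintegrable mu setT f ->
  cintegrable mu setT (fun x => g x * f x).
Proof.
move=> mg gk /cintegrableP[mf fi].
apply: (@cintegrable_dom _ (fun x => k * cabs (f x))).
- exact: cmeasM.
- rewrite (_ : _ \o _ = (fun x => k%:E * (EFin \o (fun x => cabs (f x))) x)%E)//.
  exact: integrableZl.
- by move=> x; rewrite cabsM ler_wpM2r// cabs_ge0.
Qed.

Lemma cintegrableZ (c : C) f : cintegrable mu setT f ->
  cintegrable mu setT (fun x => c * f x).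
Proof. by apply: (@cintegrableMb (cabs c)) => //; exact: cmeas_cst. Qed.

Lemma cintegrableJ f : cintegrable mu setT f ->
  cintegrable mu setT (fun x => Num.conj (f x)).
Proof.
move=> /cintegrableP[mf fi]; apply: (cintegrable_dom _ fi); first exact: cmeasJ.
by move=> x; rewrite cabsJ.
Qed.

Lemma cint_ext D f g : (forall x, D x -> f x = g x) -> cint mu D f = cint mu D g.
Proof.
by move=> fg; congr Complex; apply: eq_Rintegral => x /[!inE] Dx; rewrite fg.
Qed.

Lemma cintD f g : cintegrable mu setT f -> cintegrable mu setT g ->
  cint mu setT (fun x => f x + g x) = cint mu setT f + cint mu setT g.
Proof.
move=> [f1 f2] [g1 g2]; apply: cplx_eq; rewrite cE /=.
  by under eq_Rintegral do rewrite cReD; rewrite RintegralD.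
by under eq_Rintegral do rewrite cImD; rewrite RintegralD.
Qed.

Lemma cintZ (c : C) f : cintegrable mu setT f ->
  cint mu setT (fun x => c * f x) = c * cint mu setT f.
Proof.
move=> [f1 f2].
have iZ (k : R) (u : T -> R) : mu.-integrable setT (EFin \o u) ->
    mu.-integrable setT (EFin \o (fun x => k * u x)).
  by move=> iu; rewrite (_ : _ \o _ = (fun x => k%:E * (EFin \o u) x)%E)//;
    exact: integrableZl.
apply: cplx_eq; rewrite cE /=.
  under eq_Rintegral do rewrite cReM.
  by rewrite RintegralB//= ?RintegralZl//; exact: iZ.
under eq_Rintegral do rewrite cImM.
by rewrite RintegralD//= ?RintegralZl//; exact: iZ.
Qed.

Lemma cintJ f : cintegrable mu setT f ->
  cint mu setT (fun x => Num.conj (f x)) = Num.conj (cint mu setT f).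
Proof.
move=> [f1 f2]; apply: cplx_eq; rewrite cE /=.
  by under eq_Rintegral do rewrite cReJ.
by under eq_Rintegral do rewrite cImJ; rewrite RintegralN.
Qed.

Lemma cintegrable_sum (I : Type) (s : seq I) (h : I -> T -> C) :
  (forall i, cintegrable mu setT (h i)) ->
  cintegrable mu setT (fun x => \sum_(i <- s) h i x).
Proof.
move=> hi; elim: s => [|i s IH].
  under eq_fun do rewrite big_nil.
  by split; rewrite /=; exact: integrable0.
by under eq_fun do rewrite big_cons; exact: cintegrableD.
Qed.

Lemma cint0 : cint mu setT (fun=> 0) = 0.
Proof. by apply: cplx_eq => /=; rewrite Rintegral_cst// mul0r. Qed.

Lemma cint_sum (I : Type) (s : seq I) (h : I -> T -> C) :
  (forall i, cintegrable mu setT (h i)) ->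
  cint mu setT (fun x => \sum_(i <- s) h i x) = \sum_(i <- s) cint mu setT (h i).
Proof.
move=> hi; elim: s => [|i s IH].
  by under cint_ext do rewrite big_nil; rewrite cint0 big_nil.
under cint_ext do rewrite big_cons.
by rewrite cintD ?IH ?big_cons//; exact: cintegrable_sum.
Qed.

Lemma ae_eq_cint f g : cmeasurable setT f -> cmeasurable setT g ->
  f = g %[ae mu] -> cint mu setT f = cint mu setT g.
Proof.
move=> [f1 f2] [g1 g2] fg; congr Complex; apply: ae_eq_Rintegral => //;
  by apply: filterS fg => x /(_ I) + _ => ->.
Qed.

Lemma cint_real (u : T -> R) :
  cint mu setT (fun x => (u x)%:C) = (\int[mu]_x u x)%:C.
Proof. by apply: cplx_eq => //=; rewrite Rintegral_cst// mul0r. Qed.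

(** The real and the imaginary part of the integral are each bounded by K, whence the factor 2. Such
    a crude bound is enough to prove integrability. *)
Lemma csq_cint_le f (K : R) : cintegrable mu setT f ->
  \int[mu]_x cabs (f x) <= K -> csq (cint mu setT f) <= 2 * K ^+ 2.
Proof.
move=> fi fK.
have [mf ai] := (cintegrableP f).1 fi; have [f1 f2] := fi.
have H (p : C -> R) : (forall z, `|p z| <= cabs z) ->
    mu.-integrable setT (EFin \o (fun x => p (f x))) ->
    (\int[mu]_x p (f x)) ^+ 2 <= K ^+ 2.
  move=> pa pi; have A : `|\int[mu]_x p (f x)| <= K.
    apply: le_trans fK; apply: le_trans (le_normr_Rintegral _ pi) _ => //.
    apply: le_Rintegral => //; first exact: integrable_norm.
  by rewrite -real_normK ?num_real// lerXn2r// nnegrE (le_trans _ A).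
rewrite mulr2n mulrDl mul1r lerD//; apply: H => //; [exact: Re_cabs|exact: Im_cabs].
Qed.

End ComplexIntegral.

(** * Square-integrable functions *)

Section SquareIntegrableTheory.
Context d (T : measurableType d) (R : realType).
Variable mu : {measure set T -> \bar R}.
Local Notation C := R[i].
Implicit Types (f g h : T -> C).
Local Notation L2 := (LC mu 2%:E).
Local Notation ip := (inner mu).

Lemma integrableZ_EFin (k : R) (u : T -> R) : mu.-integrable setT (EFin \o u) ->
  mu.-integrable setT (EFin \o (fun x => k * u x)).
Proof.
move=> iu; rewrite (_ : _ \o _ = (fun x => k%:E * (EFin \o u) x)%E)//.
exact: integrableZl.
Qed.

Lemma integrableD_EFin (u v : T -> R) : mu.-integrable setT (EFin \o u) ->
  mu.-integrable setT (EFin \o v) ->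
  mu.-integrable setT (EFin \o (fun x => u x + v x)).
Proof. by move=> iu iv; rewrite (_ : _ \o _ = (EFin \o u) \+ (EFin \o v))%E//;
  exact: integrableD. Qed.

Definition nsq f : R := \int[mu]_x csq (f x).

Lemma L2P f : L2 f <->
  cmeasurable setT f /\ mu.-integrable setT (EFin \o (fun x => csq (f x))).
Proof.
split=> [[/Lfun2P[m1 i1] /Lfun2P[m2 i2]]|[[m1 m2] i]].
  split => //.
  apply: integrableD_EFin; apply/integrableP; split;
    try by apply/measurable_EFinP; exact: measurable_funX.
    move: i1; congr (_ < _)%E; apply: eq_integral => x _.
    by rewrite /= ger0_norm// sqr_ge0.
  move: i2; congr (_ < _)%E; apply: eq_integral => x _.
  by rewrite /= ger0_norm// sqr_ge0.
have H (p : C -> R) : measurable_fun setT (fun x => p (f x)) ->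
    (forall z, p z ^+ 2 <= csq z) -> (fun x => p (f x)) \in Lfun mu 2%:E.
  move=> mp pc; apply/Lfun2P; split => //.
  have /integrableP[_] : mu.-integrable setT (EFin \o (fun x => p (f x) ^+ 2)).
    apply: (integrable_dom _ i); first exact: measurable_funX.
    by move=> x; rewrite ger0_norm ?sqr_ge0.
  congr (_ < _)%E; apply: eq_integral => x _.
  by rewrite /= ger0_norm// sqr_ge0.
by split; apply: H => //; [exact: normRe_sq|exact: normIm_sq].
Qed.

Lemma L2_meas f : L2 f -> cmeasurable setT f.
Proof. by case/L2P. Qed.

Lemma L2_int f : L2 f -> mu.-integrable setT (EFin \o (fun x => csq (f x))).
Proof. by case/L2P. Qed.

Lemma nsq_ge0 f : 0 <= nsq f.
Proof. by apply: Rintegral_ge0 => x _; exact: csq_ge0. Qed.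

Lemma L2_dom f (v : T -> R) : cmeasurable setT f ->
  mu.-integrable setT (EFin \o v) -> (forall x, csq (f x) <= v x) -> L2 f.
Proof.
move=> mf iv fv; apply/L2P; split => //.
apply: (integrable_dom _ iv); first exact: measurable_csq.
by move=> x; rewrite ger0_norm ?csq_ge0.
Qed.

Lemma L2D f g : L2 f -> L2 g -> L2 (fun x => f x + g x).
Proof.
move=> /L2P[mf fi] /L2P[mg gi].
apply: (@L2_dom _ (fun x => 2 * (csq (f x) + csq (g x)))).
- exact: cmeasD.
- exact/integrableZ_EFin/integrableD_EFin.
- by move=> x; exact: csqD_le.
Qed.

Lemma L2Mb (k : R) g f : cmeasurable setT g -> (forall x, csq (g x) <= k) ->
  L2 f -> L2 (fun x => g x * f x).
Proof.
move=> mg gk /L2P[mf fi]; apply: (@L2_dom _ (fun x => k * csq (f x))).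
- exact: cmeasM.
- exact: integrableZ_EFin.
- by move=> x; rewrite csqM ler_wpM2r// csq_ge0.
Qed.

Lemma L2Z (c : C) f : L2 f -> L2 (fun x => c * f x).
Proof. by apply: (@L2Mb (csq c)) => //; exact: cmeas_cst. Qed.

Lemma L2N f : L2 f -> L2 (fun x => - f x).
Proof. by move=> fi; under eq_fun do rewrite -mulN1r; exact: L2Z. Qed.

Lemma L2B f g : L2 f -> L2 g -> L2 (fun x => f x - g x).
Proof. by move=> fi gi; apply: L2D => //; exact: L2N. Qed.

Lemma L2J f : L2 f -> L2 (fun x => Num.conj (f x)).
Proof.
move=> /L2P[mf fi]; apply: (L2_dom _ fi); first exact: cmeasJ.
by move=> x; rewrite csqJ.
Qed.

Lemma L2_0 : L2 (fun=> 0).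
Proof.
apply: (@L2_dom _ (fun=> 0)); [exact: cmeas_cst|exact: integrable0|].
by move=> x; rewrite csq0.
Qed.

Lemma L2_sum (I : Type) (s : seq I) (h : I -> T -> C) :
  (forall i, L2 (h i)) -> L2 (fun x => \sum_(i <- s) h i x).
Proof.
move=> hi; elim: s => [|i s IH].
  by under eq_fun do rewrite big_nil; exact: L2_0.
by under eq_fun do rewrite big_cons; exact: L2D.
Qed.

Lemma ae_eq_nsq f g : L2 f -> L2 g -> f = g %[ae mu] -> nsq f = nsq g.
Proof.
move=> fi gi fg; apply: ae_eq_Rintegral => //;
  [exact/measurable_csq/L2_meas|exact/measurable_csq/L2_meas|].
by apply: filterS fg => x /(_ I) ->.
Qed.

Lemma nsqZ (c : C) f : L2 f -> nsq (fun x => c * f x) = csq c * nsq f.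
Proof.
move=> fi; rewrite /nsq; under eq_Rintegral do rewrite csqM.
by rewrite RintegralZl//; exact: L2_int.
Qed.

Lemma nsqJ f : nsq (fun x => Num.conj (f x)) = nsq f.
Proof. by rewrite /nsq; under eq_Rintegral do rewrite csqJ. Qed.

Lemma nsqN f : nsq (fun x => - f x) = nsq f.
Proof. by rewrite /nsq; under eq_Rintegral do rewrite csqN. Qed.

Lemma nsqBC f g : nsq (fun x => f x - g x) = nsq (fun x => g x - f x).
Proof. by rewrite -nsqN /nsq; under eq_Rintegral do rewrite opprB. Qed.

Lemma nsq_le f g (k : R) : L2 f -> L2 g ->
  (forall x, csq (f x) <= k * csq (g x)) -> nsq f <= k * nsq g.
Proof.
move=> fi gi fg; rewrite /nsq -RintegralZl//; last exact: L2_int.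
apply: le_Rintegral => //; first exact: L2_int.
by apply: integrableZ_EFin; exact: L2_int.
Qed.

(** Convergence is phrased with squared norms, for which the factor 2 takes the place of the
    triangle inequality. *)
Lemma nsqD_le f g : L2 f -> L2 g ->
  nsq (fun x => f x + g x) <= 2 * (nsq f + nsq g).
Proof.
move=> fi gi; rewrite /nsq -RintegralD//; [|exact: L2_int|exact: L2_int].
have I : mu.-integrable setT (EFin \o (fun x => csq (f x) + csq (g x))).
  by apply: integrableD_EFin; exact: L2_int.
rewrite -RintegralZl//; apply: le_Rintegral => //.
- exact/L2_int/L2D.
- exact: integrableZ_EFin.
- by move=> x _; exact: csqD_le.
Qed.

Lemma nsqB_trans f g h : L2 f -> L2 g -> L2 h ->
  nsq (fun x => f x - h x) <=
  2 * (nsq (fun x => f x - g x) + nsq (fun x => g x - h x)).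
Proof.
move=> fi gi hi; apply: le_trans (nsqD_le (L2B fi gi) (L2B gi hi)).
rewrite le_eqVlt; apply/orP; left; apply/eqP; congr nsq; apply/funext => x.
by rewrite addrA subrK.
Qed.

Lemma nsq_eq0 f : L2 f -> nsq f = 0 -> f = (fun=> 0) %[ae mu].
Proof.
move=> fi f0; have mf := L2_meas fi.
have : (\int[mu]_x `|(csq (f x))%:E| = 0)%E.
  transitivity ((nsq f)%:E); last by rewrite f0.
  rewrite EFin_Rintegral//; last exact: L2_int.
  by apply: eq_integral => x _; rewrite gee0_abs// lee_fin csq_ge0.
have mc : measurable_fun setT (EFin \o (fun x => csq (f x))).
  by apply/measurable_EFinP; exact: measurable_csq.
move/(ae_eq_integral_abs mu measurableT mc).
by apply: filterS => x /(_ I) [] /csq_eq0 + _.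
Qed.

Lemma nsqB_eq0 f g : L2 f -> L2 g -> nsq (fun x => f x - g x) = 0 ->
  f = g %[ae mu].
Proof.
move=> fi gi /(nsq_eq0 (L2B fi gi)).
by apply: filterS => x /(_ I) /subr0_eq + _.
Qed.

Lemma nsqB_ae f g : L2 f -> L2 g -> f = g %[ae mu] ->
  nsq (fun x => f x - g x) = 0.
Proof.
move=> fi gi fg; rewrite (@ae_eq_nsq _ (fun=> 0)).
- by rewrite /nsq; under eq_Rintegral do rewrite csq0; rewrite Rintegral_cst// mul0r.
- exact: L2B.
- exact: L2_0.
- by apply: filterS fg => x /(_ I) -> _; rewrite subrr.
Qed.

Lemma L2M_int f g : L2 f -> L2 g -> cintegrable mu setT (fun x => f x * g x).
Proof.
move=> /L2P[mf fi] /L2P[mg gi].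
apply: (@cintegrable_dom _ _ _ _ _ (fun x => csq (f x) + csq (g x))).
- exact: cmeasM.
- exact: integrableD_EFin.
- move=> x; rewrite cabsM -!sqr_cabs.
  have := cabs_ge0 (f x); have := cabs_ge0 (g x); move: (cabs _) (cabs _) => a b a0 b0.
  by have := sqr_ge0 (a - b); nra.
Qed.

Lemma ip_int f g : L2 f -> L2 g ->
  cintegrable mu setT (fun x => Num.conj (f x) * g x).
Proof. by move=> fi gi; apply: L2M_int => //; exact: L2J. Qed.

Lemma ip_nsq f : ip f f = (nsq f)%:C.
Proof.
by rewrite /inner -cint_real; apply: cint_ext => x _; rewrite conjM_csq.
Qed.

Lemma ipC f g : L2 f -> L2 g -> ip g f = Num.conj (ip f g).
Proof.
move=> fi gi; rewrite /inner -cintJ; last exact: ip_int.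
by apply: cint_ext => x _; apply: cplx_eq; rewrite !cE; ring.
Qed.

Lemma ipDr f g h : L2 f -> L2 g -> L2 h ->
  ip f (fun x => g x + h x) = ip f g + ip f h.
Proof.
move=> fi gi hi; rewrite /inner -cintD; [|exact: ip_int|exact: ip_int].
by apply: cint_ext => x _; rewrite mulrDr.
Qed.

Lemma ipDl f g h : L2 f -> L2 g -> L2 h ->
  ip (fun x => g x + h x) f = ip g f + ip h f.
Proof.
move=> fi gi hi; rewrite /inner -cintD; [|exact: ip_int|exact: ip_int].
by apply: cint_ext => x _; apply: cplx_eq; rewrite !cE; ring.
Qed.

Lemma ipZr (c : C) f g : L2 f -> L2 g -> ip f (fun x => c * g x) = c * ip f g.
Proof.
move=> fi gi; rewrite /inner -cintZ; last exact: ip_int.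
by apply: cint_ext => x _; apply: cplx_eq; rewrite !cE; ring.
Qed.

Lemma ipZl (c : C) f g : L2 f -> L2 g ->
  ip (fun x => c * g x) f = Num.conj c * ip g f.
Proof.
move=> fi gi; rewrite /inner -cintZ; last exact: ip_int.
by apply: cint_ext => x _; apply: cplx_eq; rewrite !cE; ring.
Qed.

Lemma ipBr f g h : L2 f -> L2 g -> L2 h ->
  ip f (fun x => g x - h x) = ip f g - ip f h.
Proof.
move=> fi gi hi; rewrite ipDr//; last exact: L2N.
congr (_ + _); rewrite -mulN1r -ipZr//.
by apply: cint_ext => x _; rewrite mulN1r.
Qed.

Lemma ipBl f g h : L2 f -> L2 g -> L2 h ->
  ip (fun x => g x - h x) f = ip g f - ip h f.
Proof.
move=> fi gi hi; rewrite (ipC fi) ?ipBr//; last exact: L2B.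
rewrite (ipC fi gi) (ipC fi hi).
by rewrite rmorphB.
Qed.

Lemma ip_sumr (I : Type) (s : seq I) (h : I -> T -> C) f : L2 f ->
  (forall i, L2 (h i)) ->
  ip f (fun x => \sum_(i <- s) h i x) = \sum_(i <- s) ip f (h i).
Proof.
move=> fi hi; rewrite /inner -cint_sum; last by move=> i; exact: ip_int.
by apply: cint_ext => x _; rewrite mulr_sumr.
Qed.

Lemma ae_eq_ip f f' g g' : L2 f -> L2 f' -> L2 g -> L2 g' ->
  f = f' %[ae mu] -> g = g' %[ae mu] -> ip f g = ip f' g'.
Proof.
move=> fi fi' gi gi' ff gg; apply: ae_eq_cint.
- exact/cintegrable_meas/ip_int.
- exact/cintegrable_meas/ip_int.
- by apply: filterS2 ff gg => x /(_ I) -> /(_ I) ->.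
Qed.

Lemma ip_mulr (u : T -> C) f g :
  ip f (fun x => u x * g x) = ip (fun x => Num.conj (u x) * f x) g.
Proof. by apply: cint_ext => x _; apply: cplx_eq; rewrite !cE; ring. Qed.

Lemma nsqD f g : L2 f -> L2 g -> nsq (fun x => f x + g x) =
  nsq f + 2 * complex.Re (ip f g) + nsq g.
Proof.
move=> fi gi; apply: complexI.
rewrite -ip_nsq ipDr//; last exact: L2D.
rewrite !ipDl// !ip_nsq (ipC fi gi).
by apply: cplx_eq; rewrite !cE /=; ring.
Qed.

Lemma nsqB f g : L2 f -> L2 g -> nsq (fun x => f x - g x) =
  nsq f - 2 * complex.Re (ip f g) + nsq g.
Proof.
move=> fi gi; rewrite nsqD//; last exact: L2N.
rewrite nsqN; congr (_ + _ + _); rewrite -mulrN; congr (_ * _).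
rewrite -(cReN (ip f g)) -mulN1r -ipZr//.
by congr complex.Re; apply: cint_ext => x _; rewrite mulN1r.
Qed.

(** The squared norm of [g - c f] is nonnegative, where [c f] is the orthogonal projection of g on
    f. A null f is treated first, as c divides by [nsq f]. *)
Lemma cauchy_schwarz f g : L2 f -> L2 g -> csq (ip f g) <= nsq f * nsq g.
Proof.
move=> fi gi; have [f0|f0] := eqVneq (nsq f) 0.
  rewrite (@ae_eq_ip _ (fun=> 0) _ g) => //; [|exact: L2_0|exact: nsq_eq0|exact: ae_eq_refl].
  rewrite /inner; under cint_ext do rewrite (_ : Num.conj 0 = 0) ?mul0r ?conjC0//.
  by rewrite cint0 csq0 f0 mul0r.
have fp : 0 < nsq f by rewrite lt_neqAle eq_sym f0 nsq_ge0.
pose c := ((nsq f)^-1)%:C * ip f g.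
have := nsq_ge0 (fun x => g x - c * f x).
rewrite nsqB//; last exact: L2Z.
rewrite ipZr// nsqZ// (ipC fi gi) /c csqM csq_real.
set z := ip f g.
have -> : complex.Re ((nsq f)^-1%:C * z * Num.conj z) = (nsq f)^-1 * csq z.
  by rewrite !cE /csq /=; ring.
move=> H; rewrite -subr_ge0.
have := mulr_ge0 (ltW fp) H.
suff -> : nsq f * (nsq g - 2 * ((nsq f)^-1 * csq z) +
  (nsq f)^-1 ^+ 2 * csq z * nsq f) = nsq f * nsq g - csq z by [].
by field.
Qed.

Lemma nsqM_le (k : R) g f : cmeasurable setT g -> (forall x, csq (g x) <= k) ->
  L2 f -> nsq (fun x => g x * f x) <= k * nsq f.
Proof.
move=> mg gk fi; apply: nsq_le => //; first exact: L2Mb.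
by move=> x; rewrite csqM ler_wpM2r// csq_ge0.
Qed.

End SquareIntegrableTheory.

Lemma near_shrink (R : realType) (a : nat -> R) : a @ \oo --> (0 : R) ->
  forall e, 0 < e -> exists N, forall n, (N <= n)%N -> `|a n| <= e.
Proof.
move=> /cvgrPdist_le H e e0; have [N _ HN] := H e e0.
by exists N => n /HN; rewrite sub0r normrN.
Qed.

Section L2Convergence.
Context d (T : measurableType d) (R : realType).
Variable mu : {measure set T -> \bar R}.
Local Notation C := R[i].
Implicit Types (f g h : T -> C) (F G : nat -> T -> C).
Local Notation L2 := (LC mu 2%:E).
Local Notation ip := (inner mu).

Definition L2cvg F f :=
  (fun n => nsq mu (fun x => F n x - f x)) @ \oo --> (0 : R).

Lemma cvg_squeeze0 (a b : nat -> R) : (forall n, 0 <= a n <= b n) ->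
  b @ \oo --> (0 : R) -> a @ \oo --> (0 : R).
Proof.
move=> ab b0; apply: (squeeze_cvgr _ (cvg_cst 0) b0).
by apply: nearW => n; exact: ab.
Qed.

Lemma L2cvg_ip F f g : (forall n, L2 (F n)) -> L2 f -> L2 g -> L2cvg F f ->
  (fun n => csq (ip (F n) g - ip f g)) @ \oo --> (0 : R).
Proof.
move=> Fi fi gi Ff.
apply: (@cvg_squeeze0 _ (fun n => nsq mu (fun x => F n x - f x) * nsq mu g)).
  move=> n; rewrite csq_ge0 -ipBl//=; apply: cauchy_schwarz => //; exact: L2B.
rewrite -[X in _ --> X](mul0r (nsq mu g)); apply: cvgM => //; exact: cvg_cst.
Qed.

Lemma cvg_sqrt0 (a : nat -> R) : a @ \oo --> (0 : R) ->
  (fun n => Num.sqrt (a n)) @ \oo --> (0 : R).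
Proof.
move=> a0; rewrite -[X in _ --> X]sqrtr0.
by apply: (cvg_comp a (@Num.sqrt R) a0); exact: sqrt_continuous.
Qed.

(** The squared norms differ by [a n] plus twice the real part of <F n - f, f>, which Cauchy-Schwarz
    bounds by a multiple of the square root of [a n]. *)
Lemma L2cvg_nsq F f : (forall n, L2 (F n)) -> L2 f -> L2cvg F f ->
  (fun n => nsq mu (F n)) @ \oo --> nsq mu f.
Proof.
move=> Fi fi Ff.
pose a n := nsq mu (fun x => F n x - f x).
have E n : nsq mu (F n) - nsq mu f =
    a n + 2 * complex.Re (ip (fun x => F n x - f x) f).
  rewrite (_ : F n = (fun x => (F n x - f x) + f x)); last first.
    by apply/funext => x; rewrite subrK.
  rewrite nsqD//; last exact: L2B.
  rewrite addrK; congr (nsq mu _ + 2 * complex.Re (ip _ f));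
    by apply/funext => x; rewrite subrK.
apply/subr_cvg0.
have D0 : (fun n => a n + 2 * (Num.sqrt (a n) * Num.sqrt (nsq mu f))) @ \oo
    --> (0 : R).
  rewrite -[X in _ --> X](addr0 0); apply: cvgD => //.
  rewrite -[X in _ --> X](mulr0 2); apply: cvgM; first exact: cvg_cst.
  rewrite -[X in _ --> X](mul0r (Num.sqrt (nsq mu f))); apply: cvgM; last exact: cvg_cst.
  exact: cvg_sqrt0.
apply/norm_cvg0P; apply: (cvg_squeeze0 _ D0) => n; rewrite normr_ge0 /= E.
rewrite (le_trans (ler_normD _ _))//; apply: lerD.
  by rewrite ger0_norm// nsq_ge0.
rewrite normrM ger0_norm// ler_wpM2l//.
rewrite -sqrtrM ?nsq_ge0// -sqrtr_sqr ler_sqrt ?mulr_ge0 ?nsq_ge0//.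
apply: le_trans (normRe_sq _) _; apply: cauchy_schwarz => //; exact: L2B.
Qed.

Lemma L2cvg_unique F f g : (forall n, L2 (F n)) -> L2 f -> L2 g ->
  L2cvg F f -> L2cvg F g -> f = g %[ae mu].
Proof.
move=> Fi fi gi Ff Fg; apply: nsqB_eq0 => //.
apply/eqP; rewrite eq_le nsq_ge0 andbT; apply/ler_addgt0Pr => e e0.
have e4 : 0 < e / 4 by rewrite divr_gt0.
have [N HN] := near_shrink Ff e4; have [M HM] := near_shrink Fg e4.
have A := HN (maxn N M) (leq_maxl _ _); have B := HM (maxn N M) (leq_maxr _ _).
rewrite !ger0_norm ?nsq_ge0// in A B.
rewrite add0r (le_trans (nsqB_trans fi (Fi (maxn N M)) gi))// (nsqBC mu f).
by lra.
Qed.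

Lemma L2cvgD F f G g : (forall n, L2 (F n)) -> L2 f -> (forall n, L2 (G n)) ->
  L2 g -> L2cvg F f -> L2cvg G g ->
  L2cvg (fun n x => F n x + G n x) (fun x => f x + g x).
Proof.
move=> Fi fi Gi gi Ff Gg.
apply: (@cvg_squeeze0 _ (fun n => 2 * (nsq mu (fun x => F n x - f x) +
  nsq mu (fun x => G n x - g x)))).
  move=> n; rewrite nsq_ge0 /=; apply: le_trans (nsqD_le (L2B (Fi n) fi) (L2B (Gi n) gi)).
  rewrite le_eqVlt; apply/orP; left; apply/eqP; congr nsq; apply/funext => x; ring.
rewrite -[X in _ --> X](mulr0 2); apply: cvgM; first exact: cvg_cst.
by rewrite -[X in _ --> X](addr0 0); apply: cvgD.
Qed.

Lemma L2cvgM F f g (k : R) : (forall n, L2 (F n)) -> L2 f ->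
  cmeasurable setT g -> (forall x, csq (g x) <= k) -> L2cvg F f ->
  L2cvg (fun n x => g x * F n x) (fun x => g x * f x).
Proof.
move=> Fi fi mg gk Ff.
apply: (@cvg_squeeze0 _ (fun n => k * nsq mu (fun x => F n x - f x))).
  move=> n; rewrite nsq_ge0 /=; apply: le_trans (nsqM_le mg gk (L2B (Fi n) fi)).
  rewrite le_eqVlt; apply/orP; left; apply/eqP; congr nsq; apply/funext => x; ring.
by rewrite -[X in _ --> X](mulr0 k); apply: cvgM => //; exact: cvg_cst.
Qed.

Lemma nsq_dct F (v : T -> R) : (forall n, cmeasurable setT (F n)) ->
  mu.-integrable setT (EFin \o v) -> (forall n x, csq (F n x) <= v x) ->
  (forall x, (fun n => csq (F n x)) @ \oo --> (0 : R)) ->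
  (fun n => nsq mu (F n)) @ \oo --> (0 : R).
Proof.
move=> mF iv Fv F0.
have iF n : mu.-integrable setT (EFin \o (fun x => csq (F n x))).
  apply: (integrable_dom _ iv); first exact: measurable_csq.
  by move=> x; rewrite ger0_norm ?csq_ge0.
have [] := @dominated_convergence _ T R mu setT measurableT
  (fun n x => (csq (F n x))%:E) (fun=> 0%E) (EFin \o v).
- by move=> n; apply/measurable_EFinP; exact: measurable_csq.
- exact: measurable_cst.
- by apply: aeW => x _; apply/fine_cvgP; split; [exact: nearW|exact: F0].
- exact: iv.
- by apply: aeW => x n _; rewrite gee0_abs ?lee_fin ?csq_ge0.
move=> _ _; rewrite integral0 => /fine_cvgP[_].
by apply: cvg_trans.
Qed.

Lemma L2_dct F f (v : T -> R) : (forall n, cmeasurable setT (F n)) ->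
  cmeasurable setT f ->
  mu.-integrable setT (EFin \o v) -> (forall n x, csq (F n x - f x) <= v x) ->
  (forall x, (fun n => csq (F n x - f x)) @ \oo --> (0 : R)) -> L2cvg F f.
Proof.
by move=> mF mf iv Fv F0; apply: (nsq_dct _ iv) => // n; exact: cmeasB.
Qed.

Lemma fatou_le (u : nat -> T -> R) (w : T -> R) (e : R) :
  (forall n, measurable_fun setT (u n)) -> (forall n x, 0 <= u n x) ->
  (forall x, (u ^~ x) @ \oo --> w x) ->
  (forall n, (\int[mu]_x (u n x)%:E <= e%:E)%E) ->
  (\int[mu]_x (w x)%:E <= e%:E)%E.
Proof.
move=> mu' u0 uw ue.
have := @fatou _ T R mu setT measurableT (fun n x => (u n x)%:E).
have -> : (\int[mu]_x limn_einf (fun n => (u n x)%:E) =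
    \int[mu]_x (w x)%:E)%E.
  apply: eq_integral => x _.
  suff /cvg_limn_einf_sup[] : (fun n => (u n x)%:E) @ \oo --> (w x)%:E by [].
  by apply/fine_cvgP; split; [exact: nearW|exact: uw].
move=> H; apply: le_trans (H _ _) _.
- by move=> n; exact/measurable_EFinP.
- by move=> n x _; rewrite lee_fin.
rewrite limn_einf_lim; apply: lime_le; first exact: is_cvg_einfs.
apply: nearW => n; apply: le_trans (ue n).
by apply: ereal_inf_lbound; exists n => /=.
Qed.

Lemma cvg_of_geometric_steps (u : nat -> R) (A : R) : 0 <= A ->
  (forall k, `|u k.+1 - u k| <= A * 2^-1 ^+ k) -> cvgn u.
Proof.
move=> A0 H.
have : cvgn (series (fun k => u k.+1 - u k)).
  apply: normed_cvg.
  apply: (@series_le_cvg _ _ (geometric A 2^-1)) => //.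
  - by move=> n; exact: normr_ge0.
  - by move=> n; rewrite /geometric /= mulr_ge0// exprn_ge0// invr_ge0.
  - apply: is_cvg_geometric_series; rewrite ger0_norm ?invr_ge0//; lra.
move=> /cvg_ex[l Hl]; apply/cvg_ex; exists (l + u 0%N).
have E : (fun n => series (fun k => u k.+1 - u k) n + u 0%N) = u.
  by apply/funext => n; rewrite /series /= telescope_sumr ?subrK.
rewrite -{1}E; apply: cvgD => //; exact: cvg_cst.
Qed.

(* Riesz-Fischer: a fast subsequence converges almost everywhere, and Fatou's
   lemma bounds the distance to its limit. *)
Lemma L2_complete F : (forall n, L2 (F n)) ->
  (forall e, 0 < e -> exists N, forall m n, (N <= m)%N -> (N <= n)%N ->
     nsq mu (fun x => F m x - F n x) <= e) ->
  exists2 f, L2 f & L2cvg F f.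
Proof.
move=> Fi HF.
(* The factor [4 ^+ k] in [h] below turns these tolerances into the convergent series of 2^-(k+1).
   Where its pointwise sum S is finite, the k-th step of the subsequence has modulus at most sqrt S
   / 2^k. *)
pose dl k : R := (1 / (2 ^ (k + 0.+1))%:R) / 4 ^+ k.
have dl0 k : 0 < dl k by rewrite /dl !divr_gt0// ?exprn_gt0// ltr0n expn_gt0.
have /choice[N HN] : forall k, exists N, forall m n, (N <= m)%N -> (N <= n)%N ->
  nsq mu (fun x => F m x - F n x) <= dl k by move=> k; exact: HF (dl0 k).
(* Partial sums, so that the indices increase and dominate both [N k] and k. *)
pose M k := (\sum_(j < k.+1) (N j).+1)%N.
have MN k : (N k <= M k)%N by rewrite /M big_ord_recr/= (leq_trans (leqnSn _))// leq_addl.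
have MS k : (M k <= M k.+1)%N by rewrite /M [leqRHS]big_ord_recr/= leq_addr.
have kM k : (k <= M k)%N.
  by elim: k => [//|k IH]; rewrite /M big_ord_recr/= -[leqLHS]addn1; apply: leq_add.
pose g k := F (M k).
have gi k : L2 (g k) by exact: Fi.
pose h k x := 4 ^+ k * csq (g k.+1 x - g k x).
have h0 k x : 0 <= h k x by rewrite mulr_ge0 ?exprn_ge0// csq_ge0.
have mh k : measurable_fun setT (fun x => (h k x)%:E).
  apply/measurable_EFinP; apply: measurable_funM; first exact: measurable_cst.
  by apply: measurable_csq; apply: cmeasB; exact: L2_meas (gi _).
pose S x := (\sum_(0 <= k <oo) (h k x)%:E)%E.
have mS : measurable_fun setT S.
  by apply: ge0_emeasurable_sum => // k x _ _; rewrite lee_fin.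
have S0 x : (0 <= S x)%E by apply: nneseries_ge0 => k _ _; rewrite lee_fin.
have iS : (\int[mu]_x S x < +oo)%E.
  rewrite integral_nneseries//; last by move=> k x _; rewrite lee_fin.
  apply: (@le_lt_trans _ _ (\sum_(0 <= k <oo) (1 / (2 ^ (k + 0.+1))%:R)%:E)%E).
    apply: lee_nneseries => [k _ _|k _].
      by apply: integral_ge0 => x _; rewrite lee_fin.
    have -> : (\int[mu]_x (h k x)%:E)%E =
        (4 ^+ k * nsq mu (fun x => g k.+1 x - g k x))%:E.
      rewrite EFinM EFin_Rintegral//; last exact/L2_int/L2B.
      rewrite -ge0_integralZl_EFin ?exprn_ge0//.
      + by move=> x _; rewrite lee_fin csq_ge0.
      + by apply/measurable_EFinP; apply: measurable_csq; apply: cmeasB;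
          exact: L2_meas (gi _).
    rewrite lee_fin mulrC -ler_pdivlMr ?exprn_gt0//; apply: HN.
      exact: leq_trans (MN k) (MS k).
    exact: MN.
  by rewrite (cvg_lim _ (@cvg_geometric_eseries_half R 1 0))// ltry.
pose A := [set x | S x \is a fin_num].
have mA : measurable A.
  have := emeasurable_fin_num measurableT mS; by rewrite setTI.
have aeA : {ae mu, forall x, A x}.
  have : mu.-integrable setT S.
    apply/integrableP; split => //; apply: le_lt_trans iS.
    by under eq_integral do rewrite gee0_abs//.
  by move/(integrable_ae measurableT); apply: filterS => x; apply.
have csq_step k x : A x -> csq (g k.+1 x - g k x) <= fine (S x) * (2^-1 ^+ k) ^+ 2.
  move=> Ax; rewrite -ler_pdivrMr ?exprn_gt0 ?invr_gt0//.
  have -> : (2^-1 ^+ k) ^+ 2 = (4 ^+ k)^-1 :> R.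
    by rewrite -exprM mulnC exprM -exprVn; congr (_ ^+ k); field.
  rewrite invrK mulrC -lee_fin fineK//.
  apply: le_trans (@nneseries_lim_ge _ (fun k => (h k x)%:E) xpredT 0%N k.+1 _).
    rewrite big_nat_recr//= leeDr// sume_ge0// => j _; by rewrite lee_fin.
  by move=> n _ _; rewrite lee_fin.
(* Multiplying by the indicator of A makes the subsequence converge everywhere, so that its
   pointwise limit is measurable. *)
pose G k x : C := (\1_A x)%:C * g k x.
have mG k : cmeasurable setT (G k).
  apply: cmeasM; last exact: L2_meas.
  by apply: cmeas_real; exact: measurable_indic.
have pcvg (p : C -> R) : (forall a b : C, p (a - b) = p a - p b) ->
    (forall z, p z ^+ 2 <= csq z) -> p 0 = 0 -> forall x, cvgn (fun k => p (G k x)).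
  move=> pB pc p0 x; have [xA|xA] := boolP (x \in A); last first.
    rewrite (_ : (fun k => _) = (fun=> 0)); first exact: is_cvg_cst.
    by apply/funext => k; rewrite /G indicE (negbTE xA) mul0r.
  have Ax : A x by rewrite inE in xA.
  apply: (@cvg_of_geometric_steps _ (Num.sqrt (fine (S x)))) => [|k].
    exact: sqrtr_ge0.
  rewrite /G indicE xA !mul1r -pB -sqrtr_sqr.
  rewrite -[leRHS]ger0_norm ?mulr_ge0 ?sqrtr_ge0 ?exprn_ge0 ?invr_ge0//.
  rewrite -[leRHS]sqrtr_sqr ler_sqrt ?sqr_ge0//.
  rewrite exprMn sqr_sqrtr ?fine_ge0//.
  exact: le_trans (pc _) (csq_step _ _ Ax).
have cRe := pcvg (@complex.Re R) (fun a b => ltac:(by rewrite !cE)) (@normRe_sq R) erefl.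
have cIm := pcvg (@complex.Im R) (fun a b => ltac:(by rewrite !cE)) (@normIm_sq R) erefl.
pose f x : C := (limn (fun k => complex.Re (G k x))) +i* (limn (fun k => complex.Im (G k x))).
have mf : cmeasurable setT f.
  split; [apply: (@measurable_fun_cvg _ _ _ _ (fun k x => complex.Re (G k x)))|
          apply: (@measurable_fun_cvg _ _ _ _ (fun k x => complex.Im (G k x)))].
  - by move=> k; case: (mG k).
  - by move=> x _ /=; exact: cRe.
  - by move=> k; case: (mG k).
  - by move=> x _ /=; exact: cIm.
have Gi k : L2 (G k).
  apply: (@L2Mb _ _ _ _ 1) => //.
    by apply: cmeas_real; exact: measurable_indic.
  by move=> x; rewrite csq_real indicE; case: (x \in A); rewrite ?expr1n ?expr0n.
have Gg k : G k = g k %[ae mu].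
  by apply: filterS aeA => x Ax _; rewrite /G indicE mem_set// mul1r.
have key e : 0 < e -> exists N0, forall m, (N0 <= m)%N ->
    (\int[mu]_x (csq (F m x - f x))%:E <= e%:E)%E.
  move=> e0; have [N0 HN0] := HF e e0; exists N0 => m Nm.
  apply: (@fatou_le (fun k x => csq (F m x - G (k + N0)%N x))).
  - by move=> k; apply: measurable_csq; apply: cmeasB => //; exact: L2_meas.
  - by move=> k x; exact: csq_ge0.
  - move=> x; rewrite /csq.
    have H (p : C -> R) l : (forall a b : C, p (a - b) = p a - p b) ->
        (fun k => p (G k x)) @ \oo --> l ->
        (fun k => p (F m x - G (k + N0)%N x) ^+ 2) @ \oo --> (p (F m x) - l) ^+ 2.
      move=> pB pl; under eq_fun do rewrite pB expr2; rewrite expr2.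
      have D : (fun k => p (F m x) - p (G (k + N0)%N x)) @ \oo --> p (F m x) - l.
        apply: cvgB; first exact: cvg_cst.
        exact: (cvg_comp _ _ (cvg_addnr N0) pl).
      exact: cvgM.
    apply: cvgD.
      rewrite cReD cReN; apply: (H (@complex.Re R)); [by move=> a b; rewrite !cE|exact: cRe].
    by rewrite cImD cImN; apply: (H (@complex.Im R)); [by move=> a b; rewrite !cE|exact: cIm].
  - move=> k; rewrite -EFin_Rintegral//; last exact/L2_int/L2B.
    rewrite lee_fin.
    have -> : \int[mu]_x csq (F m x - G (k + N0)%N x) =
        nsq mu (fun x => F m x - g (k + N0)%N x).
      apply: ae_eq_nsq; [exact: L2B|exact: L2B|].
      by apply: filterS (Gg (k + N0)%N) => x /(_ I) ->.
    apply: HN0 => //.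
    by apply: leq_trans (kM _); rewrite leq_addl.
have L2Ff m : (\int[mu]_x (csq (F m x - f x))%:E < +oo)%E ->
    L2 (fun x => F m x - f x).
  move=> fin; apply/L2P; split; first by apply: cmeasB => //; exact: L2_meas.
  apply/integrableP; split.
    apply/measurable_EFinP; apply: measurable_csq; apply: cmeasB => //.
    exact: L2_meas.
  apply: le_lt_trans fin; rewrite le_eqVlt; apply/orP; left; apply/eqP.
  by apply: eq_integral => x _; rewrite /= ger0_norm// csq_ge0.
have [N0 HN0] := key 1 ltr01.
have fi : L2 f.
  rewrite (_ : f = (fun x => F N0 x - (F N0 x - f x))).
    apply: L2B => //; apply: L2Ff; apply: le_lt_trans (HN0 N0 (leqnn _)) _.
    exact: ltry.
  by apply/funext => x; rewrite subKr.
exists f => //; apply: limn_le_bound => [n|e e0]; first exact: nsq_ge0.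
have [N1 HN1] := key e e0; exists N1 => // n /= /HN1.
by rewrite -EFin_Rintegral ?lee_fin//; exact/L2_int/L2B.
Qed.

End L2Convergence.

Lemma cvg_sqB0 (R : realType) (u : nat -> R) (l : R) : u @ \oo --> l ->
  (fun n => (u n - l) ^+ 2) @ \oo --> (0 : R).
Proof.
move=> ul; have D : (fun n => u n - l) @ \oo --> (0 : R) by apply/subr_cvg0.
by rewrite -[X in _ --> X](mulr0 0); under eq_fun do rewrite expr2; exact: cvgM.
Qed.

Section IntegrableHelpers.
Context d (T : measurableType d) (R : realType).
Variable mu : {measure set T -> \bar R}.

Lemma integrable_meas (D : set T) (f : T -> \bar R) :
  mu.-integrable D f -> measurable_fun D f.
Proof. by case/integrableP. Qed.

Lemma integrable_rmeas (D : set T) (f : T -> R) :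
  mu.-integrable D (EFin \o f) -> measurable_fun D f.
Proof. by case/integrableP => /measurable_EFinP. Qed.

Lemma integrable_indic_lty (A : set T) : measurable A ->
  mu.-integrable setT (EFin \o \1_A) <-> (mu A < +oo)%E.
Proof.
move=> mA; have E : (\int[mu]_x `|(\1_A x)%:E| = mu A)%E.
  transitivity (\int[mu]_x (\1_A x)%:E)%E; last by rewrite integral_indic// setIT.
  by apply: eq_integral => x _; rewrite gee0_abs// lee_fin indicE.
split=> [/integrableP[_]|h]; first by rewrite /= E.
by apply/integrableP; rewrite /= E; split => //; apply/measurable_EFinP;
  exact: measurable_indic.
Qed.

End IntegrableHelpers.

(** * Induction over simple functions in L^2 *)

Section Density.
Context d (T : measurableType d) (R : realType).
Variable mu : {measure set T -> \bar R}.
Local Notation C := R[i].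
Implicit Types (f g h : T -> C).
Local Notation L2 := (LC mu 2%:E).
Import HBNNSimple.

Lemma L2_indic (A : set T) : measurable A -> (mu A < +oo)%E ->
  L2 (fun x => (\1_A x)%:C).
Proof.
move=> mA fA; apply: (@L2_dom _ _ _ _ _ (\1_A)).
- by apply: cmeas_real; exact: measurable_indic.
- exact/integrable_indic_lty.
- by move=> x; rewrite csq_real indicE; case: (x \in A); rewrite ?expr1n ?expr0n.
Qed.

(** Nonnegative functions are limits from below of simple functions, which they dominate; positive
    and negative, real and imaginary parts give the rest. The form of an induction principle suits
    any property that is linear and closed under limits. *)
Lemma L2_dense_ind (M : (T -> C) -> Prop) :
  (forall f g, L2 f -> L2 g -> M f -> M g -> M (fun x => f x + g x)) ->
  (forall (c : C) f, L2 f -> M f -> M (fun x => c * f x)) ->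
  (forall F f, (forall n, L2 (F n)) -> (forall n, M (F n)) -> L2 f ->
    L2cvg mu F f -> M f) ->
  (forall A, measurable A -> (mu A < +oo)%E -> M (fun x => (\1_A x)%:C)) ->
  forall f, L2 f -> M f.
Proof.
move=> MD MZ Mlim Mind f fi.
have M0 : M (fun=> 0).
  have f0 : (mu set0 < +oo)%E by rewrite measure0.
  have := MZ 0 _ (L2_indic measurable0 f0) (Mind set0 measurable0 f0).
  by congr M; apply/funext => x; rewrite mul0r.
have Mpos (u : T -> R) : (forall x, 0 <= u x) -> measurable_fun setT u ->
    mu.-integrable setT (EFin \o (fun x => u x ^+ 2)) -> M (fun x => (u x)%:C).
  move=> u0 mu' iu.
  have meu : measurable_fun setT (EFin \o u) by exact/measurable_EFinP.
  pose g := nnsfun_approx measurableT meu.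
  have gu x : EFin \o g ^~ x @ \oo --> (u x)%:E.
    by apply: cvg_nnsfun_approx => // t _; rewrite lee_fin.
  have gle n x : 0 <= g n x <= u x.
    rewrite fun_ge0 /= -lee_fin.
    have /fine_cvgP[_ gx] := gu x.
    have /cvg_lim <- // := gx; rewrite lee_fin.
    apply: (@nondecreasing_cvgn_le _ (fun n => g n x)); last first.
      by apply/cvg_ex; eexists; exact: gx.
    by move=> a b ab; exact/lefP/nd_nnsfun_approx.
  have gi n : L2 (fun x => (g n x)%:C).
    apply: (@L2_dom _ _ _ _ _ (fun x => u x ^+ 2)) => // x.
    rewrite csq_real lerXn2r// ?nnegrE ?u0//;
    by case/andP: (gle n x).
  have Mg n : M (fun x => (g n x)%:C).
    under eq_fun do rewrite fimfunEord rmorph_sum /=.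
    set s := finmap.enum_fset _.
    have H (i : nat) : L2 (fun x => (s`_i * \1_(g n @^-1` [set s`_i]) x)%:C) /\
      M (fun x => (s`_i * \1_(g n @^-1` [set s`_i]) x)%:C).
      under eq_fun do rewrite rmorphM.
      have [->|s0] := eqVneq (s`_i) 0.
        by under eq_fun do rewrite mul0r; split => //; exact: L2_0.
      set B := _ @^-1` _.
      have mB : measurable B by apply: measurable_funPTI; exact: measurable_set1.
      (* Chebyshev: on B the function u is at least the nonzero value that defines B, and the square
         of u is integrable. *)
      have fB : (mu B < +oo)%E.
        have i2 : mu.-integrable setT (EFin \o (fun x => (s`_i ^- 2) * u x ^+ 2)).
          exact: integrableZ_EFin.
        have : mu.-integrable setT (EFin \o \1_B).
          apply: (integrable_dom _ i2) => [|x]; first exact: measurable_indic.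
          rewrite indicE; have [xB|_] := boolP (x \in B); last first.
            by rewrite normr0 mulr_ge0// ?sqr_ge0// invr_ge0 sqr_ge0.
          rewrite normr1; move: xB; rewrite inE /B /= => gx.
          rewrite mulrC ler_pdivlMr ?exprn_even_gt0//= mul1r -gx.
          have /andP[a b] := gle n x.
          by rewrite lerXn2r ?nnegrE.
        by move/integrable_indic_lty; exact.
      by split; [apply: L2Z; exact: L2_indic|apply: MZ; [exact: L2_indic|exact: Mind]].
    have : L2 (fun x => \sum_(i < size s) (s`_i * \1_(g n @^-1` [set s`_i]) x)%:C) /\
           M (fun x => \sum_(i < size s) (s`_i * \1_(g n @^-1` [set s`_i]) x)%:C).
      elim: (size s) => [|k [IH1 IH2]].
        by under eq_fun do rewrite big_ord0; split => //; exact: L2_0.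
      have [H1 H2] := H k.
      under eq_fun do rewrite big_ord_recr /=.
      by split; [exact: L2D|exact: MD].
    by case.
  apply: (Mlim (fun n x => (g n x)%:C)) => //.
    apply: (@L2_dom _ _ _ _ _ (fun x => u x ^+ 2)) => //; try exact: cmeas_real.
    by move=> x; rewrite csq_real.
  apply: (@L2_dct _ _ _ _ _ _ (fun x => u x ^+ 2)).
  - by move=> n; exact: L2_meas (gi n).
  - exact: cmeas_real.
  - exact: iu.
  - move=> n x; rewrite -rmorphB csq_real -sqrrN opprB.
    have /andP[a b] := gle n x.
    by rewrite lerXn2r ?nnegrE ?subr_ge0// lerBlDr lerDl.
  - move=> x; have /fine_cvgP[_ gx] := gu x.
    apply: (cvg_squeeze0 _ (cvg_sqB0 gx)) => n.
    by rewrite csq_ge0 -rmorphB csq_real /= lexx.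
have Mreal (u : T -> R) : measurable_fun setT u ->
    mu.-integrable setT (EFin \o (fun x => u x ^+ 2)) ->
    L2 (fun x => (u x)%:C) /\ M (fun x => (u x)%:C).
  move=> mu' iu.
  have Lu (v : T -> R) : measurable_fun setT v -> (forall x, `|v x| <= `|u x|) ->
      L2 (fun x => (v x)%:C) /\ mu.-integrable setT (EFin \o (fun x => v x ^+ 2)).
    move=> mv vu.
    have vu2 x : v x ^+ 2 <= u x ^+ 2.
      by rewrite -[leLHS]real_normK ?num_real// -[leRHS]real_normK ?num_real// lerXn2r// nnegrE.
    split; last first.
      apply: (integrable_dom _ iu); first exact: measurable_funX.
      by move=> x; rewrite ger0_norm ?sqr_ge0.
    apply: (@L2_dom _ _ _ _ _ (fun x => u x ^+ 2)) => //; try exact: cmeas_real.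
    by move=> x; rewrite csq_real.
  have mp : measurable_fun setT (fun x => Num.max (u x) 0).
    apply: measurable_maxr; [exact: mu'|exact: measurable_cst].
  have mn : measurable_fun setT (fun x => Num.max (- u x) 0).
    apply: measurable_maxr; [exact: measurableT_comp|exact: measurable_cst].
  have [p1 p2] : L2 (fun x => (Num.max (u x) 0)%:C) /\
      mu.-integrable setT (EFin \o (fun x => (Num.max (u x) 0) ^+ 2)).
    by apply: Lu => // x; case: (leP (u x) 0) => h; rewrite ?normr0.
  have [n1 n2] : L2 (fun x => (Num.max (- u x) 0)%:C) /\
      mu.-integrable setT (EFin \o (fun x => (Num.max (- u x) 0) ^+ 2)).
    by apply: Lu => // x; case: (leP (- u x) 0) => h; rewrite ?normr0 ?normrN.
  have E x : (u x)%:C = (Num.max (u x) 0)%:C + (-1) * (Num.max (- u x) 0)%:C.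
    rewrite mulN1r -rmorphB; congr (_%:C).
    by case: (leP (u x) 0); case: (leP (- u x) 0); lra.
  split; first by case: (Lu u mu' (fun x => lexx _)).
  under eq_fun do rewrite E; apply: MD => //; first exact: L2Z.
  - by apply: Mpos => // x; rewrite le_max lexx orbT.
  - by apply: MZ => //; apply: Mpos => // x; rewrite le_max lexx orbT.
have [[m1 m2] ci] := (L2P mu f).1 fi.
have [] := @Mreal (fun x => complex.Re (f x)) m1.
  apply: (integrable_dom _ ci); first exact: measurable_funX.
  by move=> x; rewrite ger0_norm ?sqr_ge0 ?normRe_sq.
have [] := @Mreal (fun x => complex.Im (f x)) m2.
  apply: (integrable_dom _ ci); first exact: measurable_funX.
  by move=> x; rewrite ger0_norm ?sqr_ge0 ?normIm_sq.
move=> I1 I2 R1 R2.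
rewrite (_ : f = (fun x => (complex.Re (f x))%:C + 'i%C * (complex.Im (f x))%:C)).
  by apply: MD => //; [exact: L2Z|exact: MZ].
by apply/funext => x; exact: complexE.
Qed.

End Density.

(** * Fubini's theorem for real and complex integrands *)

Section ComplexFubini.
Context d1 d2 (T1 : measurableType d1) (T2 : measurableType d2) (R : realType).
Variables (m1 : {sigma_finite_measure set T1 -> \bar R})
          (m2 : {sigma_finite_measure set T2 -> \bar R}).
Local Notation C := R[i].
Local Notation m12 := (m1 \x m2)%E.

(** [Rintegral] applies [fine] to the inner integral, which is finite only for almost every x; the
    two outer integrands therefore agree almost everywhere. *)
Lemma RFubini12 (u : T1 * T2 -> R) : m12.-integrable setT (EFin \o u) ->
  \int[m1]_x \int[m2]_y u (x, y) = \int[m12]_z u z.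
Proof.
move=> iu; rewrite /Rintegral -(integral12_prod_meas1 iu); congr fine.
have iF := integrable_fubini_F iu.
apply: ae_eq_integral => //.
- apply/measurable_EFinP; apply: measurableT_comp => //.
  exact: integrable_meas iF.
- exact: integrable_meas iF.
- have := integrable_ae measurableT iF; apply: filterS => x /(_ I) h _.
  by rewrite /= fineK.
Qed.

Lemma RFubini21 (u : T1 * T2 -> R) : m12.-integrable setT (EFin \o u) ->
  \int[m2]_y \int[m1]_x u (x, y) = \int[m12]_z u z.
Proof.
move=> iu; rewrite /Rintegral -(integral21_prod_meas1 iu); congr fine.
have iG : m2.-integrable setT (fubini_G m1 (EFin \o u)).
  apply/integrableP; split; first exact: measurable_fubini_G iu.
  apply: le_lt_trans ((integrable21ltyP m1 m2 (integrable_meas iu)).1 iu).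
  apply: ge0_le_integral => //.
  - by apply: measurableT_comp => //; exact: measurable_fubini_G iu.
  - apply: (@measurable_fun_fubini_tonelli_G _ _ _ _ _ m1 (fun z => `|(u z)%:E|%E)) => //.
    by apply: measurableT_comp => //; exact: integrable_meas iu.
  - move=> y _; apply: le_abse_integral => //.
    by apply: measurableT_comp (pair2_measurable y); exact: integrable_meas iu.
apply: ae_eq_integral => //.
- apply/measurable_EFinP; apply: measurableT_comp => //.
  exact: integrable_meas iG.
- exact: integrable_meas iG.
- have := integrable_ae measurableT iG; apply: filterS => x /(_ I) h _.
  by rewrite /= fineK.
Qed.

Lemma cFubini12 (f : T1 * T2 -> C) : cintegrable m12 setT f ->
  cint m1 setT (fun x => cint m2 setT (fun y => f (x, y))) = cint m12 setT f.
Proof. by move=> [i1 i2]; apply: cplx_eq; [exact: (RFubini12 i1)|exact: (RFubini12 i2)]. Qed.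

Lemma cFubini21 (f : T1 * T2 -> C) : cintegrable m12 setT f ->
  cint m2 setT (fun y => cint m1 setT (fun x => f (x, y))) = cint m12 setT f.
Proof. by move=> [i1 i2]; apply: cplx_eq; [exact: (RFubini21 i1)|exact: (RFubini21 i2)]. Qed.

Lemma cintegrable_prod_dom (f : T1 * T2 -> C) (v : T1 * T2 -> R) :
  cmeasurable setT f -> measurable_fun setT v -> (forall z, cabs (f z) <= v z) ->
  (\int[m1]_x \int[m2]_y (v (x, y))%:E < +oo)%E -> cintegrable m12 setT f.
Proof.
move=> mf mv fv fin; apply: (cintegrable_dom mf _ fv).
apply/(integrable12ltyP m1 m2); first exact/measurable_EFinP.
move: fin; congr (_ < _)%E; apply: eq_integral => x _; apply: eq_integral => y _.
by rewrite /= ger0_norm// (le_trans _ (fv _))// cabs_ge0.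
Qed.

Lemma cmeas_fst (f : T1 -> C) : cmeasurable setT f ->
  cmeasurable setT (fun z : T1 * T2 => f z.1).
Proof. by apply: cmeas_comp; exact: measurable_fst. Qed.

Lemma cmeas_snd (f : T2 -> C) : cmeasurable setT f ->
  cmeasurable setT (fun z : T1 * T2 => f z.2).
Proof. by apply: cmeas_comp; exact: measurable_snd. Qed.

Lemma integrable_tensor (u : T1 -> R) (v : T2 -> R) :
  (forall x, 0 <= u x) -> (forall y, 0 <= v y) ->
  m1.-integrable setT (EFin \o u) -> m2.-integrable setT (EFin \o v) ->
  m12.-integrable setT (EFin \o (fun z => u z.1 * v z.2)).
Proof.
move=> u0 v0 iu iv.
have mU : measurable_fun setT u by exact: integrable_rmeas iu.
have mV : measurable_fun setT v by exact: integrable_rmeas iv.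
have muv : measurable_fun setT (EFin \o (fun z : T1 * T2 => u z.1 * v z.2)).
  apply/measurable_EFinP; apply: measurable_funM;
    [exact: measurableT_comp measurable_fst|exact: measurableT_comp measurable_snd].
apply/(integrable12ltyP m1 m2 muv).
rewrite (_ : (\int[m1]_x _)%E = (\int[m1]_x ((\int[m2]_y v y) * u x)%:E)%E).
  have := integrableZ_EFin (\int[m2]_y v y) iu => /integrableP[_].
  move/(le_lt_trans _); apply.
  by apply: le_trans (le_abse_integral _ _ _) => //; [exact: lee_abs|
    apply/measurable_EFinP; apply: measurable_funM => //; exact: measurable_cst].
apply: eq_integral => x _; rewrite EFinM EFin_Rintegral// muleC.
rewrite -ge0_integralZl_EFin//.
- by apply: eq_integral => y _; rewrite /= ger0_norm ?mulr_ge0.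
- by move=> y _; rewrite lee_fin.
- exact/measurable_EFinP.
Qed.

Lemma cintegrable_tensor (f : T1 -> C) (g : T2 -> C) :
  cintegrable m1 setT f -> cintegrable m2 setT g ->
  cintegrable m12 setT (fun z => f z.1 * g z.2).
Proof.
move=> /cintegrableP[mf fi] /cintegrableP[mg gi].
apply: (@cintegrable_dom _ _ _ _ _ (fun z => cabs (f z.1) * cabs (g z.2))).
- by apply: cmeasM; [exact: cmeas_fst|exact: cmeas_snd].
- by apply: (@integrable_tensor (fun x => cabs (f x)) (fun y => cabs (g y))) => // x;
    exact: cabs_ge0.
- by move=> z; rewrite cabsM.
Qed.

Lemma cint_tensor (f : T1 -> C) (g : T2 -> C) :
  cintegrable m1 setT f -> cintegrable m2 setT g ->
  cint m12 setT (fun z => f z.1 * g z.2) = cint m1 setT f * cint m2 setT g.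
Proof.
move=> fi gi; rewrite -cFubini12; last exact: cintegrable_tensor.
rewrite (@cint_ext _ _ _ _ _ _ (fun x => cint m2 setT g * f x)).
  by rewrite cintZ// mulrC.
by move=> x _ /=; rewrite cintZ// mulrC.
Qed.

Lemma measurable_param_integral (f : T1 * T2 -> \bar R) : measurable_fun setT f ->
  measurable_fun setT (fun x => \int[m2]_y f (x, y))%E.
Proof.
move=> mf; under eq_fun do rewrite integralE.
apply: emeasurable_funB.
  have := @measurable_fun_fubini_tonelli_F _ _ _ _ _ m2 (f^\+)%E
    (measurable_funepos mf) (@funepos_ge0 _ _ f).
  by apply: eq_measurable_fun => x _; apply: eq_integral => y _; rewrite !funeposE.
have := @measurable_fun_fubini_tonelli_F _ _ _ _ _ m2 (f^\-)%E
  (measurable_funeneg mf) (@funeneg_ge0 _ _ f).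
by apply: eq_measurable_fun => x _; apply: eq_integral => y _; rewrite !funenegE.
Qed.

Lemma cmeas_param_cint (f : T1 * T2 -> C) : cmeasurable setT f ->
  cmeasurable setT (fun x => cint m2 setT (fun y => f (x, y))).
Proof.
move=> [f1 f2]; split => /=; (apply: measurableT_comp; [exact: fine_measurable|]).
  apply: (measurable_param_integral (f := fun z => (complex.Re (f z))%:E)).
  exact/measurable_EFinP.
apply: (measurable_param_integral (f := fun z => (complex.Im (f z))%:E)).
exact/measurable_EFinP.
Qed.

End ComplexFubini.

(** * Lebesgue measure on R^3 *)

Section ProductInvariance.
Context d1 d2 (T1 : measurableType d1) (T2 : measurableType d2) (R : realType).
Variables (m1 : {sigma_finite_measure set T1 -> \bar R})
          (m2 : {sigma_finite_measure set T2 -> \bar R}).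

(** The push-forward agrees with the product measure on rectangles, which characterizes the product
    measure. *)
Lemma product_measure_invariant (f1 : T1 -> T1) (f2 : T2 -> T2) :
  measurable_fun setT f1 -> measurable_fun setT f2 ->
  (forall A, measurable A -> m1 (f1 @^-1` A) = m1 A) ->
  (forall A, measurable A -> m2 (f2 @^-1` A) = m2 A) ->
  forall A, measurable A ->
    (m1 \x m2)%E ((fun z => (f1 z.1, f2 z.2)) @^-1` A) = (m1 \x m2)%E A.
Proof.
move=> mf1 mf2 i1 i2 A mA.
have mf : measurable_fun [set: T1 * T2] (fun z : T1 * T2 => (f1 z.1, f2 z.2)).
  apply/measurable_fun_pair;
    [exact: measurableT_comp measurable_fst|exact: measurableT_comp measurable_snd].
have -> : (m1 \x m2)%E ((fun z => (f1 z.1, f2 z.2)) @^-1` A) =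
  pushforward (m1 \x m2)%E (fun z : T1 * T2 => (f1 z.1, f2 z.2)) A by [].
pose nu : {measure set (T1 * T2) -> \bar R} :=
  measure_function_pushforward__canonical__measure_function_Measure (m1 \x m2)%E mf.
rewrite (_ : pushforward _ _ = nu)//.
symmetry; apply: (@product_measure_unique _ _ _ _ _ m1 m2 nu) => // X Y mX mY.
rewrite /nu /= /pushforward.
have -> : (fun z : T1 * T2 => (f1 z.1, f2 z.2)) @^-1` (X `*` Y) =
  (f1 @^-1` X) `*` (f2 @^-1` Y) by [].
rewrite product_measure1E; first by congr (_ * _)%E; [exact: i1|exact: i2].
- by rewrite -(setTI (_ @^-1` _)); exact: mf1.
- by rewrite -(setTI (_ @^-1` _)); exact: mf2.
Qed.

Lemma product_sigma_finite (F : nat -> set T1) (G : nat -> set T2) :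
  (forall n, measurable (F n) /\ (m1 (F n) < +oo)%E) ->
  (forall n, measurable (G n) /\ (m2 (G n) < +oo)%E) ->
  (forall x y, exists n, F n x /\ G n y) ->
  sigma_finite setT (m1 \x m2)%E.
Proof.
move=> HF HG cov; exists (fun n => F n `*` G n).
  apply/esym/seteqP; split=> // -[x y] _; have [n [Fx Gy]] := cov x y.
  by exists n.
move=> n; have [mF fF] := HF n; have [mG fG] := HG n.
split; first exact: measurableX.
rewrite product_measure1E//; apply: lte_mul_pinfty => //.
by rewrite ge0_fin_numE.
Qed.

End ProductInvariance.

Section Lebesgue1.
Variable R : realType.
Local Notation leb := (@lebesgue_measure R).

Lemma lebesgue_translation (h : R) (A : set R) : measurable A ->
  leb ((fun x => x + h) @^-1` A) = leb A.
Proof.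
move=> mA.
have mf : measurable_fun setT (fun x : measurableTypeR R => x + h : measurableTypeR R).
  by apply: measurable_funD => //; exact: measurable_cst.
pose nu : {measure set (measurableTypeR R) -> \bar R} :=
  measure_function_pushforward__canonical__measure_function_Measure leb mf.
have -> : leb ((fun x => x + h) @^-1` A) = nu A by [].
symmetry; apply: lebesgue_measure_unique => // X [[a b] _ <-].
rewrite /nu /= /pushforward.
have -> : (fun x : R => x + h) @^-1` [set` `]a, b]] = [set` `](a - h), (b - h)]].
  by apply/seteqP; split=> x /=; rewrite !in_itv /= lerBrDr ltrBlDr.
rewrite !lebesgue_measure_itv /= !lte_fin ltrD2r; case: ifP => // _.
by rewrite -!EFinB; congr (_%:E); ring.
Qed.

Lemma leb_itv_lty (a b : R) : (leb `]a, b]%classic < +oo)%E.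
Proof.
by rewrite lebesgue_measure_itv /=; case: ifP => // _; rewrite -EFinB ltry.
Qed.

Lemma real_in_itv (x : R) (n : nat) : (Num.trunc `|x| < n)%N ->
  `]- n%:R, n%:R]%classic x.
Proof.
move=> h; rewrite /= in_itv /=.
have xn : `|x| < n%:R.
  by apply: lt_le_trans (truncnS_gt _) _; rewrite ler_nat.
have := ler_norm x; have := ler_norm (- x); rewrite normrN; lra.
Qed.

End Lebesgue1.

Section Lebesgue3Theory.
Variable R : realType.
Local Notation lam := (@borel_lebesgue3 R).
Local Notation l1 := (@lebesgue_measure R).
Local Notation B3 := (measurableTypeR R * measurableTypeR R * measurableTypeR R)%type.

Lemma sigma_finite_l2 : sigma_finite setT (l1 \x l1)%E.
Proof.
apply: (@product_sigma_finite _ _ _ _ _ l1 l1 (fun n => `]- n%:R, n%:R]%classic)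
  (fun n => `]- n%:R, n%:R]%classic)).
- by move=> n; split; [exact: measurable_itv|exact: leb_itv_lty].
- by move=> n; split; [exact: measurable_itv|exact: leb_itv_lty].
- move=> x y; exists (Num.trunc `|x| + Num.trunc `|y|).+1.
  by split; apply: real_in_itv; rewrite ltnS ?leq_addr ?leq_addl.
Qed.

(** Named so that sigma-finiteness, which Fubini's theorem requires, can be registered for the
    product. *)
Definition leb2 := (l1 \x l1)%E.
HB.instance Definition _ := Measure.on leb2.
HB.instance Definition _ := Measure_isSigmaFinite.Build _ _ _ leb2 sigma_finite_l2.

Lemma lamE : lam = (leb2 \x l1)%E.
Proof. by []. Qed.

Lemma sigma_finite_lam : sigma_finite setT lam.
Proof.
rewrite lamE; pose I (n : nat) : set R := `]- n%:R, n%:R]%classic.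
apply: (@product_sigma_finite _ _ _ _ _ leb2 l1 (fun n => I n `*` I n)
  (fun n => `]- n%:R, n%:R]%classic)).
- move=> n; split; first by apply: measurableX; exact: measurable_itv.
  rewrite [X in (X < _)%E](_ : _ =
      (l1 (I n) * l1 (I n))%E); last first.
    by apply: product_measure1E; exact: measurable_itv.
  apply: lte_mul_pinfty => //; last exact: leb_itv_lty.
  by rewrite ge0_fin_numE// leb_itv_lty.
- by move=> n; split; [exact: measurable_itv|exact: leb_itv_lty].
- move=> [x y] z; exists (Num.trunc `|x| + Num.trunc `|y| + Num.trunc `|z|).+1.
  by split; [split|]; apply: real_in_itv; rewrite /= ltnS;
    [rewrite -addnA leq_addr|rewrite -addnA addnCA leq_addr|rewrite leq_addl].
Qed.

HB.instance Definition _ := Measure_isSigmaFinite.Build _ _ _ lam sigma_finite_lam.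

Local Notation leb := (@lebesgue3 R).

Lemma measurable_R3E (A : set (R3 R)) :
  measurable A = (lam^*)%mu.-caratheodory A.
Proof. by rewrite /measurable /=. Qed.

Lemma measurable_B3 (A : set (R * R * R)) : measurable (A : set B3) ->
  measurable (A : set (R3 R)).
Proof.
move=> mA; rewrite measurable_R3E.
exact: (@caratheodory_measurable_mu_ext _ R B3 lam A mA).
Qed.

Lemma leb3_lam (A : set (R * R * R)) : measurable (A : set B3) ->
  leb A = lam A.
Proof. exact: measurable_mu_extE. Qed.

Lemma sigma_finite_leb3 : sigma_finite [set: R3 R] (@lebesgue3 R).
Proof.
have [F HF1 HF2] := sigma_finite_lam.
exists F => // n; have [mF fF] := HF2 n; split; first exact: measurable_B3.
by rewrite leb3_lam.
Qed.

HB.instance Definition _ := Measure_isSigmaFinite.Build _ _ _ (@lebesgue3 R)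
  sigma_finite_leb3.

Lemma measurable_fun_id3 : measurable_fun setT (fun x : R3 R => x : B3).
Proof. by move=> _ A mA; rewrite setTI; exact: measurable_B3. Qed.

Lemma measurable_fun_B3 d (T : measurableType d) (f : R * R * R -> T) :
  measurable_fun [set: B3] f -> measurable_fun [set: R3 R] f.
Proof. by move=> mf; exact: (measurableT_comp mf measurable_fun_id3). Qed.

(** The identity, from the Lebesgue to the Borel measurable sets, pushes the completed measure
    forward to the Borel one. Integrals of Borel functions can thus be computed with the product
    measure. *)
Lemma ge0_integral_B3 (f : R * R * R -> \bar R) :
  measurable_fun [set: B3] f -> (forall x, (0 <= f x)%E) ->
  (\int[leb]_x f x = \int[lam]_x f x)%E.
Proof.
move=> mf f0.
have E := @ge0_integral_pushforward _ _ (R3 R) B3 R (fun x => x)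
  measurable_fun_id3 leb setT f measurableT mf (fun y _ => f0 y).
transitivity (\int[pushforward leb (fun x : R3 R => x : B3)]_(y in setT) f y)%E.
  exact: (esym E).
apply: (@eq_measure_integral _ B3) => [|mid A mA _]; first exact: measurable_fun_id3.
exact: (leb3_lam mA).
Qed.

Lemma lam_translation (h : R * R * R) (A : set B3) : measurable A ->
  lam ((fun x : R * R * R => x + h) @^-1` A) = lam A.
Proof.
move: h => [[h1 h2] h3] mA; rewrite lamE.
have mt (h : R) : measurable_fun setT (fun x : measurableTypeR R => x + h : measurableTypeR R).
  by apply: measurable_funD => //; exact: measurable_cst.
apply: (@product_measure_invariant _ _ _ _ _ leb2 l1
  (fun z => (z.1 + h1, z.2 + h2)) (fun x => x + h3)) => //.
- apply/measurable_fun_pair;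
    [exact: measurableT_comp (mt _) measurable_fst|
     exact: measurableT_comp (mt _) measurable_snd].
- move=> B mB; apply: (@product_measure_invariant _ _ _ _ _ l1 l1
    (fun x => x + h1) (fun x => x + h2)) => //; try exact: mt.
  + by move=> X mX; exact: lebesgue_translation.
  + by move=> X mX; exact: lebesgue_translation.
- by move=> X mX; exact: lebesgue_translation.
Qed.

Section BijectionInvariance.
Variables f g : R * R * R -> R * R * R.
Hypotheses (fK : cancel f g) (gK : cancel g f).
Hypotheses (mf : measurable_fun setT (f : B3 -> B3))
           (mg : measurable_fun setT (g : B3 -> B3)).
Hypothesis f_inv : forall A : set B3, measurable A -> lam (f @^-1` A) = lam A.

Let g_inv (A : set B3) : measurable A -> lam (g @^-1` A) = lam A.
Proof.
move=> mA; rewrite -f_inv; last by rewrite -(setTI (g @^-1` A)); exact: mg.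
by congr (lam _); apply/seteqP; split => x /=; rewrite fK.
Qed.

Let preim_f (A : set B3) : measurable A -> measurable ((f : B3 -> B3) @^-1` A).
Proof. by move=> mA; rewrite -(setTI (f @^-1` A)); exact: mf. Qed.

Let preim_g (A : set B3) : measurable A -> measurable ((g : B3 -> B3) @^-1` A).
Proof. by move=> mA; rewrite -(setTI (g @^-1` A)); exact: mg. Qed.

(** The outer measure is an infimum over countable Borel covers, and pulling back a cover of X by u
    gives a cover of the preimage with the same total measure. *)
Let leb_le (u : R * R * R -> R * R * R) (X : set (R * R * R)) :
  (forall A : set B3, measurable A -> measurable ((u : B3 -> B3) @^-1` A)) ->
  (forall A : set B3, measurable A -> lam (u @^-1` A) = lam A) ->
  (leb (u @^-1` X) <= leb X)%E.
Proof.
move=> mu iu; apply: le_ereal_inf_tmp => _ [F [mF XF] <-].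
apply: ereal_inf_lbound; exists (fun n => u @^-1` (F n)); first split.
- by move=> n; exact: mu.
- by move=> x /= /XF[n _ Fx]; exists n.
- by apply: eq_eseriesr => n _; exact: iu.
Qed.

Lemma leb3_preimage (X : set (R * R * R)) : leb (f @^-1` X) = leb X.
Proof.
apply/eqP; rewrite eq_le leb_le//=.
have {1}-> : X = g @^-1` (f @^-1` X).
  by apply/seteqP; split => x /=; rewrite gK.
exact: leb_le.
Qed.

(** Caratheodory's criterion speaks only of the outer measure, which f preserves on all sets. Borel
    measurability of f would not suffice: it does not control preimages of Lebesgue measurable
    sets. *)
Lemma measurable_R3_preimage : measurable_fun setT (f : R3 R -> R3 R).
Proof.
move=> _ A; rewrite setTI !measurable_R3E => mA X.
have E : X = f @^-1` (g @^-1` X) by apply/seteqP; split => x /=; rewrite fK.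
have inv Y : (lam^*)%mu (f @^-1` Y) = (lam^*)%mu Y by exact: leb3_preimage.
by rewrite E preimage_setC -!preimage_setI !inv; exact: mA.
Qed.

End BijectionInvariance.

Lemma measurable_proj3 :
  [/\ measurable_fun [set: B3] (fun x => x.1.1 : R),
      measurable_fun [set: B3] (fun x => x.1.2 : R) &
      measurable_fun [set: B3] (fun x => x.2 : R)].
Proof.
split.
- exact: measurableT_comp measurable_fst measurable_fst.
- exact: measurableT_comp measurable_snd measurable_fst.
- exact: measurable_snd.
Qed.

Lemma measurable_B3P d (T : measurableType d) (f : T -> R * R * R) :
  measurable_fun setT (fun x => (f x).1.1) ->
  measurable_fun setT (fun x => (f x).1.2) ->
  measurable_fun setT (fun x => (f x).2) ->
  measurable_fun setT (f : T -> B3).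
Proof.
move=> m1 m2 m3; rewrite (_ : f = (fun x => ((f x).1.1, (f x).1.2, (f x).2))).
  by apply: measurable_fun_pair => //; exact: measurable_fun_pair.
by apply/funext => x; case: (f x) => [[]].
Qed.

Lemma measurable_coord3 d (T : measurableType d) (f : T -> R * R * R) i :
  measurable_fun setT (f : T -> B3) -> measurable_fun setT (fun x => coord3 i (f x)).
Proof.
move=> mf; have [m1 m2 m3] := measurable_proj3.
case: i => [[|[|[|]]] hi]//; rewrite /coord3 /tnth /=.
- exact: measurableT_comp m1 mf.
- exact: measurableT_comp m2 mf.
- exact: measurableT_comp m3 mf.
Qed.

Lemma measurable_dot3 d (T : measurableType d) (f g : T -> R * R * R) :
  measurable_fun setT (f : T -> B3) -> measurable_fun setT (g : T -> B3) ->
  measurable_fun setT (fun x => dot3 (f x) (g x)).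
Proof.
move=> mf mg; rewrite /dot3; under eq_fun do rewrite !big_ord_recr big_ord0 /=.
by repeat apply: measurable_funD; try apply: measurable_funM;
  (exact: measurable_cst || exact: measurable_coord3).
Qed.

Lemma measurable_norm3 d (T : measurableType d) (f : T -> R * R * R) :
  measurable_fun setT (f : T -> B3) -> measurable_fun setT (fun x => norm3 (f x)).
Proof.
move=> mf; apply: (@measurableT_comp _ _ _ _ _ _ (@Num.sqrt R)).
  by apply: continuous_measurable_fun; exact: sqrt_continuous.
exact: measurable_dot3.
Qed.

Lemma measurable_add3 d (T : measurableType d) (f g : T -> R * R * R) :
  measurable_fun setT (f : T -> B3) -> measurable_fun setT (g : T -> B3) ->
  measurable_fun setT ((fun x => f x + g x) : T -> B3).
Proof.
have [p1 p2 p3] := measurable_proj3.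
move=> mf mg; apply: measurable_B3P => /=; apply: measurable_funD;
  [exact: measurableT_comp p1 mf|exact: measurableT_comp p1 mg|
   exact: measurableT_comp p2 mf|exact: measurableT_comp p2 mg|
   exact: measurableT_comp p3 mf|exact: measurableT_comp p3 mg].
Qed.

Lemma measurable_opp3 d (T : measurableType d) (f : T -> R * R * R) :
  measurable_fun setT (f : T -> B3) ->
  measurable_fun setT ((fun x => - f x) : T -> B3).
Proof.
have [p1 p2 p3] := measurable_proj3.
move=> mf; apply: measurable_B3P => /=; apply: measurableT_comp => //;
  [exact: measurableT_comp p1 mf|exact: measurableT_comp p2 mf|
   exact: measurableT_comp p3 mf].
Qed.

Lemma measurable_sub3 d (T : measurableType d) (f g : T -> R * R * R) :
  measurable_fun setT (f : T -> B3) -> measurable_fun setT (g : T -> B3) ->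
  measurable_fun setT ((fun x => f x - g x) : T -> B3).
Proof. by move=> mf mg; apply: measurable_add3 => //; exact: measurable_opp3. Qed.

Lemma translation3_leb (h : R * R * R) (X : set (R * R * R)) :
  leb ((fun x : R * R * R => x + h) @^-1` X) = leb X.
Proof.
apply: (@leb3_preimage _ (fun x => x - h)); [exact: addrK|exact: subrK| | |].
- by apply: measurable_add3 => //; exact: measurable_cst.
- by apply: measurable_sub3 => //; exact: measurable_cst.
- by move=> A; exact: lam_translation.
Qed.

Lemma measurable_translation3 (h : R * R * R) :
  measurable_fun setT (fun x : R3 R => x + h : R3 R).
Proof.
apply: (@measurable_R3_preimage _ (fun x => x - h)); [exact: addrK|exact: subrK| | |].
- by apply: measurable_add3 => //; exact: measurable_cst.
- by apply: measurable_sub3 => //; exact: measurable_cst.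
- by move=> A; exact: lam_translation.
Qed.

End Lebesgue3Theory.

Lemma indic1 (T : Type) (R : pzRingType) (A : set T) x : A x -> \1_A x = 1 :> R.
Proof. by move=> Ax; rewrite indicE mem_set. Qed.

Lemma indic0E (T : Type) (R : pzRingType) (A : set T) x : ~ A x -> \1_A x = 0 :> R.
Proof. by move=> Ax; rewrite indicE memNset. Qed.

(** * Extension of a linear and closed property from boxes to L^2 *)

Section DynkinDensity.
Context d (T : measurableType d) (R : realType).
Variable mu : {measure set T -> \bar R}.
Local Notation C := R[i].
Local Notation L2 := (LC mu 2%:E).
Variable M : (T -> C) -> Prop.
Hypothesis MD : forall f g, L2 f -> L2 g -> M f -> M g -> M (fun x => f x + g x).
Hypothesis MZ : forall (c : C) f, L2 f -> M f -> M (fun x => c * f x).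
Hypothesis Mlim : forall F f, (forall n, L2 (F n)) -> (forall n, M (F n)) ->
  L2 f -> L2cvg mu F f -> M f.
Local Notation ind A := (fun x => (\1_A x)%:C).

(** The constant sequence [ind A] converges to [ind B] in L^2, so closure under limits includes
    closure under changes on null sets. *)
Lemma ind_ae (A B : set T) : measurable A -> measurable B -> (mu A < +oo)%E ->
  (mu B < +oo)%E -> M (ind A) -> (forall x, B x -> A x) -> mu (A `\` B) = 0%E ->
  M (ind B).
Proof.
move=> mA mB fA fB MA BA AB0.
apply: (Mlim (F := fun=> ind A)) => //; try by move=> _; exact: L2_indic.
  exact: L2_indic.
apply: (@cvg_squeeze0 _ _ (fun=> 0)); last exact: cvg_cst.
move=> n; rewrite nsq_ge0 /= nsqB_ae//; [exact: L2_indic|exact: L2_indic|].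
exists (A `\` B); split => //; first exact: measurableD.
move=> x /= h; apply: contrapT => h2; apply: h => _.
have [b|b] := pselect (B x); first by rewrite !indic1//; exact: BA.
by rewrite !indic0E// => a; exact: h2.
Qed.

Lemma ind_disjointU (A B : set T) : measurable A -> measurable B ->
  (mu A < +oo)%E -> (mu B < +oo)%E -> (forall x, A x -> B x -> False) ->
  M (ind A) -> M (ind B) -> M (ind (A `|` B)).
Proof.
move=> mA mB fA fB AB MA MB.
rewrite (_ : ind (A `|` B) = (fun x => (\1_A x)%:C + (\1_B x)%:C)).
  by apply: MD => //; exact: L2_indic.
apply/funext => x; rewrite -rmorphD; congr (_%:C).
have [a|a] := pselect (A x); have [b|b] := pselect (B x).
- by exfalso; exact: AB a b.
- by rewrite (indic1 _ a) (indic0E _ b) indic1 ?addr0//; left.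
- by rewrite (indic0E _ a) (indic1 _ b) indic1 ?add0r//; right.
- by rewrite !indic0E ?addr0// => -[].
Qed.

Lemma ind_diff (A B : set T) : measurable A -> measurable B ->
  (mu A < +oo)%E -> (mu B < +oo)%E -> (forall x, B x -> A x) ->
  M (ind A) -> M (ind B) -> M (ind (A `\` B)).
Proof.
move=> mA mB fA fB BA MA MB.
rewrite (_ : ind (A `\` B) = (fun x => (\1_A x)%:C + -1 * (\1_B x)%:C)).
  apply: MD => //; [exact: L2_indic|apply: L2Z; exact: L2_indic|].
  by apply: MZ => //; exact: L2_indic.
apply/funext => x; rewrite mulN1r -rmorphB; congr (_%:C).
have [b|b] := pselect (B x).
  by rewrite (indic1 _ b) (indic1 _ (BA _ b)) subrr indic0E// => -[].
have [a|a] := pselect (A x); first by rewrite (indic0E _ b) (indic1 _ a) subr0 indic1.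
by rewrite !indic0E ?subr0// => -[].
Qed.

Lemma ind_increasing (B : nat -> set T) (A : set T) :
  (forall n, measurable (B n)) -> measurable A -> (mu A < +oo)%E ->
  (forall n x, B n x -> A x) ->
  (forall x, A x -> exists N, forall n, (N <= n)%N -> B n x) ->
  (forall n, M (ind (B n))) -> M (ind A).
Proof.
move=> mB mA fA BA AB MB.
have fB n : (mu (B n) < +oo)%E.
  by apply: le_lt_trans fA; apply: le_measure; rewrite ?inE//; exact: BA.
apply: (Mlim (F := fun n => ind (B n))) => //.
- by move=> n; exact: L2_indic.
- exact: L2_indic.
apply: (@L2_dct _ _ _ _ _ _ (\1_A)).
- by move=> n; apply: cmeas_real; exact: measurable_indic.
- by apply: cmeas_real; exact: measurable_indic.
- exact/integrable_indic_lty.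
- move=> n x; rewrite -rmorphB csq_real.
  have [b|b] := pselect (B n x).
    by rewrite (indic1 _ b) (indic1 _ (BA _ _ b)) subrr expr0n.
  rewrite (indic0E _ b) sub0r sqrrN indicE.
  by case: (x \in A); rewrite ?expr1n ?expr0n.
- move=> x; have [a|a] := pselect (A x).
    have [N HN] := AB x a; apply: cvg_near_cst; exists N => // n /= Nn.
    by rewrite (indic1 _ (HN n Nn)) (indic1 _ a) subrr csq0.
  apply: cvg_near_cst; apply: nearW => n.
  by rewrite (indic0E _ a) indic0E ?subrr ?csq0// => /BA.
Qed.

Section Dynkin.
Context d' (T' : measurableType d').
Variables (p : T -> T') (Z : set T).
Hypotheses (mp : measurable_fun setT p) (mZ : measurable Z) (fZ : (mu Z < +oo)%E).
Hypothesis MIZ : M (ind Z).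

Let mpre (S : set T') : measurable S -> measurable (p @^-1` S `&` Z).
Proof. by move=> mS; apply: measurableI => //; rewrite -(setTI (_ @^-1` _)); exact: mp. Qed.

Let fpre (S : set T') : measurable S -> (mu (p @^-1` S `&` Z) < +oo)%E.
Proof.
move=> mS; apply: le_lt_trans fZ; apply: le_measure; rewrite ?inE//.
exact: mpre.
Qed.

(** The pi-lambda theorem, with complements taken within Z, since only indicators of sets of finite
    measure are square-integrable. The map p will be a projection or the identity, so that one
    factor of a box can be generalized at a time. *)
Lemma ind_dynkin (G : set (set T')) : @measurable _ T' = <<s G >> ->
  setI_closed G -> (forall S, G S -> M (ind (p @^-1` S `&` Z))) ->
  forall S, measurable S -> M (ind (p @^-1` S `&` Z)).
Proof.
move=> mG GI MG S mS; move: (mS); rewrite mG.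
apply: (@dynkin_induction _ T' G (fun S => M (ind (p @^-1` S `&` Z))) mG GI) => {S mS}.
- by rewrite preimage_setT setTI.
- exact: MG.
- move=> S mS MS.
  rewrite (_ : p @^-1` (~` S) `&` Z = Z `\` (p @^-1` S `&` Z)).
    apply: ind_diff => //; [exact: mpre|exact: fpre|by move=> x []].
  by apply/seteqP; split=> x /= [a b]; split => //; [move=> []|move=> c; apply: b].
- move=> F mF tF MF.
  have mU n : measurable (\bigcup_(i in `I_n) F i) by exact: bigcup_measurable.
  apply: (ind_increasing (B := fun n => p @^-1` (\bigcup_(i in `I_n) F i) `&` Z)).
  + by move=> n; exact: mpre.
  + by apply: mpre; exact: bigcup_measurable.
  + by apply: fpre; exact: bigcup_measurable.
  + by move=> n x [[i _ Fi] Zx]; split => //; exists i.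
  + move=> x [[i _ Fi] Zx]; exists i.+1 => n ni; split => //.
    by exists i.
  + elim=> [|n IH].
      rewrite (_ : _ `&` _ = Z `\` Z); first exact: ind_diff.
      by apply/seteqP; split=> x /= -[] // [j].
    rewrite (_ : _ `&` _ = (p @^-1` (\bigcup_(i in `I_n) F i) `&` Z) `|` (p @^-1` F n `&` Z)).
      apply: ind_disjointU => //; try exact: mpre; try exact: fpre.
      move=> x [[i /= i_n Fi] _] [Fn _].
      have e : i = n by apply: (tF i n) => //; exists (p x).
      by move: i_n; rewrite e ltnn.
    apply/seteqP; split=> x /=.
      move=> [[i /= ]]; rewrite ltnS leq_eqVlt => /orP[/eqP ->|lin] Fi Zx; first by right.
      by left; split => //; exists i.
    move=> [[[i /= lin] Fi] Zx|[Fn Zx]]; split => //.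
      by exists i => //=; rewrite ltnW.
    by exists n => /=.
Qed.

End Dynkin.

End DynkinDensity.

Section BoxDensity.
Variable R : realType.
Local Notation C := R[i].
Local Notation leb := (@lebesgue3 R).
Local Notation lam := (@borel_lebesgue3 R).
Local Notation B1 := (measurableTypeR R).
Local Notation B3 := (measurableTypeR R * measurableTypeR R * measurableTypeR R)%type.
Local Notation ind A := (fun x : R3 R => (\1_A x)%:C).

Definition box3 (I1 I2 I3 : set R) : set (R * R * R) := (I1 `*` I2) `*` I3.

Lemma measurable_box3 (I1 I2 I3 : set R) : measurable I1 -> measurable I2 ->
  measurable I3 -> measurable (box3 I1 I2 I3 : set B3).
Proof. by move=> m1 m2 m3; apply: measurableX => //; exact: measurableX. Qed.

Lemma lam_box3 (I1 I2 I3 : set R) : measurable I1 -> measurable I2 ->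
  measurable I3 -> lam (box3 I1 I2 I3) =
    (lebesgue_measure I1 * lebesgue_measure I2 * lebesgue_measure I3)%E.
Proof.
move=> m1 m2 m3; rewrite lamE.
have -> : (@leb2 R \x lebesgue_measure)%E (box3 I1 I2 I3) =
    (@leb2 R (I1 `*` I2) * lebesgue_measure I3)%E.
  by apply: product_measure1E => //; exact: measurableX.
by congr (_ * _)%E; exact: product_measure1E.
Qed.

Lemma ocitv_measurable (I : set R) : ocitv I -> measurable I.
Proof. by move=> [ab _ <-]; exact: measurable_itv. Qed.

Lemma ocitv_lty (I : set R) : ocitv I -> (lebesgue_measure I < +oo)%E.
Proof. by move=> [[a b] _ <-]; exact: leb_itv_lty. Qed.

Lemma leb_box3_lty (I1 I2 I3 : set R) : ocitv I1 -> ocitv I2 -> ocitv I3 ->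
  (leb (box3 I1 I2 I3) < +oo)%E.
Proof.
move=> o1 o2 o3; rewrite leb3_lam; last by apply: measurable_box3; exact: ocitv_measurable.
rewrite lam_box3; [|exact: ocitv_measurable|exact: ocitv_measurable|exact: ocitv_measurable].
have fin (I : set R) : ocitv I -> lebesgue_measure I \is a fin_num.
  by move=> o; rewrite ge0_fin_numE// ocitv_lty.
by rewrite -(fineK (fin _ o1)) -(fineK (fin _ o2)) -(fineK (fin _ o3)) -!EFinM ltry.
Qed.

(** Intersect Borel covers whose measure exceeds that of A by at most 1 / (n + 1). *)
Lemma borel_hull (A : set (R * R * R)) : (leb A < +oo)%E ->
  exists B : set B3, [/\ measurable B, A `<=` B & leb B = leb A].
Proof.
move=> fA.
have fin : leb A \is a fin_num by rewrite ge0_fin_numE// mu_ext_ge0.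
have H (n : nat) : exists B : set B3, [/\ measurable B, A `<=` B &
    (lam B <= leb A + n.+1%:R^-1%:E)%E].
  have e0 : 0 < n.+1%:R^-1 :> R by rewrite invr_gt0.
  have [_ [F [mF AF] <-] lt] := lb_ereal_inf_adherent e0 fin.
  exists (\bigcup_k F k); split => //; first exact: bigcup_measurable.
  apply: le_trans (ltW lt).
  apply: generalized_Boole_inequality => //; exact: bigcup_measurable.
have [B HB] := choice H.
have mI : measurable (\bigcap_n B n) by apply: bigcap_measurable => // n _; case: (HB n).
have AI : A `<=` \bigcap_n B n by move=> x Ax n _; case: (HB n) => _ + _; exact.
exists (\bigcap_n B n); split => //.
apply/eqP; rewrite eq_le; apply/andP; split; last exact: le_mu_ext.
rewrite leb3_lam//; apply/lee_addgt0Pr => e e0.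
pose n := Num.trunc e^-1.
have [mB _ le] := HB n.
apply: le_trans (_ : (lam (B n) <= _)%E).
  by apply: le_measure; rewrite ?inE//; exact: bigcap_inf.
apply: le_trans le _; rewrite leeD2l// lee_fin.
rewrite -[leRHS]invrK lef_pV2 ?posrE ?invr_gt0//.
exact/ltW/truncnS_gt.
Qed.

Variable M : (R3 R -> C) -> Prop.
Hypothesis MD : forall f g, L2 f -> L2 g -> M f -> M g -> M (fun x => f x + g x).
Hypothesis MZ : forall (c : C) f, L2 f -> M f -> M (fun x => c * f x).
Hypothesis Mlim : forall F f, (forall n, L2 (F n)) -> (forall n, M (F n)) ->
  L2 f -> L2cvg leb F f -> M f.
Hypothesis Mbox : forall I1 I2 I3 : set R, ocitv I1 -> ocitv I2 -> ocitv I3 ->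
  M (ind (box3 I1 I2 I3)).

Let dyn d' (T' : measurableType d') (p : R * R * R -> T') (Z : set B3)
    (G : set (set T')) : measurable_fun [set: B3] p -> measurable Z ->
  (leb Z < +oo)%E -> M (ind Z) -> @measurable _ T' = <<s G >> -> setI_closed G ->
  (forall S, G S -> M (ind (p @^-1` S `&` Z))) ->
  forall S, measurable S -> M (ind (p @^-1` S `&` Z)).
Proof.
move=> mp mZ fZ MIZ mG GI MG.
apply: (@ind_dynkin _ (R3 R) R leb M MD MZ Mlim _ T' p Z _ _ fZ MIZ G mG GI MG).
- exact: (measurable_fun_B3 mp).
- exact: (measurable_B3 mZ).
Qed.

Let mR : @measurable _ B1 = <<s @ocitv R >>.
Proof. by []. Qed.

Let box_lty (A1 A2 A3 I1 I2 I3 : set R) : measurable A1 -> measurable A2 ->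
  measurable A3 -> ocitv I1 -> ocitv I2 -> ocitv I3 ->
  (leb (box3 (A1 `&` I1) (A2 `&` I2) (A3 `&` I3)) < +oo)%E.
Proof.
move=> m1 m2 m3 o1 o2 o3; apply: le_lt_trans (leb_box3_lty o1 o2 o3).
by apply: le_mu_ext => -[[x y] z] [[[_ a] [_ b]] [_ c]].
Qed.

Let mbox (A1 A2 A3 I1 I2 I3 : set R) : measurable A1 -> measurable A2 ->
  measurable A3 -> ocitv I1 -> ocitv I2 -> ocitv I3 ->
  measurable (box3 (A1 `&` I1) (A2 `&` I2) (A3 `&` I3) : set B3).
Proof.
move=> m1 m2 m3 o1 o2 o3; apply: measurable_box3;
  apply: measurableI => //; exact: ocitv_measurable.
Qed.

(** Stages 1 to 3 replace the intervals by Borel sets, one coordinate at a time. Stage 4 passes from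
    rectangles to Borel sets of the plane, stage 5 to Borel sets of space. Each time the sets
    already treated contain a generating family closed under intersection, and the fixed intervals
    keep the measure finite. *)
Let stage1 (A1 I1 I2 I3 : set R) : measurable A1 -> ocitv I1 -> ocitv I2 ->
  ocitv I3 -> M (ind (box3 (A1 `&` I1) I2 I3)).
Proof.
move=> m1 o1 o2 o3; have [p1 p2 p3] := @measurable_proj3 R.
have E (S : set R) : box3 (S `&` I1) I2 I3 = (fun x => x.1.1) @^-1` S `&` box3 I1 I2 I3.
  by apply/seteqP; split=> -[[x y] z] /=; rewrite /box3 /=; tauto.
rewrite E; apply: (dyn (T' := B1) (p := fun x => x.1.1) _ _ _ _ mR (@ocitvI R)) => //.
- by apply: measurable_box3; exact: ocitv_measurable.
- exact: leb_box3_lty.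
- exact: Mbox.
- by move=> S oS; rewrite -E; apply: Mbox => //; exact: ocitvI.
Qed.

Let stage2 (A1 A2 I1 I2 I3 : set R) : measurable A1 -> measurable A2 ->
  ocitv I1 -> ocitv I2 -> ocitv I3 ->
  M (ind (box3 (A1 `&` I1) (A2 `&` I2) I3)).
Proof.
move=> m1 m2 o1 o2 o3; have [p1 p2 p3] := @measurable_proj3 R.
have E (S : set R) : box3 (A1 `&` I1) (S `&` I2) I3 =
    (fun x => x.1.2) @^-1` S `&` box3 (A1 `&` I1) I2 I3.
  by apply/seteqP; split=> -[[x y] z] /=; rewrite /box3 /=; tauto.
rewrite E; apply: (dyn (T' := B1) (p := fun x => x.1.2) _ _ _ _ mR (@ocitvI R)) => //.
- by rewrite -(setTI I2) -(setTI I3); exact: mbox.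
- by rewrite -(setTI I2) -(setTI I3); exact: box_lty.
- exact: stage1.
- by move=> S oS; rewrite -E; apply: stage1 => //; exact: ocitvI.
Qed.

Let stage3 (A1 A2 A3 I1 I2 I3 : set R) : measurable A1 -> measurable A2 ->
  measurable A3 -> ocitv I1 -> ocitv I2 -> ocitv I3 ->
  M (ind (box3 (A1 `&` I1) (A2 `&` I2) (A3 `&` I3))).
Proof.
move=> m1 m2 m3 o1 o2 o3; have [p1 p2 p3] := @measurable_proj3 R.
have E (S : set R) : box3 (A1 `&` I1) (A2 `&` I2) (S `&` I3) =
    (fun x => x.2) @^-1` S `&` box3 (A1 `&` I1) (A2 `&` I2) I3.
  by apply/seteqP; split=> -[[x y] z] /=; rewrite /box3 /=; tauto.
rewrite E; apply: (dyn (T' := B1) (p := fun x => x.2) _ _ _ _ mR (@ocitvI R)) => //.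
- by rewrite -(setTI I3); exact: mbox.
- by rewrite -(setTI I3); exact: box_lty.
- exact: stage2.
- by move=> S oS; rewrite -E; apply: stage2 => //; exact: ocitvI.
Qed.

Let rectI (d1 d2 : measure_display) (T1 : measurableType d1) (T2 : measurableType d2) :
  setI_closed [set A `*` B | A in @measurable _ T1 & B in @measurable _ T2].
Proof.
move=> _ _ [A mA [B mB <-]] [A' mA' [B' mB' <-]].
exists (A `&` A'); first exact: measurableI.
by exists (B `&` B'); [exact: measurableI|rewrite setXI].
Qed.

Let stage4 (A : set (B1 * B1)) (A3 I1 I2 I3 : set R) : measurable A ->
  measurable A3 -> ocitv I1 -> ocitv I2 -> ocitv I3 ->
  M (ind (A `*` A3 `&` box3 I1 I2 I3)).
Proof.
move=> mA m3 o1 o2 o3.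
have E (S : set (B1 * B1)) : S `*` A3 `&` box3 I1 I2 I3 =
    (fun x => x.1) @^-1` S `&` box3 I1 I2 (A3 `&` I3).
  by apply/seteqP; split=> -[[x y] z] /=; rewrite /box3 /=; tauto.
rewrite E; apply: (dyn (T' := (B1 * B1)%type) (p := fun x => x.1) _ _ _ _
  (@measurable_prod_measurableType _ _ B1 B1) (@rectI _ _ _ _)) => //.
- exact: measurable_fst.
- by rewrite -(setTI I1) -(setTI I2); exact: mbox.
- by rewrite -(setTI I1) -(setTI I2); exact: box_lty.
- by rewrite -(setTI I1) -(setTI I2); exact: stage3.
- move=> _ [A1 m1 [A2 m2 <-]].
  rewrite (_ : _ `&` _ = box3 (A1 `&` I1) (A2 `&` I2) (A3 `&` I3)); first exact: stage3.
  by apply/seteqP; split=> -[[x y] z] /=; rewrite /box3 /=; tauto.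
Qed.

Let stage5 (A : set B3) (I1 I2 I3 : set R) : measurable A ->
  ocitv I1 -> ocitv I2 -> ocitv I3 -> M (ind (A `&` box3 I1 I2 I3)).
Proof.
move=> mA o1 o2 o3.
apply: (dyn (T' := B3) (p := fun x => x) _ _ _ _
  (@measurable_prod_measurableType _ _ (B1 * B1)%type B1) (@rectI _ _ _ _)) => //.
- by rewrite -(setTI I1) -(setTI I2) -(setTI I3); exact: mbox.
- by rewrite -(setTI I1) -(setTI I2) -(setTI I3); exact: box_lty.
- exact: Mbox.
- by move=> _ [A1 m1 [A2 m2 <-]]; exact: stage4.
Qed.

(** A set of finite measure differs from a Borel set by a null set, and this Borel set is exhausted
    by its intersections with cubes. *)
Lemma L2_box_ind (f : R3 R -> C) : L2 f -> M f.
Proof.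
apply: (L2_dense_ind MD MZ Mlim) => A mA fA.
have [B [mB AB eB]] := borel_hull fA.
have mB' : measurable (B : set (R3 R)) by exact: measurable_B3.
have fB : (leb B < +oo)%E by rewrite eB.
pose I (n : nat) : set R := `]- n%:R, n%:R]%classic.
have oI n : ocitv (I n) by exists (- n%:R, n%:R).
have MB : M (ind B).
  apply: (ind_increasing Mlim (B := fun n => B `&` box3 (I n) (I n) (I n))) => //.
  - move=> n; apply: measurable_B3; apply: measurableI => //.
    by apply: measurable_box3; exact: ocitv_measurable.
  - by move=> n x [].
  - move=> -[[x y] z] Bx.
    exists (Num.trunc `|x| + Num.trunc `|y| + Num.trunc `|z|).+1 => n Nn; split => //.
    split; [split|]; apply: real_in_itv; apply: leq_trans Nn; rewrite ltnS;
      [rewrite -addnA leq_addr|rewrite -addnA addnCA leq_addr|rewrite leq_addl]; done.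
  - by move=> n; exact: stage5.
apply: (ind_ae Mlim (A := B)) => //.
have e : leb (B `&` A) = leb A by rewrite (setIidr AB).
rewrite (measureD mB' mA fB) /= e eB subee// ge0_fin_numE//.
Qed.

End BoxDensity.

Section Dot3.
Variable R : realType.
Implicit Types x y z : R * R * R.

Lemma dot3E x y : dot3 x y = x.1.1 * y.1.1 + x.1.2 * y.1.2 + x.2 * y.2.
Proof. by rewrite /dot3 !big_ord_recr big_ord0 /= add0r /coord3 !(tnth_nth 0). Qed.

Lemma dot3C x y : dot3 x y = dot3 y x.
Proof. by rewrite !dot3E; ring. Qed.
Lemma dot3Dl x y z : dot3 (x + y) z = dot3 x z + dot3 y z.
Proof. by rewrite !dot3E /=; ring. Qed.
Lemma dot3Dr x y z : dot3 z (x + y) = dot3 z x + dot3 z y.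
Proof. by rewrite !dot3E /=; ring. Qed.
Lemma dot3Nl x y : dot3 (- x) y = - dot3 x y.
Proof. by rewrite !dot3E /=; ring. Qed.
Lemma dot3Nr x y : dot3 x (- y) = - dot3 x y.
Proof. by rewrite !dot3E /=; ring. Qed.
Lemma dot3Bl x y z : dot3 (x - y) z = dot3 x z - dot3 y z.
Proof. by rewrite dot3Dl dot3Nl. Qed.
Lemma dot3_ge0 x : 0 <= dot3 x x.
Proof. by rewrite dot3E !addr_ge0// -expr2 sqr_ge0. Qed.
Lemma norm3_ge0 x : 0 <= norm3 x.
Proof. exact: sqrtr_ge0. Qed.
Lemma sqr_norm3 x : norm3 x ^+ 2 = dot3 x x.
Proof. by rewrite sqr_sqrtr// dot3_ge0. Qed.
Lemma norm3N x : norm3 (- x) = norm3 x.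
Proof. by rewrite /norm3 dot3Nl dot3Nr opprK. Qed.
Lemma norm3BC x y : norm3 (x - y) = norm3 (y - x).
Proof. by rewrite -norm3N opprB. Qed.
Lemma norm3_eq0 x : norm3 x = 0 -> x = 0.
Proof.
move=> h; have := sqr_norm3 x; rewrite h expr0n /= dot3E.
case: x {h} => [[a b] c] /= /esym/eqP; rewrite -!expr2.
rewrite paddr_eq0 ?addr_ge0 ?sqr_ge0// paddr_eq0 ?sqr_ge0// !sqrf_eq0.
by move=> /andP[/andP[/eqP -> /eqP ->] /eqP ->].
Qed.
Lemma dot3_le x y : dot3 x y <= norm3 x * norm3 y.
Proof.
apply: le_trans (ler_norm _) _.
rewrite -[leRHS]ger0_norm ?mulr_ge0 ?norm3_ge0// -!sqrtr_sqr ler_sqrt ?sqr_ge0//.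
rewrite exprMn !sqr_norm3 !dot3E -subr_ge0.
set a := x.1.1; set b := x.1.2; set c := x.2.
set a' := y.1.1; set b' := y.1.2; set c' := y.2.
(* Lagrange's identity. *)
rewrite (_ : _ - _ = (a * b' - b * a') ^+ 2 + (a * c' - c * a') ^+ 2 +
  (b * c' - c * b') ^+ 2); last by ring.
by rewrite !addr_ge0// sqr_ge0.
Qed.
Lemma norm3D_le x y : norm3 (x + y) <= norm3 x + norm3 y.
Proof.
rewrite -(@ler_pXn2r _ 2)// ?nnegrE ?addr_ge0 ?norm3_ge0//.
rewrite sqr_norm3 dot3Dl !dot3Dr sqrrD -!sqr_norm3 (dot3C y x).
by have := dot3_le x y; lra.
Qed.
Lemma norm3B_trans y x z : norm3 (x - z) <= norm3 (x - y) + norm3 (y - z).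
Proof. by apply: le_trans (norm3D_le _ _); rewrite addrA subrK. Qed.

Lemma coord3_le x i : `|coord3 i x| <= norm3 x.
Proof.
rewrite -[leRHS]ger0_norm ?norm3_ge0// -!sqrtr_sqr ler_sqrt ?sqr_ge0//.
rewrite sqr_norm3 /dot3 (bigD1 i)//= -expr2 lerDl sumr_ge0// => j _.
by rewrite -expr2 sqr_ge0.
Qed.
Lemma norm3_le_coord x : norm3 x <= `|x.1.1| + `|x.1.2| + `|x.2|.
Proof.
rewrite -(@ler_pXn2r _ 2)// ?nnegrE ?norm3_ge0// sqr_norm3 dot3E.
rewrite -!expr2 -(real_normK (num_real x.1.1)) -(real_normK (num_real x.1.2)).
rewrite -(real_normK (num_real x.2)).
have := normr_ge0 x.1.1; have := normr_ge0 x.1.2; have := normr_ge0 x.2.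
move: `|_| `|_| `|_| => a b c; nra.
Qed.

End Dot3.

(** * Invariance of Lebesgue measure under isometries *)

Section TonelliSet.
Context d1 d2 (T1 : measurableType d1) (T2 : measurableType d2) (R : realType).
Variables (m1 : {sigma_finite_measure set T1 -> \bar R})
          (m2 : {sigma_finite_measure set T2 -> \bar R}).

Lemma tonelli_set (S : set (T1 * T2)) : measurable S ->
  (\int[m1]_x m2 [set y | S (x, y)] = \int[m2]_y m1 [set x | S (x, y)])%E.
Proof.
move=> mS.
have := @fubini_tonelli _ _ T1 T2 R m1 m2 (fun z => (\1_S z)%:E).
have mi : measurable_fun setT (fun z => (\1_S z)%:E : \bar R).
  by apply/measurable_EFinP; exact: measurable_indic.
have p1 z : (0%R <= (\1_S z)%:E :> \bar R)%E by rewrite lee_fin indicE.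
move=> /(_ mi p1) H.
transitivity (\int[m1]_x \int[m2]_y (\1_S (x, y))%:E)%E.
  apply: eq_integral => x _.
  rewrite (eq_integral (fun y => (\1_[set y | S (x, y)] y)%:E)).
    rewrite integral_indic ?setIT//.
    have := measurable_xsection x mS.
    by congr measurable; apply/seteqP; split => y; rewrite /xsection /= in_setE.
  by move=> y _; congr (_%:E); rewrite !indicE; congr (nat_of_bool _)%:R; apply/idP/idP; rewrite !in_setE.
rewrite H; apply: eq_integral => y _.
rewrite (eq_integral (fun x => (\1_[set x | S (x, y)] x)%:E)).
  rewrite integral_indic ?setIT//.
  have := measurable_ysection y mS.
  by congr measurable; apply/seteqP; split => x; rewrite /ysection /= in_setE.
by move=> x _; congr (_%:E); rewrite !indicE; congr (nat_of_bool _)%:R; apply/idP/idP; rewrite !in_setE.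
Qed.

Lemma integral_indic_mulr (A : set T1) (c : \bar R) : measurable A -> (0 <= c)%E ->
  (\int[m1]_x ((\1_A x)%:E * c) = m1 A * c)%E.
Proof.
move=> mA c0; rewrite ge0_integralZr ?integral_indic ?setIT//.
by apply/measurable_EFinP; exact: measurable_indic.
Qed.

End TonelliSet.

Lemma mule_cancel (R : realType) (a b c : \bar R) : (0 < a)%E -> (a < +oo)%E ->
  (a * b = a * c -> b = c)%E.
Proof.
move=> a0 ay abc; have fa : a \is a fin_num by rewrite ge0_fin_numE// ltW.
have a1 : fine a != 0 by rewrite gt_eqF// fine_gt0// a0.
have : ((fine a)^-1%:E * (a * b) = (fine a)^-1%:E * (a * c))%E by rewrite abc.
by rewrite -(fineK fa) !muleA -EFinM mulVf// !mul1e.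
Qed.

Section IsometryInvariance.
Variable R : realType.
Local Notation lam := (@borel_lebesgue3 R).
Local Notation B3 := (measurableTypeR R * measurableTypeR R * measurableTypeR R)%type.

Let K : set B3 := [set x | norm3 x <= 1].

Let mK : measurable K.
Proof.
have := @measurable_norm3 R _ B3 (fun x => x) (@measurable_id _ _ _) measurableT
  `]-oo, 1]%classic (measurable_itv _).
by rewrite setTI; congr measurable; apply/seteqP; split => x /=; rewrite in_itv.
Qed.

Let K_gt0 : (0 < lam K)%E.
Proof.
pose I : set R := `]0, 2^-1]%classic.
apply: (@lt_le_trans _ _ (lam (box3 I I I))).
  rewrite lam_box3; [|exact: measurable_itv|exact: measurable_itv|exact: measurable_itv].
  rewrite lebesgue_measure_itv /= lte_fin invr_gt0 ltr0n /= -EFinB -!EFinM lte_fin subr0.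
  by rewrite !mulr_gt0.
apply: le_measure; rewrite ?inE//.
  by apply: measurable_box3; exact: measurable_itv.
move=> -[[x y] z] [[]]; rewrite /I /= !in_itv /= => /andP[x0 x1] /andP[y0 y1] /andP[z0 z1].
rewrite /K /= -(@ler_pXn2r _ 2)// ?nnegrE ?norm3_ge0// sqr_norm3 dot3E /= expr1n.
nra.
Qed.

Let K_lty : (lam K < +oo)%E.
Proof.
pose I : set R := `]-2, 2]%classic.
have oI : ocitv I by exists (-2, 2).
apply: le_lt_trans (leb_box3_lty oI oI oI).
rewrite leb3_lam; last by apply: measurable_box3; exact: measurable_itv.
apply: le_measure; rewrite ?inE//.
  by apply: measurable_box3; exact: measurable_itv.
move=> x Kx; have h i := le_trans (coord3_le x i) Kx.
have := h 0; have := h 1; have := h 2%:R; rewrite /coord3 !(tnth_nth 0) /=.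
case: x {Kx h} => [[x y] z] /=; rewrite !ler_norml => /andP[a b] /andP[c e] /andP[u v].
by split; [split|]; rewrite /I /= in_itv /=; lra.
Qed.

(* Uniqueness of Haar measure: by Tonelli and translation invariance,
   lam (f^-1 B) * lam K = lam B * lam K for the unit ball K, which f preserves. *)
Lemma lam_isometry (f g : R * R * R -> R * R * R) :
  measurable_fun setT (f : B3 -> B3) -> measurable_fun setT (g : B3 -> B3) ->
  {morph f : x y / x + y} -> {morph f : x / - x} -> cancel f g -> cancel g f ->
  (forall x, norm3 (f x) = norm3 x) ->
  forall A : set B3, measurable A -> lam (f @^-1` A) = lam A.
Proof.
move=> mf mg fD fN fK gK fn B mB.
have mfB : measurable (f @^-1` B : set B3).
  by rewrite -(setTI (f @^-1` B)); exact: mf.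
have mfst : measurable_fun setT (fun z : B3 * B3 => z.1 : B3) by exact: measurable_fst.
have msnd : measurable_fun setT (fun z : B3 * B3 => f z.2 : B3).
  exact: measurableT_comp mf measurable_snd.
(* For fixed y the slices of [S1] and [S2] are translates of each other by [f y]. Integrated over x,
   the slices of [S1] at fixed x give [lam K] times the measure of the preimage of B, those of [S2]
   give [lam B] times [lam K]. *)
pose S1 := [set z : B3 * B3 | K z.1 /\ B ((z.1 + f z.2) : R * R * R)].
pose S2 := [set z : B3 * B3 | B z.1 /\ K ((z.1 - f z.2) : R * R * R)].
have mS1 : measurable S1.
  apply: measurableI.
    by have := mfst measurableT _ mK; rewrite setTI.
  have := measurable_add3 mfst msnd; move=> /(_ measurableT _ mB); rewrite setTI.
  exact.
have mS2 : measurable S2.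
  apply: measurableI.
    by have := mfst measurableT _ mB; rewrite setTI.
  have := measurable_sub3 mfst msnd; move=> /(_ measurableT _ mK); rewrite setTI.
  exact.
have E1 : (\int[lam]_x lam [set y | S1 (x, y)] = lam K * lam (f @^-1` B))%E.
  rewrite (eq_integral (fun x => ((\1_K x)%:E * lam (f @^-1` B))%E)).
    exact: integral_indic_mulr.
  move=> x _; have [k|k] := pselect (K x); last first.
    have e : [set y | S1 (x, y)] = set0.
      apply/seteqP; split=> y; last exact: (@False_ind _).
      by move=> [bx _]; have := k bx.
    by rewrite e (indic0E _ k) mul0e; exact: measure0.
  rewrite (indic1 _ k) mul1e.
  transitivity (lam ((fun y : R * R * R => y + g x) @^-1` (f @^-1` B)));
    last exact: lam_translation.
  by congr (lam _); apply/seteqP; split => y; rewrite /S1 /= fD gK addrC; [case|].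
have E2 : (\int[lam]_y lam [set x | S1 (x, y)] =
    \int[lam]_y lam [set x | S2 (x, y)])%E.
  apply: eq_integral => y _.
  transitivity (lam ((fun x : R * R * R => x + f y) @^-1` [set x | S2 (x, y)])).
    by congr (lam _); apply/seteqP; split => x; rewrite /S1 /S2 /= addrK => -[].
  apply: lam_translation; have := measurable_ysection y mS2.
  by congr measurable; apply/seteqP; split => x; rewrite /ysection /= in_setE.
have E3 : (\int[lam]_x lam [set y | S2 (x, y)] = lam B * lam K)%E.
  rewrite (eq_integral (fun x => ((\1_B x)%:E * lam K)%E)).
    exact: integral_indic_mulr.
  move=> x _; have [k|k] := pselect (B x); last first.
    have e : [set y | S2 (x, y)] = set0.
      apply/seteqP; split=> y; last exact: (@False_ind _).
      by move=> [bx _]; have := k bx.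
    by rewrite e (indic0E _ k) mul0e; exact: measure0.
  rewrite (indic1 _ k) mul1e.
  transitivity (lam ((fun y : R * R * R => y + - g x) @^-1` K));
    last exact: lam_translation.
  have e y : norm3 (x - f y) = norm3 (y + - g x).
    by rewrite norm3BC -[in LHS](gK x) -fN -fD fn.
  congr (lam _); apply/seteqP; split => y.
    by move=> [_]; rewrite /K /= e.
  by move=> h; split; [exact: k|rewrite /K /= e].
apply: (mule_cancel K_gt0 K_lty).
by rewrite -E1 (tonelli_set lam lam mS1) E2 -(tonelli_set lam lam mS2) E3 muleC.
Qed.

End IsometryInvariance.

(** * Rotations *)

Section Rotations.
Variable R : realType.
Local Notation C := R[i].
Local Notation SU2 := (@SU2 R).
Local Notation lam := (@borel_lebesgue3 R).
Local Notation leb := (@lebesgue3 R).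
Local Notation B3 := (measurableTypeR R * measurableTypeR R * measurableTypeR R)%type.
Implicit Types (B : 'M[C]_2) (x y p k : R * R * R).

Lemma sum2 (V : nmodType) (F : 'I_2 -> V) : \sum_(i < 2) F i = F 0 + F 1.
Proof.
by rewrite big_ord_recl big_ord1; congr (_ + F _); apply/val_inj.
Qed.

Lemma SU2_mulV B : SU2 B -> B *m B^t* = 1%:M.
Proof. by move=> [/unitarymxP]. Qed.

Lemma SU2_unit B : SU2 B -> B \in unitmx.
Proof. by move=> [_ d]; rewrite unitmxE d unitr1. Qed.

Lemma SU2_inv B : SU2 B -> invmx B = B^t*.
Proof.
move=> SB; have /mulmx1C h := SU2_mulV SB.
by rewrite -[LHS]mul1mx -h -mulmxA mulmxV ?mulmx1// SU2_unit.
Qed.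

Lemma SU2V B : SU2 B -> SU2 (invmx B).
Proof.
move=> SB; have [uB dB] := SB; split.
  by apply/unitarymxP; rewrite (SU2_inv SB) trmxCK; apply: mulmx1C; exact: SU2_mulV.
by rewrite det_inv dB invr1.
Qed.

Lemma SU2_1 : SU2 1%:M.
Proof. by split; [apply/unitarymxP; rewrite trmx1 map_mx1 mulmx1|rewrite det1]. Qed.

(** Multiplying an entry of the second row by the squared norm 1 of the first row and regrouping
    leaves only the orthogonality of the rows and the determinant. *)
Lemma SU2_entries B : SU2 B ->
  [/\ B 1 0 = - Num.conj (B 0 1), B 1 1 = Num.conj (B 0 0) &
      csq (B 0 0) + csq (B 0 1) = 1].
Proof.
move=> SB; have [uB dB] := SB; have h := SU2_mulV SB.
have e i j : B i 0 * Num.conj (B j 0) + B i 1 * Num.conj (B j 1) = (i == j)%:R.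
  by have := congr1 (fun M : 'M[C]_2 => M i j) h; rewrite !mxE sum2 !mxE.
have d : B 0 0 * B 1 1 - B 0 1 * B 1 0 = 1.
  rewrite -dB (expand_det_row B 0) sum2 /cofactor !det_mx11 !mxE.
  have -> : lift 0 0 = 1 :> 'I_2 by apply/val_inj.
  have -> : lift 1 0 = 0 :> 'I_2 by apply/val_inj.
  by rewrite /= !expr0 !expr1; ring.
have e00 := e 0 0; have e10 := e 1 0; rewrite /= in e00 e10.
have n1 : csq (B 0 0) + csq (B 0 1) = 1.
  by have := congr1 (@complex.Re R) e00; rewrite !cE /csq => /= <-; ring.
split => //.
  transitivity (B 1 0 * (B 0 0 * Num.conj (B 0 0) + B 0 1 * Num.conj (B 0 1))).
    by rewrite e00 mulr1.
  transitivity (B 0 0 * (B 1 0 * Num.conj (B 0 0) + B 1 1 * Num.conj (B 0 1))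
    - Num.conj (B 0 1) * (B 0 0 * B 1 1 - B 0 1 * B 1 0)); first by ring.
  by rewrite e10 d mulr0 mulr1 sub0r.
transitivity (B 1 1 * (B 0 0 * Num.conj (B 0 0) + B 0 1 * Num.conj (B 0 1))).
  by rewrite e00 mulr1.
transitivity (B 0 1 * (B 1 0 * Num.conj (B 0 0) + B 1 1 * Num.conj (B 0 1))
  + Num.conj (B 0 0) * (B 0 0 * B 1 1 - B 0 1 * B 1 0)); first by ring.
by rewrite e10 d mulr0 mulr1 add0r.
Qed.

(** The Euler-Rodrigues formula for the quaternion with components a and b. It turns linearity and
    isometry of [rot3] into polynomial identities. *)
Definition rotq (a b : C) x : R * R * R :=
  let a1 := complex.Re a in let a2 := complex.Im a in
  let b1 := complex.Re b in let b2 := complex.Im b in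
  ((a1 ^+ 2 - a2 ^+ 2 - b1 ^+ 2 + b2 ^+ 2) * x.1.1
     + (2 * (a1 * a2 + b1 * b2)) * x.1.2 + (2 * (a2 * b2 - a1 * b1)) * x.2,
   (2 * (b1 * b2 - a1 * a2)) * x.1.1
     + (a1 ^+ 2 - a2 ^+ 2 + b1 ^+ 2 - b2 ^+ 2) * x.1.2
     + (2 * (a1 * b2 + a2 * b1)) * x.2,
   (2 * (a1 * b1 + a2 * b2)) * x.1.1 + (2 * (a2 * b1 - a1 * b2)) * x.1.2
     + (a1 ^+ 2 + a2 ^+ 2 - b1 ^+ 2 - b2 ^+ 2) * x.2).

Lemma conj_entries B x i j : (B *m pauli x *m B^t*) i j =
  (B i 0 * pauli x 0 0 + B i 1 * pauli x 1 0) * Num.conj (B j 0) +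
  (B i 0 * pauli x 0 1 + B i 1 * pauli x 1 1) * Num.conj (B j 1).
Proof. by rewrite mxE sum2 !mxE !sum2 !mxE. Qed.

Lemma pauliE x : [/\ pauli x 0 0 = x.2%:C, pauli x 0 1 = x.1.1 -i* x.1.2,
  pauli x 1 0 = x.1.1 +i* x.1.2 & pauli x 1 1 = (- x.2)%:C].
Proof. by rewrite !mxE. Qed.

Lemma rot3E B x : SU2 B -> rot3 B x = rotq (B 0 0) (B 0 1) x.
Proof.
move=> /SU2_entries [e1 e2 _]; rewrite /rot3 /rotq.
have [p1 p2 p3 p4] := pauliE x.
rewrite !conj_entries p1 p2 p3 p4 e1 e2 !cE /=.
by congr (_, _, _); ring.
Qed.

(** [rot3] reads only the first column of the conjugated matrix. That the second column fits as well
    is what makes [rot3] multiplicative. *)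
Lemma pauli_rot3 B x : SU2 B -> B *m pauli x *m B^t* = pauli (rot3 B x).
Proof.
move=> SB; rewrite (rot3E _ SB); have [e1 e2 n] := SU2_entries SB.
have [p1 p2 p3 p4] := pauliE x.
have [q1 q2 q3 q4] := pauliE (rotq (B 0 0) (B 0 1) x).
apply/matrixP => i j; rewrite conj_entries p1 p2 p3 p4.
have /orP[/eqP ->|/eqP ->] : (i == 0) || (i == 1) by case: i => [[|[|]]].
  have /orP[/eqP ->|/eqP ->] : (j == 0) || (j == 1) by case: j => [[|[|]]].
    by rewrite q1 /rotq; apply: cplx_eq; rewrite !cE /=; ring.
  by rewrite q2 e1 e2 /rotq; apply: cplx_eq; rewrite !cE /=; ring.
have /orP[/eqP ->|/eqP ->] : (j == 0) || (j == 1) by case: j => [[|[|]]].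
  by rewrite q3 e1 e2 /rotq; apply: cplx_eq; rewrite !cE /=; ring.
by rewrite q4 e1 e2 /rotq; apply: cplx_eq; rewrite !cE /=; ring.
Qed.

Lemma rot3M B B' x : SU2 B -> SU2 B' -> rot3 (B *m B') x = rot3 B (rot3 B' x).
Proof.
move=> SB SB'; rewrite {1}/rot3 trmx_mul map_mxM.
rewrite (_ : B *m B' *m pauli x *m _ = B *m (B' *m pauli x *m B'^t*) *m B^t*).
  by rewrite pauli_rot3.
by rewrite !mulmxA.
Qed.

Lemma rot3_1 x : rot3 1%:M x = x.
Proof.
rewrite (rot3E _ SU2_1) /rotq !mxE /= !expr0n /= expr1n.
by case: x => [[x y] z]; congr (_, _, _) => /=; ring.
Qed.

Lemma rot3K B : SU2 B -> cancel (rot3 B) (rot3 (invmx B)).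
Proof.
move=> SB x; rewrite -rot3M//; last exact: SU2V.
by rewrite mulVmx ?rot3_1// SU2_unit.
Qed.

Lemma rot3VK B : SU2 B -> cancel (rot3 (invmx B)) (rot3 B).
Proof.
move=> SB x; rewrite -rot3M//; last exact: SU2V.
by rewrite mulmxV ?rot3_1// SU2_unit.
Qed.

Lemma rot3D B : SU2 B -> {morph rot3 B : x y / x + y}.
Proof.
by move=> SB x y; rewrite !(rot3E _ SB) /rotq /=; congr (_, _, _) => /=; ring.
Qed.

Lemma rot3N B : SU2 B -> {morph rot3 B : x / - x}.
Proof.
by move=> SB x; rewrite !(rot3E _ SB) /rotq /=; congr (_, _, _) => /=; ring.
Qed.

Lemma dot3_rot B x y : SU2 B -> dot3 (rot3 B x) (rot3 B y) = dot3 x y.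
Proof.
move=> SB; rewrite !(rot3E _ SB) /rotq !dot3E /=.
have [_ _] := SU2_entries SB; rewrite /csq => n.
set a1 := complex.Re (B 0 0) in n *; set a2 := complex.Im (B 0 0) in n *.
set b1 := complex.Re (B 0 1) in n *; set b2 := complex.Im (B 0 1) in n *.
(* For arbitrary a and b the formula multiplies scalar products by (|a|^2 + |b|^2)^2, which is 1
   here. *)
transitivity ((a1 ^+ 2 + a2 ^+ 2 + (b1 ^+ 2 + b2 ^+ 2)) ^+ 2 *
  (x.1.1 * y.1.1 + x.1.2 * y.1.2 + x.2 * y.2)); first by ring.
by rewrite n expr1n mul1r.
Qed.

Lemma norm3_rot B x : SU2 B -> norm3 (rot3 B x) = norm3 x.
Proof. by move=> SB; rewrite /norm3 dot3_rot. Qed.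

Lemma measurable_rot3 B : SU2 B -> measurable_fun setT (rot3 B : B3 -> B3).
Proof.
move=> SB; have [p1 p2 p3] := @measurable_proj3 R.
rewrite (_ : rot3 B = rotq (B 0 0) (B 0 1)); last by apply/funext => x; rewrite rot3E.
by apply: measurable_B3P => /=; repeat apply: measurable_funD;
  apply: measurable_funM; try exact: measurable_cst.
Qed.

Lemma rot3_leb B (X : set (R * R * R)) : SU2 B -> leb (rot3 B @^-1` X) = leb X.
Proof.
move=> SB; have SV := SU2V SB.
apply: (@leb3_preimage _ (rot3 B) (rot3 (invmx B))).
- exact: rot3K.
- exact: rot3VK.
- exact: measurable_rot3.
- exact: measurable_rot3.
- apply: (lam_isometry (measurable_rot3 SB) (measurable_rot3 SV));
    [exact: rot3D|exact: rot3N|exact: rot3K|exact: rot3VK|].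
  by move=> x; exact: norm3_rot.
Qed.

Lemma measurable_rot3_R3 B : SU2 B -> measurable_fun setT (rot3 B : R3 R -> R3 R).
Proof.
move=> SB; have SV := SU2V SB.
apply: (@measurable_R3_preimage _ (rot3 B) (rot3 (invmx B))).
- exact: rot3K.
- exact: rot3VK.
- exact: measurable_rot3.
- exact: measurable_rot3.
- apply: (lam_isometry (measurable_rot3 SB) (measurable_rot3 SV));
    [exact: rot3D|exact: rot3N|exact: rot3K|exact: rot3VK|].
  by move=> x; exact: norm3_rot.
Qed.

End Rotations.

(** * The Poisson kernel *)

Lemma ae_imp d (T : measurableType d) (R : realType)
    (mu : {measure set T -> \bar R}) (P Q : T -> Prop) :
  {ae mu, forall x, P x} -> (forall x, P x -> Q x) -> {ae mu, forall x, Q x}.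
Proof. by move=> h PQ; apply: filterS h. Qed.

Section MeasurePreserving.
Context d (T : measurableType d) (R : realType).
Variable mu : {measure set T -> \bar R}.
Local Notation C := R[i].
Variable p : T -> T.
Hypothesis mp : measurable_fun setT p.
Hypothesis pmu : forall A, measurable A -> mu (p @^-1` A) = mu A.

Lemma ge0_integral_preserving (f : T -> \bar R) : measurable_fun setT f ->
  (forall x, 0 <= f x)%E -> (\int[mu]_x f (p x) = \int[mu]_x f x)%E.
Proof.
move=> mf f0.
have E := @ge0_integral_pushforward _ _ T T R p mp mu setT f measurableT mf (fun y _ => f0 y).
transitivity (\int[pushforward mu p]_(y in setT) f y)%E; first exact: (esym E).
by apply: (@eq_measure_integral _ T) => A mA _; exact: pmu.
Qed.

Lemma integral_preserving (f : T -> \bar R) : measurable_fun setT f ->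
  (\int[mu]_x f (p x) = \int[mu]_x f x)%E.
Proof.
move=> mf; rewrite [LHS]integralE [RHS]integralE; congr (_ - _)%E.
  rewrite -[RHS](ge0_integral_preserving (f := (f^\+)%E)) //.
    by apply: eq_integral => x _; rewrite !funeposE.
  exact: measurable_funepos.
rewrite -[RHS](ge0_integral_preserving (f := (f^\-)%E)) //.
  by apply: eq_integral => x _; rewrite !funenegE.
exact: measurable_funeneg.
Qed.

Lemma integrable_preserving (f : T -> \bar R) : mu.-integrable setT f ->
  mu.-integrable setT (fun x => f (p x)).
Proof.
move=> fi; have mf := integrable_meas fi; apply/integrableP; split.
  exact: (measurableT_comp mf mp).
have /integrableP[_] := fi.
by rewrite -(ge0_integral_preserving (f := fun x => `|f x|%E)) //; exact: measurableT_comp.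
Qed.

Lemma cintegrable_preserving (f : T -> C) : cintegrable mu setT f ->
  cintegrable mu setT (fun x => f (p x)).
Proof.
move=> [f1 f2]; split.
  exact: (integrable_preserving f1).
exact: (integrable_preserving f2).
Qed.

Lemma cint_preserving (f : T -> C) : cmeasurable setT f ->
  cint mu setT (fun x => f (p x)) = cint mu setT f.
Proof.
move=> [f1 f2]; congr Complex; congr fine.
  by apply: (integral_preserving (f := fun x => (complex.Re (f x))%:E)); exact/measurable_EFinP.
by apply: (integral_preserving (f := fun x => (complex.Im (f x))%:E)); exact/measurable_EFinP.
Qed.

Lemma Rintegral_preserving (f : T -> R) : measurable_fun setT f ->
  \int[mu]_x f (p x) = \int[mu]_x f x.
Proof.
move=> mf; congr fine; apply: (integral_preserving (f := fun x => (f x)%:E)).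
exact/measurable_EFinP.
Qed.

Lemma L2_preserving (f : T -> C) : LC mu 2%:E f -> LC mu 2%:E (fun x => f (p x)).
Proof.
move=> /L2P[mf fi]; apply/L2P; split; first exact: cmeas_comp.
exact: (integrable_preserving fi).
Qed.

Lemma L1_preserving (f : T -> C) : LC mu 1%:E f -> LC mu 1%:E (fun x => f (p x)).
Proof. by move=> /L1P fi; apply/L1P; exact: cintegrable_preserving. Qed.

Lemma nsq_preserving (f : T -> C) : cmeasurable setT f ->
  nsq mu (fun x => f (p x)) = nsq mu f.
Proof.
move=> mf; apply: (Rintegral_preserving (f := fun x => csq (f x))).
exact: measurable_csq.
Qed.

Lemma ae_preserving (P : T -> Prop) : {ae mu, forall x, P x} ->
  {ae mu, forall x, P (p x)}.
Proof.
move=> [N [mN N0 PN]]; exists (p @^-1` N); split.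
- by rewrite -(setTI (_ @^-1` _)); exact: mp.
- by rewrite pmu.
- by move=> x /= h; apply: PN.
Qed.

Lemma ae_eq_preserving (U : Type) (f g : T -> U) : f = g %[ae mu] ->
  (fun x => f (p x)) = (fun x => g (p x)) %[ae mu].
Proof. exact: ae_preserving. Qed.

End MeasurePreserving.

Section BorelTransfer.
Variable R : realType.
Local Notation C := R[i].
Local Notation lam := (@borel_lebesgue3 R).
Local Notation leb := (@lebesgue3 R).
Local Notation B3 := (measurableTypeR R * measurableTypeR R * measurableTypeR R)%type.

Lemma integral_B3 (f : B3 -> \bar R) : measurable_fun setT f ->
  (\int[leb]_x f x = \int[lam]_x f x)%E.
Proof.
move=> mf; rewrite [LHS]integralE [RHS]integralE; congr (_ - _)%E.
  by apply: ge0_integral_B3 => //; exact: measurable_funepos.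
by apply: ge0_integral_B3 => //; exact: measurable_funeneg.
Qed.

Lemma integrable_B3 (f : B3 -> \bar R) : lam.-integrable setT f ->
  leb.-integrable setT (f : R3 R -> \bar R).
Proof.
move=> /integrableP[mf fi]; apply/integrableP; split; first exact: measurable_fun_B3.
move: fi; congr (_ < _)%E; symmetry; apply: ge0_integral_B3 => //.
exact: measurableT_comp.
Qed.

Lemma cintegrable_B3 (f : B3 -> C) : cintegrable lam setT f ->
  cintegrable leb setT (f : R3 R -> C).
Proof. by move=> [f1 f2]; split; exact: integrable_B3. Qed.

Lemma cint_B3 (f : B3 -> C) : cmeasurable setT f ->
  cint leb setT (f : R3 R -> C) = cint lam setT f.
Proof.
move=> [f1 f2]; congr Complex; congr fine.
  by apply: (integral_B3 (f := fun x => (complex.Re (f x))%:E)); exact/measurable_EFinP.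
by apply: (integral_B3 (f := fun x => (complex.Im (f x))%:E)); exact/measurable_EFinP.
Qed.

End BorelTransfer.

Section PoissonKernel1.
Variable R : realType.
Local Notation C := R[i].
Local Notation l1 := (@lebesgue_measure R).
Variable dl : R.
Hypothesis dl0 : 0 < dl.

Lemma is_derive_lin (c x : R) : is_derive x (1 : R) (fun y : R => c * y) c.
Proof.
have := @is_deriveZ R R _ id c x 1 1 (is_derive_id x 1).
by move=> h; apply: is_derive_eq h _; rewrite /GRing.scale /= mulr1.
Qed.

Lemma halfline_FTC (f F : R -> R) (l : R) : (forall x, 0 <= f x) ->
  continuous f -> (forall x, is_derive x (1 : R) F (f x)) ->
  F x @[x --> +oo] --> l ->
  (\int[l1]_(x in [set x | (0 <= x)%R]) (f x)%:E = (l - F 0)%:E)%E.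
Proof.
move=> f0 cf dF Fl.
have -> : [set x : R | (0 <= x)%R] = `[0, +oo[%classic.
  by apply/seteqP; split=> x /=; rewrite in_itv /= andbT.
have dFx x : derivable F x 1 by exact: (@ex_derive _ _ _ _ _ _ _ (dF x)).
have cF : continuous F by move=> x; apply/differentiable_continuous/derivable1_diffP.
rewrite (@ge0_continuous_FTC2y _ f F 0 l) ?EFinB//.
- exact: continuous_subspaceT.
- exact/cvg_at_right_filter/cF.
- by move=> x _; rewrite derive1E; exact: (@derive_val _ _ _ _ _ _ _ (dF x)).
Qed.

(** The Fourier transform of exp(-dl |x|), and 2 pi times the Cauchy density of scale dl; up to this
    factor, an approximate identity as dl tends to 0. *)
Definition pois (q : R) : R := 2 * dl / (dl ^+ 2 + q ^+ 2).

Lemma pois_den q : dl ^+ 2 + q ^+ 2 != 0.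
Proof. by rewrite gt_eqF// ltr_pwDl ?sqr_ge0// exprn_gt0. Qed.

Lemma pois_ge0 q : 0 <= pois q.
Proof.
by rewrite /pois divr_ge0 ?mulr_ge0 ?(ltW dl0)// addr_ge0 ?sqr_ge0// exprn_ge0// ltW.
Qed.

Lemma pois_even q : pois (- q) = pois q.
Proof. by rewrite /pois sqrrN. Qed.

Lemma cvg_expR_lin : (fun x => expR (- dl * x)) @ +oo --> (0 : R).
Proof.
have h : (fun x : R => dl * x) @ +oo --> +oo.
  apply/cvgryPge => A; near=> x.
  rewrite mulrC -ler_pdivrMr//; near: x; exact: nbhs_pinfty_ge.
have := cvg_comp _ _ h (@cvgr_expR R).
by apply: cvg_trans; apply: near_eq_cvg; apply: nearW => x /=; rewrite mulNr.
Unshelve. all: by end_near. Qed.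

Lemma cvg_bounded_expR (u : R -> R) (c : R) : (forall x, `|u x| <= c) ->
  (fun x => expR (- dl * x) * u x) @ +oo --> (0 : R).
Proof.
move=> uc; apply/norm_cvg0P.
apply: (@squeeze_cvgr _ _ _ _ (fun=> 0) (fun x => expR (- dl * x) * c)).
- apply: nearW => x; rewrite normr_ge0 normrM ger0_norm ?expR_ge0//.
  by rewrite ler_wpM2l// expR_ge0.
- exact: cvg_cst.
- rewrite -[X in _ --> X](mul0r c); apply: cvgM; [exact: cvg_expR_lin|exact: cvg_cst].
Qed.

Definition e1 (x : R) : R := expR (- dl * `|x|).

Lemma continuous_e1 : continuous e1.
Proof.
move=> x; apply: (@continuous_comp _ _ _ (fun x : R => - dl * `|x|) expR); last exact: continuous_expR.
by apply: continuousM; [exact: cst_continuous|exact: norm_continuous].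
Qed.

Lemma continuous_coslin (k : R) : continuous (fun x : R => cos (k * x)).
Proof.
move=> x; apply: (@continuous_comp _ _ _ (fun x : R => k * x) cos); last exact: continuous_cos.
by apply: continuousM; [exact: cst_continuous|exact: cvg_id].
Qed.

Lemma continuous_sinlin (k : R) : continuous (fun x : R => sin (k * x)).
Proof.
move=> x; apply: (@continuous_comp _ _ _ (fun x : R => k * x) sin); last exact: continuous_sin.
by apply: continuousM; [exact: cst_continuous|exact: cvg_id].
Qed.

Lemma norm_cos_le1 (x : R) : `|cos x| <= 1.
Proof. by rewrite ler_norml cos_geN1 cos_le1. Qed.
Lemma norm_sin_le1 (x : R) : `|sin x| <= 1.
Proof. by rewrite ler_norml sin_geN1 sin_le1. Qed.

(** The summand 1 makes the integrand nonnegative, as required by the form of the fundamental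
    theorem used on the half-line. Its contribution is found from k = 0 and subtracted
    afterwards. *)
Lemma int_e1_cos (k : R) :
  (\int[l1]_x (e1 x * (1 + cos (k * x)))%:E = (2 / dl + pois k)%:E)%E.
Proof.
have f0 x : 0 <= e1 x * (1 + cos (k * x)).
  by rewrite mulr_ge0 ?expR_ge0// addrC -lerBlDr sub0r; have := norm_cos_le1 (k * x); rewrite ler_norml => /andP[].
rewrite ge0_symfun_integralT//; last 2 first.
- move=> x; apply: continuousM; first exact: continuous_e1.
  by apply: continuousD; [exact: cst_continuous|exact: continuous_coslin].
- by move=> x /=; rewrite /e1 normrN mulrN cosN.
pose D := dl ^+ 2 + k ^+ 2.
have D0 : D != 0 := pois_den k.
(* The real part of exp((i k - dl) x) / (i k - dl), and -exp(-dl x) / dl for the summand 1, both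
   without the factor exp(-dl x). *)
pose u x := k / D * sin (k * x) + (- (dl / D) * cos (k * x) - dl^-1).
pose F (x : R) : R := expR (- dl * x) * u x.
rewrite (_ : (\int[l1]_(x in _) _)%E =
    \int[l1]_(x in [set x | (0 <= x)%R]) (expR (- dl * x) * (1 + cos (k * x)))%:E)%E; last first.
  by apply: eq_integral => x; rewrite inE /= /e1 => x0; rewrite ger0_norm.
have dF x : is_derive x (1 : R) F (expR (- dl * x) * (1 + cos (k * x))).
  have dE : is_derive x (1 : R) (fun x => expR (- dl * x)) (expR (- dl * x) * - dl).
    exact: (@is_derive1_comp _ expR (fun x => - dl * x) x _ _ _ (is_derive_lin _ _)).
  have dS : is_derive x (1 : R) (fun x => sin (k * x)) (cos (k * x) * k).
    exact: (@is_derive1_comp _ sin (fun x => k * x) x _ _ _ (is_derive_lin _ _)).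
  have dC : is_derive x (1 : R) (fun x => cos (k * x)) (- sin (k * x) * k).
    exact: (@is_derive1_comp _ cos (fun x => k * x) x _ _ _ (is_derive_lin _ _)).
  have dS' := @is_deriveZ _ _ _ _ (k / D) _ _ _ dS.
  have dC' := @is_deriveZ _ _ _ _ (- (dl / D)) _ _ _ dC.
  have dU : is_derive x (1 : R) u (k / D * (cos (k * x) * k) +
      (- (dl / D) * (- sin (k * x) * k) - 0)).
    exact: (@is_deriveD _ _ _ _ _ _ _ _ _ dS' (@is_deriveB _ _ _ _ _ _ _ _ _ dC'
      (is_derive_cst dl^-1 x 1))).
  have dM := @is_deriveM _ _ _ _ _ _ _ _ dE dU.
  apply: is_derive_eq dM _; rewrite /GRing.scale /= /u.
  by rewrite /D; field; rewrite (gt_eqF dl0) /=; exact: D0.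
have Fl : F x @[x --> +oo] --> (0 : R).
  apply: (@cvg_bounded_expR _ (`|k / D| + (`|dl / D| + dl^-1))) => x.
  rewrite /u (le_trans (ler_normD _ _))// lerD//.
    by rewrite normrM ler_piMr// norm_sin_le1.
  rewrite (le_trans (ler_normB _ _))// lerD//.
    by rewrite normrM normrN ler_piMr// norm_cos_le1.
  by rewrite ger0_norm// invr_ge0 ltW.
have cf : continuous (fun x : R => expR (- dl * x) * (1 + cos (k * x))).
  move=> x; apply: (@continuousM _ _ (fun x => expR (- dl * x)) (fun x => 1 + cos (k * x))).
    apply: (@continuous_comp _ _ _ (fun x : R => - dl * x) expR); last exact: continuous_expR.
    by apply: continuousM; [exact: cst_continuous|exact: cvg_id].
  by apply: continuousD; [exact: cst_continuous|exact: continuous_coslin].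
have f0' x : 0 <= expR (- dl * x) * (1 + cos (k * x)).
  by rewrite mulr_ge0 ?expR_ge0// addrC -lerBlDr sub0r;
    have := norm_cos_le1 (k * x); rewrite ler_norml => /andP[].
rewrite (halfline_FTC f0' cf dF Fl) -EFinM; congr (_%:E).
rewrite /F /u !mulr0 expR0 sin0 cos0 /pois -/D.
by field; rewrite (gt_eqF dl0) D0.
Qed.

Lemma measurable_e1 : measurable_fun setT e1.
Proof. by apply: continuous_measurable_fun; exact: continuous_e1. Qed.

Lemma int_e1 : (\int[l1]_x (e1 x)%:E = (2 / dl)%:E)%E.
Proof.
have := int_e1_cos 0; rewrite (_ : 2 / dl + pois 0 = 2 * (2 / dl)); last first.
  by rewrite /pois; field; rewrite (gt_eqF dl0).
under eq_integral do rewrite mul0r cos0 mulrC EFinM.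
rewrite ge0_integralZl_EFin//; last 2 first.
- by move=> x _; rewrite lee_fin expR_ge0.
- by apply/measurable_EFinP; exact: measurable_e1.
rewrite -[(2 * _)%:E]EFinM => /(congr1 (fun z => (2^-1)%:E * z)%E).
rewrite muleA -!EFinM mulrA (_ : 2^-1 * (1 + 1) = 1 :> R); last by field.
by rewrite mul1e (_ : 2^-1 * _ = 2 / dl)//; field; rewrite (gt_eqF dl0).
Qed.

Lemma integrable_e1 : l1.-integrable setT (fun x => (e1 x)%:E).
Proof.
apply/integrableP; split.
  by apply/measurable_EFinP; exact: measurable_e1.
under eq_integral do rewrite /= ger0_norm ?expR_ge0//.
by rewrite int_e1 ltry.
Qed.

Lemma integrable_e1M (u : R -> R) : measurable_fun setT u -> (forall x, `|u x| <= 1) ->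
  l1.-integrable setT (fun x => (e1 x * u x)%:E).
Proof.
move=> mu u1; apply: (integrable_dom _ integrable_e1).
  by apply: measurable_funM => //; exact: measurable_e1.
move=> x; rewrite normrM ger0_norm ?expR_ge0//.
by rewrite ler_piMr ?expR_ge0.
Qed.

Lemma Rint_e1_cos (k : R) : \int[l1]_x (e1 x * cos (k * x)) = pois k.
Proof.
have ic := integrable_e1M (continuous_measurable_fun (@continuous_coslin k)) (fun x => norm_cos_le1 (k * x)).
have : \int[l1]_x (e1 x + e1 x * cos (k * x)) = 2 / dl + pois k.
  rewrite /Rintegral -[RHS]/(fine (2 / dl + pois k)%:E) -int_e1_cos; congr fine.
  by apply: eq_integral => x _; rewrite mulrDr mulr1.
rewrite (RintegralD measurableT integrable_e1 ic).
by rewrite {1}/Rintegral int_e1 /= => /addrI.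
Qed.

Lemma Rint_e1_sin (k : R) : \int[l1]_x (e1 x * sin (k * x)) = 0.
Proof.
have ms := continuous_measurable_fun (@continuous_sinlin k).
have is_ := integrable_e1M ms (fun x => norm_sin_le1 (k * x)).
have e : \int[l1]_x (e1 x * sin (k * x)) = - \int[l1]_x (e1 x * sin (k * x)).
  rewrite -RintegralN// -[LHS](@Rintegral_preserving _ _ _ l1 (fun x : R => - x)).
  - by apply: eq_Rintegral => x _; rewrite /e1 normrN mulrN sinN mulrN.
  - exact: oppr_measurable.
  - exact: lebesgue_measureN.
  - by apply: measurable_funM => //; exact: measurable_e1.
by move: e; set z := Rintegral _ _ _; clearbody z; lra.
Qed.

Lemma cintegrable_e1 (k : R) : cintegrable l1 setT (fun x => (e1 x)%:C * expi (k * x)).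
Proof.
apply: (@cintegrable_dom _ (measurableTypeR R) _ l1 _ e1).
- apply: cmeasM; first by apply: cmeas_real; exact: measurable_e1.
  by apply: cmeas_expi; exact: measurable_funM.
- exact: integrable_e1.
- move=> x; rewrite cabsM cabs_expi mulr1 /cabs csq_real sqrtr_sqr ger0_norm//.
  exact: expR_ge0.
Qed.

Lemma cint_e1 (k : R) : cint l1 setT (fun x => (e1 x)%:C * expi (k * x)) = (pois k)%:C.
Proof.
apply: cplx_eq => /=.
  rewrite -Rint_e1_cos; apply: eq_Rintegral => x _.
  by rewrite /= mul0r subr0.
rewrite -[RHS](Rint_e1_sin k); apply: eq_Rintegral => x _.
by rewrite /= mul0r addr0.
Qed.

Lemma continuous_pois : continuous pois.
Proof.
have c : continuous (fun q : R => (dl ^+ 2 + q ^+ 2)^-1).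
  move=> x; apply: (@continuousV _ _ (fun q : R => dl ^+ 2 + q ^+ 2)); first exact: pois_den.
  apply: (@continuousD _ _ _ (fun=> dl ^+ 2) (fun q : R => q ^+ 2)); first exact: cst_continuous.
  exact: exprn_continuous.
by move=> x; exact: (cvgM (cvg_cst (2 * dl)) (c x)).
Qed.

Let P (q : R) : R := 2 * atan (dl^-1 * q).

Let dP x : is_derive x (1 : R) P (pois x).
Proof.
have dA : is_derive x (1 : R) (fun x => atan (dl^-1 * x)) ((1 + (dl^-1 * x) ^+ 2)^-1 * dl^-1).
  exact: (@is_derive1_comp _ atan (fun x => dl^-1 * x) x _ _ _ (is_derive_lin _ _)).
have dZ := @is_deriveZ _ _ _ _ 2 _ _ _ dA.
apply: is_derive_eq dZ _; rewrite /GRing.scale /= /pois; field.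
by rewrite pois_den (gt_eqF dl0).
Qed.

Let Py : P x @[x --> +oo] --> (pi : R).
Proof.
have h : (fun x : R => dl^-1 * x) @ +oo --> +oo.
  apply/cvgryPge => A; near=> x.
  rewrite mulrC ler_pdivlMr//; near: x; exact: nbhs_pinfty_ge.
have g := cvg_comp _ _ h (@cvgy_atan R).
rewrite (_ : pi = 2 * (pi / 2)); last by field.
by apply: cvgM; [exact: cvg_cst|exact: g].
Unshelve. all: by end_near. Qed.

Lemma int_pois : (\int[l1]_x (pois x)%:E = (2 * pi)%:E)%E.
Proof.
rewrite ge0_symfun_integralT//; last 3 first.
- exact: pois_ge0.
- exact: continuous_pois.
- by move=> x /=; rewrite pois_even.
rewrite (halfline_FTC pois_ge0 continuous_pois dP Py) /P mulr0 atan0 mulr0 subr0.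
by rewrite -EFinM.
Qed.

Lemma measurable_pois : measurable_fun setT pois.
Proof. by apply: continuous_measurable_fun; exact: continuous_pois. Qed.

Lemma integrable_pois : l1.-integrable setT (fun x => (pois x)%:E).
Proof.
apply/integrableP; split; first by apply/measurable_EFinP; exact: measurable_pois.
under eq_integral do rewrite /= ger0_norm ?pois_ge0//.
by rewrite int_pois ltry.
Qed.

End PoissonKernel1.

Lemma dominated_Rint d (T : measurableType d) (R : realType)
    (mu : {measure set T -> \bar R}) (f_ : nat -> T -> R) (f g : T -> R) :
  (forall n, measurable_fun setT (f_ n)) -> measurable_fun setT f ->
  {ae mu, forall x, f_ ^~ x @ \oo --> f x} ->
  mu.-integrable setT (EFin \o g) -> (forall n x, `|f_ n x| <= g x) ->
  (fun n => \int[mu]_x f_ n x) @ \oo --> \int[mu]_x f x.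
Proof.
move=> mf_ mf cvf ig fg.
have h : [/\ mu.-integrable setT (EFin \o f),
    [sequence \int[mu]_(x in setT) `|(f_ n x)%:E - (f x)%:E| ]_n @ \oo --> 0 &
    [sequence \int[mu]_(x in setT) (f_ n x)%:E]_n @ \oo --> \int[mu]_(x in setT) (f x)%:E]%E.
  apply: (@dominated_convergence _ _ _ mu setT measurableT
    (fun n x => (f_ n x)%:E) (EFin \o f) (EFin \o g)).
  - by move=> n; exact/measurable_EFinP.
  - exact/measurable_EFinP.
  - apply: filterS cvf => x h _; apply: cvg_EFin; last exact: h.
    by apply: nearW.
  - exact: ig.
  - by apply: aeW => x n _; rewrite /= lee_fin.
have [fi _ h2] := h.
by apply: fine_cvg; rewrite EFin_Rintegral.
Qed.

Section PoissonLimit.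
Variable R : realType.
Local Notation l1 := (@lebesgue_measure R).
Local Notation B1 := (measurableTypeR R).

Lemma Rint_pois_shift (dl k : R) : 0 < dl ->
  l1.-integrable setT (fun p => (pois dl (k - p))%:E) /\
  \int[l1]_p pois dl (k - p) = 2 * pi.
Proof.
move=> dl0.
have mt : measurable_fun setT (fun p : B1 => p + - k : B1) by exact: measurable_funD.
have E p : pois dl (k - p) = pois dl (p + - k) by rewrite -pois_even opprB.
split.
  rewrite (_ : (fun p => _) = (fun p => (pois dl (p + - k))%:E)); last first.
    by apply/funext => p; rewrite E.
  apply: (@integrable_preserving _ B1 _ l1 (fun p => p + - k) mt (@lebesgue_translation _ _)
    (fun p => (pois dl p)%:E)).
  exact: integrable_pois.
transitivity (\int[l1]_p pois dl (p + - k)).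
  by apply: eq_Rintegral => p _; exact: E.
rewrite (@Rintegral_preserving _ B1 _ l1 (fun p => p + - k) mt (@lebesgue_translation _ _)).
  by rewrite /Rintegral int_pois.
exact: measurable_pois.
Qed.

Lemma measurable_poisB (dl : R) : 0 < dl ->
  measurable_fun setT (fun z : B1 * B1 => pois dl (z.1 - z.2)).
Proof.
move=> dl0; apply: (measurableT_comp (measurable_pois dl0)).
by apply: measurable_funB.
Qed.

Definition poisc (dl : R) (I : set R) (k : R) : R :=
  \int[l1]_p (\1_I p * pois dl (k - p)).

Section OneInterval.
Variable I : set R.
Hypothesis mI : measurable (I : set B1).

Lemma integrable_poisc (dl k : R) : 0 < dl ->
  l1.-integrable setT (fun p => (\1_I p * pois dl (k - p))%:E).
Proof.
move=> dl0; apply: (integrable_dom _ (Rint_pois_shift k dl0).1).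
  apply: measurable_funM; first exact: measurable_indic.
  exact: integrable_rmeas (Rint_pois_shift k dl0).1.
move=> p; rewrite normrM [X in _ * X]ger0_norm ?pois_ge0//.
rewrite ler_piMl ?pois_ge0// indicE; case: (_ \in _); by rewrite ?normr1 ?normr0.
Qed.

Lemma poisc_ge0 dl k : 0 < dl -> 0 <= poisc dl I k.
Proof. by move=> dl0; apply: Rintegral_ge0 => p _; rewrite mulr_ge0 ?pois_ge0. Qed.

Lemma poisc_le dl k : 0 < dl -> poisc dl I k <= 2 * pi.
Proof.
move=> dl0; have [ip e] := Rint_pois_shift k dl0; rewrite -e.
apply: le_Rintegral => //; first exact: integrable_poisc.
by move=> p _; rewrite ler_piMl ?pois_ge0// indicE; case: (_ \in _).
Qed.

Lemma measurable_poisc dl : 0 < dl -> measurable_fun setT (poisc dl I : B1 -> R).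
Proof.
move=> dl0; apply: measurableT_comp; first exact: fine_measurable.
apply: (@measurable_param_integral _ _ B1 B1 R l1
  (fun z => (\1_I z.2 * pois dl (z.1 - z.2))%:E)).
apply/measurable_EFinP/measurable_funM; last exact: measurable_poisB.
exact: (measurableT_comp (measurable_indic mI) (@measurable_snd _ _ B1 B1)).
Qed.

(* Off the eta-neighbourhood of k the kernel is at most a multiple of
   dl * pois 1. *)
Lemma poisc_tail (dl k eta : R) : 0 < dl -> 0 < eta ->
  (forall p, ~ I p -> eta <= `|k - p|) ->
  2 * pi - poisc dl I k <= dl * ((1 + eta ^- 2) * (2 * pi)).
Proof.
move=> dl0 eta0 hI; have [ip e] := Rint_pois_shift k dl0.
have [ip1 e1] := Rint_pois_shift k (ltr01 : 0 < 1 :> R).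
rewrite -{1}e -e1 -RintegralB//; last exact: integrable_poisc.
rewrite mulrA -RintegralZl//.
apply: le_Rintegral => //.
- by have := integrableB measurableT ip (integrable_poisc k dl0); apply: eq_integrable => // p _ /=.
- exact: integrableZ_EFin.
move=> p _; rewrite indicE; case: (boolP (p \in I)) => [|/negP]; rewrite inE => Ip.
  rewrite mul1r subrr mulr_ge0 ?pois_ge0// mulr_ge0 ?(ltW dl0)// addr_ge0//.
  by rewrite invr_ge0 sqr_ge0.
rewrite mul0r subr0 /pois; have := hI p Ip.
have -> : (k - p) ^+ 2 = `|k - p| ^+ 2 by rewrite real_normK// num_real.
move: `|_| => q eq; have q0 := lt_le_trans eta0 eq.
have h : 1 + q ^+ 2 <= (1 + eta ^- 2) * (dl ^+ 2 + q ^+ 2).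
  have h1 : 1 <= eta ^- 2 * q ^+ 2.
    by rewrite mulrC ler_pdivlMr ?exprn_gt0// mul1r ler_sqr ?nnegrE// ltW.
  have h2 : 0 <= eta ^- 2 by rewrite invr_ge0 sqr_ge0.
  rewrite mulrDl mul1r mulrDr.
  have h3 := mulr_ge0 h2 (sqr_ge0 dl); have h4 := sqr_ge0 dl; lra.
rewrite ler_pdivrMr ?addr_gt0 ?exprn_gt0// mulr1 expr1n.
have B0 : 1 + q ^+ 2 != 0 by rewrite gt_eqF// ltr_pwDl// sqr_ge0.
rewrite (_ : dl * (1 + eta ^- 2) * (2 / (1 + q ^+ 2)) * (dl ^+ 2 + q ^+ 2) =
    2 * dl * ((1 + eta ^- 2) * (dl ^+ 2 + q ^+ 2) / (1 + q ^+ 2))); last first.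
  by field; rewrite ?B0 ?(gt_eqF eta0).
rewrite ler_peMr ?mulr_ge0 ?(ltW dl0)// ler_pdivlMr ?mul1r//.
by rewrite ltr_pwDl// sqr_ge0.
Qed.

Lemma cvg_poisc (k eta : R) : 0 < eta ->
  (forall p, ~ I p -> eta <= `|k - p|) ->
  (fun n => poisc n.+1%:R^-1 I k) @ \oo --> 2 * pi.
Proof.
move=> eta0 hI; apply/subr_cvg0.
have h : (fun n => 2 * pi - poisc n.+1%:R^-1 I k) @ \oo --> (0 : R).
  apply: (cvg_squeeze0 (b := fun n => n.+1%:R^-1 * ((1 + eta ^- 2) * (2 * pi)))).
    move=> n; rewrite subr_ge0 poisc_le ?invr_gt0//=.
    by apply: poisc_tail; rewrite ?invr_gt0.
  rewrite -[X in _ --> X](mul0r ((1 + eta ^- 2) * (2 * pi))).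
  by apply: cvgM; [exact: cvg_harmonic|exact: cvg_cst].
rewrite -oppr0 (_ : (fun n => _) = (fun n => - (2 * pi - poisc n.+1%:R^-1 I k))).
  exact: cvgN.
by apply/funext => n; rewrite opprB.
Qed.

Lemma integrable_ind_poisc dl : 0 < dl -> (l1 I < +oo)%E ->
  l1.-integrable setT (fun k => (\1_I k * poisc dl I k)%:E).
Proof.
move=> dl0 /(integrable_indic_lty l1 mI) iI.
have iJ : l1.-integrable setT (EFin \o (fun k => 2 * pi * \1_I k)) by exact: integrableZ_EFin.
apply: (integrable_dom _ iJ).
  by apply: measurable_funM; [exact: measurable_indic|exact: measurable_poisc].
move=> k; rewrite normrM ger0_norm// mulrC ler_wpM2r// ger0_norm ?poisc_ge0//.
exact: poisc_le.
Qed.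

(** The hypothesis on almost all k says that almost every point of I is interior. There [cvg_poisc]
    gives the limit [2 * pi], and [2 * pi * \1_I] dominates. *)
Lemma cvg_int_poisc : (l1 I < +oo)%E ->
  {ae l1, forall k, exists2 eta : R, 0 < eta & I k -> forall p, ~ I p -> eta <= `|k - p|} ->
  (fun n => \int[l1]_k (\1_I k * poisc n.+1%:R^-1 I k)) @ \oo -->
    2 * pi * fine (l1 I).
Proof.
move=> Ifin aeI; have iI := (integrable_indic_lty l1 mI).2 Ifin.
rewrite (_ : 2 * pi * _ = \int[l1]_k (\1_I k * (2 * pi))); last first.
  under eq_Rintegral do rewrite mulrC.
  by rewrite RintegralZl// /Rintegral integral_indic// setIT.
have pi0 : 0 <= 2 * pi :> R by rewrite mulr_ge0 ?pi_ge0.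
apply: (@dominated_Rint _ B1 _ l1 _ _ (fun k => \1_I k * (2 * pi))).
- move=> n; apply: measurable_funM; first exact: measurable_indic.
  by apply: measurable_poisc; rewrite invr_gt0.
- by apply: measurable_funM => //; exact: measurable_indic.
- apply: (ae_imp aeI) => k [eta eta0 hI].
  have [Ik|Ik] := pselect (I k).
    by apply: cvgM; [exact: cvg_cst|exact: cvg_poisc (hI Ik)].
  rewrite indic0E// mul0r (_ : (fun n => _) = fun=> 0); first exact: cvg_cst.
  by apply/funext => n; rewrite mul0r.
- rewrite (_ : EFin \o _ = EFin \o (fun k => 2 * pi * \1_I k)); first exact: integrableZ_EFin.
  by apply/funext => k /=; rewrite mulrC.
- move=> n k; rewrite normrM ger0_norm// ler_wpM2l// ger0_norm ?poisc_ge0 ?poisc_le ?invr_gt0//.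
Qed.

End OneInterval.
End PoissonLimit.

Section Tensor3.
Variable R : realType.
Local Notation C := R[i].
Local Notation l1 := (@lebesgue_measure R).
Local Notation leb := (@lebesgue3 R).
Local Notation lam := (@borel_lebesgue3 R).
Local Notation B1 := (measurableTypeR R).
Local Notation B3 := (B1 * B1 * B1)%type.

Definition tens3 (S : pzRingType) (f g h : R -> S) (x : R * R * R) : S :=
  f x.1.1 * g x.1.2 * h x.2.

Lemma cint_tens3 (f g h : R -> C) :
  cintegrable l1 setT (f : B1 -> C) -> cintegrable l1 setT (g : B1 -> C) ->
  cintegrable l1 setT (h : B1 -> C) ->
  cintegrable leb setT (tens3 f g h : R3 R -> C) /\
  cint leb setT (tens3 f g h : R3 R -> C) =
    cint l1 setT f * cint l1 setT g * cint l1 setT h.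
Proof.
move=> fi gi hi.
have fgi := cintegrable_tensor (m1 := l1) (m2 := l1) fi gi.
have I := cintegrable_tensor (m1 := @leb2 R) (m2 := l1) fgi hi.
have il : cintegrable lam setT (tens3 f g h : B3 -> C).
  move: I; rewrite lamE; exact.
split; first exact: cintegrable_B3.
rewrite (cint_B3 (cintegrable_meas il)).
transitivity (cint (@leb2 R \x l1)%E setT (tens3 f g h : B3 -> C)).
  by rewrite lamE.
transitivity (cint (@leb2 R) setT (fun z : B1 * B1 => f z.1 * g z.2) * cint l1 setT h).
  exact: (cint_tensor (m1 := @leb2 R) (m2 := l1) fgi hi).
congr (_ * _); exact: (cint_tensor (m1 := l1) (m2 := l1) fi gi).
Qed.

Lemma cintegrable_real d (T : measurableType d) (mu : {measure set T -> \bar R})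
    (u : T -> R) :
  mu.-integrable setT (EFin \o u) -> cintegrable mu setT (fun x => (u x)%:C).
Proof. by move=> ui; split => //=; exact: (integrable0 mu setT). Qed.

Lemma Rint_tens3 (f g h : R -> R) :
  l1.-integrable setT (EFin \o f) -> l1.-integrable setT (EFin \o g) ->
  l1.-integrable setT (EFin \o h) ->
  leb.-integrable setT (EFin \o (tens3 f g h : R3 R -> R)) /\
  \int[leb]_x tens3 f g h x =
    \int[l1]_x f x * \int[l1]_x g x * \int[l1]_x h x.
Proof.
move=> fi gi hi.
have [I E] := cint_tens3 (cintegrable_real fi) (cintegrable_real gi) (cintegrable_real hi).
have e : tens3 (fun x => (f x)%:C) (fun x => (g x)%:C) (fun x => (h x)%:C) =
    (fun x => (tens3 f g h x)%:C).
  by apply/funext => x; rewrite /tens3 !rmorphM.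
move: I E; rewrite e => -[I _]; rewrite !cint_real => E; split; first exact: I.
by move: (congr1 (@complex.Re R) E); rewrite -!rmorphM /=.
Qed.

End Tensor3.

Section PoissonKernel3.
Variable R : realType.
Local Notation C := R[i].
Local Notation l1 := (@lebesgue_measure R).
Local Notation leb := (@lebesgue3 R).
Local Notation B1 := (measurableTypeR R).
Local Notation B3 := (B1 * B1 * B1)%type.

Section FixedWidth.
Variable dl : R.
Hypothesis dl0 : 0 < dl.

Definition e3 : R * R * R -> R := tens3 (e1 dl) (e1 dl) (e1 dl).
Definition pois3 : R * R * R -> R := tens3 (pois dl) (pois dl) (pois dl).

Lemma e1_ge0 x : 0 <= e1 dl x. Proof. exact: expR_ge0. Qed.
Lemma e1_le1 x : e1 dl x <= 1.
Proof. by rewrite /e1 expR_le1 mulNr oppr_le0 mulr_ge0 ?(ltW dl0). Qed.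

Lemma e3_ge0 x : 0 <= e3 x.
Proof. by rewrite /e3 /tens3 !mulr_ge0 ?e1_ge0. Qed.

Lemma pois3_ge0 x : 0 <= pois3 x.
Proof. by rewrite /pois3 /tens3; apply: mulr_ge0; [apply: mulr_ge0|]; exact: (pois_ge0 dl0). Qed.

Lemma pois3_even x : pois3 (- x) = pois3 x.
Proof. by rewrite /pois3 /tens3 /= !pois_even. Qed.

Lemma measurable_e3 : measurable_fun setT (e3 : R3 R -> R).
Proof.
exact: (integrable_rmeas (Rint_tens3 (integrable_e1 dl0) (integrable_e1 dl0) (integrable_e1 dl0)).1).
Qed.

Lemma integrable_e3 : leb.-integrable setT (EFin \o (e3 : R3 R -> R)).
Proof. exact: (Rint_tens3 (integrable_e1 dl0) (integrable_e1 dl0) (integrable_e1 dl0)).1. Qed.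

Lemma cint_e3 (q : R * R * R) :
  cint leb setT (fun x : R3 R => (e3 x)%:C * expi (dot3 q x)) = (pois3 q)%:C.
Proof.
pose f (k x : R) : C := (e1 dl x)%:C * expi (k * x).
have [_ E] := cint_tens3 (cintegrable_e1 dl0 q.1.1) (cintegrable_e1 dl0 q.1.2)
  (cintegrable_e1 dl0 q.2).
transitivity (cint leb setT (tens3 (f q.1.1) (f q.1.2) (f q.2) : R3 R -> C)).
  apply: cint_ext => x _; rewrite dot3E !expiD /e3 /tens3 /f !rmorphM /=.
  by rewrite [LHS]mulrACA; congr (_ * _); exact: mulrACA.
by rewrite E !cint_e1// /pois3 /tens3 !rmorphM.
Qed.

Lemma measurable_pois3 d (T : measurableType d) (f : T -> R * R * R) :
  measurable_fun setT (f : T -> B3) -> measurable_fun setT (fun x => pois3 (f x)).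
Proof.
move=> mf; have [m1 m2 m3] := measurable_proj3 R.
have mp := measurable_pois dl0.
apply: measurable_funM; first apply: measurable_funM.
- exact: (measurableT_comp mp (measurableT_comp m1 mf)).
- exact: (measurableT_comp mp (measurableT_comp m2 mf)).
- exact: (measurableT_comp mp (measurableT_comp m3 mf)).
Qed.

Lemma Rint_pois3_shift (k : R * R * R) :
  leb.-integrable setT (fun p : R3 R => (pois3 (k - p))%:E) /\
  \int[leb]_p pois3 (k - p) = (2 * pi) ^+ 3.
Proof.
have [i1 e1] := Rint_pois_shift k.1.1 dl0.
have [i2 e2] := Rint_pois_shift k.1.2 dl0.
have [i3 e3] := Rint_pois_shift k.2 dl0.
have [I E] := Rint_tens3 i1 i2 i3; split; first exact: I.
transitivity (\int[leb]_p tens3 (fun p => pois dl (k.1.1 - p))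
  (fun p => pois dl (k.1.2 - p)) (fun p => pois dl (k.2 - p)) p); first by [].
by rewrite E e1 e2 e3; ring.
Qed.

End FixedWidth.

(** The indicator of a box and the kernel both factor over the coordinates, which reduces the
    six-fold integral to a product of three double ones. *)
Lemma cvg_pois3_box (I1 I2 I3 : set R) : ocitv I1 -> ocitv I2 -> ocitv I3 ->
  (fun n => \int[leb]_k (\1_(box3 I1 I2 I3) k *
     \int[leb]_p (\1_(box3 I1 I2 I3) p * pois3 n.+1%:R^-1 (k - p)))) @ \oo -->
  (2 * pi) ^+ 3 * fine (leb (box3 I1 I2 I3)).
Proof.
move=> o1 o2 o3.
have m1 := ocitv_measurable o1; have m2 := ocitv_measurable o2.
have m3 := ocitv_measurable o3.
have ibox x : \1_(box3 I1 I2 I3) x = tens3 \1_I1 \1_I2 \1_I3 x :> R.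
  rewrite /tens3 !indicE -!natrM !mulnb; congr ((nat_of_bool _)%:R).
  apply/idP/idP; rewrite inE => h.
    by move: h => [[h1 h2] h3]; rewrite !mem_set.
  by move: h => /andP[/andP[]]; rewrite !inE.
have H I : ocitv I -> (fun n => \int[l1]_k (\1_I k * poisc n.+1%:R^-1 I k)) @ \oo -->
    2 * pi * fine (l1 I).
  move=> oI; apply: cvg_int_poisc; [exact: ocitv_measurable|exact: ocitv_lty|].
  (* The right endpoint b is the only point of ]a, b] that is not interior. *)
  case: oI => -[a b] _ <- /=; exists [set b]; split.
  - exact: measurable_set1.
  - exact: lebesgue_measure_set1.
  move=> k /=; apply: contra_notP => kb.
  have [[ak kb']|Ik] := pselect (a < k /\ k < b); last first.
    exists 1 => //; rewrite in_itv /= => /andP[ak kb']; case: Ik; split=> //.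
    by rewrite lt_neqAle kb' andbT; exact/eqP.
  exists (Num.min (k - a) (b - k)); first by rewrite lt_min !subr_gt0 ak kb'.
  move=> _ p; rewrite in_itv /= => /negP; rewrite negb_and -leNgt -ltNge => /orP[pa|bp].
    by rewrite ge_min ler_normr lerB// .
  by rewrite ge_min; apply/orP; right; rewrite distrC ler_normr lerB// ltW.
have fin I : ocitv I -> l1 I \is a fin_num.
  by move=> oI; rewrite ge0_fin_numE//; exact: ocitv_lty.
have -> : (2 * pi) ^+ 3 * fine (leb (box3 I1 I2 I3)) = (2 * pi * fine (l1 I1)) *
    (2 * pi * fine (l1 I2)) * (2 * pi * fine (l1 I3)).
  rewrite (leb3_lam (measurable_box3 m1 m2 m3)) lam_box3// fineM ?fin_numM ?fin//.
  by rewrite fineM ?fin//; ring.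
have -> : (fun n => \int[leb]_k (\1_(box3 I1 I2 I3) k *
     \int[leb]_p (\1_(box3 I1 I2 I3) p * pois3 n.+1%:R^-1 (k - p)))) =
   (fun n => \int[l1]_k (\1_I1 k * poisc n.+1%:R^-1 I1 k) *
   \int[l1]_k (\1_I2 k * poisc n.+1%:R^-1 I2 k) *
   \int[l1]_k (\1_I3 k * poisc n.+1%:R^-1 I3 k)); last first.
  by apply: cvgM; [apply: cvgM|]; exact: H.
apply/funext => n; have : 0 < n.+1%:R^-1 :> R by rewrite invr_gt0.
move: (n.+1%:R^-1) => dl dl0.
have I_ I : ocitv I -> l1.-integrable setT (fun k => (\1_I k * poisc dl I k)%:E).
  by move=> oI; apply: integrable_ind_poisc => //; [exact: ocitv_measurable|exact: ocitv_lty].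
have [_ <-] := Rint_tens3 (I_ _ o1) (I_ _ o2) (I_ _ o3).
apply: eq_Rintegral => k _; rewrite ibox.
have [_] := Rint_tens3 (integrable_poisc m1 k.1.1 dl0) (integrable_poisc m2 k.1.2 dl0)
  (integrable_poisc m3 k.2 dl0).
rewrite /tens3 => E.
have -> : \int[leb]_p (\1_(box3 I1 I2 I3) p * pois3 dl (k - p)) =
    poisc dl I1 k.1.1 * poisc dl I2 k.1.2 * poisc dl I3 k.2.
  rewrite -[RHS]E; apply: eq_Rintegral => p _; rewrite ibox /tens3.
  by rewrite mulrACA; congr (_ * _); exact: mulrACA.
by rewrite mulrACA; congr (_ * _); exact: mulrACA.
Qed.

End PoissonKernel3.

(** * Plancherel's theorem and the Fourier transformation *)

Section Leb6.
Variable R : realType.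
Local Notation leb := (@lebesgue3 R).

Definition leb6 := (leb \x leb)%E.

HB.instance Definition _ := Measure.on leb6.

Lemma sigma_finite_leb6 : sigma_finite setT leb6.
Proof.
pose I n : set R := `]- n%:R, n%:R]%classic.
pose F n : set (R3 R) := box3 (I n) (I n) (I n).
have oI n : ocitv (I n) by exists (- n%:R, n%:R).
have mI n := ocitv_measurable (oI n).
have hF n : measurable (F n) /\ (leb (F n) < +oo)%E.
  by split; [apply: measurable_B3; exact: measurable_box3|exact: leb_box3_lty].
apply: (product_sigma_finite (F := F) (G := F) hF hF) => x y.
have [n nx ny] : exists2 n, F n x & F n y.
  pose t (z : R) := (Num.trunc `|z|).+1.
  exists (maxn (maxn (maxn (t x.1.1) (t x.1.2)) (t x.2))
               (maxn (maxn (t y.1.1) (t y.1.2)) (t y.2))).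
    by split; [split|]; apply: real_in_itv; rewrite /= -/(t _) !leq_max leqnn ?orbT.
  by split; [split|]; apply: real_in_itv; rewrite /= -/(t _) !leq_max leqnn ?orbT.
by exists n.
Qed.

HB.instance Definition _ :=
  Measure_isSigmaFinite.Build _ _ _ leb6 sigma_finite_leb6.

End Leb6.

Section PoissonForm.
Variable R : realType.
Local Notation C := R[i].
Local Notation leb := (@lebesgue3 R).
Local Notation leb6 := (@leb6 R).
Local Notation T6 := (R3 R * R3 R)%type.
Local Notation L2 := (LC leb 2%:E).
Local Notation pi3 := ((2 * pi) ^+ 3 : R).

Lemma measurable_R3_fst : measurable_fun [set: T6]
  (fun z => z.1 : measurableTypeR R * measurableTypeR R * measurableTypeR R).
Proof. exact: (measurableT_comp (@measurable_fun_id3 R) measurable_fst). Qed.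

Lemma measurable_R3_snd : measurable_fun [set: T6]
  (fun z => z.2 : measurableTypeR R * measurableTypeR R * measurableTypeR R).
Proof. exact: (measurableT_comp (@measurable_fun_id3 R) measurable_snd). Qed.

Section FixedWidth.
Variable dl : R.
Hypothesis dl0 : 0 < dl.

Let W (z : T6) : R := pois3 dl (z.1 - z.2).

Lemma measurable_W : measurable_fun setT W.
Proof.
apply: (measurable_pois3 dl0); apply: measurable_sub3.
  exact: measurable_R3_fst.
exact: measurable_R3_snd.
Qed.

Lemma W_ge0 z : 0 <= W z.
Proof. exact: pois3_ge0. Qed.

Lemma W_sym k p : W (k, p) = W (p, k).
Proof. by rewrite /W /= -pois3_even opprB. Qed.

Lemma integral_W (k : R3 R) : (\int[leb]_p (W (k, p))%:E = pi3%:E)%E.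
Proof.
have [i e] := Rint_pois3_shift dl0 k.
by rewrite -e EFin_Rintegral.
Qed.

Lemma integral_W_scal (k : R3 R) (c : R) : 0 <= c ->
  (\int[leb]_p (c * W (k, p))%:E = (pi3 * c)%:E)%E.
Proof.
move=> c0; transitivity (c%:E * \int[leb]_p (W (k, p))%:E)%E; last first.
  by rewrite integral_W -EFinM mulrC.
rewrite -ge0_integralZl_EFin; first by [].
- exact: measurableT.
- by move=> y _; rewrite lee_fin; exact: pois3_ge0.
- exact: integrable_meas (Rint_pois3_shift dl0 k).1.
- exact: c0.
Qed.

Lemma Rint_W_scal (k : R3 R) (c : R) : \int[leb]_p (c * W (k, p)) = pi3 * c.
Proof.
have [i e] := Rint_pois3_shift dl0 k.
transitivity (c * \int[leb]_p pois3 dl (k - p)); last by rewrite e mulrC.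
by rewrite -(RintegralZl c measurableT i).
Qed.

Lemma integral_absW (u : R3 R -> R) : leb.-integrable setT (EFin \o u) ->
  (\int[leb]_x \int[leb]_y (`|u x| * W (x, y))%:E < +oo)%E.
Proof.
move=> ui; have mu := integrable_rmeas ui.
have pi0 : 0 <= pi3 by rewrite exprn_ge0// mulr_ge0// pi_ge0.
under eq_integral do rewrite integral_W_scal// EFinM.
rewrite ge0_integralZl_EFin.
- by have /integrableP[_ ulty] := ui; rewrite lte_mul_pinfty ?lee_fin.
- exact: measurableT.
- by move=> x _; rewrite lee_fin.
- by apply/measurable_EFinP; exact: measurableT_comp.
- exact: pi0.
Qed.

Lemma W_fst (u : R3 R -> R) : leb.-integrable setT (EFin \o u) ->
  leb6.-integrable setT (EFin \o (fun z => u z.1 * W z)) /\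
  \int[leb6]_z (u z.1 * W z) = pi3 * \int[leb]_x u x.
Proof.
move=> ui; have mu := integrable_rmeas ui.
have hb z : cabs (u z.1 * W z)%:C <= `|u z.1| * W z.
  by rewrite /cabs csq_real sqrtr_sqr normrM [`|W z|]ger0_norm ?lexx ?W_ge0.
have mU : measurable_fun setT (fun z : T6 => u z.1 * W z).
  by apply: measurable_funM; [exact: (measurableT_comp mu measurable_fst)|exact: measurable_W].
have I : leb6.-integrable setT (EFin \o (fun z => u z.1 * W z)).
  have : cintegrable leb6 setT (fun z => (u z.1 * W z)%:C).
    apply: (cintegrable_prod_dom (v := fun z => `|u z.1| * W z)).
    - exact: cmeas_real.
    - apply: measurable_funM; last exact: measurable_W.
      by apply: measurableT_comp => //; exact: (measurableT_comp mu measurable_fst).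
    - exact: hb.
    - rewrite [X in (X < _)%E](_ : _ = \int[leb]_x \int[leb]_y (`|u x| * W (x, y))%:E)%E; last by [].
      exact: (integral_absW ui).
  by case.
split; first exact: I.
rewrite -(RFubini12 I) -(RintegralZl _ measurableT ui).
by apply: eq_Rintegral => k _; exact: (Rint_W_scal k (u k)).
Qed.

Lemma W_snd (u : R3 R -> R) : leb.-integrable setT (EFin \o u) ->
  leb6.-integrable setT (EFin \o (fun z => u z.2 * W z)) /\
  \int[leb6]_z (u z.2 * W z) = pi3 * \int[leb]_x u x.
Proof.
move=> ui; have mu := integrable_rmeas ui.
have hb z : cabs (u z.2 * W z)%:C <= `|u z.2| * W z.
  by rewrite /cabs csq_real sqrtr_sqr normrM [`|W z|]ger0_norm ?lexx ?W_ge0.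
have mU : measurable_fun setT (fun z : T6 => u z.2 * W z).
  by apply: measurable_funM; [exact: (measurableT_comp mu measurable_snd)|exact: measurable_W].
have mV : measurable_fun setT (fun z : T6 => `|u z.2| * W z).
  apply: measurable_funM; last exact: measurable_W.
  by apply: measurableT_comp => //; exact: (measurableT_comp mu measurable_snd).
have E : (\int[leb]_y \int[leb]_x (`|u y| * W (y, x))%:E =
    \int[leb]_y \int[leb]_x (`|u y| * W (x, y))%:E)%E.
  by apply: eq_integral => y _; apply: eq_integral => x _; rewrite W_sym.
have I : leb6.-integrable setT (EFin \o (fun z => u z.2 * W z)).
  have : cintegrable leb6 setT (fun z => (u z.2 * W z)%:C).
    apply: (cintegrable_prod_dom (v := fun z => `|u z.2| * W z)).
    - exact: cmeas_real.
    - exact: mV.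
    - exact: hb.
    - rewrite (@fubini_tonelli _ _ _ _ _ leb leb (fun z => (`|u z.2| * W z)%:E)).
      + by rewrite /= -E; exact: (integral_absW ui).
      + exact/measurable_EFinP.
      + by move=> z; rewrite lee_fin mulr_ge0 ?normr_ge0 ?W_ge0.
  by case.
split; first exact: I.
rewrite -(RFubini21 I) -(RintegralZl _ measurableT ui).
apply: eq_Rintegral => k _; rewrite -(Rint_W_scal k (u k)).
by apply: eq_Rintegral => p _; rewrite /= W_sym.
Qed.

Lemma W_cross f g : L2 f -> L2 g ->
  cintegrable leb6 setT (fun z => Num.conj (f z.1) * g z.2 * (W z)%:C).
Proof.
move=> fL gL.
have [i1 _] := W_fst (L2_int fL); have [i2 _] := W_snd (L2_int gL).
apply: (cintegrable_dom _ (integrableD_EFin i1 i2)).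
  apply: cmeasM; last by apply: cmeas_real; exact: measurable_W.
  apply: cmeasM; last exact: cmeas_snd (L2_meas gL).
  exact: cmeasJ (cmeas_fst _ (L2_meas fL)).
move=> z; rewrite !cabsM cabsJ /cabs csq_real sqrtr_sqr -/(cabs _) -/(cabs _).
rewrite [`|W z|]ger0_norm; last exact: pois3_ge0.
rewrite -mulrDl ler_wpM2r//; first exact: pois3_ge0.
rewrite -!sqr_cabs; move: (cabs _) (cabs _) => a b; clear.
have := sqr_ge0 (a - b); have := sqr_ge0 (a + b); rewrite sqrrB sqrrD; lra.
Qed.

(** The defect pi3 |f|^2 - [pform f] is half the squared norm of this expression, which is linear in
    f. That the defect tends to 0 is thereby a property closed under linear combinations and limits,
    to be checked on boxes only. *)
Definition pdiff (f : R3 R -> C) (z : T6) : C :=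
  (Num.sqrt (W z))%:C * (f z.1 - f z.2).

Definition pform (f : R3 R -> C) : R :=
  complex.Re (cint leb6 setT (fun z => Num.conj (f z.1) * f z.2 * (W z)%:C)).

Lemma csq_pdiff f z : csq (pdiff f z) = csq (f z.1 - f z.2) * W z.
Proof. by rewrite csqM csq_real sqr_sqrtr ?pois3_ge0// mulrC. Qed.

Lemma L2_pdiff f : L2 f -> LC leb6 2%:E (pdiff f).
Proof.
move=> fL; have [i1 _] := W_fst (L2_int fL); have [i2 _] := W_snd (L2_int fL).
apply: (L2_dom _ (integrableZ_EFin 2 (integrableD_EFin i1 i2))).
  apply: cmeasM.
    apply: cmeas_real; apply: (@measurableT_comp _ _ _ _ _ _ (@Num.sqrt R)).
      by apply: continuous_measurable_fun; exact: sqrt_continuous.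
    exact: measurable_W.
  by apply: cmeasB; [exact: cmeas_fst (L2_meas fL)|exact: cmeas_snd (L2_meas fL)].
move=> z; rewrite csq_pdiff -mulrDl mulrA ler_wpM2r ?csqB_le//.
exact: pois3_ge0.
Qed.

(** Integrated over either variable, the kernel gives the constant pi3; this accounts for the two
    diagonal terms of the expanded square. *)
Lemma nsq_pdiff f : L2 f ->
  nsq leb6 (pdiff f) = 2 * (pi3 * nsq leb f - pform f).
Proof.
move=> fL; have [i1 e1] := W_fst (L2_int fL); have [i2 e2] := W_snd (L2_int fL).
have [i3 _] := W_cross fL fL.
have E : nsq leb6 (pdiff f) = \int[leb6]_z (csq (f z.1) * W z + csq (f z.2) * W z
    - 2 * complex.Re (Num.conj (f z.1) * f z.2 * (W z)%:C)).
  apply: eq_Rintegral => z _; rewrite csq_pdiff /csq !cE /= ?cE; ring.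
have i12 := integrableD_EFin i1 i2.
rewrite E RintegralB//; last exact: integrableZ_EFin.
rewrite RintegralD// RintegralZl// e1 e2 /pform /= -/(nsq _ _); ring.
Qed.

Lemma pform_le f : L2 f -> pform f <= pi3 * nsq leb f.
Proof.
move=> fL; have := nsq_ge0 leb6 (pdiff f); rewrite nsq_pdiff//.
by rewrite pmulr_rge0// subr_ge0.
Qed.

(** The bound is uniform in dl, as the passage to limits in f requires. *)
Lemma nsq_pdiff_le f : L2 f -> nsq leb6 (pdiff f) <= 4 * pi3 * nsq leb f.
Proof.
move=> fL; have [i1 e1] := W_fst (L2_int fL); have [i2 e2] := W_snd (L2_int fL).
have -> : 4 * pi3 * nsq leb f =
    \int[leb6]_z (2 * (csq (f z.1) * W z + csq (f z.2) * W z)).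
  rewrite RintegralZl// ?RintegralD// ?e1 ?e2; last exact: integrableD_EFin.
  by rewrite /nsq; ring.
apply: le_Rintegral => //; first exact: L2_int (L2_pdiff fL).
  exact: integrableZ_EFin (integrableD_EFin i1 i2).
move=> z _; rewrite csq_pdiff -mulrDl mulrA ler_wpM2r ?csqB_le//.
exact: pois3_ge0.
Qed.

End FixedWidth.

Lemma cvg_pdiff f : L2 f ->
  (fun n => nsq leb6 (pdiff n.+1%:R^-1 f)) @ \oo --> (0 : R).
Proof.
have dl0 n : 0 < n.+1%:R^-1 :> R by rewrite invr_gt0.
apply: (@L2_box_ind _ (fun f => (fun n => nsq leb6 (pdiff n.+1%:R^-1 f)) @ \oo --> (0 : R))).
- move=> {}f g fL gL Mf Mg.
  apply: (cvg_squeeze0 (b := fun n => 2 * (nsq leb6 (pdiff n.+1%:R^-1 f) +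
      nsq leb6 (pdiff n.+1%:R^-1 g)))).
    move=> n; rewrite nsq_ge0 /=.
    rewrite (_ : pdiff _ _ = fun z => pdiff n.+1%:R^-1 f z + pdiff n.+1%:R^-1 g z).
      by apply: nsqD_le; exact: L2_pdiff.
    by apply/funext => z; rewrite /pdiff -mulrDr opprD addrACA.
  rewrite -[X in _ --> X](mulr0 2); apply: cvgM; first exact: cvg_cst.
  by rewrite -[X in _ --> X](addr0 0); exact: cvgD.
- move=> c {}f fL Mf.
  rewrite (_ : (fun n => _) = (fun n => csq c * nsq leb6 (pdiff n.+1%:R^-1 f))).
    by rewrite -[X in _ --> X](mulr0 (csq c)); apply: cvgM; [exact: cvg_cst|].
  apply/funext => n; rewrite -nsqZ; last exact: L2_pdiff.
  by congr (nsq _ _); apply/funext => z; rewrite /pdiff -mulrBr mulrCA.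
- move=> F {}f FL MF fL Ff.
  apply: limn_le_bound => [n|e e0]; first exact: nsq_ge0.
  (* With the bound [4 * pi3 * nsq leb f] the first summand is at most e / 4. The second is at most
     e / 4 as well, and [nsqD_le] doubles their sum. *)
  pose c : R := 16 * pi3; have c0 : 0 < c.
    by rewrite mulr_gt0// exprn_gt0// mulr_gt0// pi_gt0.
  have [N HN] := near_shrink Ff (divr_gt0 e0 c0).
  have [N' HN'] := near_shrink (MF N) (divr_gt0 e0 (ltr0Sn R 3)).
  exists N' => // n /= Nn.
  have FfL := L2B fL (FL N).
  rewrite (_ : pdiff _ _ = fun z => pdiff n.+1%:R^-1 (fun x => f x - F N x) z +
      pdiff n.+1%:R^-1 (F N) z); last first.
    by apply/funext => z; rewrite /pdiff -mulrDr; congr (_ * _); ring.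
  apply: (le_trans (nsqD_le (L2_pdiff (dl0 n) FfL) (L2_pdiff (dl0 n) (FL N)))).
  have h1 := nsq_pdiff_le (dl0 n) FfL.
  have := HN N (leqnn N); rewrite nsqBC ger0_norm ?nsq_ge0// ler_pdivlMr// => h2.
  have := HN' n Nn; rewrite ger0_norm ?nsq_ge0// => h3.
  move: h2; rewrite /c => h2; lra.
- move=> I1 I2 I3 o1 o2 o3; set A := box3 I1 I2 I3.
  have mA : measurable (A : set (R3 R)).
    by apply: measurable_B3; apply: measurable_box3; exact: ocitv_measurable.
  have fA : (leb A < +oo)%E by exact: leb_box3_lty.
  have fL := L2_indic mA fA.
  have nA : nsq leb (fun x => (\1_A x)%:C) = fine (leb A).
    congr fine; transitivity (\int[leb]_x (\1_A x)%:E)%E; last by rewrite integral_indic// setIT.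
    apply: eq_integral => x _; rewrite csq_real indicE.
    by case: (_ \in _); rewrite ?expr1n ?expr0n.
  have pA n : pform n.+1%:R^-1 (fun x => (\1_A x)%:C) =
      \int[leb]_k (\1_A k * \int[leb]_p (\1_A p * pois3 n.+1%:R^-1 (k - p))).
    have [i1 _] := W_cross (dl0 n) fL fL.
    have [i2 _] := Rint_pois3_shift (dl0 n) (0 : R3 R).
    have iA (k : R3 R) : leb.-integrable setT (EFin \o (fun p : R3 R => \1_A p * pois3 n.+1%:R^-1 (k - p))).
      have [ik _] := Rint_pois3_shift (dl0 n) k.
      apply: (integrable_dom _ ik).
        by apply: measurable_funM; [exact: measurable_indic|exact: integrable_rmeas ik].
      move=> p; rewrite normrM [X in _ * X]ger0_norm; last exact: pois3_ge0.
      rewrite ler_piMl//; first exact: pois3_ge0.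
      by rewrite indicE; case: (_ \in _); rewrite ?normr1 ?normr0.
    transitivity (\int[leb]_k \int[leb]_p complex.Re (Num.conj (\1_A k)%:C * (\1_A p)%:C *
        (pois3 n.+1%:R^-1 (k - p))%:C)).
      exact: (esym (RFubini12 i1)).
    apply: eq_Rintegral => k _.
    rewrite -(RintegralZl (\1_A k) measurableT (iA k)).
    apply: eq_Rintegral => p _; rewrite !cE /=; ring.
  rewrite (_ : (fun n => _) = (fun n => 2 * (pi3 * fine (leb A) -
      \int[leb]_k (\1_A k * \int[leb]_p (\1_A p * pois3 n.+1%:R^-1 (k - p)))))).
    rewrite -[X in _ --> X](mulr0 2); apply: cvgM; first exact: cvg_cst.
    rewrite -(subrr (pi3 * fine (leb A))); apply: cvgB; first exact: cvg_cst.
    exact: cvg_pois3_box.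
  by apply/funext => n; rewrite nsq_pdiff// nA pA.
Qed.

Lemma cvg_pform f : L2 f ->
  (fun n => pform n.+1%:R^-1 f) @ \oo --> pi3 * nsq leb f.
Proof.
move=> fL; have dl0 n : 0 < n.+1%:R^-1 :> R by rewrite invr_gt0.
rewrite (_ : (fun n => _) = (fun n => pi3 * nsq leb f - 2^-1 * nsq leb6 (pdiff n.+1%:R^-1 f))).
  rewrite -[X in _ --> X]subr0 -[X in _ - X](mulr0 2^-1).
  apply: cvgB; first exact: cvg_cst.
  by apply: cvgM; [exact: cvg_cst|exact: cvg_pdiff].
by apply/funext => n; rewrite nsq_pdiff//; field.
Qed.

End PoissonForm.

Section FourierL1.
Variable R : realType.
Local Notation C := R[i].
Local Notation leb := (@lebesgue3 R).
Local Notation leb6 := (@leb6 R).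
Local Notation T6 := (R3 R * R3 R)%type.
Local Notation L2 := (LC leb 2%:E).
Local Notation L1 := (LC leb 1%:E).
Local Notation pi3 := ((2 * pi) ^+ 3 : R).

Definition F0 (f : R3 R -> C) (x : R3 R) : C :=
  cint leb setT (fun y => expi (- dot3 x y) * f y).

Lemma normM_le (a b : R) : 0 <= a <= 1 -> 0 <= b -> `|a * b| <= b.
Proof. by case/andP=> a0 a1 b0; rewrite ger0_norm ?mulr_ge0// ler_piMl. Qed.

Lemma expi_conjM (s t : R) : Num.conj (expi (- s)) * expi (- t) = expi (s - t) :> C.
Proof. by rewrite -expiN opprK -expiD. Qed.

Lemma cmeas_expi_dot3 d (T : measurableType d) (f g : T -> R3 R) :
  measurable_fun setT f -> measurable_fun setT g ->
  cmeasurable setT (fun z => expi (dot3 (f z) (g z)) : C).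
Proof.
move=> mf mg; apply: cmeas_expi; apply: measurable_dot3.
  exact: (measurableT_comp (@measurable_fun_id3 R) mf).
exact: (measurableT_comp (@measurable_fun_id3 R) mg).
Qed.

Lemma cmeas_expiN_dot3 d (T : measurableType d) (f g : T -> R3 R) :
  measurable_fun setT f -> measurable_fun setT g ->
  cmeasurable setT (fun z => expi (- dot3 (f z) (g z)) : C).
Proof.
move=> mf mg; under eq_fun do rewrite expiN.
exact: cmeasJ (cmeas_expi_dot3 mf mg).
Qed.

Lemma cintegrable_F0 f x : L1 f ->
  cintegrable leb setT (fun y => expi (- dot3 x y) * f y).
Proof.
move=> /L1P fi; apply: (cintegrableMb (k := 1) _ _ fi).
  by apply: cmeas_expiN_dot3; [exact: measurable_cst|exact: measurable_id].
by move=> y; rewrite cabs_expi.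
Qed.

Lemma cmeas_F0 f : L1 f -> cmeasurable setT (F0 f).
Proof.
move=> /L1P fi.
apply: (@cmeas_param_cint _ _ _ _ _ leb (fun z : T6 => expi (- dot3 z.1 z.2) * f z.2)).
apply: cmeasM; last exact: cmeas_snd (cintegrable_meas fi).
by apply: cmeas_expiN_dot3; [exact: measurable_fst|exact: measurable_snd].
Qed.

(* Gauss-Weierstrass type summability: damping by e3 turns the square of the
   Fourier transform into the quadratic form of the Poisson kernel. *)
Lemma F0_pform (dl : R) f : 0 < dl -> L1 f -> L2 f ->
  leb.-integrable setT (EFin \o (fun x => e3 dl x * csq (F0 f x))) /\
  \int[leb]_x (e3 dl x * csq (F0 f x)) = pform dl f.
Proof.
move=> dl0 fL1 fL2; have /L1P fi := fL1; have fJ := cintegrableJ fi.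
pose g (z : T6) : C := Num.conj (f z.1) * f z.2.
have gi : cintegrable leb6 setT g by exact: (cintegrable_tensor (m1 := leb) (m2 := leb) fJ fi).
pose ph (w : R3 R * T6) : C := (e3 dl w.1)%:C * expi (dot3 (w.2.1 - w.2.2) w.1).
pose H (w : R3 R * T6) : C := ph w * g w.2.
have csqF x : (csq (F0 f x))%:C = cint leb6 setT (fun z => expi (dot3 (z.1 - z.2) x) * g z).
  rewrite -conjM_csq /F0 -cintJ; last exact: cintegrable_F0.
  rewrite -[LHS](cint_tensor (m1 := leb) (m2 := leb)); last 2 first.
  - exact: cintegrableJ (cintegrable_F0 x fL1).
  - exact: cintegrable_F0.
  apply: cint_ext => z _; rewrite rmorphM mulrACA expi_conjM; congr (expi _ * _).
  by rewrite dot3Bl ![dot3 x _]dot3C.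
have mH : cmeasurable setT H.
  apply: cmeasM; last exact: cmeas_snd (cintegrable_meas gi).
  apply: cmeasM; first by apply: cmeas_fst (cmeas_real (measurable_e3 dl0)).
  apply: cmeas_expi; apply: measurable_dot3.
    apply: measurable_sub3.
      exact: (measurableT_comp (@measurable_R3_fst R) measurable_snd).
    exact: (measurableT_comp (@measurable_R3_snd R) measurable_snd).
  exact: (measurableT_comp (@measurable_fun_id3 R) measurable_fst).
have /cintegrableP[_ gabs] := gi.
(* Without the damping the modulus of the integrand would not depend on x, and Fubini's theorem
   would not apply. *)
have IH : cintegrable (leb \x leb6)%E setT H.
  apply: (cintegrable_dom mH (integrable_tensor (m1 := leb) (m2 := leb6) (e3_ge0 dl) _ (integrable_e3 dl0) gabs)).
    by move=> z; exact: cabs_ge0.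
  move=> w; rewrite !cabsM cabs_expi mulr1 /cabs csq_real sqrtr_sqr ger0_norm//.
  exact: e3_ge0.
have gx x : cintegrable leb6 setT (fun z => expi (dot3 (z.1 - z.2) x) * g z).
  apply: (cintegrableMb (k := 1) _ _ gi) => [|z]; last by rewrite cabs_expi.
  apply: cmeas_expi; apply: measurable_dot3; last exact: measurable_cst.
  by apply: measurable_sub3; [exact: measurable_R3_fst|exact: measurable_R3_snd].
have ex z : cintegrable leb setT (fun x => (e3 dl x)%:C * expi (dot3 (z.1 - z.2) x)).
  apply: (cintegrable_dom _ (integrable_e3 dl0)) => [|x].
    apply: cmeasM; first exact: cmeas_real (measurable_e3 dl0).
    by apply: cmeas_expi_dot3; [exact: measurable_cst|exact: measurable_id].
  rewrite cabsM cabs_expi mulr1 /cabs csq_real sqrtr_sqr ger0_norm ?lexx//.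
  exact: e3_ge0.
have E x : cint leb6 setT (fun z => H (x, z)) = (e3 dl x * csq (F0 f x))%:C.
  transitivity ((e3 dl x)%:C * cint leb6 setT (fun z => expi (dot3 (z.1 - z.2) x) * g z)).
    rewrite -cintZ; last exact: gx.
    by apply: cint_ext => z _; rewrite /H /ph /= mulrA.
  by rewrite -csqF -rmorphM.
have E' z : cint leb setT (fun x => H (x, z)) = g z * (pois3 dl (z.1 - z.2))%:C.
  rewrite -(cint_e3 dl0) -cintZ; last exact: ex.
  by apply: cint_ext => x _; rewrite /H /ph /= mulrC.
have F : cint leb setT (fun x => (e3 dl x * csq (F0 f x))%:C) =
    cint leb6 setT (fun z => g z * (pois3 dl (z.1 - z.2))%:C).
  transitivity (cint leb setT (fun x => cint leb6 setT (fun z => H (x, z)))).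
    by apply: cint_ext => x _; rewrite E.
  transitivity (cint leb6 setT (fun z => cint leb setT (fun x => H (x, z)))).
    by rewrite (cFubini12 (m1 := leb) (m2 := leb6) IH) (cFubini21 (m1 := leb) (m2 := leb6) IH).
  by apply: cint_ext => z _; rewrite E'.
split; last by move: (congr1 (@complex.Re R) F); rewrite cint_real.
have mF := measurable_csq (cmeas_F0 fL1).
pose K := \int[leb]_y cabs (f y).
apply: (integrable_dom _ (integrableZ_EFin (2 * K ^+ 2) (integrable_e3 dl0))).
  exact: measurable_funM (measurable_e3 dl0) mF.
move=> x; have e0 : 0 <= e3 dl x := e3_ge0 dl x.
rewrite (_ : `|_| = csq (F0 f x) * e3 dl x); last first.
  by rewrite mulrC ger0_norm// mulr_ge0// csq_ge0.
apply: ler_wpM2r; first exact: e0.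
apply: csq_cint_le; first exact: cintegrable_F0.
rewrite le_eqVlt; apply/orP; left; apply/eqP; apply: eq_Rintegral => y _.
by rewrite cabsM cabs_expi mul1r.
Qed.

(* By Fatou, then dominated convergence as the damping is removed. *)
Lemma cvg_e3 (x : R3 R) : (fun n => e3 n.+1%:R^-1 x) @ \oo --> (1 : R).
Proof.
have h (t : R) : (fun n => e1 n.+1%:R^-1 t) @ \oo --> (1 : R).
  have h0 : (fun n => - n.+1%:R^-1 * `|t|) @ \oo --> (0 : R).
    rewrite -[X in _ --> X](mul0r `|t|); apply: cvgM; last exact: cvg_cst.
    by rewrite -oppr0; apply: cvgN; exact: cvg_harmonic.
  by rewrite -[X in _ --> X]expR0; exact: (cvg_comp _ _ h0 (@continuous_expR R 0)).
by have := cvgM (cvgM (h x.1.1) (h x.1.2)) (h x.2); rewrite !mulr1; exact.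
Qed.

Lemma plancherel_L1 f : L1 f -> L2 f ->
  L2 (F0 f) /\ nsq leb (F0 f) = pi3 * nsq leb f.
Proof.
move=> fL1 fL2.
have dl0 n : 0 < n.+1%:R^-1 :> R by rewrite invr_gt0.
have mF := measurable_csq (cmeas_F0 fL1).
have e01 n (x : R3 R) : 0 <= e3 n.+1%:R^-1 x <= 1.
  rewrite e3_ge0 /= /e3 /tens3.
  by rewrite !mulr_ile1 ?mulr_ge0 ?e1_ge0 ?e1_le1.
have cv (x : R3 R) : (fun n => e3 n.+1%:R^-1 x * csq (F0 f x)) @ \oo --> csq (F0 f x).
  by rewrite -[X in _ --> X]mul1r; apply: cvgM; [exact: cvg_e3|exact: cvg_cst].
have me n : measurable_fun setT (fun x : R3 R => e3 n.+1%:R^-1 x * csq (F0 f x)).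
  exact: measurable_funM (measurable_e3 (dl0 n)) mF.
have bnd : (\int[leb]_x (csq (F0 f x))%:E <= (pi3 * nsq leb f)%:E)%E.
  apply: (fatou_le me _ cv) => [n x|n].
    by rewrite mulr_ge0 ?csq_ge0//; case/andP: (e01 n x).
  have [i e] := F0_pform (dl0 n) fL1 fL2.
  rewrite -EFin_Rintegral; [|exact: measurableT|exact: i].
  by rewrite e lee_fin; exact: pform_le.
have FL : L2 (F0 f).
  apply/L2P; split; first exact: cmeas_F0.
  apply/integrableP; split; first exact/measurable_EFinP.
  apply: (le_lt_trans _ (ltry (pi3 * nsq leb f))).
  apply: (le_trans _ bnd); rewrite le_eqVlt; apply/orP; left; apply/eqP.
  by apply: eq_integral => x _; rewrite /= ger0_norm// csq_ge0.
split; first exact: FL.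
(* By Fatou's lemma [csq (F0 f x)] is now known to be integrable in x, and can itself dominate. *)
have h1 : (fun n => \int[leb]_x (e3 n.+1%:R^-1 x * csq (F0 f x))) @ \oo --> nsq leb (F0 f).
  apply: (dominated_Rint me mF _ (L2_int FL)).
    by apply: aeW => x; exact: cv.
  by move=> n x; exact: normM_le (e01 n x) (csq_ge0 _).
have h2 : (fun n => \int[leb]_x (e3 n.+1%:R^-1 x * csq (F0 f x))) @ \oo --> pi3 * nsq leb f.
  rewrite (_ : (fun n => _) = (fun n => pform n.+1%:R^-1 f)); first exact: cvg_pform.
  by apply/funext => n; exact: (F0_pform (dl0 n) fL1 fL2).2.
exact: (cvg_unique _ h1 h2).
Qed.

End FourierL1.

Lemma ae_imp2 d (T : measurableType d) (R : realType)
    (mu : {measure set T -> \bar R}) (P Q S : T -> Prop) :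
  {ae mu, forall x, P x} -> {ae mu, forall x, Q x} ->
  (forall x, P x -> Q x -> S x) -> {ae mu, forall x, S x}.
Proof. by move=> h h' PQ; apply: filterS2 h h'. Qed.

Section Cutoff.
Variable R : realType.
Local Notation C := R[i].
Local Notation leb := (@lebesgue3 R).
Local Notation L2 := (LC leb 2%:E).
Local Notation L1 := (LC leb 1%:E).
Implicit Types f g : R3 R -> C.

Definition cube (n : nat) : set (R3 R) :=
  let I : set R := `]- n%:R, n%:R]%classic in box3 I I I.

Lemma cube_ocitv (n : nat) : ocitv (`]- n%:R, n%:R]%classic : set R).
Proof. by exists (- n%:R, n%:R). Qed.

Lemma measurable_cube n : measurable (cube n).
Proof.
have mI := ocitv_measurable (cube_ocitv n).
by apply: measurable_B3; exact: measurable_box3.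
Qed.

Lemma cube_lty n : (leb (cube n) < +oo)%E.
Proof. by have oI := cube_ocitv n; exact: leb_box3_lty. Qed.

Lemma cubeP (x : R3 R) : exists N, forall n, (N <= n)%N -> cube n x.
Proof.
pose t (z : R) := (Num.trunc `|z|).+1.
exists (maxn (maxn (t x.1.1) (t x.1.2)) (t x.2)) => n; rewrite !geq_max.
move=> /andP[/andP[h1 h2] h3].
by split; [split|]; exact: real_in_itv.
Qed.

Definition cutoff (n : nat) f : R3 R -> C := fun x => (\1_(cube n) x)%:C * f x.

Lemma csq_ind_le (A : set (R3 R)) x : csq (\1_A x)%:C <= 1 :> R.
Proof. by rewrite csq_real indicE; case: (_ \in _); rewrite ?expr1n ?expr0n. Qed.

Lemma cmeas_ind (A : set (R3 R)) : measurable A ->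
  cmeasurable setT (fun x => (\1_A x)%:C : C).
Proof. by move=> mA; apply: cmeas_real; exact: measurable_indic. Qed.

Lemma L2_ind (A : set (R3 R)) f : measurable A -> L2 f ->
  L2 (fun x => (\1_A x)%:C * f x).
Proof. by move=> mA fL; apply: (L2Mb (k := 1) (cmeas_ind mA) (csq_ind_le A) fL). Qed.

Lemma L2_cut n f : L2 f -> L2 (cutoff n f).
Proof. exact: L2_ind (measurable_cube n). Qed.

Lemma L1_cut n f : L2 f -> L1 (cutoff n f).
Proof.
move=> fL; apply/L1P; apply: L2M_int fL.
exact: L2_indic (measurable_cube n) (cube_lty n).
Qed.

Lemma cvg_cut f : L2 f -> L2cvg leb (fun n => cutoff n f) f.
Proof.
move=> fL; apply: (L2_dct (v := fun x => csq (f x)) _ (L2_meas fL) (L2_int fL)).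
- by move=> n; exact: L2_meas (L2_cut n fL).
- move=> n x; rewrite /cutoff indicE; case: (_ \in _) => /=.
    by rewrite mul1r subrr csq0 csq_ge0.
  by rewrite mul0r sub0r csqN.
- move=> x; have [N HN] := cubeP x.
  apply: cvg_near_cst; exists N => // n /= Nn.
  by rewrite /cutoff indic1 ?mul1r ?subrr ?csq0//; exact: HN.
Qed.

End Cutoff.

Section Isometries.
Variable R : realType.
Local Notation C := R[i].
Local Notation leb := (@lebesgue3 R).
Local Notation L2 := (LC leb 2%:E).
Local Notation L1 := (LC leb 1%:E).
Local Notation ip := (inner leb).
Local Notation nsq := (nsq leb).
Implicit Types f g : R3 R -> C.

Definition isom (A : (R3 R -> C) -> R3 R -> C) : Prop :=
  linear_op A /\ forall f, L2 f -> nsq (A f) = nsq f.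

Variable A : (R3 R -> C) -> R3 R -> C.

Lemma linear_opD f g : linear_op A -> L2 f -> L2 g ->
  A (fun x => f x + g x) = (fun x => A f x + A g x) %[ae leb].
Proof.
move=> [_ _ lin] fL gL.
rewrite (_ : (fun x => f x + g x) = (fun x => 1 * f x + g x)); last first.
  by apply/funext => x; rewrite mul1r.
by apply: (ae_imp (lin 1 f g fL gL)) => x e xT; rewrite e// mul1r.
Qed.

Lemma linear_opB f g : linear_op A -> L2 f -> L2 g ->
  A (fun x => f x - g x) = (fun x => A f x - A g x) %[ae leb].
Proof.
move=> [_ _ lin] fL gL.
rewrite (_ : (fun x => f x - g x) = (fun x => -1 * g x + f x)); last first.
  by apply/funext => x; rewrite mulN1r addrC.
by apply: (ae_imp (lin (-1) g f gL fL)) => x e xT; rewrite e// mulN1r addrC.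
Qed.

Lemma linear_op0 : linear_op A -> A (fun=> 0) = (fun=> 0) %[ae leb].
Proof.
move=> lA; rewrite (_ : (fun=> 0) = (fun x : R3 R => (0 : C) - 0)); last first.
  by apply/funext => x; rewrite subrr.
apply: (ae_imp (linear_opB lA (L2_0 leb) (L2_0 leb))) => x e xT.
by rewrite e// !subrr.
Qed.

Lemma linear_opZ (c : C) f : linear_op A -> L2 f ->
  A (fun x => c * f x) = (fun x => c * A f x) %[ae leb].
Proof.
move=> lA fL; have [h1 h2 lin] := lA.
rewrite (_ : (fun x => c * f x) = (fun x => c * f x + 0)); last first.
  by apply/funext => x; rewrite addr0.
apply: (ae_imp2 (lin c f (fun=> 0) fL (L2_0 leb)) (linear_op0 lA)) => x e e0 xT.
by rewrite e// e0// addr0.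
Qed.

Lemma isom_cvg F f : isom A -> (forall n, L2 (F n)) -> L2 f ->
  L2cvg leb F f -> L2cvg leb (fun n => A (F n)) (A f).
Proof.
move=> [lA nA] FL fL Ff; have [AL _ _] := lA.
rewrite /L2cvg (_ : (fun n => _) = (fun n => nsq (fun x => F n x - f x))); first exact: Ff.
apply/funext => n; rewrite -(nA _ (L2B (FL n) fL)).
apply: ae_eq_nsq; [exact: L2B (AL _ (FL n)) (AL _ fL)|exact: AL (L2B (FL n) fL)|].
by apply: ae_eq_sym; exact: linear_opB.
Qed.

Lemma isom_ip f g : isom A -> L2 f -> L2 g -> ip (A f) (A g) = ip f g.
Proof.
move=> [lA nA] fL gL; have [AL Aae _] := lA.
have re h : L2 h -> complex.Re (ip (A f) (A h)) = complex.Re (ip f h).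
  move=> hL; have := nA _ (L2D fL hL).
  rewrite (ae_eq_nsq _ _ (linear_opD lA fL hL)); last 2 first.
  - exact: AL (L2D fL hL).
  - exact: L2D (AL _ fL) (AL _ hL).
  rewrite (nsqD (AL _ fL) (AL _ hL)) (nsqD fL hL) (nA _ fL) (nA _ hL).
  by move: (complex.Re _) (complex.Re _) (nsq f) (nsq h) => a b c d; lra.
apply: cplx_eq; first exact: re.
have := re _ (L2Z 'i gL).
rewrite (ae_eq_ip (AL _ fL) (AL _ fL) _ _ _ (linear_opZ 'i lA gL)).
- rewrite (ipZr _ (AL _ fL) (AL _ gL)) (ipZr _ fL gL) !cReM /=.
  by rewrite !mul0r !mul1r !sub0r => /oppr_inj.
- exact: AL (L2Z _ gL).
- exact: L2Z (AL _ gL).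
- exact: ae_eq_refl.
Qed.

End Isometries.

(** Cutoffs to cubes lie in L^1 and converge in L^2. Identities between isometries need therefore be
    checked only where the Fourier integral converges absolutely. *)
Lemma isom_unique (R : realType) (A B : (R3 R -> R[i]) -> R3 R -> R[i]) :
  isom A -> isom B ->
  (forall f, L1 f -> L2 f -> A f = B f %[ae @lebesgue3 R]) ->
  forall f, L2 f -> A f = B f %[ae @lebesgue3 R].
Proof.
move=> iA iB AB f fL; have cL n := L2_cut n fL.
have [[AL _ _] _] := iA; have [[BL _ _] _] := iB.
have cA := isom_cvg iA cL fL (cvg_cut fL).
have cB := isom_cvg iB cL fL (cvg_cut fL).
apply: (L2cvg_unique (fun n => AL _ (cL n)) (AL _ fL) (BL _ fL) cA).
rewrite /L2cvg (_ : (fun n => _) = (fun n => nsq (@lebesgue3 R) (fun x => B (cutoff n f) x - B f x))).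
  exact: cB.
apply/funext => n; apply: ae_eq_nsq.
- exact: L2B (AL _ (cL n)) (BL _ fL).
- exact: L2B (BL _ (cL n)) (BL _ fL).
by apply: (ae_imp (AB _ (L1_cut n fL) (cL n))) => x e xT; rewrite /= e.
Qed.

Section AeEq.
Context d (T : measurableType d) (R : realType) (U : Type).
Variable mu : {measure set T -> \bar R}.
Implicit Types f g h : T -> U.

Lemma aeS f g : f = g %[ae mu] -> g = f %[ae mu].
Proof. by move=> h; apply: (ae_imp h) => x e xT; rewrite e. Qed.

Lemma aeT f g h : f = g %[ae mu] -> g = h %[ae mu] -> f = h %[ae mu].
Proof. by move=> h1 h2; apply: (ae_imp2 h1 h2) => x e1 e2 xT; rewrite e1// e2. Qed.

End AeEq.

Lemma cvg0_2D (R : realType) (u v : nat -> R) : u @ \oo --> (0 : R) ->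
  v @ \oo --> (0 : R) -> (fun n => 2 * (u n + v n)) @ \oo --> (0 : R).
Proof.
move=> u0 v0; have := cvgM (cvg_cst (2 : R)) (cvgD u0 v0).
by rewrite addr0 mulr0; exact.
Qed.

Lemma L2cvg_ip2 d (T : measurableType d) (R : realType)
    (mu : {measure set T -> \bar R}) (F G : nat -> T -> R[i]) (a b : T -> R[i]) :
  (forall n, LC mu 2%:E (F n)) -> LC mu 2%:E a ->
  (forall n, LC mu 2%:E (G n)) -> LC mu 2%:E b -> L2cvg mu F a -> L2cvg mu G b ->
  (fun n => csq (inner mu (F n) (G n) - inner mu a b)) @ \oo --> (0 : R).
Proof.
move=> FL aL GL bL Fa Gb.
apply: (cvg_squeeze0 (b := fun n => 2 * (nsq mu (F n) * nsq mu (fun x => G n x - b x) +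
    csq (inner mu (F n) b - inner mu a b)))).
  move=> n; rewrite csq_ge0 /=.
  rewrite (_ : inner mu (F n) (G n) - inner mu a b =
     inner mu (F n) (fun x => G n x - b x) + (inner mu (F n) b - inner mu a b)).
    apply: (le_trans (csqD_le _ _)); rewrite ler_pM2l// lerD2r.
    exact: cauchy_schwarz (FL n) (L2B (GL n) bL).
  by rewrite (ipBr (FL n) (GL n) bL); ring.
apply: cvg0_2D; last exact: L2cvg_ip.
by rewrite -[X in _ --> X](mulr0 (nsq mu a)); apply: cvgM Gb; exact: L2cvg_nsq.
Qed.

Section Conj.
Variable R : realType.
Implicit Types x y : R[i].

Lemma cconjK x : Num.conj (Num.conj x) = x.
Proof. by apply: cplx_eq; rewrite !cE ?opprK. Qed.

Lemma cconjD x y : Num.conj (x + y) = Num.conj x + Num.conj y.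
Proof. exact: rmorphD. Qed.

Lemma cconjM x y : Num.conj (x * y) = Num.conj x * Num.conj y.
Proof. exact: rmorphM. Qed.

Lemma cconj_real (a : R) : Num.conj a%:C = a%:C.
Proof. by apply: cplx_eq; rewrite !cE /= ?oppr0. Qed.

Lemma cconj_expiN (t : R) : Num.conj (expi (- t)) = expi t.
Proof. by rewrite -expiN opprK. Qed.

End Conj.

(** * The Fourier transformation on L^2 and its inverse *)

Section FourierOperator.
Variable R : realType.
Local Notation C := R[i].
Local Notation leb := (@lebesgue3 R).
Local Notation L2 := (LC leb 2%:E).
Local Notation L1 := (LC leb 1%:E).
Local Notation ip := (inner leb).
Local Notation nsq := (nsq leb).
Local Notation pi3 := ((2 * pi) ^+ 3 : R).
Implicit Types f g : R3 R -> C.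

Definition c0 : R := (2 * pi) `^ (- (3 / 2)).

Lemma sqr_c0 : c0 ^+ 2 * pi3 = 1.
Proof.
have p0 : 0 < 2 * pi :> R by rewrite mulr_gt0// pi_gt0.
rewrite /c0 -powR_mulrn ?powR_ge0// -powRrM.
rewrite (_ : - (3 / 2) * 2%:R = - 3%:R :> R); last by field.
rewrite powRN powR_mulrn ?ltW// mulVf// expf_neq0// gt_eqF//.
Qed.

Lemma F0D f g : L1 f -> L1 g -> F0 (fun x => f x + g x) = (fun x => F0 f x + F0 g x).
Proof.
move=> fL gL; apply/funext => x; rewrite /F0 -cintD; last 2 first.
- exact: cintegrable_F0.
- exact: cintegrable_F0.
by apply: cint_ext => y _; rewrite mulrDr.
Qed.

Lemma F0Z (c : C) f : L1 f -> F0 (fun x => c * f x) = (fun x => c * F0 f x).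
Proof.
move=> fL; apply/funext => x; rewrite /F0 -cintZ; last exact: cintegrable_F0.
by apply: cint_ext => y _; rewrite mulrCA.
Qed.

Lemma ae_eq_F0 f g : L1 f -> L1 g -> f = g %[ae leb] -> F0 f = F0 g.
Proof.
move=> fL gL fg; apply/funext => x; apply: ae_eq_cint.
- exact: cintegrable_meas (cintegrable_F0 x fL).
- exact: cintegrable_meas (cintegrable_F0 x gL).
by apply: (ae_imp fg) => y e yT; rewrite e.
Qed.

Definition F1 f : R3 R -> C := fun x => c0%:C * F0 f x.

Lemma F1D f g : L1 f -> L1 g -> F1 (fun x => f x + g x) = (fun x => F1 f x + F1 g x).
Proof. by move=> fL gL; rewrite /F1 F0D//; apply/funext => x; rewrite mulrDr. Qed.

Lemma F1Z (c : C) f : L1 f -> F1 (fun x => c * f x) = (fun x => c * F1 f x).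
Proof. by move=> fL; rewrite /F1 F0Z//; apply/funext => x; rewrite mulrCA. Qed.

Lemma L1D f g : L1 f -> L1 g -> L1 (fun x => f x + g x).
Proof. by move=> /L1P h /L1P k; apply/L1P; exact: cintegrableD. Qed.

Lemma L1Z (c : C) f : L1 f -> L1 (fun x => c * f x).
Proof. by move=> /L1P h; apply/L1P; exact: cintegrableZ. Qed.

Lemma L1J f : L1 f -> L1 (fun x => Num.conj (f x)).
Proof. by move=> /L1P h; apply/L1P; exact: cintegrableJ. Qed.

Lemma F1B f g : L1 f -> L1 g -> F1 (fun x => f x - g x) = (fun x => F1 f x - F1 g x).
Proof.
move=> fL gL; rewrite (_ : (fun x => f x - g x) = (fun x => f x + -1 * g x)).
  by rewrite F1D ?F1Z//; [apply/funext => x; rewrite mulN1r|exact: L1Z].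
by apply/funext => x; rewrite mulN1r.
Qed.

Lemma plancherel_F1 f : L1 f -> L2 f -> L2 (F1 f) /\ nsq (F1 f) = nsq f.
Proof.
move=> fL1 fL2; have [FL e] := plancherel_L1 fL1 fL2.
split; first exact: L2Z.
by rewrite /F1 (nsqZ _ FL) e csq_real mulrA sqr_c0 mul1r.
Qed.

(** The L^2 limit of the Fourier integrals over growing cubes. It is a witness for [is_fourier]; the
    transform [fourier], chosen by [xget], then agrees with it almost everywhere on each vector. *)
Definition Fop f : R3 R -> C :=
  xget (fun=> 0) [set g | L2 g /\ L2cvg leb (fun n => F1 (cutoff n f)) g].

Lemma L2_F1cut f n : L2 f -> L2 (F1 (cutoff n f)).
Proof. by move=> fL; case: (plancherel_F1 (L1_cut n fL) (L2_cut n fL)). Qed.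

Lemma FopP f : L2 f -> L2 (Fop f) /\ L2cvg leb (fun n => F1 (cutoff n f)) (Fop f).
Proof.
move=> fL; have cL n := L2_cut n fL; have c1 n := L1_cut n fL.
have [g gL Fg] : exists2 g, L2 g & L2cvg leb (fun n => F1 (cutoff n f)) g.
  apply: L2_complete => [n|e e0]; first exact: L2_F1cut.
  have [N HN] := near_shrink (cvg_cut fL) (divr_gt0 e0 (ltr0Sn R 3)).
  exists N => m n Nm Nn.
  have L1B : L1 (fun x => cutoff m f x - cutoff n f x).
    have h := L1D (c1 m) (L1Z (-1) (c1 n)).
    by rewrite (_ : (fun x => _) = (fun x => cutoff m f x + -1 * cutoff n f x))//;
      apply/funext => x; rewrite mulN1r.
  rewrite -(F1B (c1 m) (c1 n)) (plancherel_F1 L1B (L2B (cL m) (cL n))).2.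
  apply: (le_trans (nsqB_trans (cL m) fL (cL n))).
  have := HN m Nm; rewrite ger0_norm ?nsq_ge0// => h1.
  have := HN n Nn; rewrite ger0_norm ?nsq_ge0// nsqBC => h2; lra.
have : [set g | L2 g /\ L2cvg leb (fun n => F1 (cutoff n f)) g] (Fop f).
  by apply: xgetPex; exists g.
by [].
Qed.

Lemma Fop_F1 f : L1 f -> L2 f -> Fop f = F1 f %[ae leb].
Proof.
move=> f1 fL; have [FL Fc] := FopP fL.
have [F1L _] := plancherel_F1 f1 fL.
apply: (L2cvg_unique (fun n => L2_F1cut n fL) FL F1L Fc).
rewrite /L2cvg (_ : (fun n => _) = (fun n => nsq (fun x => cutoff n f x - f x))).
  exact: cvg_cut.
apply/funext => n; rewrite -(F1B (L1_cut n fL) f1).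
apply: (plancherel_F1 _ (L2B (L2_cut n fL) fL)).2.
rewrite (_ : (fun x => _) = (fun x => cutoff n f x + -1 * f x)); last first.
  by apply/funext => x; rewrite mulN1r.
by apply: L1D (L1_cut n fL) (L1Z _ f1).
Qed.

Lemma isom_Fop : isom Fop.
Proof.
split; last first.
  move=> f fL; have [FL Fc] := FopP fL.
  have h := L2cvg_nsq (fun n => L2_F1cut n fL) FL Fc.
  rewrite (_ : (fun n => _) = (fun n => nsq (cutoff n f))) in h.
    exact: (cvg_unique _ h (L2cvg_nsq (fun n => L2_cut n fL) fL (cvg_cut fL))).
  by apply/funext => n; case: (plancherel_F1 (L1_cut n fL) (L2_cut n fL)).
split.
- by move=> f fL; case: (FopP fL).
- move=> f g fL gL fg; have [FL Fc] := FopP fL; have [GL Gc] := FopP gL.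
  apply: (L2cvg_unique (fun n => L2_F1cut n fL) FL GL Fc).
  rewrite (_ : (fun n => _) = (fun n => F1 (cutoff n g))); first exact: Gc.
  apply/funext => n; rewrite /F1 (ae_eq_F0 (L1_cut n fL) (L1_cut n gL))//.
  by apply: (ae_imp fg) => x e xT; rewrite /cutoff e.
- move=> c f g fL gL; have [FL Fc] := FopP fL; have [GL Gc] := FopP gL.
  have [SL Sc] := FopP (L2D (L2Z c fL) gL).
  apply: (L2cvg_unique (fun n => L2_F1cut n (L2D (L2Z c fL) gL)) SL (L2D (L2Z c FL) GL) Sc).
  rewrite (_ : (fun n => _) = (fun n x => c * F1 (cutoff n f) x + F1 (cutoff n g) x)).
    apply: (L2cvgD (fun n => L2Z c (L2_F1cut n fL)) (L2Z c FL) (fun n => L2_F1cut n gL) GL _ Gc).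
    apply: (L2cvgM (g := fun=> c) (k := csq c) (fun n => L2_F1cut n fL) FL _ _ Fc).
      exact: cmeas_cst.
    by move=> x.
  apply/funext => n.
  transitivity (F1 (fun x => c * cutoff n f x + cutoff n g x)).
    by congr F1; apply/funext => x; rewrite /cutoff mulrDr mulrCA.
  by rewrite (F1D (L1Z c (L1_cut n fL)) (L1_cut n gL)) (F1Z c (L1_cut n fL)).
Qed.

(** The kernel exp(-i x y) is symmetric, so conjugation before and after [Fop] yields the adjoint,
    with kernel exp(i x y). *)
Definition Fadj f : R3 R -> C := fun x => Num.conj (Fop (fun y => Num.conj (f y)) x).

Lemma isom_Fadj : isom Fadj.
Proof.
have [[FL Fae lin] nF] := isom_Fop.
split; last by move=> f fL; rewrite /Fadj nsqJ (nF _ (L2J fL)) nsqJ.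
split.
- by move=> f fL; exact: L2J (FL _ (L2J fL)).
- move=> f g fL gL fg.
  have h : (fun y => Num.conj (f y)) = (fun y => Num.conj (g y)) %[ae leb].
    by apply: (ae_imp fg) => x e xT; rewrite e.
  by apply: (ae_imp (Fae _ _ (L2J fL) (L2J gL) h)) => x e xT; rewrite /Fadj e.
- move=> c f g fL gL; rewrite /Fadj.
  rewrite (_ : (fun y => Num.conj (c * f y + g y)) =
    (fun y => Num.conj c * Num.conj (f y) + Num.conj (g y))); last first.
    by apply/funext => y; rewrite cconjD cconjM.
  apply: (ae_imp (lin (Num.conj c) _ _ (L2J fL) (L2J gL))) => x e xT.
  by rewrite e// cconjD cconjM cconjK.
Qed.

(** Fubini's theorem for the absolutely integrable conj(f(y)) g(x) exp(i x y). Plancherel makes both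
    single integrals integrable, as products of two square-integrable functions. *)
Lemma F1_adj f g : L1 f -> L2 f -> L1 g -> L2 g ->
  ip (F1 f) g = ip f (fun x => Num.conj (F1 (fun y => Num.conj (g y)) x)).
Proof.
move=> f1 f2 g1 g2; have /L1P fi := f1; have /L1P gi := g1.
pose H (z : R3 R * R3 R) : C := expi (dot3 z.1 z.2) * (Num.conj (f z.2) * g z.1).
have IH : cintegrable (leb \x leb)%E setT H.
  apply: (cintegrableMb (k := 1)) => [|z|]; last 2 first.
  - by rewrite cabs_expi.
  - have := cintegrable_tensor (m1 := leb) (m2 := leb) gi (cintegrableJ fi).
    by under eq_fun do rewrite mulrC.
  by apply: cmeas_expi_dot3; [exact: measurable_fst|exact: measurable_snd].
have IH' : cintegrable leb setT (fun x => cint leb setT (fun y => H (x, y))).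
  have := L2M_int (L2J (plancherel_L1 f1 f2).1) g2; congr (cintegrable _ _ _).
  apply/funext => x; rewrite /F0 -cintJ; last exact: cintegrable_F0.
  rewrite mulrC -cintZ; last exact: cintegrableJ (cintegrable_F0 x f1).
  by apply: cint_ext => y _; rewrite /H /= cconjM cconj_expiN; ring.
have IH2 : cintegrable leb setT (fun y => cint leb setT (fun x => H (x, y))).
  have := L2M_int (L2J f2) (L2J (plancherel_L1 (L1J g1) (L2J g2)).1); congr (cintegrable _ _ _).
  apply/funext => y; rewrite /F0 -cintJ; last exact: cintegrable_F0 (L1J g1).
  rewrite -cintZ; last exact: cintegrableJ (cintegrable_F0 y (L1J g1)).
  by apply: cint_ext => x _; rewrite /H /= cconjM cconj_expiN cconjK dot3C; ring.
transitivity (c0%:C * cint leb setT (fun x => cint leb setT (fun y => H (x, y)))).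
  rewrite -cintZ//; apply: cint_ext => x _.
  rewrite /F1 cconjM cconj_real -mulrA; congr (_ * _).
  rewrite /F0 -cintJ; last exact: cintegrable_F0.
  rewrite mulrC -cintZ; last exact: cintegrableJ (cintegrable_F0 x f1).
  by apply: cint_ext => y _; rewrite /H /= cconjM cconj_expiN; ring.
rewrite (cFubini12 (m1 := leb) (m2 := leb) IH) -(cFubini21 (m1 := leb) (m2 := leb) IH).
rewrite -cintZ//; apply: cint_ext => y _.
rewrite /F1 cconjM cconj_real mulrCA; congr (_ * _).
rewrite /F0 -cintJ; last exact: cintegrable_F0 (L1J g1).
rewrite -cintZ; last exact: cintegrableJ (cintegrable_F0 y (L1J g1)).
by apply: cint_ext => x _; rewrite /H /= cconjM cconj_expiN cconjK dot3C; ring.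
Qed.

Lemma Fop_adj f g : L2 f -> L2 g -> ip (Fop f) g = ip f (Fadj g).
Proof.
have [[FL _ _] _] := isom_Fop; have [[GL _ _] _] := isom_Fadj.
have adj1 f' g' : L1 f' -> L2 f' -> L1 g' -> L2 g' -> ip (Fop f') g' = ip f' (Fadj g').
  move=> f1 f2 g1 g2.
  have F := Fop_F1 f1 f2; have G := Fop_F1 (L1J g1) (L2J g2).
  rewrite (ae_eq_ip (FL _ f2) (plancherel_F1 f1 f2).1 g2 g2 F (ae_eq_refl _ _ _)).
  rewrite F1_adj//; apply: ae_eq_ip.
  - exact: f2.
  - exact: f2.
  - exact: L2J (plancherel_F1 (L1J g1) (L2J g2)).1.
  - exact: GL.
  - exact: ae_eq_refl.
  - by apply: aeS; apply: (ae_imp G) => x e xT; rewrite /Fadj e.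
move=> fL gL.
have cf := cvg_cut fL; have cg := cvg_cut gL.
have cfL n := L2_cut n fL; have cgL n := L2_cut n gL.
have iF := isom_cvg isom_Fop cfL fL cf.
have iG := isom_cvg isom_Fadj cgL gL cg.
have h1 := L2cvg_ip2 (fun n => FL _ (cfL n)) (FL _ fL) cgL gL iF cg.
have h2 := L2cvg_ip2 cfL fL (fun n => GL _ (cgL n)) (GL _ gL) cf iG.
apply/eqP; rewrite -subr_eq0; apply/eqP/csq_eq0.
have h : (fun n : nat => csq (ip (Fop f) g - ip f (Fadj g))) @ \oo --> (0 : R).
  apply: (cvg_squeeze0 (b := fun n => 2 * (csq (ip (Fop (cutoff n f)) (cutoff n g) - ip (Fop f) g) +
    csq (ip (cutoff n f) (Fadj (cutoff n g)) - ip f (Fadj g))))).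
    move=> n; rewrite csq_ge0 /=.
    rewrite -(adj1 _ _ (L1_cut n fL) (cfL n) (L1_cut n gL) (cgL n)).
    rewrite [X in csq X](_ : _ = (ip (Fop (cutoff n f)) (cutoff n g) - ip f (Fadj g)) -
       (ip (Fop (cutoff n f)) (cutoff n g) - ip (Fop f) g)); last by ring.
    by rewrite [X in 2 * X]addrC; exact: csqB_le.
  exact: cvg0_2D.
exact: (cvg_unique _ (cvg_cst _) h).
Qed.

(** With F = [Fop] and its adjoint G = [Fadj], both isometric, |F G g - g|^2 expands to |g|^2 - 2
    |g|^2 + |g|^2 = 0. Surjectivity of F thus follows without a pointwise inversion theorem. *)
Lemma Fop_Fadj g : L2 g -> Fop (Fadj g) = g %[ae leb].
Proof.
have [[FL _ _] nF] := isom_Fop; have [[GL _ _] nG] := isom_Fadj.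
move=> gL; have hL := GL _ gL.
apply: nsqB_eq0; [exact: FL|exact: gL|].
rewrite (nsqB (FL _ hL) gL) (Fop_adj hL gL) ip_nsq /= (nF _ hL) (nG _ gL).
by move: (nsq g) => a; lra.
Qed.

Lemma Fadj_Fop g : L2 g -> Fadj (Fop g) = g %[ae leb].
Proof.
have [[FL _ _] nF] := isom_Fop; have [[GL _ _] nG] := isom_Fadj.
move=> gL; have hL := FL _ gL.
apply: nsqB_eq0; [exact: GL|exact: gL|].
rewrite (nsqB (GL _ hL) gL) (ipC gL (GL _ hL)) -(Fop_adj gL hL) ip_nsq /= (nG _ hL) (nF _ gL).
by move: (nsq g) => a; lra.
Qed.

Lemma is_fourier_Fop : is_fourier Fop.
Proof.
have iF := isom_Fop; have [lF nF] := iF; have [[GL _ _] _] := isom_Fadj.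
split; last by move=> f f1 f2; exact: Fop_F1.
split; first exact: lF.
- by move=> f g fL gL; exact: isom_ip.
- by move=> g gL; exists (Fadj g); [exact: GL|exact: Fop_Fadj].
Qed.

Lemma is_fourierP (F : (R3 R -> C) -> R3 R -> C) : is_fourier F -> isom F /\
  forall f, L2 f -> F f = Fop f %[ae leb].
Proof.
move=> [[lF ipF _] F0]; have iF : isom F.
  split=> // f fL; have := ipF f f fL fL.
  by rewrite /Defs.ip !ip_nsq => /(congr1 (@complex.Re R)).
split=> // f fL; apply: (isom_unique iF isom_Fop _ fL) => g g1 g2.
exact: (aeT (F0 g g1 g2) (aeS (Fop_F1 g1 g2))).
Qed.

Lemma fourierP : isom (@fourier R) /\ forall f, L2 f -> fourier f = Fop f %[ae leb].
Proof.
apply: is_fourierP.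
have : (@is_fourier R) (@fourier R) by apply: xgetPex; exists Fop; exact: is_fourier_Fop.
by [].
Qed.

Definition Finv := op_inv (@fourier R).

Lemma FinvP g : L2 g -> L2 (Finv g) /\ fourier (Finv g) = g %[ae leb].
Proof.
move=> gL; have [iF FF] := fourierP; have [[GL _ _] _] := isom_Fadj.
have : [set phi | L2 phi /\ fourier phi = g %[ae leb]] (Finv g); last by [].
apply: xgetPex; exists (Fadj g); split; first exact: GL.
exact: (aeT (FF _ (GL _ gL)) (Fop_Fadj gL)).
Qed.

Lemma Finv_Fadj g : L2 g -> Finv g = Fadj g %[ae leb].
Proof.
move=> gL; have [hL hF] := FinvP gL; have [iF FF] := fourierP.
have [[GL Gae _] _] := isom_Fadj; have [[FL _ _] _] := isom_Fop.
have e : Fop (Finv g) = g %[ae leb] := aeT (aeS (FF _ hL)) hF.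
have e' := Gae _ _ (FL _ hL) gL e.
exact: (aeT (aeS (Fadj_Fop hL)) e').
Qed.

Lemma isom_ae_eq A B : isom A -> (forall f, L2 f -> L2 (B f)) ->
  (forall f, L2 f -> B f = A f %[ae leb]) -> isom B.
Proof.
move=> [[AL Aae lin] nA] BL AB; split; last first.
  by move=> f fL; rewrite -(nA _ fL); apply: ae_eq_nsq; [exact: BL|exact: AL|exact: AB].
split; first exact: BL.
- move=> f g fL gL fg.
  apply: (ae_imp2 (AB _ fL) (ae_imp2 (AB _ gL) (Aae _ _ fL gL fg) (fun x e1 e2 => conj e1 e2))).
  by move=> x e1 [e2 e3] xT; rewrite e1// e2// e3.
- move=> c f g fL gL.
  have h := ae_imp2 (AB _ fL) (AB _ gL) (fun x e1 e2 => conj e1 e2).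
  have h' := ae_imp2 (AB _ (L2D (L2Z c fL) gL)) (lin c f g fL gL) (fun x e1 e2 => conj e1 e2).
  by apply: (ae_imp2 h h') => x [e1 e2] [e3 e4] xT; rewrite e1// e2// e3// e4.
Qed.

Lemma isom_Finv : isom Finv.
Proof.
apply: (isom_ae_eq isom_Fadj) => f fL; first by case: (FinvP fL).
exact: Finv_Fadj.
Qed.

Lemma fourier_adj f g : L2 f -> L2 g -> ip (fourier f) g = ip f (Finv g).
Proof.
move=> fL gL; have [iF FF] := fourierP; have [hL hF] := FinvP gL.
have [[FL _ _] _] := iF.
rewrite -(isom_ip iF fL hL); apply: ae_eq_ip; [exact: FL|exact: FL|exact: gL|exact: FL|exact: ae_eq_refl|].
exact: ae_eq_sym.
Qed.

Lemma Finv_L1 g : L1 g -> L2 g ->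
  Finv g = (fun x => c0%:C * cint leb setT (fun y => expi (dot3 x y) * g y)) %[ae leb].
Proof.
move=> g1 g2.
apply: (ae_imp2 (Finv_Fadj g2) (Fop_F1 (L1J g1) (L2J g2))) => x e1 e2 xT.
rewrite e1// /Fadj e2// /F1 cconjM cconj_real; congr (_ * _).
rewrite /F0 -cintJ; last exact: cintegrable_F0 (L1J g1).
by apply: cint_ext => y _; rewrite cconjM cconj_expiN cconjK.
Qed.

End FourierOperator.

(** * Symmetries of the Fourier transformation *)

Section OperatorAlgebra.
Variable R : realType.
Local Notation C := R[i].
Local Notation leb := (@lebesgue3 R).
Local Notation L2 := (LC leb 2%:E).
Local Notation ip := (inner leb).
Local Notation nsq := (nsq leb).
Local Notation op := ((R3 R -> C) -> R3 R -> C).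
Implicit Types (f g : R3 R -> C) (A B : op).

Lemma linear_op_comp A B : linear_op A -> linear_op B -> linear_op (A \o B).
Proof.
move=> [AL Aae Alin] [BL Bae Blin]; split.
- by move=> f fL; exact: AL (BL _ fL).
- by move=> f g fL gL fg; exact: Aae (BL _ fL) (BL _ gL) (Bae _ _ fL gL fg).
- move=> c f g fL gL; have fB := BL _ fL; have gB := BL _ gL.
  exact: (aeT (Aae _ _ (BL _ (L2D (L2Z c fL) gL)) (L2D (L2Z c fB) gB) (Blin c f g fL gL))
    (Alin c _ _ fB gB)).
Qed.

(** A version of [bounded_op] with real squared norms and a nonnegative constant, convenient for
    compositions and sums. *)
Definition bop A := linear_op A /\
  exists2 K : R, 0 <= K & forall f, L2 f -> nsq (A f) <= K * nsq f.

Lemma bop_bounded A : bop A -> bounded_op A.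
Proof.
move=> [lA [K K0 AK]]; split=> //; exists K => f fL.
by rewrite /Defs.ip !ip_nsq -rmorphM lecR; exact: AK.
Qed.

Lemma isom_bop A : isom A -> bop A.
Proof. by move=> [lA nA]; split=> //; exists 1 => // f fL; rewrite nA// mul1r. Qed.

Lemma isom_comp A B : isom A -> isom B -> isom (A \o B).
Proof.
move=> [lA nA] [lB nB]; split; first exact: linear_op_comp.
by have [BL _ _] := lB; move=> f fL; rewrite /= (nA _ (BL _ fL)) nB.
Qed.

Lemma bop_comp A B : bop A -> bop B -> bop (A \o B).
Proof.
move=> [lA [K K0 nA]] [lB [K' K'0 nB]]; split; first exact: linear_op_comp.
have [BL _ _] := lB; exists (K * K'); first exact: mulr_ge0.
move=> f fL; apply: (le_trans (nA _ (BL _ fL))).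
by rewrite -mulrA ler_wpM2l// nB.
Qed.

Lemma bopD A B : bop A -> bop B -> bop (fun f x => A f x + B f x).
Proof.
move=> [[AL Aae Alin] [K K0 nA]] [[BL Bae Blin] [K' K'0 nB]]; split; [split|].
- by move=> f fL; exact: L2D (AL _ fL) (BL _ fL).
- move=> f g fL gL fg.
  by apply: (ae_imp2 (Aae _ _ fL gL fg) (Bae _ _ fL gL fg)) => x e1 e2 xT; rewrite e1// e2.
- move=> c f g fL gL.
  apply: (ae_imp2 (Alin c f g fL gL) (Blin c f g fL gL)) => x e1 e2 xT.
  by rewrite e1// e2//; ring.
- exists (2 * (K + K')); first by rewrite mulr_ge0// addr_ge0.
  move=> f fL; apply: (le_trans (nsqD_le (AL _ fL) (BL _ fL))).
  by rewrite -mulrA ler_wpM2l// mulrDl lerD// ?nA ?nB.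
Qed.

Lemma bop_mul (u : R3 R -> C) (K : R) : cmeasurable setT u ->
  (forall x, csq (u x) <= K) -> bop (fun f x => u x * f x).
Proof.
move=> mu uK; split; [split|].
- by move=> f fL; exact: (L2Mb mu uK fL).
- by move=> f g fL gL fg; apply: (ae_imp fg) => x e xT; rewrite e.
- by move=> c f g fL gL; apply: aeW => x xT; ring.
- exists K; first exact: le_trans (csq_ge0 (u 0)) (uK 0).
  by move=> f fL; exact: nsqM_le.
Qed.

Lemma bop0 : bop (fun _ _ => 0).
Proof.
split; [split|].
- by move=> f _; exact: L2_0.
- by move=> f g _ _ _; exact: ae_eq_refl.
- by move=> c f g _ _; apply: aeW => x _; rewrite mulr0 addr0.
- exists 0 => // f fL; rewrite mul0r -(mul0r (nsq f)).
  by apply: nsq_le => //; [exact: L2_0|move=> x; rewrite csq0 mul0r].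
Qed.

Lemma bop_sum n (A : 'I_n -> op) : (forall i, bop (A i)) ->
  bop (fun f x => \sum_(i < n) A i f x).
Proof.
elim: n A => [|n IH] A bA.
  rewrite (_ : (fun f x => _) = (fun _ _ => 0)); first exact: bop0.
  by apply/funext => f; apply/funext => x; rewrite big_ord0.
rewrite (_ : (fun f x => _) = (fun f x => A ord0 f x + \sum_(i < n) A (lift ord0 i) f x)).
  exact: bopD (bA _) (IH _ (fun i => bA _)).
by apply/funext => f; apply/funext => x; rewrite big_ord_recl.
Qed.

Lemma isom_mul (u : R3 R -> C) : cmeasurable setT u -> (forall x, csq (u x) = 1) ->
  isom (fun f x => u x * f x).
Proof.
move=> mu u1; split; first by case: (@bop_mul u 1 mu) => // x; rewrite u1.
move=> f fL; apply: eq_Rintegral => x _.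
by rewrite csqM u1 mul1r.
Qed.

Lemma isom_preserving (p : R3 R -> R3 R) : measurable_fun setT p ->
  (forall X, measurable X -> leb (p @^-1` X) = leb X) -> isom (fun f x => f (p x)).
Proof.
move=> mp pl; split; [split|].
- by move=> f; exact: L2_preserving.
- by move=> f g fL gL fg; exact: ae_eq_preserving.
- by move=> c f g fL gL; exact: ae_eq_refl.
- by move=> f fL; exact: (nsq_preserving mp pl (L2_meas fL)).
Qed.

Lemma op_invP A : isom A ->
  (forall g, L2 g -> exists2 f, L2 f & A f = g %[ae leb]) ->
  forall g, L2 g -> L2 (op_inv A g) /\ A (op_inv A g) = g %[ae leb].
Proof.
move=> iA sA g gL; have [f fL fg] := sA g gL.
have : [set phi | L2 phi /\ A phi = g %[ae leb]] (op_inv A g) by apply: xgetPex; exists f.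
by [].
Qed.

Lemma isom_inj A f g : isom A -> L2 f -> L2 g -> A f = A g %[ae leb] -> f = g %[ae leb].
Proof.
move=> [lA nA] fL gL fg; have [AL _ _] := lA.
apply: nsqB_eq0 => //; rewrite -(nA _ (L2B fL gL)).
rewrite (ae_eq_nsq _ _ (linear_opB lA fL gL)); last 2 first.
- exact: AL (L2B fL gL).
- exact: L2B (AL _ fL) (AL _ gL).
exact: nsqB_ae (AL _ fL) (AL _ gL) fg.
Qed.

Lemma polarize (x y x' y' : C) : 1 * x + Num.conj 1 * y = 1 * x' + Num.conj 1 * y' ->
  'i * x + Num.conj 'i * y = 'i * x' + Num.conj 'i * y' -> x = x'.
Proof.
move=> h1 h2.
have a1 := congr1 (@complex.Re R) h1; have a2 := congr1 (@complex.Im R) h1.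
have a3 := congr1 (@complex.Re R) h2; have a4 := congr1 (@complex.Im R) h2.
move: a1 a2 a3 a4; rewrite !cE /= => a1 a2 a3 a4.
by apply: cplx_eq; lra.
Qed.

(** Polarization with the coefficients 1 and i. Covariance need then be checked only on the
    quadratic form of T, which is a sum of squared norms. *)
Lemma form_eq A B : linear_op A -> linear_op B ->
  (forall f, L2 f -> ip f (A f) = ip f (B f)) -> op_eq A B.
Proof.
move=> lA lB AB; have [AL _ _] := lA; have [BL _ _] := lB.
have pol (c : C) f g : L2 f -> L2 g ->
    c * ip f (A g) + Num.conj c * ip g (A f) = c * ip f (B g) + Num.conj c * ip g (B f).
  have ex D : linear_op D -> L2 f -> L2 g ->
      ip (fun x => c * g x + f x) (D (fun x => c * g x + f x)) =
      Num.conj c * c * ip g (D g) + Num.conj c * ip g (D f) + c * ip f (D g) + ip f (D f).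
    move=> lD fL gL; have [DL _ lin] := lD.
    have cgL := L2Z c gL; have sL := L2D cgL fL.
    have DgL := DL _ gL; have DfL := DL _ fL.
    rewrite (ae_eq_ip sL sL (DL _ sL) (L2D (L2Z c DgL) DfL) (ae_eq_refl _ _ _) (lin c g f gL fL)).
    rewrite (ipDr sL (L2Z c DgL) DfL) (ipZr _ sL DgL).
    rewrite (ipDl DgL cgL fL) (ipDl DfL cgL fL) (ipZl _ DgL gL) (ipZl _ DfL gL).
    by ring.
  move=> fL gL; have := AB _ (L2D (L2Z c gL) fL).
  rewrite (ex _ lA fL gL) (ex _ lB fL gL) (AB _ fL) (AB _ gL).
  by move=> /addIr; rewrite -!addrA => /addrI; rewrite addrC => ->; rewrite addrC.
have AB' f g : L2 f -> L2 g -> ip f (A g) = ip f (B g).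
  move=> fL gL; have h1 := pol 1 f g fL gL; have h2 := pol 'i f g fL gL.
  exact: polarize h1 h2.
move=> g gL; apply: nsqB_eq0; [exact: AL|exact: BL|].
have sL := L2B (AL _ gL) (BL _ gL).
have : ip (fun x => A g x - B g x) (fun x => A g x - B g x) = 0.
  by rewrite (ipBr sL (AL _ gL) (BL _ gL)) (AB' _ _ sL gL) subrr.
by rewrite ip_nsq => /(congr1 (@complex.Re R)).
Qed.

End OperatorAlgebra.

Section FinvSymmetry.
Variable R : realType.
Local Notation C := R[i].
Local Notation leb := (@lebesgue3 R).
Local Notation L2 := (LC leb 2%:E).
Local Notation L1 := (LC leb 1%:E).
Local Notation Finv := (@Finv R).
Implicit Types (f g : R3 R -> C) (h x : R3 R).

Lemma translation_preserving h :
  measurable_fun setT (fun x : R3 R => x + h : R3 R) /\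
  forall X, measurable X -> leb ((fun x : R3 R => x + h : R3 R) @^-1` X) = leb X.
Proof. by split=> [|X mX]; [exact: measurable_translation3|exact: translation3_leb]. Qed.

Lemma rot3_preserving (B : 'M[C]_2) : SU2 B ->
  measurable_fun setT (rot3 B : R3 R -> R3 R) /\
  forall X, measurable X -> leb ((rot3 B : R3 R -> R3 R) @^-1` X) = leb X.
Proof. by move=> sB; split=> [|X mX]; [exact: measurable_rot3_R3|exact: rot3_leb]. Qed.

Definition phase h f : R3 R -> C := fun p => expi (dot3 h p) * f p.

Lemma cmeas_phase h : cmeasurable setT (fun p : R3 R => expi (dot3 h p) : C).
Proof. by apply: cmeas_expi_dot3; [exact: measurable_cst|exact: measurable_id]. Qed.

Lemma isom_phase h : isom (phase h).
Proof. by apply: isom_mul; [exact: cmeas_phase|move=> x; rewrite csq_expi]. Qed.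

Lemma L1_phase h f : L1 f -> L1 (phase h f).
Proof.
move=> /L1P fi; apply/L1P; apply: (cintegrableMb (k := 1) (cmeas_phase h) _ fi) => x.
by rewrite cabs_expi.
Qed.

Lemma Finv_phase h f : L2 f ->
  Finv (phase h f) = (fun x => Finv f (x + h)) %[ae leb].
Proof.
move: f; have [mt pt] := translation_preserving h.
apply: (isom_unique (A := Finv \o phase h) (B := fun f x => Finv f (x + h))).
- exact: isom_comp (isom_Finv R) (isom_phase h).
- exact: (isom_comp (isom_preserving mt pt) (isom_Finv R)).
move=> f f1 f2; have [[PL _ _] _] := isom_phase h.
apply: (aeT (Finv_L1 (L1_phase h f1) (PL _ f2))).
apply: aeS; apply: (aeT (ae_eq_preserving mt pt (Finv_L1 f1 f2))).
apply: aeW => x xT; congr (_ * _); apply: cint_ext => p _.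
by rewrite /phase dot3Dl expiD; ring.
Qed.

Lemma L1_rot B f : SU2 B -> L1 f -> L1 (fun p => f (rot3 (invmx B) p)).
Proof. by move=> /SU2V sB; have [mr pr] := rot3_preserving sB; exact: L1_preserving. Qed.

Lemma isom_rot B : SU2 B -> isom (fun f (p : R3 R) => f (rot3 (invmx B) p) : C).
Proof. by move=> /SU2V sB; have [mr pr] := rot3_preserving sB; exact: isom_preserving. Qed.

Lemma Finv_rot B f : SU2 B -> L2 f ->
  Finv (fun p => f (rot3 (invmx B) p)) = (fun x => Finv f (rot3 (invmx B) x)) %[ae leb].
Proof.
move=> sB; move: f; have [mr pr] := rot3_preserving (SU2V sB).
have iR := isom_rot sB.
apply: (isom_unique (A := Finv \o (fun f p => f (rot3 (invmx B) p)))
  (B := fun f x => Finv f (rot3 (invmx B) x))).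
- exact: isom_comp (isom_Finv R) iR.
- exact: (isom_comp iR (isom_Finv R)).
move=> f f1 f2; have [[PL _ _] _] := iR.
apply: (aeT (Finv_L1 (L1_rot sB f1) (PL _ f2))).
apply: aeS; apply: (aeT (ae_eq_preserving mr pr (Finv_L1 f1 f2))).
apply: aeW => x xT; congr (_ * _).
have mF : cmeasurable setT (fun y : R3 R => expi (dot3 (rot3 (invmx B) x) y) * f y).
  by apply: cmeasM; [exact: cmeas_phase|exact: (L2_meas f2)].
rewrite -(cint_preserving mr pr mF); apply: cint_ext => p _.
by rewrite dot3_rot//; exact: SU2V.
Qed.

Lemma Finv_U0 b B f : SU2 B -> L2 f ->
  Finv (U0 b B f) = (fun x => Finv f (rot3 (invmx B) (x - b))) %[ae leb].
Proof.
move=> sB fL; have [[RL _ _] _] := isom_rot sB.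
rewrite (_ : U0 b B f = phase (- b) (fun p => f (rot3 (invmx B) p))); last first.
  by apply/funext => p; rewrite /U0 /phase dot3Nl.
apply: (aeT (Finv_phase (- b) (RL _ fL))).
have [mt pt] := translation_preserving (- b).
by apply: (ae_imp (ae_preserving mt pt (Finv_rot sB fL))) => x e xT; exact: e.
Qed.

Lemma isom_U0 b B : SU2 B -> isom (@U0 R b B).
Proof.
move=> sB; rewrite (_ : U0 b B = phase (- b) \o (fun f p => f (rot3 (invmx B) p))).
  exact: isom_comp (isom_phase _) (isom_rot sB).
by apply/funext => f; apply/funext => p; rewrite /U0 /= /phase dot3Nl.
Qed.

Lemma U0_surj b B : SU2 B -> forall g, L2 g -> exists2 f, L2 f & U0 b B f = g %[ae leb].
Proof.
move=> sB g gL; have [mr pr] := rot3_preserving sB.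
exists (fun p => phase b g (rot3 B p)).
  by apply: (L2_preserving mr pr); case: (isom_phase b) => -[PL _ _] _; exact: PL.
apply: aeW => p _; rewrite /U0 /phase rot3VK// mulrA expiNM mul1r //.
Qed.

End FinvSymmetry.

(** * The localization as a sum of five transforms *)

Section Symbol.
Variable R : realType.
Local Notation C := R[i].
Variable m : R.
Hypothesis m0 : 0 < m.
Implicit Types (p k x : R * R * R) (B : 'M[C]_2).

Lemma sqr_eps p : eps m p ^+ 2 = m ^+ 2 + dot3 p p.
Proof. by rewrite /eps sqr_sqrtr ?sqr_norm3// addr_ge0 ?sqr_ge0 ?dot3_ge0. Qed.

Lemma eps_gt0 p : 0 < eps m p.
Proof. by rewrite sqrtr_gt0 ltr_pwDl ?exprn_gt0// sqr_ge0. Qed.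

Lemma eps_rot B p : SU2 B -> eps m (rot3 B p) = eps m p.
Proof. by move=> sB; rewrite /eps norm3_rot. Qed.

Lemma measurable_eps d (T : measurableType d) (f : T -> R3 R) :
  measurable_fun setT f -> measurable_fun setT (fun z => eps m (f z)).
Proof.
move=> mf; apply: (@measurableT_comp _ _ _ _ _ _ (@Num.sqrt R)).
  by apply: continuous_measurable_fun; exact: sqrt_continuous.
apply: measurable_funD; first exact: measurable_cst.
apply: measurable_funX; apply: measurable_norm3.
exact: (measurableT_comp (@measurable_fun_id3 R) mf).
Qed.

Lemma measurable_epsV : measurable_fun setT (fun p : R3 R => (eps m p)^-1).
Proof.
have cs : continuous (fun y : R => Num.sqrt (m ^+ 2 + y ^+ 2)).
  move=> y; apply: (@continuous_comp _ _ _ (fun y : R => m ^+ 2 + y ^+ 2) (@Num.sqrt R)).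
    apply: (@continuousD _ _ _ (fun=> m ^+ 2) (fun y : R => y ^+ 2)); first exact: cst_continuous.
    exact: exprn_continuous.
  exact: sqrt_continuous.
have ci : continuous (fun y : R => (Num.sqrt (m ^+ 2 + y ^+ 2))^-1).
  move=> y; apply: (@continuousV _ _ (fun y : R => Num.sqrt (m ^+ 2 + y ^+ 2))); last exact: cs.
  by rewrite gt_eqF// sqrtr_gt0 ltr_pwDl ?exprn_gt0// sqr_ge0.
apply: (measurableT_comp (continuous_measurable_fun ci)).
apply: measurable_norm3; exact: measurable_fun_id3.
Qed.

(* The column v(p) = (1, m / eps(p), p / eps(p)) / sqrt 2, which is normalized,
   and whose scalar products are t(k, p). *)
Definition vcomp (a : 'I_(2 + 3)) p : R :=
  match fintype.split a with
  | inl i => if i == 0 then (Num.sqrt 2)^-1 else m / (Num.sqrt 2 * eps m p)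
  | inr i => coord3 i p / (Num.sqrt 2 * eps m p)
  end.

Lemma vcomp_l (i : 'I_2) p : vcomp (lshift 3 i) p =
  if i == 0 then (Num.sqrt 2)^-1 else m / (Num.sqrt 2 * eps m p).
Proof. by rewrite /vcomp (unsplitK (inl i)). Qed.

Lemma vcomp_r (i : 'I_3) p : vcomp (rshift 2 i) p = coord3 i p / (Num.sqrt 2 * eps m p).
Proof. by rewrite /vcomp (unsplitK (inr i)). Qed.

Lemma sum5 (V : nmodType) (F : 'I_(2 + 3) -> V) :
  \sum_a F a = F (lshift 3 0) + F (lshift 3 1) + \sum_(i < 3) F (rshift 2 i).
Proof. by rewrite big_split_ord /= sum2. Qed.

Lemma sqrt2_neq0 : Num.sqrt 2 != 0 :> R.
Proof. by rewrite sqrtr_eq0 -ltNge. Qed.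

Lemma sqr_sqrt2 : Num.sqrt 2 ^+ 2 = 2 :> R.
Proof. by rewrite sqr_sqrtr. Qed.

Lemma sum_vcomp k p : \sum_a vcomp a k * vcomp a p =
  2^-1 * (1 + (m ^+ 2 + dot3 k p) / (eps m k * eps m p)).
Proof.
have ek := gt_eqF (eps_gt0 k); have ep := gt_eqF (eps_gt0 p).
rewrite sum5 !vcomp_l /=; under eq_bigr do rewrite !vcomp_r.
have := sqr_sqrt2; have := sqrt2_neq0; move: (Num.sqrt 2 : R) => s sn s2.
have -> : \sum_(i < 3) coord3 i k / (s * eps m k) * (coord3 i p / (s * eps m p)) =
    dot3 k p / (s ^+ 2 * (eps m k * eps m p)).
  rewrite /dot3 mulr_suml; apply: eq_bigr => i _.
  by field; rewrite ek ep sn.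
by rewrite -s2; field; rewrite ek ep sn.
Qed.

Lemma sum_sqr_vcomp p : \sum_a vcomp a p ^+ 2 = 1.
Proof.
under eq_bigr do rewrite expr2.
rewrite sum_vcomp -sqr_eps; have ep := gt_eqF (eps_gt0 p).
by rewrite -expr2 divff ?expf_neq0 ?ep// -[1 + 1]/(2%:R) mulVf.
Qed.

Lemma sqr_vcomp_le1 a p : vcomp a p ^+ 2 <= 1.
Proof.
rewrite -(sum_sqr_vcomp p) (bigD1 a)//= lerDl.
by apply: sumr_ge0 => i _; rewrite sqr_ge0.
Qed.

Lemma measurable_vcomp a : measurable_fun setT (vcomp a : R3 R -> R).
Proof.
have me : measurable_fun setT (fun p : R3 R => (Num.sqrt 2 * eps m p)^-1).
  under eq_fun do rewrite invfM.
  exact: (measurable_funM (@measurable_cst _ _ _ _ setT _) measurable_epsV).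
rewrite /vcomp; case: (fintype.split a) => i.
  case: (i == 0); first exact: measurable_cst.
  exact: (measurable_funM (@measurable_cst _ _ _ _ setT m) me).
apply: (measurable_funM _ me).
apply: measurable_coord3; exact: measurable_fun_id3.
Qed.

Definition bas3 (j : 'I_3) : R * R * R := ((j == 0)%:R, (j == 1)%:R, (j == 2)%:R).

Lemma sum3 (V : nmodType) (F : 'I_3 -> V) : \sum_(i < 3) F i = F 0 + F 1 + F 2.
Proof.
rewrite !big_ord_recl big_ord0 addr0 addrA; congr (_ + _ + _); congr F; exact: val_inj.
Qed.

Definition rotmx B : 'M[R]_3 := \matrix_(i, j) coord3 i (rot3 B (bas3 j)).

Lemma coord3_bas (j k : 'I_3) : coord3 j (bas3 k) = (j == k)%:R.
Proof.
by case: j => -[|[|[|//]]] hj; case: k => -[|[|[|//]]] hk; rewrite /coord3 /bas3.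
Qed.

Lemma dot3_bas (j k : 'I_3) : dot3 (bas3 j) (bas3 k) = (j == k)%:R.
Proof.
rewrite /dot3; under eq_bigr do rewrite !coord3_bas.
rewrite (bigD1 j)//= eqxx mul1r big1 ?addr0// => i ij.
by rewrite (negbTE ij) mul0r.
Qed.

Lemma coord3_rot B i x : SU2 B ->
  coord3 i (rot3 B x) = \sum_j rotmx B i j * coord3 j x.
Proof.
move=> sB; under eq_bigr do rewrite mxE.
rewrite sum3 !rot3E//; case: x => -[x1 x2] x3.
case: i => -[|[|[|//]]] hi; rewrite /coord3 !(tnth_nth 0) /rotq /bas3 /=; ring.
Qed.

Lemma rotmx_orth B : SU2 B -> (rotmx B)^T *m rotmx B = 1%:M.
Proof.
move=> sB; apply/matrixP => j k; rewrite !mxE.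
under eq_bigr do rewrite !mxE.
by rewrite -/(dot3 _ _) dot3_rot// dot3_bas.
Qed.

Lemma rotmxM B B' : SU2 B -> SU2 B' -> rotmx (B *m B') = rotmx B *m rotmx B'.
Proof.
move=> sB sB'; apply/matrixP => i j; rewrite !mxE rot3M// coord3_rot//.
by apply: eq_bigr => k _; congr (_ * _); rewrite mxE.
Qed.

Lemma rotmx1 : rotmx 1%:M = 1%:M.
Proof. by apply/matrixP => i j; rewrite !mxE rot3_1 coord3_bas. Qed.

(** Under rotations the first two components of v are scalars and the last three form a vector:
    twice the trivial representation plus that of spin 1. *)
Definition rhoR B : 'M[R]_(2 + 3) := block_mx 1%:M 0 0 (rotmx B).

Lemma rhoR_orth B : SU2 B -> (rhoR B)^T *m rhoR B = 1%:M.
Proof.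
move=> sB; rewrite /rhoR tr_block_mx mulmx_block !trmx0 !mulmx0 !mul0mx trmx1 mulmx1.
by rewrite rotmx_orth// !addr0 add0r -scalar_mx_block.
Qed.

Lemma rhoRM B B' : SU2 B -> SU2 B' -> rhoR (B *m B') = rhoR B *m rhoR B'.
Proof.
move=> sB sB'; rewrite /rhoR mulmx_block !mulmx0 !mul0mx mulmx1 rotmxM//.
by rewrite !addr0 add0r.
Qed.

Lemma rhoR1 : rhoR 1%:M = 1%:M.
Proof. by rewrite /rhoR rotmx1 -scalar_mx_block. Qed.

Lemma vcomp_rot B a p : SU2 B ->
  vcomp a p = \sum_b rhoR B a b * vcomp b (rot3 (invmx B) p).
Proof.
move=> sB; have e := eps_rot p (SU2V sB).
rewrite -[in LHS](splitK a) sum5; case: (fintype.split a) (splitK a) => i /= <-.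
- rewrite !vcomp_l /rhoR !block_mxEul.
  under eq_bigr do rewrite block_mxEur mxE mul0r.
  rewrite big1 ?addr0// !mxE e.
  by case: i => -[|[|//]] hi /=; rewrite !(mul1r, mul0r, addr0, add0r).
- rewrite !vcomp_r /rhoR !block_mxEdl !mxE !mul0r !add0r.
  under eq_bigr do rewrite block_mxEdr vcomp_r e mulrA.
  by rewrite -mulr_suml -coord3_rot// rot3VK.
Qed.

Definition rho B : 'M[C]_(2 + 3) := map_mx (real_complex R) (rhoR B).

(** A real orthogonal matrix acts on real and imaginary parts separately and preserves both sums of
    squares. *)
Lemma sum_csq_rho B (z : 'I_(2 + 3) -> C) : SU2 B ->
  \sum_a csq (\sum_b (rhoR B a b)%:C * z b) = \sum_a csq (z a).
Proof.
move=> sB.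
have real (x : 'I_(2 + 3) -> R) : \sum_a (\sum_b rhoR B a b * x b) ^+ 2 = \sum_a x a ^+ 2.
  pose X : 'cV[R]_(2 + 3) := \col_a x a.
  have h (Y : 'cV[R]_(2 + 3)) : (Y^T *m Y) 0 0 = \sum_a Y a 0 ^+ 2.
    by rewrite mxE; apply: eq_bigr => a _; rewrite mxE.
  have e a : (rhoR B *m X) a 0 = \sum_b rhoR B a b * x b.
    by rewrite mxE; apply: eq_bigr => b _; congr (_ * _); rewrite mxE.
  have := h (rhoR B *m X); rewrite trmx_mul mulmxA -(mulmxA X^T) rhoR_orth// mulmx1 h.
  have -> : \sum_a X a 0 ^+ 2 = \sum_a x a ^+ 2.
    by apply: eq_bigr => a _; congr (_ ^+ 2); rewrite mxE.
  by move=> ->; apply: eq_bigr => a _; rewrite e.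
rewrite /csq [LHS]big_split [RHS]big_split /=; congr (_ + _).
  rewrite -(real (fun a => complex.Re (z a))); apply: eq_bigr => a _.
  congr (_ ^+ 2); rewrite cRe_sum.
  by apply: eq_bigr => b _; rewrite !cE /= mul0r subr0.
rewrite -(real (fun a => complex.Im (z a))); apply: eq_bigr => a _.
congr (_ ^+ 2); rewrite cIm_sum.
by apply: eq_bigr => b _; rewrite !cE /= mul0r addr0.
Qed.

End Symbol.

Lemma ae_finite d (T : measurableType d) (R : realType)
    (mu : {measure set T -> \bar R}) (I : finType) (U : Type) (f g : I -> T -> U) :
  (forall i, f i = g i %[ae mu]) -> {ae mu, forall x, forall i, f i x = g i x}.
Proof.
move=> h; apply: filter_forall => i.
by apply: (ae_imp (h i)) => x e; exact: e.
Qed.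

(** [op_inv] picks its preimages arbitrarily; injectivity of A up to null sets makes these choices
    linear and compatible with equality almost everywhere. *)
Lemma isom_op_inv (R : realType) (A : (R3 R -> R[i]) -> R3 R -> R[i]) : isom A ->
  (forall g, LC (@lebesgue3 R) 2%:E g ->
     exists2 f, LC (@lebesgue3 R) 2%:E f & A f = g %[ae @lebesgue3 R]) ->
  isom (op_inv A).
Proof.
move=> iA sA; have P := op_invP iA sA; have [[AL Aae lin] nA] := iA.
split; last first.
  move=> f fL; have [gL e] := P f fL; rewrite -(nA _ gL).
  by apply: ae_eq_nsq => //; exact: AL.
split.
- by move=> f fL; case: (P f fL).
- move=> f g fL gL fg; have [fL' ef] := P f fL; have [gL' eg] := P g gL.
  apply: (isom_inj iA fL' gL'); exact: (aeT (aeT ef fg) (aeS eg)).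
- move=> c f g fL gL; have [fL' ef] := P f fL; have [gL' eg] := P g gL.
  have [sL' es] := P _ (L2D (L2Z c fL) gL).
  apply: (isom_inj iA sL' (L2D (L2Z c fL') gL')).
  apply: (aeT es); apply: aeS; apply: (aeT (lin c _ _ fL' gL')).
  by apply: (ae_imp2 ef eg) => x e1 e2 xT; rewrite e1// e2.
Qed.

Lemma linear_op_sum (R : realType) n (A : (R3 R -> R[i]) -> R3 R -> R[i])
    (c : 'I_n -> R[i]) (f : 'I_n -> R3 R -> R[i]) : linear_op A ->
  (forall i, LC (@lebesgue3 R) 2%:E (f i)) ->
  A (fun x => \sum_i c i * f i x) = (fun x => \sum_i c i * A (f i) x) %[ae @lebesgue3 R].
Proof.
move=> lA; have [_ _ lin] := lA; elim: n c f => [|n IH] c f fL.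
  rewrite (_ : (fun x => _) = (fun=> 0)); last first.
    by apply/funext => x; rewrite big_ord0.
  by apply: (ae_imp (linear_op0 lA)) => x e xT; rewrite e// big_ord0.
rewrite (_ : (fun x => _) = (fun x => c ord0 * f ord0 x +
    \sum_i c (lift ord0 i) * f (lift ord0 i) x)); last first.
  by apply/funext => x; rewrite big_ord_recl.
have sL : LC (@lebesgue3 R) 2%:E (fun x => \sum_i c (lift ord0 i) * f (lift ord0 i) x).
  by apply: L2_sum => i; exact: L2Z.
apply: (ae_imp2 (lin (c ord0) _ _ (fL ord0) sL)
  (IH (fun i => c (lift ord0 i)) (fun i => f (lift ord0 i)) (fun i => fL _))) => x e1 e2 xT.
by rewrite e1// e2// big_ord_recl.
Qed.

Lemma Rintegral_sum d (T : measurableType d) (R : realType)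
    (mu : {measure set T -> \bar R}) n (f : 'I_n -> T -> R) :
  (forall i, mu.-integrable setT (EFin \o f i)) ->
  \int[mu]_x (\sum_i f i x) = \sum_i \int[mu]_x f i x.
Proof.
move=> fi; have [] : (\int[mu]_x (\sum_i f i x) = \sum_i \int[mu]_x f i x) /\
    mu.-integrable setT (EFin \o (fun x => \sum_i f i x)); last by [].
elim: n f fi => [|n IH] f fi.
  rewrite big_ord0 (_ : (fun x => \sum_i f i x) = fun=> 0).
    by split; [rewrite /Rintegral integral0|exact: integrable0].
  by apply/funext => x; rewrite big_ord0.
have [e i] := IH (fun i => f (lift ord0 i)) (fun i => fi _).
rewrite big_ord_recl -e (_ : (fun x => \sum_i f i x) = fun x => f ord0 x + \sum_i f (lift ord0 i) x).
  by split; [exact: RintegralD|exact: integrableD_EFin].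
by apply/funext => x; rewrite big_ord_recl.
Qed.

Lemma sum_nsq d (T : measurableType d) (R : realType)
    (mu : {measure set T -> \bar R}) n (f : 'I_n -> T -> R[i]) :
  (forall i, LC mu 2%:E (f i)) ->
  \sum_i nsq mu (f i) = \int[mu]_x (\sum_i csq (f i x)).
Proof. by move=> fL; rewrite -Rintegral_sum// => i; exact: L2_int. Qed.

Lemma cvg_real_complex (R : realType) (u : nat -> R) (l : R) : u @ \oo --> l ->
  (fun n => (u n)%:C : R[i]^o) @ \oo --> (l%:C : R[i]^o).
Proof.
move=> ul; apply/cvgrPdist_lt => e e0.
have re : complex.Im e = 0 by move: e0; rewrite ltcE /= => /andP[/eqP <-].
have re0 : 0 < complex.Re e by move: e0; rewrite ltcE /= => /andP[_].
have /cvgrPdist_lt /(_ _ re0) h := ul.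
apply: filterS h => n hn; rewrite -rmorphB normc_def /= expr0n addr0 sqrtr_sqr.
by rewrite ltcE /= re eqxx.
Qed.

Lemma cvg_sum_ord (R : realType) n (u : 'I_n -> nat -> R) (l : 'I_n -> R) :
  (forall i, u i @ \oo --> l i) ->
  (fun k => \sum_i u i k) @ \oo --> \sum_i l i.
Proof.
elim: n u l => [|n IH] u l ul.
  rewrite big_ord0 (_ : (fun k => _) = fun=> 0); first exact: cvg_cst.
  by apply/funext => k; rewrite big_ord0.
rewrite big_ord_recl (_ : (fun k => _) = (fun k => u ord0 k + \sum_i u (lift ord0 i) k)).
  by apply: cvgD => //; exact: IH.
by apply/funext => k; rewrite big_ord_recl.
Qed.

Section ComponentTransforms.
Variable R : realType.
Local Notation C := R[i].
Local Notation leb := (@lebesgue3 R).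
Local Notation L2 := (LC leb 2%:E).
Local Notation L1 := (LC leb 1%:E).
Local Notation ip := (inner leb).
Local Notation nsq := (nsq leb).
Local Notation Finv := (@Finv R).
Variable m : R.
Hypothesis m0 : 0 < m.
Local Notation I5 := 'I_(2 + 3).
Implicit Types (f g phi : R3 R -> C) (D : set (R3 R)) (a : I5) (B : 'M[C]_2).

Local Notation v := (@vcomp R m).

Lemma cmeas_vcomp a : cmeasurable setT (fun p : R3 R => (v a p)%:C : C).
Proof. exact: cmeas_real (measurable_vcomp m0 a). Qed.

Lemma csq_vcomp a (p : R3 R) : csq (v a p)%:C <= 1.
Proof. by rewrite csq_real; exact: sqr_vcomp_le1. Qed.

Definition vmul a f : R3 R -> C := fun p => (v a p)%:C * f p.

Lemma bop_vmul a : bop (vmul a).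
Proof. exact: bop_mul (cmeas_vcomp a) (csq_vcomp a). Qed.

Lemma L2_vmul a f : L2 f -> L2 (vmul a f).
Proof. by have [[h _ _] _] := bop_vmul a; exact: h. Qed.

Definition vtr a f : R3 R -> C := Finv (vmul a f).

Lemma linear_vtr a : linear_op (vtr a).
Proof.
apply: linear_op_comp; last by case: (bop_vmul a).
by case: (isom_Finv R).
Qed.

Lemma L2_vtr a f : L2 f -> L2 (vtr a f).
Proof. by have [h _ _] := linear_vtr a; exact: h. Qed.

Definition ind D f : R3 R -> C := fun x => (\1_D x)%:C * f x.

Lemma bop_ind D : measurable D -> bop (ind D).
Proof. by move=> mD; exact: bop_mul (cmeas_ind mD) (@csq_ind_le R D). Qed.

Lemma L2_indf D f : measurable D -> L2 f -> L2 (ind D f).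
Proof. by move=> mD; have [[h _ _] _] := bop_ind mD; exact: h. Qed.

Lemma bop_fourier : bop (@fourier R).
Proof. by apply: isom_bop; case: (fourierP R). Qed.

Lemma L2_fourier f : L2 f -> L2 (fourier f).
Proof. by have [[h _ _] _] := bop_fourier; exact: h. Qed.

Lemma bop_ENW D : measurable D -> bop (ENW D).
Proof.
move=> mD; apply: (bop_comp (bop_comp bop_fourier (bop_ind mD))).
exact: isom_bop (isom_Finv R).
Qed.

Lemma bop_T D : measurable D -> bop (T_TM m D).
Proof.
move=> mD; have bE := bop_ENW mD.
have bl : bop (@mH R m).
  have := bop_vmul (lshift 3 1); congr bop; apply/funext => f; apply/funext => p.
  by rewrite /vmul vcomp_l.
have br i : bop (@PH R m i).
  have := bop_vmul (rshift 2 i); congr bop; apply/funext => f; apply/funext => p.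
  by rewrite /vmul vcomp_r.
apply: (bopD (A := fun f p => 2^-1 * ENW D f p + (mH m \o ENW D \o mH m) f p)
  (B := fun f p => \sum_(i < 3) (PH m i \o ENW D \o PH m i) f p)).
  apply: (bopD (A := fun f p => 2^-1 * ENW D f p)); last exact: bop_comp (bop_comp bl bE) bl.
  apply: (bop_comp (A := fun f p => 2^-1 * f p) _ bE).
  by apply: (bop_mul (K := csq 2^-1)) => //; exact: cmeas_cst.
by apply: bop_sum => i; exact: bop_comp (bop_comp (br i) bE) (br i).
Qed.

(** The coefficient 1/2 of the first term is split into factors 1 / sqrt 2 before and after [ENW],
    which gives it the form of the other four. Linearity of [ENW] holds only up to null sets, hence
    the equality almost everywhere. *)
Lemma T_sum D f : measurable D -> L2 f ->
  T_TM m D f = (fun p => \sum_a (v a p)%:C * fourier (ind D (vtr a f)) p) %[ae leb].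
Proof.
move=> mD fL.
have s2 : 2^-1 = ((Num.sqrt 2)^-1)%:C * ((Num.sqrt 2)^-1)%:C :> C.
  rewrite -rmorphM -expr2 exprVn sqr_sqrt2.
  by rewrite (_ : 2 = (2 : R)%:C) ?fmorphV// rmorph_nat.
have h := linear_opZ ((Num.sqrt 2)^-1)%:C (bop_ENW mD).1 fL.
apply: (ae_imp h) => p e _; rewrite /T_TM sum5 vcomp_l /= vcomp_l /=.
congr (_ + _); [congr (_ + _)|].
- rewrite s2 -mulrA; congr (_ * _).
  rewrite /vtr (_ : vmul (lshift 3 0) f = fun x => ((Num.sqrt 2)^-1)%:C * f x); last first.
    by apply/funext => x; rewrite /vmul vcomp_l.
  exact: (esym (e I)).
- rewrite /mH /mul_op /=; congr (_ * fourier (ind D (Finv _)) p).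
  by apply/funext => x; rewrite /vmul vcomp_l.
- apply: eq_bigr => i _; rewrite vcomp_r /PH /mul_op /=.
  congr (_ * fourier (ind D (Finv _)) p).
  by apply/funext => x; rewrite /vmul vcomp_r.
Qed.

Lemma ip_T D f g : measurable D -> L2 f -> L2 g ->
  ip f (T_TM m D g) = \sum_a ip (vtr a f) (ind D (vtr a g)).
Proof.
move=> mD fL gL; have [[TL _ _] _] := bop_T mD.
have FL a : L2 (fourier (ind D (vtr a g))).
  by apply: L2_fourier; apply: L2_indf => //; exact: L2_vtr.
have sL : L2 (fun p => \sum_a (v a p)%:C * fourier (ind D (vtr a g)) p).
  by apply: L2_sum => a; exact: L2_vmul.
rewrite (ae_eq_ip fL fL (TL _ gL) sL (ae_eq_refl _ _ _) (T_sum mD gL)).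
rewrite ip_sumr//; last by move=> a; exact: L2_vmul.
apply: eq_bigr => a _; rewrite ip_mulr.
rewrite (_ : (fun x => Num.conj (v a x)%:C * f x) = vmul a f); last first.
  by apply/funext => x; rewrite cconj_real.
have iL := L2_indf mD (L2_vtr a gL); have fa := L2_vmul a fL.
rewrite (ipC (FL a) fa) (fourier_adj iL fa) -(ipC iL (L2_vtr a fL)).
by [].
Qed.

Lemma ip_ind D f : measurable D -> L2 f -> ip f (ind D f) = (nsq (ind D f))%:C.
Proof.
move=> mD fL; rewrite -ip_nsq; apply: cint_ext => x _.
by rewrite /ind indicE; case: (_ \in _); rewrite ?mul1r// !mul0r mulr0 rmorph0 mul0r.
Qed.

(** Multiplication by an indicator is a projection. Positivity, sigma-additivity, covariance,
    causality and the kernel formula are all read off this sum of squared norms. *)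
Lemma ip_TT D f : measurable D -> L2 f ->
  ip f (T_TM m D f) = (\sum_a nsq (ind D (vtr a f)))%:C.
Proof.
move=> mD fL; rewrite ip_T// rmorph_sum; apply: eq_bigr => a _.
exact: ip_ind mD (L2_vtr a fL).
Qed.

Lemma sum_ip_vmul f g : L2 f -> L2 g -> \sum_a ip (vmul a f) (vmul a g) = ip f g.
Proof.
move=> fL gL.
transitivity (\sum_a ip f (fun x => (v a x)%:C * vmul a g x)).
  apply: eq_bigr => a _; rewrite ip_mulr; congr (inner _ _ _).
  by apply/funext => x; rewrite cconj_real.
rewrite -ip_sumr//; last by move=> a; exact/L2_vmul/L2_vmul.
congr (inner _ _ _); apply/funext => x.
rewrite /vmul; under eq_bigr do rewrite mulrA -rmorphM -expr2.
by rewrite -mulr_suml -rmorph_sum sum_sqr_vcomp// mul1r.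
Qed.

Lemma nsq_vmul_sum f : L2 f -> \sum_a nsq (vmul a f) = nsq f.
Proof.
move=> fL; apply: (@complexI R); rewrite rmorph_sum -ip_nsq -sum_ip_vmul//.
by apply: eq_bigr => a _; exact: (esym (ip_nsq _ _)).
Qed.

Lemma T_setT f : L2 f -> T_TM m setT f = f %[ae leb].
Proof.
move=> fL; apply: (aeT (T_sum measurableT fL)).
have h a : fourier (ind setT (vtr a f)) = vmul a f %[ae leb].
  rewrite (_ : ind setT (vtr a f) = vtr a f); last first.
    by apply/funext => x; rewrite /ind indic1// mul1r.
  by case: (FinvP (L2_vmul a fL)).
have H := ae_finite h.
apply: (ae_imp H) => x e _; under eq_bigr do rewrite e// /vmul mulrA -rmorphM -expr2.
by rewrite -mulr_suml -rmorph_sum sum_sqr_vcomp// mul1r.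
Qed.

(** Finite additivity is an induction on indicators; the limit is dominated convergence, each
    component being dominated by its own squared modulus. *)
Lemma T_sigma_additive (D : nat -> set (R3 R)) : (forall n, measurable (D n)) ->
  trivIset setT D -> forall phi, L2 phi ->
  (fun n => \sum_(i < n) ip phi (T_TM m (D i) phi) : C^o) @ \oo -->
      (ip phi (T_TM m (\bigcup_n D n) phi) : C^o).
Proof.
move=> mD tD f fL; have mU : measurable (\bigcup_n D n) by exact: bigcup_measurable.
pose w (E : set (R3 R)) : R := \sum_a nsq (ind E (vtr a f)).
rewrite (ip_TT mU fL) (_ : (fun n => _) = (fun n => (\sum_(i < n) w (D i))%:C)); last first.
  by apply/funext => n; rewrite rmorph_sum; apply: eq_bigr => i _; exact: ip_TT.
apply: cvg_real_complex.
have nsqE (E : set (R3 R)) (g : R3 R -> C) :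
    nsq (ind E g) = \int[leb]_x (\1_E x * csq (g x)).
  apply: eq_Rintegral => x _; rewrite /ind csqM csq_real indicE.
  by case: (_ \in _); rewrite ?expr1n ?expr0n.
rewrite (_ : (fun n => _) = (fun n => \sum_a nsq (ind (\bigcup_(i < n) D i) (vtr a f)))).
  apply: cvg_sum_ord => a; have cL := L2_vtr a fL; have mc := measurable_csq (L2_meas cL).
  have mUn n : measurable (\bigcup_(i < n) D i) by exact: bigcup_measurable.
  rewrite nsqE; under eq_fun do rewrite nsqE.
  apply: (dominated_Rint _ _ _ (L2_int cL)).
  - by move=> n; apply: measurable_funM mc; exact: measurable_indic.
  - by apply: measurable_funM mc; exact: measurable_indic.
  - apply: aeW => x; apply: cvgM; last exact: cvg_cst.
    have [[N _ DNx]|nU] := pselect ((\bigcup_n D n) x).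
      rewrite (indic1 _ (ex_intro2 _ _ N I DNx)).
      apply: cvg_near_cst; exists N.+1 => // n /= Nn.
      by apply: indic1; exists N.
    rewrite indic0E// (_ : (fun n => _) = fun=> 0); first exact: cvg_cst.
    by apply/funext => n; apply: indic0E => -[i _ Di]; apply: nU; exists i.
  - move=> n x; apply: normM_le (csq_ge0 _).
    by rewrite indicE; case: (_ \in _); rewrite ?lexx ?ler01.
apply/funext => n; rewrite /w exchange_big /=; apply: eq_bigr => a _.
have cL := L2_vtr a fL; have mc := measurable_csq (L2_meas cL).
have iD (E : set (R3 R)) : measurable E ->
    leb.-integrable setT (EFin \o (fun x => \1_E x * csq (vtr a f x))).
  move=> mE; apply: (integrable_dom _ (L2_int cL)).
    by apply: measurable_funM mc; exact: measurable_indic.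
  move=> x; apply: normM_le (csq_ge0 _).
  by rewrite indicE; case: (_ \in _); rewrite ?lexx ?ler01.
elim: n => [|n IH].
  rewrite big_ord0 nsqE; under eq_Rintegral do rewrite bigcup_mkord big_ord0 indic0 mul0r.
  by rewrite /Rintegral integral0.
rewrite big_ord_recr /= IH !nsqE -RintegralD//; last 2 first.
- by apply: iD; exact: bigcup_measurable.
- exact: iD.
apply: eq_Rintegral => x _; rewrite -mulrDl; congr (_ * _).
have [Dx|Dx] := pselect (D n x).
  have Ux : (\bigcup_(i < n.+1) D i) x by exists n => /=.
  rewrite (indic1 _ Dx) (indic1 _ Ux).
  rewrite indic0E ?add0r// => -[i /= ltin Di].
  have := tD i n I I (ex_intro _ x (conj Di Dx)) => e.
  by rewrite e ltnn in ltin.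
rewrite (indic0E _ Dx) addr0.
have [[i /= ltin Di]|nU] := pselect ((\bigcup_(i < n) D i) x).
  by rewrite !indic1//; exists i => //=; exact: ltnW.
rewrite !indic0E// => -[i /=]; rewrite ltnS leq_eqVlt => /orP[/eqP->//|ltin Di].
by apply: nU; exists i.
Qed.

Lemma POVM_T : POVM (@T_TM R m).
Proof.
split.
- by move=> D mD; apply: bop_bounded; exact: bop_T.
- move=> D mD f fL; rewrite /Defs.ip ip_TT//.
  rewrite (_ : inner _ _ _ = 0); last first.
    rewrite /inner -[RHS](cint0 leb); apply: cint_ext => x _.
    by rewrite mulr0.
  by rewrite lecR; apply: sumr_ge0 => a _; exact: nsq_ge0.
- by move=> f fL; exact: T_setT.
- exact: T_sigma_additive.
Qed.

Lemma vmul_U0 b B a f : SU2 B ->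
  vmul a (U0 b B f) = U0 b B (fun p => \sum_c (rhoR B a c)%:C * vmul c f p).
Proof.
move=> sB; apply/funext => p; rewrite /vmul /U0 mulrCA; congr (_ * _).
rewrite (vcomp_rot m a p sB) rmorph_sum mulr_suml; apply: eq_bigr => c _.
by rewrite rmorphM mulrA.
Qed.

Lemma vtr_U0 b B a f : SU2 B -> L2 f -> vtr a (U0 b B f) =
  (fun x => \sum_c (rhoR B a c)%:C * vtr c f (rot3 (invmx B) (x - b))) %[ae leb].
Proof.
move=> sB fL; rewrite /vtr vmul_U0//.
have vL c := L2_vmul c fL.
have sL : L2 (fun p => \sum_c (rhoR B a c)%:C * vmul c f p).
  by apply: L2_sum => c; exact: L2Z.
apply: (aeT (Finv_U0 b sB sL)).
have [mt pt] := translation_preserving (- b).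
have [mr pr] := rot3_preserving (SU2V sB).
have lin : Finv (fun p => \sum_c (rhoR B a c)%:C * vmul c f p) =
    (fun x => \sum_c (rhoR B a c)%:C * Finv (vmul c f) x) %[ae leb].
  exact: linear_op_sum (isom_Finv R).1 vL.
by apply: (ae_imp (ae_preserving mt pt (ae_preserving mr pr lin))) => x e; exact: e.
Qed.

Definition euclid_inv b B (x : R * R * R) := rot3 (invmx B) (x - b).

Lemma euclid_preimage b B D : SU2 B -> euclid3 b B @` D = euclid_inv b B @^-1` D.
Proof.
move=> sB; apply/seteqP; split=> [_ [x Dx <-]|x Dx].
  by rewrite /preimage /= /euclid_inv /euclid3 addrC addKr rot3K.
by exists (euclid_inv b B x) => //; rewrite /euclid3 /euclid_inv rot3VK// addrC subrK.
Qed.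

Lemma euclid_inv_preserving b B : SU2 B ->
  measurable_fun setT (euclid_inv b B : R3 R -> R3 R) /\
  forall X, measurable X -> leb ((euclid_inv b B : R3 R -> R3 R) @^-1` X) = leb X.
Proof.
move=> sB; have [mt pt] := translation_preserving (- b).
have [mr pr] := rot3_preserving (SU2V sB).
split; first exact: (measurableT_comp mr mt).
move=> X mX; rewrite (_ : _ @^-1` X = (fun x : R3 R => x - b : R3 R) @^-1` (rot3 (invmx B) @^-1` X)).
  by rewrite pt ?pr// -(setTI (_ @^-1` _)); exact: mr.
by [].
Qed.

Lemma measurable_euclid b B D : SU2 B -> measurable D -> measurable (euclid3 b B @` D : set (R3 R)).
Proof.
move=> sB mD; rewrite euclid_preimage//; have [me _] := euclid_inv_preserving b sB.
by rewrite -(setTI (_ @^-1` _)); exact: me.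
Qed.

(** The representation mixes the components by an orthogonal matrix that depends on B alone, so the
    sum of squares is preserved at every point; the Euclidean motion of space preserves the
    measure. *)
Lemma covariant_form b B D f : SU2 B -> measurable D -> L2 f ->
  ip (U0 b B f) (T_TM m (euclid3 b B @` D) (U0 b B f)) = ip f (T_TM m D f).
Proof.
move=> sB mD fL; have mgD := measurable_euclid b sB mD.
have [[UL _ _] _] := isom_U0 b sB; have UfL := UL _ fL.
have [me pe] := euclid_inv_preserving b sB.
rewrite (ip_TT mgD UfL) (ip_TT mD fL); congr (_%:C).
pose h a x := \sum_c (rhoR B a c)%:C * vtr c f x.
have hL a : L2 (h a) by apply: L2_sum => c; exact: L2Z (L2_vtr c fL).
transitivity (\sum_a nsq (ind D (h a))).
  apply: eq_bigr => a _.
  rewrite -(nsq_preserving me pe (L2_meas (L2_indf mD (hL a)))).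
  apply: ae_eq_nsq.
  - exact: L2_indf mgD (L2_vtr a UfL).
  - exact: (L2_preserving me pe (L2_indf mD (hL a))).
  - apply: (ae_imp (vtr_U0 b a sB fL)) => x e xT; rewrite /ind e//.
    by congr (_%:C * _); rewrite euclid_preimage// !indicE; congr (nat_of_bool _)%:R; apply/idP/idP; rewrite !inE.
rewrite (sum_nsq (fun a => L2_indf mD (hL a))) (sum_nsq (fun a => L2_indf mD (L2_vtr a fL))).
apply: eq_Rintegral => x _.
rewrite /ind; under eq_bigr do rewrite csqM.
under [RHS]eq_bigr do rewrite csqM.
by rewrite -!mulr_sumr sum_csq_rho.
Qed.

Lemma POL_T : POL (@T_TM R m).
Proof.
split; first exact: POVM_T.
move=> b B sB D mD; have iU := isom_U0 b sB; have sU := U0_surj b sB.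
have mgD := measurable_euclid b sB mD.
have iUV := isom_op_inv iU sU.
have lU : linear_op (U0 b B \o T_TM m D \o op_inv (U0 b B)).
  apply: linear_op_comp; last by case: iUV.
  by apply: linear_op_comp; [case: iU|case: (bop_T mD)].
apply: form_eq => //; first by case: (bop_T mgD).
move=> g gL; have [fL e] := op_invP iU sU gL.
set f := op_inv (U0 b B) g in fL e *.
have [[UL Uae _] _] := iU; have [[TL Tae _] _] := bop_T mD.
have [[GL Gae _] _] := bop_T mgD.
transitivity (ip (U0 b B f) (U0 b B (T_TM m D f))).
  apply: ae_eq_ip; [exact: gL|exact: UL|exact/UL/TL|exact/UL/TL|exact: aeS|exact: ae_eq_refl].
rewrite (isom_ip iU fL (TL _ fL)) -(covariant_form b sB mD fL).
apply: ae_eq_ip; [exact: UL|exact: gL|exact/GL/UL|exact: GL|exact: e|].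
exact: Gae (UL _ fL) gL e.
Qed.

End ComponentTransforms.

(** * Finiteness and kernel *)

Section MatrixContinuity.
Variable R : realType.
Local Notation C := R[i].

Lemma continuous_conj : continuous (fun z : C^o => Num.conj z : C^o).
Proof.
move=> z A /= /(nbhs_ballP _) [e e0 eA]; apply/nbhs_ballP; exists e => //= t.
rewrite -ball_normE /= => zt; apply: eA; rewrite -ball_normE /=.
by rewrite -rmorphB norm_conjC.
Qed.

Lemma continuous_mx m n (f : 'M[C^o]_2 -> 'M[C^o]_(m, n)) :
  (forall i j, continuous (fun B => f B i j : C^o)) -> continuous f.
Proof.
move=> cf B A [P hP PA].
have h : nbhs B (fun M => forall i j, P i j (f M i j)).
  exact: (@filter_forall _ 'I_m (fun i M => forall j, P i j (f M i j)) (nbhs B) _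
    (fun i => @filter_forall _ 'I_n (fun j M => P i j (f M i j)) (nbhs B) _
      (fun j => cf i j B _ (hP i j)))).
by apply: (@filterS _ (nbhs B) _ _ _ _ h) => M hM; apply: PA => i j; exact: hM.
Qed.

Lemma continuous_mulC (f g : 'M[C^o]_2 -> C^o) : continuous f -> continuous g ->
  continuous (fun B => f B * g B : C^o).
Proof. by move=> cf cg B; exact: (cvgM (cf B) (cg B)). Qed.

Lemma continuous_addC (f g : 'M[C^o]_2 -> C^o) : continuous f -> continuous g ->
  continuous (fun B => f B + g B : C^o).
Proof. by move=> cf cg B; exact: (cvgD (cf B) (cg B)). Qed.

Lemma continuous_conjC (f : 'M[C^o]_2 -> C^o) : continuous f ->
  continuous (fun B => Num.conj (f B) : C^o).
Proof. by move=> cf B; exact: (cvg_comp _ _ (cf B) (@continuous_conj (f B))). Qed.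

Lemma continuous_cstC (c : C^o) : continuous (fun _ : 'M[C^o]_2 => c).
Proof. exact: cst_continuous. Qed.

Lemma continuous_ReC (f : 'M[C^o]_2 -> C^o) : continuous f ->
  continuous (fun B => (complex.Re (f B))%:C : C^o).
Proof.
move=> cf; rewrite (_ : (fun B => _) = fun B => 2^-1 * (f B + Num.conj (f B))).
  apply: continuous_mulC; first exact: continuous_cstC.
  exact: continuous_addC cf (continuous_conjC cf).
apply/funext => B; apply: (mulfI (x := 2)); first by rewrite pnatr_eq0.
rewrite mulrA divff ?pnatr_eq0// mul1r.
by apply: cplx_eq; rewrite !cE /= ?cE; ring.
Qed.

Lemma continuous_ImC (f : 'M[C^o]_2 -> C^o) : continuous f ->
  continuous (fun B => (complex.Im (f B))%:C : C^o).
Proof.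
move=> cf; rewrite (_ : (fun B => _) = fun B => (complex.Re (- 'i * f B))%:C).
  by apply: continuous_ReC; apply: continuous_mulC cf; exact: continuous_cstC.
by apply/funext => B; congr (_%:C); rewrite !cE /=; ring.
Qed.

Lemma continuous_conj_pauli (x : R * R * R) i j :
  continuous (fun B : 'M[C^o]_2 => (B *m pauli x *m B^t*) i j : C^o).
Proof.
rewrite (_ : (fun B => _) = (fun B : 'M[C]_2 =>
  (B i 0 * pauli x 0 0 + B i 1 * pauli x 1 0) * Num.conj (B j 0)
  + (B i 0 * pauli x 0 1 + B i 1 * pauli x 1 1) * Num.conj (B j 1))); last first.
  by apply/funext => B; exact: conj_entries.
have ce k l : continuous (fun B : 'M[C^o]_2 => B k l : C^o) by exact: coord_continuous.
have cc (c : C) k l : continuous (fun B : 'M[C^o]_2 => B k l * c : C^o).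
  by apply: continuous_mulC (ce k l) _; exact: continuous_cstC.
apply: continuous_addC.
  by apply: continuous_mulC (continuous_conjC (ce j 0)); exact: continuous_addC.
by apply: continuous_mulC (continuous_conjC (ce j 1)); exact: continuous_addC.
Qed.

Lemma continuous_coord3_rot3 (x : R * R * R) (i : 'I_3) :
  continuous (fun B : 'M[C^o]_2 => (coord3 i (rot3 B x))%:C : C^o).
Proof.
case: i => -[|[|[|//]]] hi; rewrite /coord3.
- apply: continuous_ReC; exact: continuous_conj_pauli.
- apply: continuous_ImC; exact: continuous_conj_pauli.
- apply: continuous_ReC; exact: continuous_conj_pauli.
Qed.

(** The entries that are not constant are real or imaginary parts of polynomials in the entries of B
    and their conjugates. *)
Lemma continuous_rho : continuous (@rho R : 'M[C^o]_2 -> 'M[C^o]_(2 + 3)).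
Proof.
apply: continuous_mx => a b.
rewrite -(splitK a) -(splitK b).
case: (fintype.split a) => i; case: (fintype.split b) => j /=.
- rewrite (_ : (fun B => _) = fun=> ((1%:M : 'M[R]_2) i j)%:C); first exact: continuous_cstC.
  by apply/funext => B; rewrite mxE block_mxEul.
- rewrite (_ : (fun B => _) = fun=> 0); first exact: continuous_cstC.
  by apply/funext => B; rewrite mxE block_mxEur mxE.
- rewrite (_ : (fun B => _) = fun=> 0); first exact: continuous_cstC.
  by apply/funext => B; rewrite mxE block_mxEdl mxE.
- rewrite (_ : (fun B => _) = fun B => (coord3 i (rot3 B (bas3 R j)))%:C).
    exact: continuous_coord3_rot3.
  by apply/funext => B; rewrite mxE block_mxEdr mxE.
Qed.

End MatrixContinuity.

Section FiniteRepresentation.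
Variable R : realType.
Local Notation C := R[i].
Local Notation leb := (@lebesgue3 R).
Local Notation L2 := (LC leb 2%:E).
Local Notation ip := (inner leb).
Variable m : R.
Hypothesis m0 : 0 < m.
Local Notation I5 := 'I_(2 + 3).
Implicit Types (f g phi : R3 R -> C) (D : set (R3 R)) (a : I5) (B : 'M[C]_2).
Local Notation v := (@vcomp R m).

Lemma unitary_rep_rho : unitary_rep (@rho R).
Proof.
split.
- move=> B sB; apply/unitarymxP.
  rewrite (_ : (rho B)^t* = map_mx (real_complex R) (rhoR B)^T).
    by rewrite /rho -map_mxM (mulmx1C (rhoR_orth sB)) map_mx1.
  by apply/matrixP => i j; rewrite !mxE cconj_real.
- by rewrite /rho rhoR1 map_mx1.
- by move=> B B' sB sB'; rewrite /rho rhoRM// map_mxM.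
- by apply: continuous_subspaceT; exact: continuous_rho.
Qed.

Definition jvec f (p : R3 R) : 'cV[C]_(2 + 3) := \col_a ((v a p)%:C * f p).
Definition jadj (chi : R3 R -> 'cV[C]_(2 + 3)) (p : R3 R) : C :=
  \sum_a (v a p)%:C * chi p a 0.

Lemma jvecE f a : (fun p => jvec f p a 0) = vmul m a f.
Proof. by apply/funext => p; rewrite mxE. Qed.

Lemma isometry_jvec : isometry_op jvec.
Proof.
split.
- by move=> f fL a; rewrite jvecE; exact: L2_vmul.
- move=> f g fL gL fg; apply: (ae_imp fg) => x e xT.
  by apply/matrixP => i j; rewrite !mxE e.
- move=> c f g fL gL; apply: aeW => x xT.
  by apply/matrixP => i j; rewrite !mxE; ring.
- move=> f g fL gL; rewrite /ipv /innerv.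
  transitivity (\sum_a ip (vmul m a f) (vmul m a g)).
    by apply: eq_bigr => a _; rewrite !jvecE.
  exact: sum_ip_vmul.
Qed.

Lemma adjoint_jadj : adjoint jvec jadj.
Proof.
move=> chi chiL; have vL a := L2_vmul m0 a (chiL a).
split; first exact: L2_sum.
move=> f fL; rewrite /ipv /innerv.
transitivity (\sum_a ip (vmul m a (fun p => chi p a 0)) f).
  have sL' : L2 (jadj chi) by exact: L2_sum.
  rewrite /Defs.ip (ipC fL sL') (ip_sumr _ fL vL) rmorph_sum.
  by apply: eq_bigr => a _; exact: (esym (ipC fL (vL a))).
apply: eq_bigr => a _; rewrite jvecE [RHS]ip_mulr.
by apply: cint_ext => x _; rewrite cconj_real.
Qed.

Lemma finite_POL_T : finite_POL (@T_TM R m).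
Proof.
exists (2 + 3)%N, (@rho R), jvec, jadj; split.
- exact: unitary_rep_rho.
- exact: isometry_jvec.
- exact: adjoint_jadj.
- move=> b B sB f fL; apply: aeW => p _; apply/matrixP => a j; rewrite (ord1 j).
  have /(congr1 (@^~ p)) := vmul_U0 m b a f sB; rewrite /vmul /U0 /Urep !mxE => ->.
  by congr (_ * _); apply: eq_bigr => c _; rewrite !mxE.
- move=> D mD f fL; have h := T_sum m mD fL.
  have liftE A (chi : R3 R -> 'cV[C]_(2 + 3)) a :
      (fun q => lift_op A chi q a 0) = A (fun q => chi q a 0).
    by apply/funext => q; rewrite mxE.
  rewrite [X in _ = X %[ae _]](_ : _ =
    (fun p => \sum_a (v a p)%:C * fourier (ind D (vtr m a f)) p)); first exact: h.
  apply/funext => p; rewrite /= /jadj; apply: eq_bigr => a _; congr (_ * _).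
  have := congr1 (@^~ p) (liftE (@fourier R) (lift_op (Ecan D) (lift_op (op_inv (@fourier R)) (jvec f))) a).
  by rewrite !liftE jvecE => ->.
Qed.

End FiniteRepresentation.

(** * The kernel of the localization *)

Section Kernel.
Variable R : realType.
Local Notation C := R[i].
Local Notation leb := (@lebesgue3 R).
Local Notation L2 := (LC leb 2%:E).
Local Notation L1 := (LC leb 1%:E).
Local Notation ip := (inner leb).
Local Notation nsq := (nsq leb).
Variable m : R.
Hypothesis m0 : 0 < m.
Local Notation I5 := 'I_(2 + 3).
Implicit Types (f g phi : R3 R -> C) (D : set (R3 R)) (a : I5) (B : 'M[C]_2).
Local Notation v := (@vcomp R m).

(** A Gram kernel: it is positive definite at sight, and for each a the integrals over k and p
    decouple. *)
Lemma t_sum (k p : R3 R) : t_TM m k p = \sum_a (v a k)%:C * (v a p)%:C.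
Proof.
rewrite /t_TM -sum_vcomp// rmorph_sum; apply: eq_bigr => a _; exact: rmorphM.
Qed.

Lemma cmeas_t : cmeasurable [set kp : R3 R * R3 R | kp.1 <> 0 /\ kp.2 <> 0]
  (fun kp => t_TM m kp.1 kp.2).
Proof.
have : cmeasurable setT (fun kp : R3 R * R3 R => t_TM m kp.1 kp.2).
  under eq_fun do rewrite t_sum.
  apply: cmeas_sum => a.
  by apply: cmeasM; [exact: cmeas_fst (cmeas_vcomp m0 a)|exact: cmeas_snd (cmeas_vcomp m0 a)].
by move=> [h1 h2]; split; exact: measurable_funS (measurableT) _ _.
Qed.

Lemma t_posdef n (p : 'I_n -> R3 R) (c : 'I_n -> C) :
  0 <= \sum_(i < n) \sum_(j < n) Num.conj (c i) * c j * t_TM m (p i) (p j).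
Proof.
have -> : \sum_(i < n) \sum_(j < n) Num.conj (c i) * c j * t_TM m (p i) (p j) =
    (\sum_a csq (\sum_i c i * (v a (p i))%:C))%:C.
  rewrite rmorph_sum.
  transitivity (\sum_a Num.conj (\sum_i c i * (v a (p i))%:C) * (\sum_i c i * (v a (p i))%:C));
    last by apply: eq_bigr => a _; exact: conjM_csq.
  under [RHS]eq_bigr do rewrite rmorph_sum mulr_suml.
  rewrite [RHS]exchange_big; apply: eq_bigr => i _ /=.
  under [RHS]eq_bigr do rewrite mulr_sumr.
  rewrite [RHS]exchange_big; apply: eq_bigr => j _ /=.
  rewrite t_sum mulr_sumr; apply: eq_bigr => a _.
  by rewrite cconjM cconj_real; ring.
by rewrite lecR; apply: sumr_ge0 => a _; exact: csq_ge0.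
Qed.

Lemma t_rot B k p : SU2 B -> t_TM m (rot3 B k) (rot3 B p) = t_TM m k p.
Proof. by move=> sB; rewrite /t_TM !eps_rot// dot3_rot. Qed.

Lemma t_diag p : t_TM m p p = 1.
Proof.
rewrite t_sum -[RHS](rmorph1 (real_complex R)) -(sum_sqr_vcomp m0 p) rmorph_sum.
by apply: eq_bigr => a _; rewrite -rmorphM.
Qed.

Lemma L1_vmul a f : L1 f -> L1 (vmul m a f).
Proof.
move=> /L1P fi; apply/L1P; apply: (cintegrableMb (k := 1) (cmeas_vcomp m0 a) _ fi) => x.
by rewrite /cabs -[leRHS]sqrtr1 ler_wsqrtr// csq_vcomp.
Qed.

(** Up to the constant [c0], the complex conjugate of [vtr]. With the conjugate, the inner integral
    over k is directly an [F0]. *)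
Let amp f a (x : R3 R) : C := F0 (fun y => Num.conj (vmul m a f y)) x.

Lemma density_sum f (x : R3 R) : L1 f ->
  cint leb setT (fun p => cint leb setT (fun k =>
      t_TM m k p * expi (dot3 (p - k) x) * Num.conj (f k) * f p)) =
  (\sum_a csq (amp f a x))%:C.
Proof.
move=> f1.
have ai a : cintegrable leb setT (fun k => expi (- dot3 x k) * Num.conj (vmul m a f k)).
  exact: cintegrable_F0 (L1J (L1_vmul a f1)).
have E p : cint leb setT (fun k => t_TM m k p * expi (dot3 (p - k) x) * Num.conj (f k) * f p) =
    \sum_a amp f a x * Num.conj (expi (- dot3 x p) * Num.conj (vmul m a f p)).
  transitivity (cint leb setT (fun k => \sum_a Num.conj (expi (- dot3 x p) * Num.conj (vmul m a f p)) *
      (expi (- dot3 x k) * Num.conj (vmul m a f k)))).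
    apply: cint_ext => k _; rewrite t_sum !mulr_suml; apply: eq_bigr => a _.
    rewrite /vmul !cconjM !cconjK cconj_expiN !cconj_real dot3Bl expiD ![dot3 _ x]dot3C; ring.
  rewrite cint_sum; last by move=> a; exact: cintegrableZ.
  by apply: eq_bigr => a _; rewrite cintZ// mulrC.
under cint_ext do rewrite E.
rewrite cint_sum; last by move=> a; apply: cintegrableZ; exact: cintegrableJ.
rewrite rmorph_sum; apply: eq_bigr => a _.
by rewrite cintZ ?cintJ//; [rewrite mulrC conjM_csq|exact: cintegrableJ].
Qed.

Lemma vtr_amp f a : L1 f -> L2 f ->
  vtr m a f = (fun x => (c0 R)%:C * Num.conj (amp f a x)) %[ae leb].
Proof.
move=> f1 f2; have v1 := L1_vmul a f1; have v2 := L2_vmul m0 a f2.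
apply: (aeT (Finv_Fadj v2)); apply: (ae_imp (Fop_F1 (L1J v1) (L2J v2))) => x e xT.
by rewrite /Fadj e// /F1 cconjM cconj_real.
Qed.

Lemma kernel_T : is_kernel (@T_TM R m) (@t_TM R m).
Proof.
split.
- exact: cmeas_t.
- by move=> n p c _; exact: t_posdef.
- by move=> B sB k p _ _; exact: t_rot.
- by move=> p _; exact: t_diag.
move=> f f1 f2 D mD density.
have aL a : L2 (amp f a) by case: (plancherel_L1 (L1J (L1_vmul a f1)) (L2J (L2_vmul m0 a f2))).
pose w x := \sum_a csq (amp f a x).
have dE : density = (fun x => (w x)%:C) by apply/funext => x; exact: density_sum.
have ia a : leb.-integrable setT (EFin \o (fun x => csq (amp f a x))) := L2_int (aL a).
have wi : leb.-integrable setT (EFin \o w).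
  rewrite (_ : w = (fun x => complex.Re (\sum_a (csq (amp f a x))%:C))).
    have [h _] := @cintegrable_sum _ _ _ leb _ (index_enum I5) (fun a x => (csq (amp f a x))%:C)
      (fun a => cintegrable_real (ia a)).
    exact: h.
  by apply/funext => x; rewrite cRe_sum.
have iD : cintegrable leb D density.
  rewrite dE; split => /=; last exact: integrable0.
  exact: (integrableS measurableT mD _ wi).
split; first exact: iD.
rewrite /Defs.ip (ip_TT m0 mD f2) dE.
have -> : cint leb D (fun x => (w x)%:C) = (\int[leb]_(x in D) w x)%:C.
  by congr Complex; rewrite /Rintegral integral0.
rewrite -rmorphM; congr (_%:C).
have iDa a : leb.-integrable setT (EFin \o (fun x => \1_D x * csq (amp f a x))).
  apply: (integrable_dom _ (ia a)).
    apply: (measurable_funM _ (integrable_rmeas (ia a))); exact: measurable_indic.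
  move=> x; apply: normM_le (csq_ge0 _).
  by rewrite indicE; case: (_ \in _); rewrite ?lexx ?ler01.
have -> : \int[leb]_(x in D) w x = \sum_a \int[leb]_x (\1_D x * csq (amp f a x)).
  rewrite -Rintegral_sum// Rintegral_mkcond; apply: eq_Rintegral => x _.
  rewrite patchE -mulr_sumr indicE; case: (x \in D); by rewrite ?mul1r ?mul0r.
rewrite mulr_sumr; apply: eq_bigr => a _.
have cc : (c0 R) ^+ 2 = (2 * pi) ^- 3.
  have h := sqr_c0 R; have pn : (2 * pi) ^+ 3 != 0 :> R.
    by rewrite expf_neq0// mulf_neq0// gt_eqF// pi_gt0.
  by apply: (mulIf pn); rewrite h mulVf.
have v2 := L2_vtr m0 a f2.
transitivity (nsq (ind D (fun x => (c0 R)%:C * Num.conj (amp f a x)))).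
  apply: ae_eq_nsq; [exact: L2_indf mD v2|exact: L2_indf mD (L2Z _ (L2J (aL a)))|].
  by apply: (ae_imp (vtr_amp a f1 f2)) => x e xT; rewrite /ind e.
rewrite -cc -(RintegralZl _ measurableT (iDa a)); apply: eq_Rintegral => x _.
rewrite /ind !csqM csqJ !csq_real indicE.
by case: (_ \in _); rewrite ?expr1n ?expr0n /= ?mul0r ?mulr0 ?mul1r.
Qed.

End Kernel.

(** * Distance functions and weights *)

Section Lipschitz.
Variable R : realType.
Local Notation leb := (@lebesgue3 R).
Local Notation B1 := (measurableTypeR R).
Local Notation B3 := (B1 * B1 * B1)%type.

Definition ratr3 (q : rat * rat * rat) : R * R * R :=
  (ratr q.1.1, ratr q.1.2, ratr q.2).

Lemma ratr3_dense (x : R * R * R) (e : R) : 0 < e ->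
  exists q, norm3 (x - ratr3 q) < e.
Proof.
move=> e0; have e30 : 0 < e / 3 by rewrite divr_gt0.
have H (t : R) : exists q : rat, `|t - ratr q| < e / 3.
  have tt : t - e / 3 < t + e / 3 by lra.
  have [q] := rat_in_itvoo tt; rewrite in_itv /= => /andP[q1 q2].
  by exists q; rewrite ltr_norml; apply/andP; split; lra.
have [q1 h1] := H x.1.1; have [q2 h2] := H x.1.2; have [q3 h3] := H x.2.
exists (q1, q2, q3); apply: (le_lt_trans (norm3_le_coord _)) => /=; lra.
Qed.

(** The set where f < r is the union over rational points q of the Borel sets f q + |x - q| < r: for
    q close enough to x, the value f q + |x - q| exceeds f x by arbitrarily little. *)
Lemma measurable_lipschitz (f : B3 -> R) : (forall x y, f x <= f y + norm3 (x - y)) ->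
  measurable_fun setT f.
Proof.
move=> fl; apply: (measurability _ (RGenInftyO.measurableE R)) => // _ [_ [r ->] <-].
rewrite setTI (_ : _ @^-1` _ = \bigcup_(n in setT)
    [set x | if (unpickle n : option (rat * rat * rat)) is Some q
             then f (ratr3 q) + norm3 (x - ratr3 q) < r else False]).
  apply: bigcupT_measurable => n; case: (unpickle n) => [q|]; last exact: measurable0.
  have mg : measurable_fun setT (fun x : B3 => f (ratr3 q) + norm3 (x - ratr3 q)).
    apply: measurable_funD; first exact: measurable_cst.
    by apply: measurable_norm3; apply: measurable_sub3; [exact: measurable_id|exact: measurable_cst].
  have := mg measurableT _ (measurable_itv `]-oo, r[).
  by rewrite setTI; congr measurable; apply/seteqP; split=> x /=; rewrite in_itv.
apply/seteqP; split=> x /=; rewrite in_itv /=.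
  move=> fx; have e0 : 0 < (r - f x) / 2 by rewrite divr_gt0// subr_gt0.
  have [q hq] := ratr3_dense x e0; exists (pickle q); first exact: I.
  rewrite /mkset pickleK.
  have := fl (ratr3 q) x; rewrite norm3BC; move: hq; set w := norm3 _; lra.
move=> [n _ /=]; case: (unpickle n) => // q; exact: le_lt_trans.
Qed.

Section Distance.
Variable D : set (R * R * R).
Hypothesis D0 : D !=set0.
Implicit Types x y : R * R * R.

Definition dist x : R := inf [set norm3 (x - y) | y in D].

Lemma dist_has_lbound x : has_lbound [set norm3 (x - y) | y in D].
Proof. by exists 0 => _ [y _ <-]; exact: norm3_ge0. Qed.

Lemma dist_nonempty x : [set norm3 (x - y) | y in D] !=set0.
Proof. by have [y Dy] := D0; exists (norm3 (x - y)), y. Qed.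

Lemma dist_ge0 x : 0 <= dist x.
Proof. by apply: lb_le_inf; [exact: dist_nonempty|move=> _ [y _ <-]; exact: norm3_ge0]. Qed.

Lemma dist_le x y : D y -> dist x <= norm3 (x - y).
Proof. by move=> Dy; apply: ge_inf; [exact: dist_has_lbound|exists y]. Qed.

Lemma dist_near x (e : R) : 0 < e -> exists2 y, D y & norm3 (x - y) < dist x + e.
Proof.
move=> e0; have [_ [y Dy <-] h] := inf_adherent e0 (conj (dist_nonempty x) (dist_has_lbound x)).
by exists y.
Qed.

Lemma dist_lip x y : dist x <= dist y + norm3 (x - y).
Proof.
apply/ler_addgt0Pr => e e0; have [z Dz hz] := dist_near y e0.
apply: (le_trans (dist_le x Dz)); apply: (le_trans (norm3B_trans y x z)); lra.
Qed.

Lemma dist_in x : D x -> dist x = 0.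
Proof.
move=> Dx; apply/eqP; rewrite eq_le dist_ge0 andbT.
apply: (le_trans (dist_le x Dx)).
by rewrite subrr /norm3 dot3E /= !mul0r !addr0 sqrtr0.
Qed.

Lemma measurable_dist : measurable_fun setT (dist : B3 -> R).
Proof. by apply: measurable_lipschitz; exact: dist_lip. Qed.

Lemma measurable_distR3 : measurable_fun setT (dist : R3 R -> R).
Proof. exact: measurable_fun_B3 measurable_dist. Qed.

End Distance.
End Lipschitz.

(** * Smoothed weights *)

Section Step.
Variable R : realType.
Implicit Types u k : R.

Definition psq u : R := (Num.max u 0) ^+ 2.

(* smooth is a C^{1,1} step rising from 0 at u <= 0 to 1 at u >= 1; dsmooth is its
   derivative. *)
Definition smooth u : R := 2 * (psq u - 2 * psq (u - 2^-1) + psq (u - 1)).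
Definition dsmooth u : R :=
  4 * (Num.max u 0 - 2 * Num.max (u - 2^-1) 0 + Num.max (u - 1) 0).

Lemma max0P u : (0 <= u /\ Num.max u 0 = u) \/ (u <= 0 /\ Num.max u 0 = 0).
Proof. by case: (leP 0 u) => h; [left|right; split=> //; exact: ltW]. Qed.

(** [psq] is convex, with second derivative at most 2 where it exists. *)
Lemma psq_taylor u k : 0 <= psq (u + k) - psq u - 2 * Num.max u 0 * k <= k ^+ 2.
Proof.
rewrite /psq; have [[h1 ->]|[h1 ->]] := max0P u; have [[h2 ->]|[h2 ->]] := max0P (u + k);
  apply/andP; split; nra.
Qed.

(** Each of the three remainders of [psq] lies between 0 and k^2, and the coefficients 2, -4, 2 have
    total weight 4 with either sign. *)
Lemma smooth_taylor u k :
  `|smooth (u + k) - smooth u - dsmooth u * k| <= 4 * k ^+ 2.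
Proof.
have /andP[a1 a2] := psq_taylor u k.
have /andP[b1 b2] := psq_taylor (u - 2^-1) k.
have /andP[c1 c2] := psq_taylor (u - 1) k.
rewrite /smooth /dsmooth ler_norml.
rewrite (_ : u + k - 2^-1 = u - 2^-1 + k); last by ring.
rewrite (_ : u + k - 1 = u - 1 + k); last by ring.
have k2 := sqr_ge0 k.
by apply/andP; split; nra.
Qed.

Lemma smooth_01 u : 0 <= smooth u <= 1.
Proof.
rewrite /smooth /psq; have [[h1 ->]|[h1 ->]] := max0P u;
have [[h2 ->]|[h2 ->]] := max0P (u - 2^-1); have [[h3 ->]|[h3 ->]] := max0P (u - 1);
  apply/andP; split; nra.
Qed.

Lemma smooth_le0 u : u <= 0 -> smooth u = 0.
Proof.
move=> u0; rewrite /smooth /psq; have [[h1 ->]|[h1 ->]] := max0P u;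
have [[h2 ->]|[h2 ->]] := max0P (u - 2^-1); have [[h3 ->]|[h3 ->]] := max0P (u - 1); nra.
Qed.

Lemma smooth_ge1 u : 1 <= u -> smooth u = 1.
Proof.
move=> u0; rewrite /smooth /psq; have [[h1 ->]|[h1 ->]] := max0P u;
have [[h2 ->]|[h2 ->]] := max0P (u - 2^-1); have [[h3 ->]|[h3 ->]] := max0P (u - 1);
  try (exfalso; lra); nra.
Qed.

Lemma dsmooth_ge0 u : 0 <= dsmooth u.
Proof.
rewrite /dsmooth; have [[h1 ->]|[h1 ->]] := max0P u;
have [[h2 ->]|[h2 ->]] := max0P (u - 2^-1); have [[h3 ->]|[h3 ->]] := max0P (u - 1); lra.
Qed.

Lemma dsmooth_le u : dsmooth u <= 2.
Proof.
rewrite /dsmooth; have [[h1 ->]|[h1 ->]] := max0P u;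
have [[h2 ->]|[h2 ->]] := max0P (u - 2^-1); have [[h3 ->]|[h3 ->]] := max0P (u - 1); lra.
Qed.

Lemma smooth_mono u v : u <= v -> smooth u <= smooth v.
Proof.
move=> uv; rewrite /smooth /psq.
have [[h1 ->]|[h1 ->]] := max0P u; have [[h2 ->]|[h2 ->]] := max0P (u - 2^-1);
have [[h3 ->]|[h3 ->]] := max0P (u - 1); have [[h4 ->]|[h4 ->]] := max0P v;
have [[h5 ->]|[h5 ->]] := max0P (v - 2^-1); have [[h6 ->]|[h6 ->]] := max0P (v - 1);
  try (exfalso; lra); nra.
Qed.

Lemma measurable_smooth : measurable_fun setT smooth.
Proof.
have mp c : measurable_fun setT (fun u => psq (u - c)).
  apply: measurable_funX; apply: measurable_maxr; last exact: measurable_cst.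
  by apply: measurable_funB.
have m0 : measurable_fun setT psq.
  by apply: measurable_funX; apply: measurable_maxr.
apply: measurable_funM; first exact: measurable_cst.
apply: measurable_funD => //; apply: measurable_funB => //.
exact: measurable_funM.
Qed.

End Step.

Section Scaling3.
Variable R : realType.
Implicit Types (c : R) (x y : R * R * R).

Definition scal3 c x : R * R * R := (c * x.1.1, c * x.1.2, c * x.2).

Lemma dot3_scalr c x y : dot3 x (scal3 c y) = c * dot3 x y.
Proof. by rewrite !dot3E /=; ring. Qed.

Lemma dot3_scall c x y : dot3 (scal3 c x) y = c * dot3 x y.
Proof. by rewrite !dot3E /=; ring. Qed.

Lemma dot3_basr (i : 'I_3) x : dot3 x (bas3 R i) = coord3 i x.
Proof.
rewrite /dot3; under eq_bigr do rewrite coord3_bas.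
rewrite (bigD1 i)//= eqxx mulr1 big1 ?addr0// => j /negbTE ji.
by rewrite ji mulr0.
Qed.

Lemma scal3N c x : scal3 (- c) x = - scal3 c x.
Proof. by rewrite /scal3 !mulNr. Qed.

End Scaling3.

Section Weight.
Variable R : realType.
Variable D : set (R * R * R).
Hypothesis D0 : D !=set0.
Variables dl la r0 : R.
Hypothesis dl0 : 0 < dl.
Hypothesis la0 : 0 < la.
Implicit Types (x y h : R * R * R).
Local Notation d := (dist D).

(** The square of the distance is semiconcave, but the distance itself is not, near D. Adding
    [dl ^+ 2] under the root keeps the root, by which one divides, at least dl. *)
Definition sdist x : R := Num.sqrt (d x ^+ 2 + dl ^+ 2).

Lemma sqr_sdist x : sdist x ^+ 2 = d x ^+ 2 + dl ^+ 2.
Proof. by rewrite sqr_sqrtr// addr_ge0// sqr_ge0. Qed.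

Lemma sdist_ge x : dl <= sdist x.
Proof.
rewrite -[leLHS](ger0_norm (ltW dl0)) -sqrtr_sqr ler_sqrt ?addr_ge0 ?sqr_ge0//.
by rewrite lerDr sqr_ge0.
Qed.

Lemma sdist_ge_dist x : d x <= sdist x.
Proof.
rewrite -[leLHS](ger0_norm (dist_ge0 D0 x)) -sqrtr_sqr ler_sqrt ?addr_ge0 ?sqr_ge0//.
by rewrite lerDl sqr_ge0.
Qed.

Lemma sqrt_tangent (r A : R) : 0 < r -> 0 <= A -> Num.sqrt A <= r + (A - r ^+ 2) / (2 * r).
Proof.
move=> r0' A0; set s := Num.sqrt A.
have <- : s ^+ 2 = A by rewrite sqr_sqrtr.
have s0 : 0 <= s := sqrtr_ge0 A.
rewrite -subr_ge0 (_ : _ - s = (s - r) ^+ 2 / (2 * r)); last by field; rewrite gt_eqF.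
by rewrite divr_ge0 ?sqr_ge0// mulr_ge0// ltW.
Qed.

(* dist^2 is semiconcave: it lies below the paraboloids centred at points of D. *)
Lemma sdist_semiconcave x (e : R) : 0 < e -> exists xi : R * R * R, dot3 xi xi <= 1 /\
  forall h, sdist (x + h) <= sdist x + dot3 xi h + (e + dot3 h h) / (2 * dl).
Proof.
move=> e0; pose e' := Num.min (Num.min e (dl ^+ 2)) 1.
have e'0 : 0 < e' by rewrite !lt_min e0 exprn_gt0//= ltr01.
have e'e : e' <= e by rewrite !ge_min lexx.
have e'd : e' <= dl ^+ 2 by rewrite !ge_min lexx orbT.
have e'1 : e' <= 1 by rewrite !ge_min lexx !orbT.
have dx := dist_ge0 D0 x.
have eta0 : 0 < e' / (2 * d x + 2) by rewrite divr_gt0// ltr_wpDl// mulr_ge0.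
have [y Dy hy] := dist_near D0 x eta0.
have hq : dot3 (x - y) (x - y) <= d x ^+ 2 + e'.
  rewrite -sqr_norm3; move: hy; set eta := e' / _ => hy.
  have he : eta * (2 * d x + 2) = e' by rewrite mulfVK// gt_eqF// ltr_wpDl// mulr_ge0.
  have eta1 : eta <= 2 by have := mulr_ge0 (ltW eta0) dx; nra.
  have n0 := norm3_ge0 (x - y).
  apply: (@le_trans _ _ ((d x + eta) ^+ 2)); first by rewrite lerXn2r ?nnegrE ?(ltW hy) ?addr_ge0 ?(ltW eta0).
  by rewrite -he; have := mulr_ge0 (ltW eta0) dx; nra.
have r1 := sdist_ge x; have r0' : 0 < sdist x := lt_le_trans dl0 r1.
(* If y were the unique closest point of D, this would be the gradient of [sdist] at x. *)
exists (scal3 (sdist x)^-1 (x - y)); split.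
  rewrite dot3_scalr dot3_scall mulrA -expr2 exprVn ler_pdivrMl ?exprn_gt0// mulr1.
  by rewrite sqr_sdist (le_trans hq)// lerD2l.
move=> h; rewrite dot3_scall.
have A0 : 0 <= d (x + h) ^+ 2 + dl ^+ 2 by rewrite addr_ge0// sqr_ge0.
apply: (le_trans (sqrt_tangent r0' A0)); rewrite -[leRHS]addrA lerD2l sqr_sdist.
have dxh : d (x + h) ^+ 2 <= dot3 (x - y) (x - y) + 2 * dot3 (x - y) h + dot3 h h.
  rewrite (_ : _ + _ = dot3 (x + h - y) (x + h - y)).
    by rewrite -sqr_norm3 ler_sqr ?nnegrE ?norm3_ge0 ?dist_ge0// dist_le.
  by rewrite !dot3E /=; ring.
set q := dot3 (x - y) h in dxh *; set hh := dot3 h h in dxh *.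
have hh0 : 0 <= hh := dot3_ge0 h.
apply: (@le_trans _ _ ((e' + 2 * q + hh) / (2 * sdist x))).
  by rewrite ler_pM2r ?invr_gt0 ?mulr_gt0//; lra.
rewrite (_ : _ / _ = (sdist x)^-1 * q + (e' + hh) / (2 * sdist x)); last first.
  by field; rewrite gt_eqF.
rewrite lerD2l; apply: (@le_trans _ _ ((e + hh) / (2 * sdist x))).
  by rewrite ler_pM2r ?invr_gt0 ?mulr_gt0// lerD2r.
by rewrite ler_pM2l ?ltr_wpDr// lef_pV2 ?posrE ?mulr_gt0// ler_pM2l.
Qed.

(** Rises from 0, where [sdist] is [r0 - tau], to 1, where it is [r0 - tau + 1 / la]: a front that
    approaches D at speed 1 as tau grows. *)
Definition weight (tau : R) x : R := smooth (la * (sdist x + tau - r0)).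

Lemma weight_01 tau x : 0 <= weight tau x <= 1.
Proof. exact: smooth_01. Qed.

Lemma measurable_weight tau : measurable_fun setT (weight tau : R3 R -> R).
Proof.
apply: (measurableT_comp (@measurable_smooth R)).
apply: measurable_funM; first exact: measurable_cst.
apply: measurable_funB; last exact: measurable_cst.
apply: measurable_funD; last exact: measurable_cst.
apply: (@measurableT_comp _ _ _ _ _ _ (@Num.sqrt R)).
  by apply: continuous_measurable_fun; exact: sqrt_continuous.
apply: measurable_funD; last exact: measurable_cst.
by apply: measurable_funX; exact: measurable_distR3.
Qed.

(** A translation has length 4 |s|, so semiconcavity with tolerance s^2 errs by (1 + 16) s^2 / (2
    dl); as [dsmooth] is at most 2, this costs 17 la / dl times s^2. The second term is the Taylor
    remainder 4 k^2 of [smooth] for an increment with |k| <= la (4 + 17 / (2 dl)) |s|. *)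
Definition step_cst : R := 17 * la / dl + 4 * (la * (4 + 17 / (2 * dl))) ^+ 2.

Lemma step_cst_ge0 : 0 <= step_cst.
Proof.
apply: addr_ge0; last by rewrite mulr_ge0// sqr_ge0.
by rewrite divr_ge0 ?(ltW dl0)// mulr_ge0// ltW.
Qed.

(* zeta is the gradient of the weight at x and Z its tau-derivative: |zeta| <= Z
   as dist is 1-Lipschitz. Only semiconcavity bounds the error, so that the
   first inequality is one-sided. *)
Lemma weight_step tau x (s : R) : s != 0 -> `|s| <= 1 ->
  exists (zeta : R * R * R) (Z : R), [/\ 0 <= Z, dot3 zeta zeta <= Z ^+ 2,
    forall (i : 'I_3) (c : R), c ^+ 2 = s ^+ 2 ->
      weight tau (x + scal3 (4 * c) (bas3 R i)) <=
      weight tau x + 4 * c * coord3 i zeta + step_cst * s ^+ 2 &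
    weight tau x + `|s| * Z <= weight (tau + `|s|) x + step_cst * s ^+ 2].
Proof.
move=> sn s1; have s20 : 0 < s ^+ 2 by rewrite exprn_even_gt0.
have [xi [xi1 hxi]] := sdist_semiconcave x s20.
pose M := la * (4 + 17 / (2 * dl)).
have laM : la <= M.
  rewrite /M ler_peMr ?(ltW la0)//.
  have : 0 <= 17 / (2 * dl) by rewrite divr_ge0 ?mulr_ge0 ?(ltW dl0).
  by lra.
have M0 : 0 <= M := le_trans (ltW la0) laM.
set u := la * (sdist x + tau - r0); have D' := dsmooth_ge0 u; have D2 := dsmooth_le u.
have Z0 : 0 <= la * dsmooth u by rewrite mulr_ge0// ltW.
exists (scal3 (la * dsmooth u) xi), (la * dsmooth u); split=> //.
- rewrite dot3_scalr dot3_scall mulrA -expr2 -[leRHS]mulr1.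
  by rewrite ler_wpM2l// sqr_ge0.
- move=> i c cs; set h := scal3 _ _.
  have hh : dot3 h h = 16 * s ^+ 2.
    by rewrite /h dot3_scalr dot3_scall dot3_bas eqxx -cs /=; ring.
  have xh : dot3 xi h = 4 * c * coord3 i xi by rewrite /h dot3_scalr dot3_basr.
  pose E := 17 * s ^+ 2 / (2 * dl).
  have := hxi h; rewrite hh xh (_ : (s ^+ 2 + 16 * s ^+ 2) / (2 * dl) = E); last first.
    by rewrite /E; congr (_ / _); ring.
  move=> h1; pose k := la * (4 * c * coord3 i xi + E).
  have h2 : weight tau (x + h) <= smooth (u + k).
    by apply: smooth_mono; rewrite /u /k -mulrDr ler_pM2l//; lra.
  have /ler_normlP[_ h3] := smooth_taylor u k.
  have E0 : 0 <= E by apply: divr_ge0; apply: mulr_ge0 => //; [exact: sqr_ge0|exact: ltW].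
  have s2s : s ^+ 2 = `|s| ^+ 2 by rewrite real_normK// num_real.
  have E1 : E <= 17 / (2 * dl) * `|s|.
    rewrite (_ : E = 17 / (2 * dl) * s ^+ 2); last by rewrite /E; ring.
    rewrite ler_wpM2l ?divr_ge0 ?mulr_ge0 ?(ltW dl0)// s2s expr2.
    by rewrite ler_piMl.
  have kM : `|k| <= M * `|s|.
    rewrite /k normrM (gtr0_norm la0) /M -[leRHS]mulrA ler_pM2l//.
    apply: (le_trans (ler_normD _ _)); rewrite [leRHS]mulrDl (ger0_norm E0); apply: lerD => //.
    have cs' : `|c| = `|s| by rewrite -!sqrtr_sqr cs.
    rewrite !normrM cs' (ger0_norm (ler0n _ 4)) ler_piMr ?mulr_ge0//.
    apply: (le_trans (coord3_le _ _)).
    by rewrite -sqrtr1 /norm3 ler_wsqrtr.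
  have k2 : k ^+ 2 <= M ^+ 2 * s ^+ 2.
    by rewrite s2s -exprMn -[k ^+ 2]real_normK ?num_real// lerXn2r ?nnegrE// mulr_ge0.
  have d3 : dsmooth u * (la * E) <= 17 * la / dl * s ^+ 2.
    rewrite (_ : 17 * la / dl * s ^+ 2 = 2 * (la * E)); last first.
      by rewrite /E; field; rewrite gt_eqF.
    by rewrite ler_wpM2r// mulr_ge0// ltW.
  have -> : coord3 i (scal3 (la * dsmooth u) xi) = la * dsmooth u * coord3 i xi.
    by rewrite -!dot3_basr dot3_scall.
  apply: (le_trans h2); rewrite /weight -/u /step_cst -/M (mulrDl (17 * la / dl)).
  move: h3 k2 d3; rewrite /k; move: (smooth _) (smooth _) => a b.
  move: (17 * la / dl * s ^+ 2) (M ^+ 2) (coord3 i xi) => X Y z h3 k2 d3.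
  have -> : 4 * c * (la * dsmooth u * z) = dsmooth u * (la * (4 * c * z)) by ring.
  rewrite [la * (_ + E)]mulrDr [dsmooth u * (_ + _)]mulrDr in h3.
  rewrite [la * (_ + E)]mulrDr in k2.
  rewrite -(mulrA 4 Y); lra.
- have /ler_normlP[h3 _] := smooth_taylor u (la * `|s|).
  have e1 : weight (tau + `|s|) x = smooth (u + la * `|s|).
    by rewrite /weight /u; congr smooth; ring.
  have s2s : `|s| ^+ 2 = s ^+ 2 by rewrite real_normK// num_real.
  have h4 : 4 * (la * `|s|) ^+ 2 <= step_cst * s ^+ 2.
    rewrite exprMn s2s mulrA ler_pM2r// /step_cst -/M.
    apply: ler_wpDl; first by rewrite divr_ge0 ?(ltW dl0)// mulr_ge0// ltW.
    by rewrite ler_pM2l// lerXn2r ?nnegrE ?(ltW la0).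
  rewrite e1 /weight -/u; move: h3 h4; move: (smooth _) (smooth _) => a b.
  by move=> h3 h4; have -> : `|s| * (la * dsmooth u) = dsmooth u * (la * `|s|); [ring|lra].
Qed.

End Weight.

(** * The boundary of a neighbourhood *)

Lemma ae_forall_fin d (T : measurableType d) (R : realType)
    (mu : {measure set T -> \bar R}) (I : finType) (P : I -> T -> Prop) :
  (forall i, {ae mu, forall x, P i x}) -> {ae mu, forall x, forall i, P i x}.
Proof. by move=> h; apply: filter_forall => i; exact: h. Qed.

Section NullSets.
Variable R : realType.
Local Notation leb := (@lebesgue3 R).
Local Notation B1 := (measurableTypeR R).
Local Notation B3 := (B1 * B1 * B1)%type.
Implicit Types (A : set (R3 R)) (x y h : R * R * R).

(** Infinitely many disjoint translates of A, all of the same measure, fit into one cube of finite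
    measure. *)
Lemma null_of_translates A n (h : nat -> R * R * R) : measurable A ->
  (forall l l' x, (l < l')%N -> A (x - h l) -> A (x - h l') -> False) ->
  (forall l x, A (x - h l) -> @cube R n x) -> leb A = 0%E.
Proof.
move=> mA dA sA.
pose B l : set (R3 R) := (fun x : R3 R => x + - h l : R3 R) @^-1` A.
have mB l : measurable (B l).
  rewrite -(setTI (B l)); exact: (measurable_translation3 (- h l) measurableT mA).
have eB l : leb (B l) = leb A by exact: translation3_leb.
have tB : trivIset setT B.
  move=> i j _ _ [x [Bi Bj]]; case: (ltngtP i j) => // ij.
    by case: (dA _ _ x ij).
  by case: (dA _ _ x ij).
have subc l : (leb (B l) <= leb (@cube R n))%E.
  apply: le_measure; rewrite ?inE; [exact: mB|exact: measurable_cube|].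
  by move=> x; exact: sA.
have finA : leb A \is a fin_num.
  by rewrite ge0_fin_numE// -(eB 0%N); apply: (le_lt_trans (subc _)); exact: cube_lty.
have finC : leb (@cube R n) \is a fin_num by rewrite ge0_fin_numE//; exact: cube_lty.
have [a ea] : exists a, leb A = a%:E by exists (fine (leb A)); rewrite fineK.
have [c ec] : exists c, leb (@cube R n) = c%:E by exists (fine (leb (@cube R n))); rewrite fineK.
have le N : a *+ N <= c.
  have E : leb (\big[setU/set0]_(i < N) B i) = (\sum_(i < N) leb (B i))%E.
    exact: measure_bigsetU.
  rewrite -lee_fin -ec (_ : (a *+ N)%:E = leb (\big[setU/set0]_(i < N) B i)); last first.
    by rewrite E; under eq_bigr do rewrite eB ea; rewrite sumEFin sumr_const card_ord.
  apply: le_measure; rewrite ?inE.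
  - exact: bigsetU_measurable.
  - exact: measurable_cube.
  - by rewrite -bigcup_mkord => x [l _ /sA].
have a0 : 0 <= a by rewrite -lee_fin -ea.
rewrite ea; congr (_%:E); apply/eqP; apply: contraT => an0.
have ap : 0 < a by rewrite lt_neqAle eq_sym an0.
have := le (Num.trunc (c / a)).+1; rewrite leNgt -mulr_natl.
by rewrite -ltr_pdivrMr// truncnS_gt.
Qed.

End NullSets.

Section Boundary.
Variable R : realType.
Local Notation leb := (@lebesgue3 R).
Local Notation B1 := (measurableTypeR R).
Local Notation B3 := (B1 * B1 * B1)%type.
Variable D : set (R * R * R).
Hypothesis D0 : D !=set0.
Variable t : R.
Hypothesis t0 : 0 < t.
Implicit Types (x y h : R * R * R).
Local Notation d := (dist D).
Local Notation K := ('I_3 * bool)%type.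

Definition axis (k : K) (s : R) : R * R * R := scal3 ((-1) ^+ k.2 * s) (bas3 R k.1).

Lemma axisD k s s' : axis k s + axis k s' = axis k (s + s').
Proof.
by rewrite /axis /scal3 /=; congr (_, _, _); rewrite /= mulrDr mulrDl.
Qed.

Lemma axisB k s s' : axis k s - axis k s' = axis k (s - s').
Proof. by rewrite -(axisD k s (- s')) /axis mulrN scal3N. Qed.

Lemma dot3_axis k s x : dot3 (axis k s) x = (-1) ^+ k.2 * s * coord3 k.1 x.
Proof. by rewrite /axis dot3_scall dot3C dot3_basr. Qed.

Lemma dot3_axis2 k s : dot3 (axis k s) (axis k s) = s ^+ 2.
Proof.
rewrite /axis dot3_scall dot3_scalr dot3_bas eqxx mulr1 mulrACA -expr2.
by rewrite sqrr_sign mul1r expr2.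
Qed.

(* From a boundary point the distance decreases along one of the six axis
   directions, that of a large component of x - y for nearly closest y. *)
Lemma boundary_axis x : d x = t ->
  exists k : K, forall s, 0 < s < t -> d (x + axis k s) < t.
Proof.
move=> dx.
have [k hk] : exists k : K, forall eta, 0 < eta -> exists y, [/\ D y,
    norm3 (x - y) < t + eta & dot3 (axis k 1) (y - x) >= t / 2].
  apply: contrapT => /forallNP H.
  have {}H k : exists eta, 0 < eta /\ forall y, D y -> norm3 (x - y) < t + eta ->
      dot3 (axis k 1) (y - x) < t / 2.
    have /existsNP[eta /not_implyP[e0 h]] := H k; exists eta; split=> // y Dy hy.
    rewrite ltNge; apply/negP => hh; apply: h; by exists y.
  have [f hf] := boolp.choice H.
  (* If every direction failed, this common threshold and a point y of D closer than t + eta would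
     bound all components of y - x by t / 2. Then |y - x|^2 <= 3 t^2 / 4, against |y - x| >= t. *)
  pose eta := \big[Num.min/1]_(k : K) f k.
  have eta0 : 0 < eta by apply: lt_bigmin => // k _; case: (hf k).
  have [y Dy] := dist_near D0 x eta0; rewrite dx => hy.
  have hk k : dot3 (axis k 1) (y - x) < t / 2.
    case: (hf k) => _; apply=> //; apply: (lt_le_trans hy).
    by rewrite lerD2l; exact: bigmin_le.
  have ty : t <= norm3 (x - y) by rewrite -dx; exact: dist_le.
  have ci i : coord3 i (y - x) ^+ 2 <= (t / 2) ^+ 2.
    have h1 := hk (i, false); have h2 := hk (i, true).
    move: h1 h2; rewrite !dot3_axis /= expr0 expr1 !mulr1 mul1r mulN1r => h1 h2.
    by rewrite -[leLHS]real_normK ?num_real// lerXn2r ?nnegrE ?divr_ge0 ?(ltW t0)// ler_norml; lra.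
  have := ler_sqr; have : t ^+ 2 <= norm3 (y - x) ^+ 2.
    by rewrite norm3BC lerXn2r ?nnegrE ?norm3_ge0 ?(ltW t0).
  rewrite sqr_norm3 /dot3; under eq_bigr do rewrite -expr2.
  rewrite sum3 => h _; have := ci 0; have := ci 1; have := ci 2.
  have := exprn_gt0 2 t0; rewrite exprMn; lra.
exists k => s /andP[s0 st].
have c0 : 0 < s * (t - s) by rewrite mulr_gt0// subr_gt0.
(* The squared distance from the moved point to y is below (t + eta)^2 - s t + s^2, and 2 t eta +
   eta^2 < eta (2 t + 2) <= s (t - s). *)
pose eta := Num.min 1 (s * (t - s) / (2 * t + 2)).
have q0 : 0 < 2 * t + 2 by lra.
have eta0 : 0 < eta by rewrite lt_min ltr01 divr_gt0.
have [y [Dy hy hd]] := hk _ eta0.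
apply: (le_lt_trans (dist_le _ Dy)).
have : norm3 (x + axis k s - y) ^+ 2 < t ^+ 2; last first.
  by rewrite ltr_sqr ?nnegrE ?norm3_ge0 ?(ltW t0).
have -> : norm3 (x + axis k s - y) ^+ 2 =
    norm3 (x - y) ^+ 2 - 2 * dot3 (axis k s) (y - x) + dot3 (axis k s) (axis k s).
  by rewrite !sqr_norm3 !dot3E /=; ring.
rewrite dot3_axis2.
have -> : dot3 (axis k s) (y - x) = s * dot3 (axis k 1) (y - x).
  by rewrite !dot3_axis; ring.
have e1 : eta <= 1 by rewrite ge_min lexx.
have e2 : eta * (2 * t + 2) <= s * (t - s) by rewrite -ler_pdivlMr// ge_min lexx orbT.
have n0 := norm3_ge0 (x - y).
have : norm3 (x - y) ^+ 2 < (t + eta) ^+ 2 by rewrite ltr_sqr ?nnegrE ?addr_ge0 ?(ltW t0) ?(ltW eta0).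
have : s * (t / 2) <= s * dot3 (axis k 1) (y - x) by rewrite ler_pM2l.
move: (norm3 _ ^+ 2) (s * dot3 _ _) => X Y h1 h2.
have := mulr_gt0 eta0 t0; have : eta ^+ 2 <= eta by rewrite expr2 ler_piMl// ltW.
nra.
Qed.

(** Runs through all t a / b with integers 0 < a < b. Countably many displacements keep [bdry_part]
    measurable, and they include the differences of the shifts in [bdry_part_null]. *)
Definition frac (j N : nat) : R := t * (j.+1%:R / (j + N).+2%:R).

Definition bdry_part (k : K) : set (R3 R) :=
  [set x | d x = t /\ forall N j, d (x + axis k (frac j N)) < t].

Lemma frac_lt j N : 0 < frac j N < t.
Proof.
apply/andP; split; first by rewrite /frac mulr_gt0// divr_gt0.
rewrite /frac -[ltRHS]mulr1 ltr_pM2l// ltr_pdivrMr// mul1r ltr_nat; lia.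
Qed.

Lemma boundary_parts x : d x = t -> exists k, bdry_part k x.
Proof.
move=> dx; have [k hk] := boundary_axis dx; exists k; split=> // N j.
exact/hk/frac_lt.
Qed.

Lemma measurable_bdry_part k : measurable (bdry_part k).
Proof.
have md := measurable_distR3 D0.
have -> : bdry_part k = d @^-1` [set t] `&`
    \bigcap_N \bigcap_j (fun x : R3 R => d (x + axis k (frac j N))) @^-1` `]-oo, t[%classic.
  apply/seteqP; split=> x /=.
    by move=> [h1 h2]; split=> // N _ j _ /=; rewrite in_itv /=; exact: h2.
  by move=> [h1 h2]; split=> // N j; have := h2 N I j I; rewrite /= in_itv.
apply: measurableI.
  by rewrite -(setTI (_ @^-1` _)); apply: md => //; exact: measurable_set1.
apply: bigcapT_measurable => N; apply: bigcapT_measurable => j.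
rewrite -(setTI (_ @^-1` _)).
have mf := measurableT_comp md (measurable_translation3 (axis k (frac j N))).
by apply: mf => //; exact: measurable_itv.
Qed.

(** The translates along the axis by t / (l + 2) are disjoint: a common point of two of them would
    give two points at distance exactly t from D, one being the other moved by the difference of the
    shifts, whereas such a move makes the distance smaller than t. *)
Lemma bdry_part_null k : leb (bdry_part k) = 0%E.
Proof.
have mA := measurable_bdry_part k.
have mAn n : measurable (bdry_part k `&` @cube R n).
  by apply: measurableI => //; exact: measurable_cube.
have Z n : leb (bdry_part k `&` @cube R n) = 0%E.
  pose s (l : nat) : R := t / l.+2%:R.
  pose M := (Num.trunc t).+1.
  apply: (null_of_translates (n := (n + M)%N) (h := fun l => axis k (s l))) => //.
    move=> l l' x ll' [[d1 h1] _] [[d2 h2] _].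
    (* Makes the denominator in [frac] equal to (l + 2) (l' + 2), for the numerator l' - l. *)
    pose N := (l.+2 * l'.+2 - (l' - l).+1)%N.
    have fe : frac (l' - l.+1) N = s l - s l'.
      rewrite /frac /s (_ : (l' - l.+1).+1 = (l' - l)%N); last by lia.
      rewrite (_ : (l' - l.+1 + N).+2 = (l.+2 * l'.+2)%N); last by rewrite /N; nia.
      rewrite natrM natrB; last exact: ltnW.
      rewrite (_ : l'%:R = l'.+2%:R - 2 :> R); last by rewrite -[l'.+2]addn2 natrD addrK.
      rewrite (_ : l%:R = l.+2%:R - 2 :> R); last by rewrite -[l.+2]addn2 natrD addrK.
      have := pnatr_eq0 R l.+2; have := pnatr_eq0 R l'.+2.
      move: (l.+2%:R : R) (l'.+2%:R : R) => u w /negbT w0 /negbT u0.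
      by field; rewrite u0 w0.
    by have := h1 N (l' - l.+1)%N; rewrite fe -axisB addrA subrK d2 ltxx.
  move=> l x [_ [[c1 c2] c3]].
  have s0 : 0 <= s l by rewrite divr_ge0// ltW.
  have sM : s l <= M%:R.
    apply: (@le_trans _ _ t); last by rewrite ltW// truncnS_gt.
    by rewrite ler_pdivrMr// ler_peMr ?(ltW t0)// ler1n.
  have nE : norm3 (axis k (s l)) = s l by rewrite /norm3 dot3_axis2 sqrtr_sqr ger0_norm.
  have ax i : `|coord3 i (axis k (s l))| <= M%:R.
    by apply: (le_trans (coord3_le _ _)); rewrite nE.
  have st (u w : R) : `|w| <= M%:R -> `]- n%:R, n%:R]%classic (u - w) ->
      `]- (n + M)%:R, (n + M)%:R]%classic u.
    rewrite /= !in_itv /= ler_norml natrD => /andP[w1 w2] /andP[u1 u2].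
    by apply/andP; split; lra.
  split; [split|].
  - exact: st (ax 0) c1.
  - exact: st (ax 1) c2.
  - exact: st (ax 2) c3.
have -> : bdry_part k = \bigcup_n (bdry_part k `&` @cube R n).
  rewrite -setI_bigcupr; apply/seteqP; split=> x; last by case.
  by move=> Ax; split=> //; have [N HN] := cubeP x; exists N => //; exact: HN.
have mU : measurable (\bigcup_n (bdry_part k `&` @cube R n)) by exact: bigcup_measurable.
have h := measure_sigma_subadditive leb mAn mU (@subset_refl _ _).
apply/eqP; rewrite -measure_le0; apply: (le_trans h).
rewrite eseries0; [exact: lexx|move=> i _ _; exact: Z].
Qed.

Lemma boundary_ae : {ae leb, forall x, d x <> t}.
Proof.
have h : {ae leb, forall x, forall k, ~ bdry_part k x}.
  apply: ae_forall_fin => k; exists (bdry_part k); split.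
  - exact: measurable_bdry_part.
  - exact: bdry_part_null.
  - by move=> x /= /contrapT.
by apply: (ae_imp h) => x nx dx; have [k hk] := boundary_parts dx; exact: nx hk.
Qed.

Lemma measurable_negligible3 (A : set (R3 R)) : leb.-negligible A -> measurable A.
Proof.
move=> [N [mN N0 AN]]; rewrite measurable_R3E.
apply: (@measure_is_complete_caratheodory _ _ ((@borel_lebesgue3 R)^*)%mu).
by exists N; split => //; rewrite -measurable_R3E.
Qed.

Lemma open_nbhd_sub x : d x < t -> causal_nbhd t D x.
Proof.
move=> dx; have e0 : 0 < t - d x by rewrite subr_gt0.
have [y Dy hy] := dist_near D0 x e0; exists y => //.
by rewrite (gtr0_norm t0); move: hy; rewrite (_ : d x + (t - d x) = t) => [/ltW|]; last by ring.
Qed.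

Lemma nbhd_sub x : causal_nbhd t D x -> d x <= t.
Proof.
move=> [y Dy]; rewrite (gtr0_norm t0) => h.
by apply: le_trans h; exact: dist_le.
Qed.

(** The neighbourhood lies between the sets d < t and d <= t, which differ by a null set, and every
    subset of a null set is Lebesgue measurable. *)
Lemma measurable_causal_nbhd : measurable (causal_nbhd t D).
Proof.
have md := measurable_distR3 D0.
have -> : causal_nbhd t D = d @^-1` `]-oo, t[%classic `|` (causal_nbhd t D `&` [set x | d x = t]).
  apply/seteqP; split=> x.
    move=> Dx; have := nbhd_sub Dx; rewrite le_eqVlt => /orP[/eqP e|h]; first by right.
    by left; rewrite /= in_itv.
  by move=> [|[]//]; rewrite /= in_itv /=; exact: open_nbhd_sub.
apply: measurableU.
  by rewrite -(setTI (_ @^-1` _)); apply: md => //; exact: measurable_itv.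
apply: measurable_negligible3; have [N [mN N0 hN]] := boundary_ae.
by exists N; split=> // x [_ dx]; apply: hN => /=; exact.
Qed.

End Boundary.

(** * Discretized evolution *)

Section Mix.
Variable R : realType.
Local Notation C := R[i].
Implicit Types (P Q : 'I_4 -> C) (z y : 'I_5 -> C) (k l : 'I_4) (j : 'I_5).

(* One-dimensional Dirac evolution of the pair (z_0, z_(k+1)): P and Q are the
   characteristic variables z_0 + z_(k+1) and z_0 - z_(k+1) after transport in
   opposite directions. *)
Definition rot2 P Q z k j : C :=
  if unlift ord0 j is Some l then
    if l == k then 2^-1 * (P k - Q k) else z j
  else 2^-1 * (P k + Q k).

Definition mix P Q z j : C := \sum_k 4^-1 * rot2 P Q z k j.

Lemma rot2_0 P Q z k : rot2 P Q z k ord0 = 2^-1 * (P k + Q k).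
Proof. by rewrite /rot2 unlift_none. Qed.

Lemma rot2_lift P Q z k l : rot2 P Q z k (lift ord0 l) =
  if l == k then 2^-1 * (P k - Q k) else z (lift ord0 l).
Proof. by rewrite /rot2 liftK. Qed.

Lemma cinvn (n : nat) : n.+1%:R^-1 = (n.+1%:R^-1)%:C :> C.
Proof. by rewrite -(rmorph_nat (real_complex R)) -fmorphV. Qed.

Lemma csq_half (x y : C) :
  csq (2^-1 * (x + y)) + csq (2^-1 * (x - y)) = 2^-1 * (csq x + csq y).
Proof.
rewrite !csqM (cinvn 1) csq_real /csq !cE; move: x y => [x1 x2] [y1 y2] /=.
by field.
Qed.

Lemma csq_sumsub (x y : C) : 2^-1 * (csq (x + y) + csq (x - y)) = csq x + csq y.
Proof. by rewrite /csq !cE; move: x y => [x1 x2] [y1 y2] /=; field. Qed.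

Lemma sum4 (V : nmodType) (F : 'I_4 -> V) :
  \sum_(i < 4) F i = F 0 + F 1 + F (inord 2) + F (inord 3).
Proof.
rewrite !big_ord_recr big_ord0 /= add0r.
by congr (_ + _ + _ + _); congr F; apply/val_inj; rewrite //= inordK.
Qed.

Lemma sum4_ub (F : 'I_4 -> R) : 4^-1 * (\sum_k F k) ^+ 2 <= \sum_k F k ^+ 2.
Proof.
rewrite !sum4; move: (F 0) (F 1) (F (inord 2)) (F (inord 3)) => a b c d.
have := sqr_ge0 (a - b); have := sqr_ge0 (a - c); have := sqr_ge0 (a - d).
have := sqr_ge0 (b - c); have := sqr_ge0 (b - d); have := sqr_ge0 (c - d).
lra.
Qed.

Lemma csq_avg (F : 'I_4 -> C) : csq (\sum_k 4^-1 * F k) <= 4^-1 * \sum_k csq (F k).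
Proof.
rewrite -big_distrr /= csqM (cinvn 3) csq_real.
rewrite /csq cRe_sum cIm_sum big_split /=.
have := sum4_ub (fun k => complex.Re (F k)); have := sum4_ub (fun k => complex.Im (F k)).
by move: (\sum_k _) (\sum_k _) (\sum_k _) (\sum_k _) => a b c d; lra.
Qed.

Lemma sum_csq_rot2 P Q z k : \sum_j csq (rot2 P Q z k j) =
  2^-1 * (csq (P k) + csq (Q k)) + \sum_(l | l != k) csq (z (lift ord0 l)).
Proof.
rewrite big_ord_recl rot2_0 (bigD1 k) //= rot2_lift eqxx addrA csq_half.
by congr (_ + _); apply: eq_bigr => l /negbTE lk; rewrite rot2_lift lk.
Qed.

Lemma sum_csq_split z k : \sum_j csq (z j) =
  csq (z ord0) + csq (z (lift ord0 k)) + \sum_(l | l != k) csq (z (lift ord0 l)).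
Proof. by rewrite big_ord_recl (bigD1 k) //= addrA. Qed.

(** Convexity of the squared modulus. The contraction in momentum space and the weighted estimate in
    position space both start from it. *)
Lemma sum_csq_mix P Q z : \sum_j csq (mix P Q z j) <=
  4^-1 * \sum_k (2^-1 * (csq (P k) + csq (Q k))
                 + \sum_(l | l != k) csq (z (lift ord0 l))).
Proof.
under [X in _ <= _ * X]eq_bigr do rewrite -sum_csq_rot2.
by rewrite exchange_big /= mulr_sumr; apply: ler_sum => j _; exact: csq_avg.
Qed.

(** In momentum space, transport of the two characteristic variables in opposite directions is
    multiplication by opposite phases. *)
Definition mstep (th : 'I_4 -> R) z : 'I_5 -> C :=
  mix (fun k => expi (th k) * (z ord0 + z (lift ord0 k)))
      (fun k => expi (- th k) * (z ord0 - z (lift ord0 k))) z.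

Lemma mstep_contract th z : \sum_j csq (mstep th z j) <= \sum_j csq (z j).
Proof.
apply: (le_trans (sum_csq_mix _ _ _)).
under eq_bigr do rewrite !csqM !csq_expi !mul1r csq_sumsub -sum_csq_split.
by rewrite sum4; move: (\sum_j _) => N; lra.
Qed.

Lemma mstepD th z y j : mstep th (fun i => z i + y i) j = mstep th z j + mstep th y j.
Proof.
rewrite /mstep /mix -big_split /=; apply: eq_bigr => k _; rewrite -mulrDr; congr (_ * _).
rewrite /rot2; case: (unlift ord0 j) => [l|]; last by ring.
by case: eqP => _ //; ring.
Qed.

Lemma mstepZ th c z j : mstep th (fun i => c * z i) j = c * mstep th z j.
Proof.
rewrite /mstep /mix big_distrr /=; apply: eq_bigr => k _; rewrite mulrCA; congr (_ * _).
rewrite /rot2; case: (unlift ord0 j) => [l|]; last by ring.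
by case: eqP => _ //; ring.
Qed.

End Mix.

Section Trigonometry.
Variable R : realType.
Implicit Types x : R.

Lemma sin_le_abs x : `|sin x| <= `|x|.
Proof.
wlog x0 : x / 0 < x.
  move=> h; have [x0|x0|->] := ltgtP x 0; [|exact: h|by rewrite sin0].
  by rewrite -normrN -sinN -[leRHS]normrN; apply: h; rewrite oppr_gt0.
have cs : {within `[0, x], continuous (@sin R)}.
  by apply: continuous_subspaceT => y; exact: continuous_sin.
have [c _ ] := MVT x0 (fun y _ => is_derive_sin y) cs.
by rewrite sin0 !subr0 => ->; rewrite normrM ler_piMl// ler_norml cos_geN1 cos_le1.
Qed.

Lemma cos_sub1 x : `|cos x - 1| = 2 * sin (x / 2) ^+ 2.
Proof.
have -> : cos x = 1 - 2 * sin (x / 2) ^+ 2.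
  rewrite {1}[x](_ : x = x / 2 + x / 2); last by field.
  rewrite cosD; have := cos2Dsin2 (x / 2); rewrite -!expr2; lra.
rewrite (_ : 1 - _ - 1 = - (2 * sin (x / 2) ^+ 2)); last by ring.
by rewrite normrN ger0_norm// mulr_ge0// sqr_ge0.
Qed.

Lemma cos_sub1_le x : `|cos x - 1| <= x ^+ 2.
Proof.
rewrite cos_sub1; have := sin_le_abs (x / 2).
rewrite -(ler_pXn2r (n := 2)) ?nnegrE// !real_normK ?num_real// => h.
by apply: (le_trans (y := 2 * (x / 2) ^+ 2)); [rewrite ler_pM2l|have := sqr_ge0 x; lra].
Qed.

Lemma cos_sub1_le_abs x : `|cos x - 1| <= `|x|.
Proof.
rewrite cos_sub1; have := sin_le_abs (x / 2).
have : `|sin (x / 2)| <= 1 by rewrite ler_norml sin_geN1 sin_le1.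
rewrite -[sin _ ^+ 2]real_normK ?num_real// normrM (ger0_norm (x := 2^-1))//.
have := normr_ge0 (sin (x / 2)); move: `|sin _| `|x| => a b; nra.
Qed.

Lemma sin_sub_le x : `|sin x - x| <= x ^+ 2.
Proof.
wlog x0 : x / 0 < x.
  move=> h; have [x0|x0|->] := ltgtP x 0; [|exact: h|by rewrite sin0 subrr normr0 expr0n].
  rewrite -sqrrN (_ : sin x - x = - (sin (- x) - - x)); last by rewrite sinN; ring.
  by rewrite normrN; apply: h; rewrite oppr_gt0.
have cs : {within `[0, x], continuous (fun y : R => sin y - y)}.
  apply: continuous_subspaceT => y; apply: continuousB; first exact: continuous_sin.
  exact: cvg_id.
have ds y : y \in `]0, x[ -> is_derive y (1 : R) (fun y : R => sin y - y) (cos y - 1).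
  by move=> _; apply: is_deriveB.
have [c ] := MVT x0 ds cs.
rewrite in_itv /= => /andP[c0 cx].
rewrite sin0 !subr0 => ->; rewrite normrM (gtr0_norm x0) expr2 ler_pM2r//.
by apply: (le_trans (cos_sub1_le_abs c)); rewrite gtr0_norm// ltW.
Qed.

End Trigonometry.

Section Symbol4.
Variable R : realType.
Local Notation C := R[i].
Variable m : R.
Hypothesis m0 : 0 < m.
Implicit Types (p : R * R * R) (k : 'I_4).

Definition energy_comp k p : R := if unlift ord0 k is Some i then coord3 i p else m.
Local Notation Pk := energy_comp.

Lemma energy_comp0 p : Pk ord0 p = m.
Proof. by rewrite /energy_comp unlift_none. Qed.

Lemma energy_comp_lift (i : 'I_3) p : Pk (lift ord0 i) p = coord3 i p.
Proof. by rewrite /energy_comp liftK. Qed.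

Lemma sum_energy_comp p : \sum_k Pk k p ^+ 2 = eps m p ^+ 2.
Proof.
rewrite big_ord_recl energy_comp0 sqr_eps; congr (_ + _).
by apply: eq_bigr => i _; rewrite energy_comp_lift expr2.
Qed.

Local Notation v := (@vcomp R m).

Lemma vcomp_ord0 p : v ord0 p = (Num.sqrt 2)^-1.
Proof. rewrite (_ : v ord0 p = v (lshift 3 0) p); first by rewrite vcomp_l.
by congr vcomp; exact/val_inj. Qed.

Lemma vcomp_lift k p : v (lift ord0 k) p = Pk k p / (Num.sqrt 2 * eps m p).
Proof.
rewrite /energy_comp; case: unliftP => [i|] ->.
  rewrite (_ : v _ p = v (rshift 2 i) p); first by rewrite vcomp_r.
  by congr vcomp; exact/val_inj.
rewrite (_ : v _ p = v (lshift 3 1) p); first by rewrite vcomp_l.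
by congr vcomp; exact/val_inj.
Qed.

Lemma mul_energy_vcomp k p : Pk k p * v ord0 p = eps m p * v (lift ord0 k) p.
Proof.
rewrite vcomp_ord0 vcomp_lift; field.
by rewrite sqrt2_neq0 (gt_eqF (eps_gt0 m0 p)).
Qed.

Lemma sum_energy_vcomp p : \sum_k Pk k p * v (lift ord0 k) p = eps m p * v ord0 p.
Proof.
apply: (mulfI (lt0r_neq0 (eps_gt0 m0 p))); rewrite mulrA -expr2 -sum_energy_comp.
rewrite mulr_sumr mulr_suml; apply: eq_bigr => k _.
by rewrite expr2 -mulrA mul_energy_vcomp; ring.
Qed.

(* The factor 4 compensates the average over k in mix. *)
Definition step_phase s p : 'I_4 -> R := fun k => 4 * s * Pk k p.

Lemma vcomp_le1 a p : `|v a p| <= 1.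
Proof.
have := sqr_vcomp_le1 m0 a p; rewrite -[_ ^+ 2]real_normK ?num_real//.
by rewrite -[leRHS](expr1n _ 2) ler_pXn2r ?nnegrE.
Qed.

Lemma sqr_energy_comp_le k p : Pk k p ^+ 2 <= eps m p ^+ 2.
Proof.
rewrite -sum_energy_comp (bigD1 k) //= lerDl; apply: sumr_ge0 => l _; exact: sqr_ge0.
Qed.

Lemma mstep_real0 th (u : 'I_5 -> R) :
  mstep th (fun b => (u b)%:C) ord0 =
  (\sum_k 4^-1 * (cos (th k) * u ord0)) +i* (\sum_k 4^-1 * (sin (th k) * u (lift ord0 k))).
Proof.
apply: cplx_eq; rewrite ?cRe_sum ?cIm_sum /=; apply: eq_bigr => k _.
  rewrite rot2_0 (cinvn _ 1) (cinvn _ 3) !cE /= cosN sinN.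
  by move: (cos _) (sin _) (u _) (u _) => c d x y; lra.
rewrite rot2_0 (cinvn _ 1) (cinvn _ 3) !cE /= cosN sinN.
by move: (cos _) (sin _) (u ord0) (u _) => c d x y; lra.
Qed.

(** Only the k-th of the four evolutions changes this component; the other three copy it. *)
Lemma mstep_real_lift th (u : 'I_5 -> R) k :
  mstep th (fun b => (u b)%:C) (lift ord0 k) =
  (u (lift ord0 k) + 4^-1 * ((cos (th k) - 1) * u (lift ord0 k)))
  +i* (4^-1 * (sin (th k) * u ord0)).
Proof.
rewrite /mstep /mix (bigD1 k) //= rot2_lift eqxx.
under eq_bigr => l /negbTE lk do rewrite rot2_lift eq_sym lk.
rewrite sumr_const (_ : #|_| = 3%N); last first.
  have e := cardC1 k; rewrite card_ord in e.
  by rewrite -[RHS]e; apply: eq_card => l; rewrite !inE.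
rewrite (_ : forall x : C, x *+ 3 = x + x + x); last by move=> x; rewrite !mulrSr mulr0n add0r.
apply: cplx_eq; rewrite (cinvn _ 1) (cinvn _ 3) !cE /= cosN sinN.
  by move: (cos _) (sin _) (u _) (u _) => c d x y; lra.
by move: (cos _) (sin _) (u _) (u _) => c d x y; lra.
Qed.

(* v(p) is an eigenvector of the symmetric matrix with first row and column
   (0, m, p) and zeroes elsewhere, for the eigenvalue eps(p). *)
Lemma mstep_vcomp s a p :
  csq (mstep (step_phase s p) (fun b => (v b p)%:C) a - expi (s * eps m p) * (v a p)%:C)
  <= 2 * (5 * s ^+ 2 * eps m p ^+ 2) ^+ 2.
Proof.
(* The second-order remainders 16 s^2 P_k^2 of the four evolutions contribute, averaged, at most 4
   s^2 eps^2, and that of exp(i s eps) contributes s^2 eps^2. *)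
set M := 5 * s ^+ 2 * eps m p ^+ 2.
have bnd (x y : R) : `|x| <= M -> `|y| <= M -> csq (x +i* y) <= 2 * M ^+ 2.
  move=> hx hy; have M0 : 0 <= M by apply: le_trans hx.
  rewrite /csq /= -[x ^+ 2]real_normK ?num_real// -[y ^+ 2]real_normK ?num_real//.
  rewrite mulr2n mulrDl mul1r; apply: lerD; by rewrite ler_pXn2r ?nnegrE.
have mulb (x y : R) : `|y| <= 1 -> `|x * y| <= `|x|.
  by move=> h; rewrite normrM ler_piMr.
have es : `|sin (s * eps m p) - s * eps m p| <= s ^+ 2 * eps m p ^+ 2.
  by rewrite -exprMn; exact: sin_sub_le.
have ec : `|cos (s * eps m p) - 1| <= s ^+ 2 * eps m p ^+ 2.
  by rewrite -exprMn; exact: cos_sub1_le.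
have ks k : `|sin (step_phase s p k) - step_phase s p k| <= 16 * s ^+ 2 * Pk k p ^+ 2.
  apply: (le_trans (sin_sub_le _)); rewrite /step_phase; lra.
have kc k : `|cos (step_phase s p k) - 1| <= 16 * s ^+ 2 * Pk k p ^+ 2.
  apply: (le_trans (cos_sub1_le _)); rewrite /step_phase; lra.
have sumP : \sum_k 4^-1 * (16 * s ^+ 2 * Pk k p ^+ 2) = 4 * s ^+ 2 * eps m p ^+ 2.
  by rewrite -sum_energy_comp mulr_sumr; apply: eq_bigr => k _; field.
have q0 : 0 <= (4^-1 : R) by [].

have Ple k : s ^+ 2 * Pk k p ^+ 2 <= s ^+ 2 * eps m p ^+ 2.
  by rewrite ler_wpM2l ?sqr_ge0// sqr_energy_comp_le.
have quarter (x b : R) : `|x| <= b -> `|4^-1 * x| <= 4^-1 * b.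
  by move=> h; rewrite normrM ger0_norm// ler_wpM2l.
have [->|[k ->]] : a = ord0 \/ exists k, a = lift ord0 k.
- by case: (unliftP ord0 a) => [k|] ->; [right; exists k|left].
- rewrite mstep_real0 (_ : _ - _ = (\sum_k 4^-1 * ((cos (step_phase s p k) - 1) * v ord0 p)
      - (cos (s * eps m p) - 1) * v ord0 p) +i*
     (\sum_k 4^-1 * ((sin (step_phase s p k) - step_phase s p k) * v (lift ord0 k) p)
      - (sin (s * eps m p) - s * eps m p) * v ord0 p)); last first.
    (* By the eigenvalue equation the terms of first order cancel. *)
    have e1 : s * eps m p * v ord0 p =
        \sum_k 4^-1 * (step_phase s p k * v (lift ord0 k) p).
      rewrite -mulrA -sum_energy_vcomp mulr_sumr; apply: eq_bigr => k _.
      by rewrite /step_phase; field.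
    apply: cplx_eq; rewrite !cE /= ?mulr0 ?subr0 ?addr0.
      move: (cos _) => c; rewrite sum4 [in RHS]sum4.
      move: (cos _) (cos _) (cos _) (cos _) (v ord0 p) => c1 c2 c3 c4 x; lra.
    rewrite [X in _ = X - _](_ : _ =
      \sum_k 4^-1 * (sin (step_phase s p k) * v (lift ord0 k) p) - s * eps m p * v ord0 p).
      by move: (\sum_k _) (sin _) => X Y; ring.
    by rewrite e1 -sumrB; apply: eq_bigr => k _; ring.
  apply: bnd; apply: (le_trans (ler_normB _ _)).
    rewrite (_ : M = \sum_k 4^-1 * (16 * s ^+ 2 * Pk k p ^+ 2) + s ^+ 2 * eps m p ^+ 2); last first.
      by rewrite sumP /M; ring.
    apply: lerD; last by apply: (le_trans (mulb _ _ (vcomp_le1 _ _))).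
    apply: (le_trans (ler_norm_sum _ _ _)); apply: ler_sum => k _; apply: quarter.
    by apply: (le_trans (mulb _ _ (vcomp_le1 _ _))).
  rewrite (_ : M = \sum_k 4^-1 * (16 * s ^+ 2 * Pk k p ^+ 2) + s ^+ 2 * eps m p ^+ 2); last first.
    by rewrite sumP /M; ring.
  apply: lerD; last by apply: (le_trans (mulb _ _ (vcomp_le1 _ _))).
  apply: (le_trans (ler_norm_sum _ _ _)); apply: ler_sum => k _; apply: quarter.
  by apply: (le_trans (mulb _ _ (vcomp_le1 _ _))).
have e2 : s * eps m p * v (lift ord0 k) p = 4^-1 * (step_phase s p k * v ord0 p).
  by rewrite -mulrA -mul_energy_vcomp /step_phase; field.
have M5 : 4^-1 * (16 * s ^+ 2 * Pk k p ^+ 2) + s ^+ 2 * eps m p ^+ 2 <= M.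
  by have := Ple k; rewrite /M; move: (s ^+ 2) (Pk _ _ ^+ 2) (eps m p ^+ 2) => *; lra.
rewrite mstep_real_lift (_ : _ - _ =
    (4^-1 * ((cos (step_phase s p k) - 1) * v (lift ord0 k) p)
      - (cos (s * eps m p) - 1) * v (lift ord0 k) p) +i*
    (4^-1 * ((sin (step_phase s p k) - step_phase s p k) * v ord0 p)
      - (sin (s * eps m p) - s * eps m p) * v (lift ord0 k) p)); last first.
  apply: cplx_eq; rewrite !cE /= ?mulr0 ?subr0 ?addr0; first by ring.
  rewrite [X in _ = _ - X]mulrBl e2 mulrBl; ring.
apply: bnd; apply: (le_trans (ler_normB _ _)); apply: le_trans M5; apply: lerD.
- by apply: quarter; apply: (le_trans (mulb _ _ (vcomp_le1 _ _))).
- by apply: (le_trans (mulb _ _ (vcomp_le1 _ _))).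
- by apply: quarter; apply: (le_trans (mulb _ _ (vcomp_le1 _ _))).
- by apply: (le_trans (mulb _ _ (vcomp_le1 _ _))).
Qed.

End Symbol4.

Section MomentumIteration.
Variable R : realType.
Local Notation C := R[i].
Local Notation leb := (@lebesgue3 R).
Local Notation L2 := (LC leb 2%:E).
Local Notation nsq := (nsq leb).
Variable m : R.
Hypothesis m0 : 0 < m.
Local Notation v := (@vcomp R m).
Local Notation Pk := (energy_comp m).
Implicit Types (p : R3 R) (phi : R3 R -> C) (F : 'I_5 -> R3 R -> C).

Lemma csqD_weighted (x y : C) (k : R) : 0 < k ->
  csq (x + y) <= (1 + k^-1) * csq x + (1 + k) * csq y.
Proof.
move=> k0; rewrite -subr_ge0 /csq !cE; move: x y => [x1 x2] [y1 y2] /=.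
rewrite (_ : _ - _ = ((x1 - k * y1) ^+ 2 + (x2 - k * y2) ^+ 2) / k).
  by apply: divr_ge0; [exact: addr_ge0 (sqr_ge0 _) (sqr_ge0 _)|exact: ltW].
by field; rewrite gt_eqF.
Qed.

Lemma measurable_energy_comp k : measurable_fun setT (Pk k : R3 R -> R).
Proof.
rewrite /energy_comp; case: (unlift ord0 k) => [i|]; last exact: measurable_cst.
apply: measurable_coord3; exact: measurable_fun_id3.
Qed.

Definition mstepf s F (a : 'I_5) : R3 R -> C :=
  fun p => mstep (step_phase m s p) (F ^~ p) a.

Lemma cmeas_step_phase s k : cmeasurable setT (fun p => expi (step_phase m s p k) : C).
Proof.
apply: cmeas_expi; apply: measurable_funM; first exact: measurable_cst.
exact: measurable_energy_comp.
Qed.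

Lemma cmeas_step_phaseN s k : cmeasurable setT (fun p => expi (- step_phase m s p k) : C).
Proof.
under eq_fun do rewrite expiN; apply: cmeasJ; exact: cmeas_step_phase.
Qed.

Lemma cmeas_mstepf s F a : (forall b, cmeasurable setT (F b)) ->
  cmeasurable setT (mstepf s F a).
Proof.
move=> mF; rewrite /mstepf /mstep /mix; apply: cmeas_sum => k; apply: cmeasZ.
have mP : cmeasurable setT (fun p => expi (step_phase m s p k) *
    (F ord0 p + F (lift ord0 k) p)).
  by apply: cmeasM; [exact: cmeas_step_phase|apply: cmeasD; exact: mF].
have mQ : cmeasurable setT (fun p => expi (- step_phase m s p k) *
    (F ord0 p - F (lift ord0 k) p)).
  by apply: cmeasM; [exact: cmeas_step_phaseN|apply: cmeasB; exact: mF].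
rewrite /rot2; case: (unlift ord0 a) => [l|].
  case: eqP => _; last exact: mF.
  apply: cmeasZ; exact: cmeasB mP mQ.
apply: cmeasZ; exact: cmeasD mP mQ.
Qed.

Definition evol s n p : 'I_5 -> C :=
  iter n (mstep (step_phase m s p)) (fun b => (v b p)%:C).

Lemma cmeas_evol s n a : cmeasurable setT (fun p => evol s n p a).
Proof.
elim: n a => [|n ih] a; first exact: cmeas_vcomp.
exact: (@cmeas_mstepf s (fun b p => evol s n p b) a ih).
Qed.

Lemma sum_csq_evol s n p : \sum_a csq (evol s n p a) <= 1.
Proof.
elim: n => [|n ih]; last exact: le_trans (mstep_contract _ _) ih.
by rewrite /evol /=; under eq_bigr do rewrite csq_real; rewrite sum_sqr_vcomp.
Qed.

Lemma csq_evol_le s n p a : csq (evol s n p a) <= 1.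
Proof.
apply: le_trans (sum_csq_evol s n p); rewrite (bigD1 a) //= lerDl.
by apply: sumr_ge0 => b _; exact: csq_ge0.
Qed.

(* Induction with csqD_weighted for k = n, which turns n^2 + 1 into (n + 1)^2
   and so plays the role of the triangle inequality. *)
Lemma evol_err s n p :
  \sum_a csq (evol s n p a - expi (n%:R * s * eps m p) * (v a p)%:C) <=
  n%:R ^+ 2 * (10 * (5 * s ^+ 2 * eps m p ^+ 2) ^+ 2).
Proof.
(* The bound of [mstep_vcomp], with its factor 2, summed over five components. *)
set B := 10 * _; have B0 : 0 <= B by rewrite mulr_ge0// sqr_ge0.
elim: n => [|n ih].
  rewrite big1 => [|a _]; last by rewrite !mul0r expi0 mul1r subrr csq0.
  by rewrite expr0n mul0r.
pose th := step_phase m s p.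
pose d a := evol s n p a - expi (n%:R * s * eps m p) * (v a p)%:C.
pose r a := mstep th (fun b => (v b p)%:C) a - expi (s * eps m p) * (v a p)%:C.
have dr a : evol s n.+1 p a - expi (n.+1%:R * s * eps m p) * (v a p)%:C =
    mstep th d a + expi (n%:R * s * eps m p) * r a.
  rewrite /evol iterS -/(evol s n p).
  have -> : evol s n p = (fun b => d b + expi (n%:R * s * eps m p) * (v b p)%:C).
    by apply: funext => b; rewrite /d subrK.
  rewrite mstepD mstepZ /r mulrBr mulrA -expiD addrA; congr (_ + _ - expi _ * _).
  by rewrite -natr1; ring.
have rB : \sum_a csq (expi (n%:R * s * eps m p) * r a) <= B.
  apply: (@le_trans _ _ (\sum_(a < 5) 2 * (5 * s ^+ 2 * eps m p ^+ 2) ^+ 2)).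
    by apply: ler_sum => a _; rewrite csqM csq_expi mul1r; exact: mstep_vcomp.
  rewrite sumr_const card_ord /B -[_ *+ 5]mulr_natr; move: (_ ^+ 2 : R) => X; lra.
have dB : \sum_a csq (mstep th d a) <= n%:R ^+ 2 * B.
  exact: le_trans (mstep_contract _ _) ih.
under eq_bigr do rewrite dr.
(* For n = 0 the weight k = n would vanish; the accumulated error is 0 then. *)
case: n => [|n] in ih d r dr rB dB *.
  rewrite expr1n mul1r; apply: le_trans rB; apply: ler_sum => a _.
  rewrite csqM csq_expi; have : csq (mstep th d a) <= 0.
    rewrite expr0n mul0r in dB; apply: le_trans dB; rewrite (bigD1 a) //= lerDl.
    by apply: sumr_ge0 => b _; exact: csq_ge0.
  move=> h; have /csq_eq0 -> : csq (mstep th d a) = 0.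
    by apply/eqP; rewrite eq_le h csq_ge0.
  by rewrite add0r csqM csq_expi.
have k0 : 0 < n.+1%:R :> R by [].
apply: (@le_trans _ _ (\sum_a ((1 + n.+1%:R^-1) * csq (mstep th d a) +
    (1 + n.+1%:R) * csq (expi (n.+1%:R * s * eps m p) * r a)))).
  by apply: ler_sum => a _; exact: csqD_weighted.
rewrite big_split /= -!mulr_sumr.
have h1 := ler_wpM2l (ltW (addr_gt0 ltr01 k0)) rB.
have h2 : (1 + n.+1%:R^-1) * (\sum_a csq (mstep th d a)) <=
    (1 + n.+1%:R^-1) * (n.+1%:R ^+ 2 * B).
  by rewrite ler_wpM2l// addr_ge0// invr_ge0 ltW.
apply: (le_trans (lerD h2 h1)).
rewrite -[n.+2%:R]natr1 le_eqVlt; apply/orP; left; apply/eqP.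
by move: k0; move: (n.+1%:R : R) => k k0; field; rewrite gt_eqF.
Qed.

Lemma evol_cvg t p a :
  (fun n => csq (evol (t / n.+1%:R) n.+1 p a - expi (t * eps m p) * (v a p)%:C))
    @ \oo --> (0 : R).
Proof.
(* With n steps of length t / n the bound n^2 10 (5 (t / n)^2 eps^2)^2 is this constant divided by
   n^2. *)
pose K := 250 * (t ^+ 2 * eps m p ^+ 2) ^+ 2.
apply: (@cvg_squeeze0 _ _ (fun n => K * harmonic n)); last first.
  rewrite -(mulr0 K); apply: cvgM; [exact: cvg_cst|exact: cvg_harmonic].
move=> n; rewrite csq_ge0 /=.
have := evol_err (t / n.+1%:R) n.+1 p.
rewrite (_ : n.+1%:R * (t / n.+1%:R) * eps m p = t * eps m p); last first.
  by rewrite mulrCA mulfV ?mulr1// pnatr_eq0.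
move=> h; apply: (@le_trans _ _ (n.+1%:R ^+ 2 *
   (10 * (5 * (t / n.+1%:R) ^+ 2 * eps m p ^+ 2) ^+ 2))).
  apply: le_trans h; rewrite (bigD1 a) //= lerDl.
  by apply: sumr_ge0 => b _; exact: csq_ge0.
rewrite (_ : _ * _ = K * (n.+1%:R^-1) ^+ 2); last first.
  rewrite /K; have : n.+1%:R != 0 :> R by rewrite pnatr_eq0.
  by move: (n.+1%:R : R) => k k0; field.
apply: ler_wpM2l; first exact: mulr_ge0 (ler0n _ 250) (sqr_ge0 _).
by rewrite expr2 ler_piMl// invf_le1// ler1n.
Qed.

Definition evolf s n phi (a : 'I_5) : R3 R -> C := fun p => evol s n p a * phi p.

Lemma evolfS s n phi a : evolf s n.+1 phi a = mstepf s (evolf s n phi) a.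
Proof.
apply: funext => p; rewrite /evolf /mstepf /evol iterS -/(evol s n p).
rewrite mulrC -mstepZ; congr (mstep _ _ a); apply: funext => b; exact: mulrC.
Qed.

Lemma L2_evolf s n phi a : L2 phi -> L2 (evolf s n phi a).
Proof.
move=> fL; apply: (L2Mb (k := 1)) fL; first exact: cmeas_evol.
by move=> p; exact: csq_evol_le.
Qed.

(** The error bound grows like eps(p)^4 and gives convergence only pointwise in p. The contraction
    property supplies the domination by 4 |phi|^2. *)
Lemma evolf_cvg t phi a : L2 phi ->
  L2cvg leb (fun n => evolf (t / n.+1%:R) n.+1 phi a) (vmul m a (V m t phi)).
Proof.
move=> fL; have mf := L2_meas fL.
have mV : cmeasurable setT (fun p : R3 R => expi (t * eps m p) : C).
  apply: cmeas_expi; apply: measurable_funM; first exact: measurable_cst.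
  exact: measurable_eps.
apply: (@L2_dct _ _ _ leb _ _ (fun p => 4 * csq (phi p))).
- move=> n; exact: (cmeasM (cmeas_evol _ _ _) mf).
- exact: (cmeasM (cmeas_vcomp m0 a) (cmeasM mV mf)).
- by apply: integrableZ_EFin; exact: L2_int.
- move=> n p; apply: (le_trans (csqB_le _ _)).
  rewrite /evolf /vmul /V !csqM csq_expi mul1r csq_real.
  have h1 := ler_wpM2r (csq_ge0 (phi p)) (csq_evol_le (t / n.+1%:R) n.+1 p a).
  have h2 := ler_wpM2r (csq_ge0 (phi p)) (sqr_vcomp_le1 m0 a p).
  rewrite (_ : 4 * _ = 2 * (1 * csq (phi p) + 1 * csq (phi p))); last by ring.
  by rewrite ler_pM2l//; exact: lerD.
- move=> p; rewrite (_ : (fun n => _) = (fun n => csq (evol (t / n.+1%:R) n.+1 p a -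
      expi (t * eps m p) * (v a p)%:C) * csq (phi p))); last first.
    apply: funext => n; rewrite -csqM /evolf /vmul /V; congr csq; ring.
  rewrite -(mul0r (csq (phi p))); apply: cvgM; [exact: evol_cvg|exact: cvg_cst].
Qed.

End MomentumIteration.

(** * The evolution step in position space *)

Section PositionStep.
Variable R : realType.
Local Notation C := R[i].
Local Notation leb := (@lebesgue3 R).
Local Notation L2 := (LC leb 2%:E).
Local Notation nsq := (nsq leb).
Local Notation Finv := (@Finv R).
Local Notation wave := (R3 R -> C).
Local Notation op := (wave -> wave).
Variable m : R.
Implicit Types (p x : R3 R) (phi f : wave) (F Z : 'I_5 -> wave) (P Q : 'I_4 -> wave)
  (A : op) (k : 'I_4) (s : R).

Definition mixf P Q Z (a : 'I_5) : wave := fun x => mix (P ^~ x) (Q ^~ x) (Z ^~ x) a.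

Lemma linear_op_mixf A P Q Z a : linear_op A ->
  (forall k, L2 (P k)) -> (forall k, L2 (Q k)) -> (forall b, L2 (Z b)) ->
  A (mixf P Q Z a) = mixf (A \o P) (A \o Q) (A \o Z) a %[ae leb].
Proof.
move=> lA LP LQ LZ.
pose G k : wave := fun x => rot2 (P ^~ x) (Q ^~ x) (Z ^~ x) k a.
pose G' k : wave := fun x => rot2 ((A \o P) ^~ x) ((A \o Q) ^~ x) ((A \o Z) ^~ x) k a.
have GE k : L2 (G k) /\ A (G k) = G' k %[ae leb].
  rewrite /G /G' /rot2; case: (unlift ord0 a) => [l|].
    case: eqP => _; last by split; [exact: LZ|exact: ae_eq_refl].
    have LB := L2B (LP k) (LQ k).
    split; first exact: (L2Z 2^-1 LB).
    apply: (aeT (linear_opZ 2^-1 lA LB)).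
    by apply: (ae_imp (linear_opB lA (LP k) (LQ k))) => x h hx; rewrite /= (h hx).
  have LD := L2D (LP k) (LQ k).
  split; first exact: (L2Z 2^-1 LD).
  apply: (aeT (linear_opZ 2^-1 lA LD)).
  by apply: (ae_imp (linear_opD lA (LP k) (LQ k))) => x h hx; rewrite /= (h hx).
apply: (aeT (linear_op_sum (fun=> 4^-1) lA (fun k => (GE k).1))).
apply: (ae_imp (ae_finite (fun k => (GE k).2))) => x h _.
by apply: eq_bigr => k _; rewrite h.
Qed.

Lemma L2_mixf P Q Z a : (forall k, L2 (P k)) -> (forall k, L2 (Q k)) ->
  (forall b, L2 (Z b)) -> L2 (mixf P Q Z a).
Proof.
move=> LP LQ LZ; apply: L2_sum => k; apply: L2Z; rewrite /rot2.
case: (unlift ord0 a) => [l|]; last exact: (L2Z 2^-1 (L2D (LP k) (LQ k))).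
case: eqP => _; last exact: LZ.
exact: (L2Z 2^-1 (L2B (LP k) (LQ k))).
Qed.

(** The entry p_i of the symbol translates by 4 s along the i-th axis; the constant entry m moves
    nothing and contributes only the phase [angle]. *)
Definition hop s k : R * R * R :=
  if unlift ord0 k is Some i then scal3 (4 * s) (bas3 R i) else 0.

Definition angle s k : R := if unlift ord0 k is Some _ then 0 else 4 * s * m.

Lemma hopN s k : hop (- s) k = - hop s k.
Proof.
rewrite /hop; case: (unlift ord0 k) => [i|]; last by rewrite oppr0.
by rewrite mulrN scal3N.
Qed.

Lemma step_phaseE s p k : step_phase m s p k = angle s k + dot3 (hop s k) p.
Proof.
rewrite /step_phase /angle /hop /energy_comp.
case: (unlift ord0 k) => [i|]; first by rewrite add0r dot3_scall dot3C dot3_basr.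
by rewrite (_ : dot3 0 p = 0) ?addr0// /dot3 sum3 /coord3 /= !mul0r !addr0.
Qed.

Lemma step_phaseN s p k : - step_phase m s p k = step_phase m (- s) p k.
Proof. by rewrite /step_phase; ring. Qed.

Definition kick s k f : wave := fun p => expi (step_phase m s p k) * f p.

Definition transport s k f : wave := fun x => expi (angle s k) * f (x + hop s k).

Lemma kickE s k f : kick s k f = fun p => expi (angle s k) * phase (hop s k) f p.
Proof. by apply: funext => p; rewrite /kick /phase mulrA -expiD -step_phaseE. Qed.

Lemma L2_kick s k f : L2 f -> L2 (kick s k f).
Proof. move=> fL; rewrite kickE; apply: L2Z.
by have [[L _ _] _] := isom_phase (hop s k); exact: L. Qed.

Lemma L2_transport s k f : L2 f -> L2 (transport s k f).
Proof.
move=> fL; apply: L2Z; have [mp pl] := translation_preserving (hop s k).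
exact: (L2_preserving mp pl).
Qed.

Lemma Finv_kick s k f : L2 f -> Finv (kick s k f) = transport s k (Finv f) %[ae leb].
Proof.
move=> fL; rewrite kickE; have [lF _] := isom_Finv R.
have LP : L2 (phase (hop s k) f) by have [[L _ _] _] := isom_phase (hop s k); exact: L.
apply: (aeT (linear_opZ _ lF LP)).
by apply: (ae_imp (Finv_phase (hop s k) fL)) => x h hx; rewrite /transport (h hx).
Qed.

Lemma transport_ae s k f g : f = g %[ae leb] ->
  transport s k f = transport s k g %[ae leb].
Proof.
move=> fg; have [mp pl] := translation_preserving (hop s k).
by apply: (ae_imp (ae_eq_preserving mp pl fg)) => x h hx; rewrite /transport (h hx).
Qed.

Definition pstep s F (a : 'I_5) : wave :=
  mixf (fun k => transport s k (fun x => F ord0 x + F (lift ord0 k) x))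
       (fun k => transport (- s) k (fun x => F ord0 x - F (lift ord0 k) x)) F a.

Lemma L2_pstep s F a : (forall b, L2 (F b)) -> L2 (pstep s F a).
Proof.
move=> LF; apply: L2_mixf => //k; apply: L2_transport; [exact: L2D|exact: L2B].
Qed.

Lemma mstepf_mixf s F a : mstepf m s F a =
  mixf (fun k => kick s k (fun x => F ord0 x + F (lift ord0 k) x))
       (fun k => kick (- s) k (fun x => F ord0 x - F (lift ord0 k) x)) F a.
Proof.
apply: funext => p; rewrite /mstepf /mstep /mixf /kick.
by congr (mix _ _ _ a); apply: funext => k; rewrite step_phaseN.
Qed.

(** Averages and characteristic variables have constant coefficients and commute with [Finv], while
    the phases become translations. *)
Lemma Finv_mstepf s F a : (forall b, L2 (F b)) ->
  Finv (mstepf m s F a) = pstep s (Finv \o F) a %[ae leb].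
Proof.
move=> LF; have [lF _] := isom_Finv R; rewrite mstepf_mixf.
have LD k := L2D (LF ord0) (LF (lift ord0 k)).
have LB k := L2B (LF ord0) (LF (lift ord0 k)).
have h := linear_op_mixf a lF (fun k => L2_kick s k (LD k)) (fun k => L2_kick (- s) k (LB k)) LF.
apply: (aeT h).
have hP k := aeT (Finv_kick s k (LD k))
  (transport_ae s k (linear_opD lF (LF ord0) (LF (lift ord0 k)))).
have hQ k := aeT (Finv_kick (- s) k (LB k))
  (transport_ae (- s) k (linear_opB lF (LF ord0) (LF (lift ord0 k)))).
apply: (ae_imp2 (ae_finite hP) (ae_finite hQ)) => x eP eQ _.
by rewrite /pstep /mixf; congr (mix _ _ _ a); apply: funext => k /=; rewrite ?eP ?eQ.
Qed.

End PositionStep.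

Section WeightedNorm.
Variable R : realType.
Local Notation C := R[i].
Local Notation leb := (@lebesgue3 R).
Local Notation L2 := (LC leb 2%:E).
Local Notation nsq := (nsq leb).
Local Notation wave := (R3 R -> C).
Implicit Types (w : R3 R -> R) (f : wave) (F : 'I_5 -> wave).

Definition wgt w := measurable_fun setT w /\ forall x, 0 <= w x <= 1.

Lemma wgt_int w f : wgt w -> L2 f -> leb.-integrable setT (EFin \o (fun x => w x * csq (f x))).
Proof.
move=> [mw w01] fL; apply: (integrable_dom _ (L2_int fL)).
  by apply: measurable_funM mw _; exact: measurable_csq (L2_meas fL).
move=> x; have /andP[w0 w1] := w01 x.
by rewrite ger0_norm ?mulr_ge0 ?csq_ge0// ler_piMl// csq_ge0.
Qed.

Definition wnorm w F : R := \int[leb]_x (w x * \sum_a csq (F a x)).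

Lemma wnorm_int w F : wgt w -> (forall a, L2 (F a)) ->
  leb.-integrable setT (EFin \o (fun x => w x * \sum_a csq (F a x))).
Proof.
move=> hw LF; rewrite (_ : EFin \o _ = (fun x => (\sum_a (w x * csq (F a x))%:E)%E)).
  by apply: integrable_sum => // a _; exact: (wgt_int hw (LF a)).
by apply: funext => x /=; rewrite sumEFin mulr_sumr.
Qed.

Lemma wnorm_sum w F : wgt w -> (forall a, L2 (F a)) ->
  wnorm w F = \sum_a \int[leb]_x (w x * csq (F a x)).
Proof.
move=> hw LF; rewrite -Rintegral_sum => [|a]; last exact: (wgt_int hw (LF a)).
by rewrite /wnorm; under eq_Rintegral do rewrite mulr_sumr.
Qed.

Lemma wgt_nsq w f : (forall x, 0 <= w x) ->
  \int[leb]_x (w x * csq (f x)) = nsq (fun x => (Num.sqrt (w x))%:C * f x).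
Proof.
by move=> w0; apply: eq_Rintegral => x _; rewrite csqM csq_real sqr_sqrtr.
Qed.

(** The square root of w turns the weighted mass into a sum of squared norms, which are
    continuous. *)
Lemma wnorm_cvg w (F : nat -> 'I_5 -> wave) (G : 'I_5 -> wave) : wgt w ->
  (forall n a, L2 (F n a)) -> (forall a, L2 (G a)) ->
  (forall a, L2cvg leb (fun n => F n a) (G a)) ->
  (fun n => wnorm w (F n)) @ \oo --> wnorm w G.
Proof.
move=> hw LF LG h; have [mw w01] := hw.
have w0 x : 0 <= w x by case/andP: (w01 x).
rewrite wnorm_sum// (_ : (fun n => _) = (fun n => \sum_a \int[leb]_x (w x * csq (F n a x)))).
  apply: cvg_sum_ord => a; rewrite wgt_nsq//.
  under eq_fun do rewrite wgt_nsq//.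
  have ms : cmeasurable setT (fun x => (Num.sqrt (w x))%:C : C).
    apply: cmeas_real; apply: (@measurableT_comp _ _ _ _ _ _ (@Num.sqrt R)); last exact: mw.
    by apply: continuous_measurable_fun; exact: sqrt_continuous.
  have s1 x : csq (Num.sqrt (w x))%:C <= 1 :> R.
    by rewrite csq_real sqr_sqrtr//; case/andP: (w01 x).
  apply: L2cvg_nsq.
  - by move=> n; exact: (L2Mb ms s1 (LF n a)).
  - exact: (L2Mb ms s1 (LG a)).
  - exact: (L2cvgM (fun n => LF n a) (LG a) ms s1 (h a)).
by apply: funext => n; exact: wnorm_sum.
Qed.

Lemma wnorm_ae w F G : wgt w -> (forall a, L2 (F a)) -> (forall a, L2 (G a)) ->
  (forall a, F a = G a %[ae leb]) -> wnorm w F = wnorm w G.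
Proof.
move=> hw LF LG h; apply: ae_eq_Rintegral.
- exact: measurableT.
- exact/measurable_EFinP/(measurable_int _ (wnorm_int hw LF)).
- exact/measurable_EFinP/(measurable_int _ (wnorm_int hw LG)).
- apply: (ae_imp (ae_finite h)) => x e _.
  by congr (_ * _); apply: eq_bigr => a _; rewrite e.
Qed.

End WeightedNorm.

(** * Finite propagation speed *)

Section StepInequality.
Variable R : realType.
Local Notation C := R[i].
Local Notation leb := (@lebesgue3 R).
Local Notation L2 := (LC leb 2%:E).
Local Notation nsq := (nsq leb).
Local Notation wave := (R3 R -> C).
Variable m : R.
Implicit Types (x : R3 R) (z : 'I_5 -> C) (F : 'I_5 -> wave).

Lemma sqr_dot3_le (x y : R * R * R) : dot3 x y ^+ 2 <= dot3 x x * dot3 y y.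
Proof.
rewrite !dot3E; case: x => [[a b] c]; case: y => [[d e] f] /=.
have := sqr_ge0 (a * e - b * d); have := sqr_ge0 (a * f - c * d).
have := sqr_ge0 (b * f - c * e); nra.
Qed.

Lemma young_bound (a X q Z : R) : 0 <= Z -> X ^+ 2 <= Z ^+ 2 * q ->
  2 * (a * X) <= Z * (a ^+ 2 + q).
Proof.
move=> Z0 h; have [Ze|Zn] := eqVneq Z 0.
  have X0 : X = 0.
    by apply/eqP; rewrite -sqrf_eq0 eq_le sqr_ge0 andbT; rewrite Ze expr0n mul0r in h.
  by rewrite X0 Ze !mulr0 mul0r.
have Zp : 0 < Z by rewrite lt_neqAle eq_sym Zn.
rewrite -(ler_pM2l Zp); have := sqr_ge0 (Z * a - X); nra.
Qed.

(* The flux Re (conj z_0 z_i) of the mass is at most half of the density: the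
   propagation speed is 1. *)
Lemma flux_bound (ze : R * R * R) (Z : R) (z0 : C) (z : 'I_3 -> C) : 0 <= Z ->
  dot3 ze ze <= Z ^+ 2 ->
  2 * `|\sum_i coord3 i ze * complex.Re (Num.conj z0 * z i)| <=
  Z * (csq z0 + \sum_i csq (z i)).
Proof.
move=> Z0 hz.
pose b : R * R * R := (complex.Re (z 0), complex.Re (z 1), complex.Re (z 2)).
pose c : R * R * R := (complex.Im (z 0), complex.Im (z 1), complex.Im (z 2)).
have hb : dot3 ze b ^+ 2 <= Z ^+ 2 * dot3 b b.
  by apply: (le_trans (sqr_dot3_le _ _)); rewrite ler_wpM2r// dot3_ge0.
have hc : dot3 ze c ^+ 2 <= Z ^+ 2 * dot3 c c.
  by apply: (le_trans (sqr_dot3_le _ _)); rewrite ler_wpM2r// dot3_ge0.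
have -> : \sum_i csq (z i) = dot3 b b + dot3 c c.
  by rewrite sum3 !dot3E /csq /=; ring.
have -> : \sum_i coord3 i ze * complex.Re (Num.conj z0 * z i) =
    complex.Re z0 * dot3 ze b + complex.Im z0 * dot3 ze c.
  by rewrite sum3 !dot3E !cE /coord3 /=; ring.
move: hb hc; rewrite /csq; move: (complex.Re z0) (complex.Im z0) => u w.
move: (dot3 ze b) (dot3 ze c) (dot3 b b) (dot3 c c) => X Y q r hX hY.
have h1 := young_bound u Z0 hX; have h2 := young_bound w Z0 hY.
have h3 := young_bound (- u) Z0 hX; have h4 := young_bound (- w) Z0 hY.
rewrite -[2]ger0_norm// -normrM ler_norml; move: h3 h4; rewrite !sqrrN; lra.
Qed.

Variable D : set (R * R * R).
Hypothesis D0 : D !=set0.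
Variables dl la r0 : R.
Hypothesis dl0 : 0 < dl.
Hypothesis la0 : 0 < la.
Local Notation W := (weight D dl la r0).
Local Notation K := (step_cst dl la).

Lemma wgt_weight tau : wgt (W tau : R3 R -> R).
Proof. by split; [exact: measurable_weight|move=> x; exact: weight_01]. Qed.

(** The contribution of the k-th evolution to the weighted mass after a step, with the translations
    moved from the field to the weight. *)
Definition part (tau s : R) z x (k : 'I_4) : R :=
  2^-1 * (W tau (x - hop s k) * csq (z ord0 + z (lift ord0 k)) +
          W tau (x + hop s k) * csq (z ord0 - z (lift ord0 k))) +
  W tau x * \sum_(l | l != k) csq (z (lift ord0 l)).

(** To first order k = 0 contributes w N, and the i-th axis at most w N - 8 s zeta_i rho_i with the
    flux rho_i = Re (conj z_0 z_i). The average is w N - 2 s zeta . rho, at most (w + |s| Z) N by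
    [flux_bound], and [weight_step] compares w + |s| Z with the weight at the later time. One K s^2
    covers the translations, the other the shift of time. *)
Lemma part_bound tau s z x : s != 0 -> `|s| <= 1 ->
  4^-1 * \sum_k part tau s z x k <=
  (W (tau + `|s|) x + 2 * K * s ^+ 2) * \sum_a csq (z a).
Proof.
move=> sn s1; have [ze [Z [Z0 hz hstep hlast]]] := weight_step D0 r0 dl0 la0 tau x sn s1.
set N := \sum_a csq (z a); set w := W tau x.
have N0 : 0 <= N by apply: sumr_ge0 => a _; exact: csq_ge0.
have K0 : 0 <= K * s ^+ 2 by rewrite mulr_ge0 ?sqr_ge0// step_cst_ge0.
pose rh (i : 'I_3) := complex.Re (Num.conj (z ord0) * z (lift ord0 (lift ord0 i))).
have p0 : part tau s z x ord0 = w * N.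
  rewrite /part /hop unlift_none subr0 addr0 -/w -mulrDr mulrCA csq_sumsub -mulrDr.
  by rewrite /N (sum_csq_split z ord0).
have pl (i : 'I_3) : part tau s z x (lift ord0 i) <=
    w * N - 8 * s * (coord3 i ze * rh i) + K * s ^+ 2 * N.
  have hp := hstep i s erefl; have hm := hstep i (- s) (sqrrN s).
  rewrite /part /hop liftK -scal3N -mulrN -/w; rewrite -/w in hp hm.
  set A := csq (z ord0 + _); set B := csq (z ord0 - _).
  have A0 : 0 <= A by exact: csq_ge0.
  have B0 : 0 <= B by exact: csq_ge0.
  have AB : A - B = 4 * rh i.
    rewrite /A /B /rh /csq !cE; case: (z ord0) => a1 a2; case: (z _) => b1 b2 /=; ring.
  have AN : 2^-1 * (A + B) + \sum_(l | l != lift ord0 i) csq (z (lift ord0 l)) = N.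
    by rewrite /A /B csq_sumsub /N (sum_csq_split z (lift ord0 i)).
  have S0 : 0 <= \sum_(l | l != lift ord0 i) csq (z (lift ord0 l)).
    by apply: sumr_ge0 => l _; exact: csq_ge0.
  have h1 := ler_wpM2r A0 hm; have h2 := ler_wpM2r B0 hp.
  move: (\sum_(l | _) _) AN S0 => S AN S0.
  have h3 : 0 <= K * s ^+ 2 * S by exact: mulr_ge0.
  rewrite -AN (_ : 8 * s * (coord3 i ze * rh i) = 2 * s * coord3 i ze * (A - B)); last first.
    by rewrite AB; ring.
  move: h1 h2 h3; move: (W _ _) (W _ _) (K * s ^+ 2) => P Q k.
  move: (coord3 i ze) => e; clear; nra.
have flux := flux_bound (z ord0) (fun i => z (lift ord0 (lift ord0 i))) Z0 hz.
have flux' : - 2 * s * (\sum_i coord3 i ze * rh i) <= `|s| * Z * N.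
  apply: (le_trans (ler_norm _)); rewrite !normrM normrN (ger0_norm (x := 2))//.
  rewrite mulrAC (mulrC _ `|s|) -[leRHS]mulrA ler_wpM2l//.
  apply: (le_trans flux); rewrite ler_wpM2l// /N [leRHS]big_ord_recl lerD2l.
  by rewrite [leRHS]big_ord_recl lerDr csq_ge0.
rewrite big_ord_recl p0.
have hs : \sum_(i < 3) part tau s z x (lift ord0 i) <=
    \sum_(i < 3) (w * N - 8 * s * (coord3 i ze * rh i) + K * s ^+ 2 * N).
  by apply: ler_sum => i _; exact: pl.
apply: (@le_trans _ _ ((w + `|s| * Z + K * s ^+ 2) * N)); last first.
  by apply: ler_wpM2r => //; move: hlast; rewrite -/w; lra.
have hE : \sum_(i < 3) (w * N - 8 * s * (coord3 i ze * rh i) + K * s ^+ 2 * N) =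
    3 * (w * N) - 8 * s * (\sum_i coord3 i ze * rh i) + 3 * (K * s ^+ 2 * N).
  by rewrite !sum3; ring.
rewrite hE in hs; move: hs flux' K0 N0.
move: (\sum_(i < 3) coord3 i ze * rh i) (\sum_(i < 3) part _ _ _ _ _) => S T.
move: (K * s ^+ 2) => k hs hf k0 N0.
have : 0 <= k * N by exact: mulr_ge0.
by move: hs hf; clear; lra.
Qed.

Lemma avg_int (A B r : 'I_4 -> R3 R -> R) :
  (forall k, leb.-integrable setT (EFin \o A k)) ->
  (forall k, leb.-integrable setT (EFin \o B k)) ->
  (forall k, leb.-integrable setT (EFin \o r k)) ->
  let G x := \sum_k 4^-1 * (2^-1 * (A k x + B k x) + r k x) in
  leb.-integrable setT (EFin \o G) /\
  \int[leb]_x G x = \sum_k 4^-1 * (2^-1 * (\int[leb]_x A k x + \int[leb]_x B k x)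
    + \int[leb]_x r k x).
Proof.
move=> iA iB ir G.
have iS k := integrableZ_EFin 2^-1 (integrableD_EFin (iA k) (iB k)).
have iT k := integrableD_EFin (iS k) (ir k).
have iU k := integrableZ_EFin 4^-1 (iT k).
split.
  rewrite (_ : EFin \o G = (fun x => (\sum_k (4^-1 * (2^-1 * (A k x + B k x) + r k x))%:E)%E)).
    by apply: integrable_sum => [|k _]; [exact: measurableT|exact: (iU k)].
  by apply: funext => x /=; rewrite sumEFin.
rewrite (Rintegral_sum iU); apply: eq_bigr => k _.
rewrite (RintegralZl _ measurableT (iT k)) (RintegralD measurableT (iS k) (ir k)).
by rewrite (RintegralZl _ measurableT (integrableD_EFin (iA k) (iB k)))
  (RintegralD measurableT (iA k) (iB k)).
Qed.

Lemma wgt_translate tau h : wgt (fun x : R3 R => W tau (x + h)).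
Proof.
have [mp _] := translation_preserving h; have [mw w01] := wgt_weight tau.
by split; [exact: (measurableT_comp mw mp)|move=> x; exact: w01].
Qed.

Lemma int_translate tau h (f : wave) : L2 f ->
  [/\ leb.-integrable setT (EFin \o (fun x => W tau x * csq (f (x + h)))),
      leb.-integrable setT (EFin \o (fun x => W tau (x - h) * csq (f x))) &
      \int[leb]_x (W tau x * csq (f (x + h))) = \int[leb]_x (W tau (x - h) * csq (f x))].
Proof.
move=> fL; have [mp pl] := translation_preserving h.
have i2 := wgt_int (wgt_translate tau (- h)) fL.
split; first exact: (wgt_int (wgt_weight tau) (L2_preserving mp pl fL)).
  exact: i2.
rewrite -[RHS](Rintegral_preserving mp pl); last first.
  exact/measurable_EFinP/(measurable_int _ i2).
by apply: eq_Rintegral => x _; rewrite addrK.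
Qed.

(** Convexity reduces the step to single transports; translation invariance of the integral moves
    these onto the weight, where [part_bound] applies pointwise. *)
Lemma wnorm_pstep tau s F : s != 0 -> `|s| <= 1 -> (forall a, L2 (F a)) ->
  wnorm (W tau) (pstep m s F) <=
  wnorm (W (tau + `|s|)) F + 2 * K * s ^+ 2 * \sum_a nsq (F a).
Proof.
move=> sn s1 LF.
have hw := wgt_weight tau; have hw' := wgt_weight (tau + `|s|).
pose p k : wave := fun x => F ord0 x + F (lift ord0 k) x.
pose q k : wave := fun x => F ord0 x - F (lift ord0 k) x.
have Lp k : L2 (p k) by exact: L2D.
have Lq k : L2 (q k) by exact: L2B.
pose r k x := W tau x * \sum_(l | l != k) csq (F (lift ord0 l) x).
have ir k : leb.-integrable setT (EFin \o r k).
  pose G l : wave := if l != k then F (lift ord0 l) else (fun=> 0).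
  have LG l : L2 (G l) by rewrite /G; case: ifP => _; [exact: LF|exact: L2_0].
  rewrite (_ : EFin \o r k = (fun x => (\sum_l (W tau x * csq (G l x))%:E)%E)).
    apply: integrable_sum => [|l _]; [exact: measurableT|exact: (wgt_int hw (LG l))].
  apply: funext => x /=; rewrite sumEFin -mulr_sumr /r; congr (_ * _)%:E.
  rewrite big_mkcond; apply: eq_bigr => l _; rewrite /G; case: ifP => // _.
  by rewrite csq0.
pose A k x := W tau x * csq (p k (x + hop s k)).
pose B k x := W tau x * csq (q k (x - hop s k)).
pose A' k x := W tau (x - hop s k) * csq (p k x).
pose B' k x := W tau (x + hop s k) * csq (q k x).
have hA k := int_translate tau (hop s k) (Lp k).
have hB k := int_translate tau (- hop s k) (Lq k).
have iA k : leb.-integrable setT (EFin \o A k) by case: (hA k).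
have iA' k : leb.-integrable setT (EFin \o A' k) by case: (hA k).
have iB k : leb.-integrable setT (EFin \o B k) by case: (hB k).
have iB' k : leb.-integrable setT (EFin \o B' k).
  have [_ h _] := hB k; move: h; congr (integrable _ _ _).
  by apply: funext => x; rewrite /= /B' opprK.
have eA k : \int[leb]_x A k x = \int[leb]_x A' k x by case: (hA k).
have eB k : \int[leb]_x B k x = \int[leb]_x B' k x.
  have [_ _ e] := hB k; apply: (etrans e); apply: eq_Rintegral => x _.
  by rewrite /B' opprK.
have [iG eG] := avg_int iA iB ir; have [iG' eG'] := avg_int iA' iB' ir.
have LP a : L2 (pstep m s F a) by exact: L2_pstep.
apply: (le_trans (le_Rintegral measurableT (wnorm_int hw LP) iG _)) => [x _|].
  rewrite -mulr_sumr; have w0 : 0 <= W tau x by case/andP: (weight_01 D dl la r0 tau x).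
  apply: (le_trans (ler_wpM2l w0 (sum_csq_mix _ _ _))).
  rewrite mulrCA ler_wpM2l// mulr_sumr le_eqVlt; apply/orP; left; apply/eqP.
  apply: eq_bigr => k _; rewrite mulrDr /r; congr (_ + _).
  by rewrite mulrCA /A /B mulrDr /transport !csqM !csq_expi !mul1r hopN.
have -> : \int[leb]_x (\sum_k 4^-1 * (2^-1 * (A k x + B k x) + r k x)) =
   \int[leb]_x (\sum_k 4^-1 * (2^-1 * (A' k x + B' k x) + r k x)).
  by rewrite eG eG'; apply: eq_bigr => k _; rewrite eA eB.
have iN := wnorm_int hw' LF.
have wgt1 : wgt (fun _ : R3 R => 1 : R).
  by split; [exact: measurable_cst|move=> x; rewrite ler01 lexx].
have i1 := wnorm_int wgt1 LF.
have iK := integrableZ_EFin (2 * K * s ^+ 2) i1.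
have e1 : \sum_a nsq (F a) = wnorm (fun=> 1) F.
  rewrite (wnorm_sum wgt1 LF); apply: eq_bigr => a _; apply: eq_Rintegral => x _.
  by rewrite mul1r.
rewrite e1 /wnorm -(RintegralZl _ measurableT i1) -(RintegralD measurableT iN iK).
apply: (le_Rintegral measurableT iG' (integrableD_EFin iN iK)) => x _.
have := part_bound tau (F ^~ x) x sn s1; rewrite mulr_sumr mul1r -mulrDl.
exact.
Qed.

End StepInequality.

Section Propagation.
Variable R : realType.
Local Notation C := R[i].
Local Notation leb := (@lebesgue3 R).
Local Notation L2 := (LC leb 2%:E).
Local Notation nsq := (nsq leb).
Local Notation Finv := (@Finv R).
Local Notation wave := (R3 R -> C).
Variable m : R.
Hypothesis m0 : 0 < m.
Implicit Types (x : R3 R) (F : 'I_5 -> wave) (phi : wave).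

Lemma sum_nsq_evolf s n phi : L2 phi ->
  \sum_a nsq (Finv (evolf m s n phi a)) <= nsq phi.
Proof.
move=> fL; have [_ nF] := isom_Finv R.
have LE a : L2 (evolf m s n phi a) by exact: L2_evolf.
under eq_bigr => a _ do rewrite (nF _ (LE a)).
rewrite -Rintegral_sum => [|a]; last exact: (L2_int (LE a)).
apply: le_Rintegral; [exact: measurableT| |exact: (L2_int fL)|].
  rewrite (_ : EFin \o _ = (fun x => (\sum_a (csq (evolf m s n phi a x))%:E)%E)).
    by apply: integrable_sum => [|a _]; [exact: measurableT|exact: (L2_int (LE a))].
  by apply: funext => x /=; rewrite sumEFin.
move=> x _; under eq_bigr do rewrite csqM.
by rewrite -mulr_suml ler_piMl ?csq_ge0// sum_csq_evol.
Qed.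

Section FixedSet.
Variable D : set (R * R * R).
Hypothesis D0 : D !=set0.
Local Notation d := (dist D).

Section FixedWeight.
Variables dl la r0 : R.
Hypothesis dl0 : 0 < dl.
Hypothesis la0 : 0 < la.
Local Notation W := (weight D dl la r0).
Local Notation K := (step_cst dl la).

(** Each step advances the weight by |s| and costs O(s^2) times the mass of phi, which bounds that
    of every iterate. The last step is peeled off first, so the induction hypothesis is needed at a
    later tau. *)
Lemma wnorm_evolf s n tau phi : s != 0 -> `|s| <= 1 -> L2 phi ->
  wnorm (W tau) (fun a => Finv (evolf m s n phi a)) <=
  wnorm (W (tau + n%:R * `|s|)) (fun a => vtr m a phi) +
    n%:R * (2 * K * s ^+ 2 * nsq phi).
Proof.
move=> sn s1 fL; elim: n tau => [|n ih] tau; first by rewrite !mul0r !addr0.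
have [[LF _ _] _] := isom_Finv R.
have LE k a : L2 (evolf m s k phi a) by exact: L2_evolf.
have LG a : L2 (Finv (evolf m s n phi a)) by exact: LF (LE n a).
have K0 : 0 <= 2 * K * s ^+ 2.
  by rewrite mulr_ge0 ?sqr_ge0// mulr_ge0// (step_cst_ge0 dl0 la0).
rewrite (@wnorm_ae _ _ _ (pstep m s (fun a => Finv (evolf m s n phi a)))).
- apply: (le_trans (wnorm_pstep m D0 r0 dl0 la0 _ sn s1 LG)).
  have h := ih (tau + `|s|).
  rewrite (_ : tau + `|s| + n%:R * `|s| = tau + n.+1%:R * `|s|) in h; last first.
    by rewrite -natr1; ring.
  apply: (le_trans (lerD h (ler_wpM2l K0 (sum_nsq_evolf s n fL)))).
  rewrite -addrA lerD2l -(natr1 n) [leRHS](mulrDl n%:R 1) mul1r; exact: lexx.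
- exact: wgt_weight.
- by move=> a; exact: LF (LE n.+1 a).
- by move=> a; exact: L2_pstep.
- move=> a; rewrite evolfS; exact: Finv_mstepf.
Qed.

Lemma wnorm_propagation t phi : t != 0 -> L2 phi ->
  wnorm (W 0) (fun a => vtr m a (V m t phi)) <= wnorm (W `|t|) (fun a => vtr m a phi).
Proof.
move=> tn fL; have [iF nF] := isom_Finv R; have [LF _ _] := iF.
have LV : L2 (V m t phi).
  apply: (L2Mb (k := 1)) fL => [|p]; last by rewrite csq_expi.
  apply: cmeas_expi; apply: measurable_funM; first exact: measurable_cst.
  exact: measurable_eps.
have LE s n a : L2 (evolf m s n phi a) by exact: L2_evolf.
have LM a : L2 (vmul m a (V m t phi)) by exact: L2_vmul.
have cv : (fun n => wnorm (W 0) (fun a => Finv (evolf m (t / n.+1%:R) n.+1 phi a))) @ \oo -->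
    wnorm (W 0) (fun a => vtr m a (V m t phi)).
  apply: wnorm_cvg.
  - exact: wgt_weight.
  - by move=> n a; exact: LF (LE _ _ _).
  - by move=> a; exact: LF (LM a).
  - move=> a; apply: (isom_cvg (isom_Finv R) _ (LM a)) => [n|]; first exact: LE.
    exact: evolf_cvg.
pose B := wnorm (W `|t|) (fun a => vtr m a phi).
pose c := 2 * K * t ^+ 2 * nsq phi.
have cB : (fun n => B + c * harmonic n) @ \oo --> B.
  rewrite -[X in _ --> X]addr0 -[X in _ + X](mulr0 c); apply: cvgD; first exact: cvg_cst.
  by apply: cvgM; [exact: cvg_cst|exact: cvg_harmonic].
(* From this index on the step t / (n + 1) has modulus at most 1, as [weight_step] demands. *)
apply: (ler_cvg_to cv cB); exists (Num.trunc `|t|).+1 => // n /= nt.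
have np : 0 < n.+1%:R :> R by [].
have sn : t / n.+1%:R != 0 by rewrite mulf_neq0// invr_neq0// pnatr_eq0.
have s1 : `|t / n.+1%:R| <= 1.
  rewrite normrM normfV (ger0_norm (ltW np)) ler_pdivrMr// mul1r; apply: ltW; apply: (lt_le_trans (truncnS_gt _)).
  by rewrite ler_nat (leq_trans nt).
apply: (le_trans (wnorm_evolf n.+1 0 sn s1 fL)).
rewrite add0r normrM normfV (ger0_norm (ltW np)) mulrCA mulfV ?gt_eqF// mulr1.
rewrite lerD2l le_eqVlt; apply/orP; left; apply/eqP.
by rewrite /c /harmonic /=; move: np; move: (n.+1%:R : R) => k k0; field; rewrite gt_eqF.
Qed.

Lemma sdist_le x : sdist D dl x <= d x + dl.
Proof.
have h0 : 0 <= d x by exact: dist_ge0.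
rewrite -(ler_pXn2r (n := 2)) ?nnegrE ?sqrtr_ge0 ?addr_ge0 ?(ltW dl0)//.
rewrite sqr_sdist sqrrD; have : 0 <= d x * dl by rewrite mulr_ge0// ltW.
lra.
Qed.

End FixedWeight.

Lemma wgt_ind (A : set (R3 R)) : measurable A -> wgt (\1_A : R3 R -> R).
Proof.
move=> mA; split; first exact: measurable_indic.
by move=> x; rewrite indicE; case: (x \in A); rewrite ?lexx ?ler01.
Qed.

Lemma wnorm_ind (A : set (R3 R)) F : measurable A -> (forall a, L2 (F a)) ->
  wnorm (\1_A) F = \sum_a nsq (ind A (F a)).
Proof.
move=> mA LF; rewrite (wnorm_sum (wgt_ind mA) LF); apply: eq_bigr => a _.
apply: eq_Rintegral => x _; rewrite /ind csqM csq_real indicE.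
by case: (x \in A); rewrite ?expr1n ?expr0n.
Qed.

Lemma wnorm_indC (A : set (R3 R)) F : measurable A -> (forall a, L2 (F a)) ->
  wnorm (\1_A) F + wnorm (\1_(~` A)) F = \sum_a nsq (F a).
Proof.
move=> mA LF; have mC := measurableC mA.
rewrite /wnorm -(RintegralD measurableT (wnorm_int (wgt_ind mA) LF) (wnorm_int (wgt_ind mC) LF)).
rewrite -Rintegral_sum => [|a]; last exact: (L2_int (LF a)).
apply: eq_Rintegral => x _; rewrite -mulrDl !indicE in_setC.
by case: (x \in A); rewrite ?addr0 ?add0r mul1r.
Qed.

Variable t : R.
Hypothesis tn : t != 0.
Local Notation far := ([set x | `|t| < d x] : set (R3 R)).

Lemma measurable_far : measurable far.
Proof.
have md := measurable_distR3 D0.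
rewrite (_ : far = d @^-1` `]`|t|, +oo[%classic).
  by rewrite -(setTI (_ @^-1` _)); apply: md => //; exact: measurable_itv.
by apply/seteqP; split=> x /=; rewrite in_itv /= andbT.
Qed.

(* The weights at time |t| vanish on D, and those at time 0 tend to the
   indicator of far as the smoothing is removed. *)
Lemma far_propagation phi : measurable (D : set (R3 R)) -> L2 phi ->
  wnorm (\1_far) (fun a => vtr m a (V m t phi)) <=
  wnorm (\1_(~` (D : set (R3 R)))) (fun a => vtr m a phi).
Proof.
move=> mD fL.
have LV : L2 (V m t phi).
  apply: (L2Mb (k := 1)) fL => [|p]; last by rewrite csq_expi.
  apply: cmeas_expi; apply: measurable_funM; first exact: measurable_cst.
  exact: measurable_eps.
have Lt a : L2 (vtr m a (V m t phi)) by exact: L2_vtr.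
have L0 a : L2 (vtr m a phi) by exact: L2_vtr.
(* With r0 = |t| + dl the argument of [smooth] at time |t| is 0 on D. At time 0 it is at least la (d
   x - |t|) - 1, hence at least 1 for large n if d x > |t|; it is at most 0 if d x <= |t|, by
   [sdist_le]. *)
pose dl n : R := n.+1%:R^-1; pose la n : R := n.+1%:R.
have dl0 n : 0 < dl n by rewrite invr_gt0.
have la0 n : 0 < la n by [].
pose w n := weight D (dl n) (la n) (`|t| + dl n).
have hw n tau : wgt (w n tau : R3 R -> R) by exact: wgt_weight.
have wgt1 : wgt (fun _ : R3 R => 1 : R).
  by split; [exact: measurable_cst|move=> x; rewrite ler01 lexx].
have N0 x (F : 'I_5 -> wave) : 0 <= \sum_a csq (F a x).
  by apply: sumr_ge0 => a _; exact: csq_ge0.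
have cv : (fun n => wnorm (w n 0) (fun a => vtr m a (V m t phi))) @ \oo -->
    wnorm (\1_far) (fun a => vtr m a (V m t phi)).
  have meas (u : R3 R -> R) : wgt u ->
      measurable_fun setT (fun x => u x * \sum_a csq (vtr m a (V m t phi) x)).
    by move=> hu; exact/measurable_EFinP/(measurable_int _ (wnorm_int hu Lt)).
  apply: (dominated_Rint _ _ _ (wnorm_int wgt1 Lt)).
  - by move=> n; exact: meas.
  - exact: (meas _ (wgt_ind measurable_far)).
  - apply: aeW => x; apply: cvgM; last exact: cvg_cst.
    rewrite indicE; case: (ltrP `|t| (d x)) => h.
      rewrite mem_set//.
      have g0 : 0 < d x - `|t| by rewrite subr_gt0.
      apply: cvg_near_cst; exists (Num.trunc (2 / (d x - `|t|))).+1 => // n /= hn.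
      rewrite /w /weight smooth_ge1// addr0.
      have h1 := sdist_ge_dist D0 (dl n) x.
      have h2 : 2 <= la n * (d x - `|t|).
        rewrite -ler_pdivrMr//; apply: ltW; apply: (lt_le_trans (truncnS_gt _)).
        by rewrite ler_nat (leq_trans hn).
      have h3 : la n * (d x) <= la n * sdist D (dl n) x by rewrite ler_pM2l.
      have h4 : la n * dl n = 1 by rewrite mulfV// pnatr_eq0.
      move: h2 h3; rewrite mulrBr mulrBr mulrDr h4; move: (la n * _) (la n * _) (la n * _).
      by move=> X Y Z h2 h3; lra.
    rewrite memNset /=; last by apply/negP; rewrite -leNgt.
    apply: cvg_near_cst; exists 0%N => // n _.
    rewrite /w /weight smooth_le0//; apply: mulr_ge0_le0; first exact: ltW.
    by have := sdist_le (dl0 n) x; lra.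
  - move=> n x; have [_ /(_ x) /andP[w0 w1]] := hw n 0.
    have S0 := N0 x (fun a => vtr m a (V m t phi)).
    by rewrite (ger0_norm (mulr_ge0 w0 S0)); exact: (ler_wpM2r S0 w1).
apply: (ler_cvg_to cv (cvg_cst _)); near=> n.
have h := wnorm_propagation (`|t| + dl n) (dl0 n) (la0 n) tn fL.
apply: (le_trans h).
apply: (le_Rintegral measurableT (wnorm_int (hw n `|t|) L0)
  (wnorm_int (wgt_ind (measurableC mD)) L0)) => x _.
apply: ler_wpM2r; first exact: (N0 x (fun a => vtr m a phi)).
have [_ /(_ x) /andP[w0 w1]] := hw n `|t|.
rewrite indicE in_setC; case: (boolP (x \in D)) => /= [|_]; last exact: w1.
rewrite inE => Dx; rewrite /w /weight /sdist (dist_in D0 Dx) expr0n add0r sqrtr_sqr gtr0_norm//.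
by rewrite (addrC `|t|) subrr mulr0 smooth_le0.
Unshelve. all: by end_near.
Qed.

(** The two sets differ only where [d x] equals |t|, which is a null set. *)
Lemma causal_nbhd_ind F : (forall a, L2 (F a)) ->
  wnorm (\1_(~` causal_nbhd t D)) F = wnorm (\1_far) F.
Proof.
move=> LF; have t0 : 0 < `|t| by rewrite normr_gt0.
have eN : causal_nbhd t D = causal_nbhd `|t| D by rewrite /causal_nbhd normr_id.
have mN : measurable (causal_nbhd t D) by rewrite eN; exact: measurable_causal_nbhd.
apply: ae_eq_Rintegral.
- exact: measurableT.
- exact/measurable_EFinP/(measurable_int _ (wnorm_int (wgt_ind (measurableC mN)) LF)).
- exact/measurable_EFinP/(measurable_int _ (wnorm_int (wgt_ind measurable_far) LF)).
- apply: (ae_imp (boundary_ae D0 t0)) => x dx _; congr (_ * _).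
  rewrite !indicE in_setC; case: (ltgtP `|t| (d x)) => h.
  + rewrite memNset ?mem_set//= eN => Dx.
    by have := nbhd_sub t0 Dx; rewrite leNgt h.
  + rewrite mem_set; last by rewrite eN; exact: open_nbhd_sub.
    by rewrite memNset//= ltNge (ltW h).
  + by case: dx.
Qed.

End FixedSet.
End Propagation.

(** * Causal time evolution *)

Section Causality.
Variable R : realType.
Local Notation C := R[i].
Local Notation leb := (@lebesgue3 R).
Local Notation L2 := (LC leb 2%:E).
Local Notation nsq := (nsq leb).
Variable m : R.
Hypothesis m0 : 0 < m.

Lemma cmeas_V t : cmeasurable setT (fun p : R3 R => expi (t * eps m p) : C).
Proof.
apply: cmeas_expi; apply: measurable_funM; first exact: measurable_cst.
exact: measurable_eps.
Qed.

Lemma isom_V t : isom (V m t : (R3 R -> C) -> R3 R -> C).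
Proof. by apply: isom_mul; [exact: cmeas_V|move=> p; rewrite csq_expi]. Qed.

Lemma V_surj t (g : R3 R -> C) : L2 g -> exists2 f, L2 f & V m t f = g %[ae leb].
Proof.
move=> gL; exists (V m (- t) g); first by have [[L _ _] _] := isom_V (- t); exact: L.
apply: aeW => p _; rewrite /V mulrA -expiD -mulrDl subrr mul0r expi0 mul1r//.
Qed.

Lemma measurable_causal (D : set (R3 R)) t : D !=set0 -> t != 0 ->
  measurable (causal_nbhd t D).
Proof.
move=> D0 tn; have -> : causal_nbhd t D = causal_nbhd `|t| D.
  by rewrite /causal_nbhd normr_id.
by apply: measurable_causal_nbhd => //; rewrite normr_gt0.
Qed.

(** The total mass is |phi|^2 at both times, as [V] is unitary and v normalized. The upper bound on
    the mass far from D therefore becomes a lower bound on the mass in the neighbourhood. *)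
Lemma causal_mass (D : set (R3 R)) t (phi : R3 R -> C) : measurable D -> D !=set0 ->
  t != 0 -> L2 phi ->
  \sum_a nsq (ind D (vtr m a phi)) <=
  \sum_a nsq (ind (causal_nbhd t D) (vtr m a (V m t phi))).
Proof.
move=> mD D0 tn fL.
have LV : L2 (V m t phi) by have [[L _ _] _] := isom_V t; exact: L.
have L0 a : L2 (vtr m a phi) by exact: L2_vtr.
have Lt a : L2 (vtr m a (V m t phi)) by exact: L2_vtr.
have mN : measurable (causal_nbhd t D) by exact: measurable_causal.
have tot f : L2 f -> \sum_a nsq (vtr m a f) = nsq f.
  move=> hf; rewrite -(nsq_vmul_sum m0 hf); apply: eq_bigr => a _.
  by have [_ n] := isom_Finv R; apply: n; exact: L2_vmul.
have e1 := wnorm_indC mD L0; have e2 := wnorm_indC mN Lt.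
have h := far_propagation m0 D0 tn mD fL.
rewrite -(causal_nbhd_ind D0 tn Lt) in h.
rewrite tot// in e1; rewrite tot// (isom_V t).2// -e1 in e2.
rewrite -(wnorm_ind mD L0) -(wnorm_ind mN Lt).
move: e2 h; move: (wnorm _ _) (wnorm _ _) (wnorm _ _) (wnorm _ _) => a b c e; clear.
by move=> ? ?; lra.
Qed.

Lemma causal_T : causal_time_evolution m (@T_TM R m).
Proof.
move=> D mD t psi pL.
have pL' : L2 psi := pL.
have [fL fV] := op_invP (isom_V t) (@V_surj t) pL'.
set phi := op_inv (V m t) psi in fL fV.
have [[LV VE _] nV] := isom_V t.
have LT f : L2 f -> L2 (T_TM m D f) by have [[L _ _] _] := bop_T m0 mD; exact: L.
have -> : Defs.ip psi ((V m t \o T_TM m D \o op_inv (V m t)) psi) =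
    (\sum_a nsq (ind D (vtr m a phi)))%:C.
  rewrite -(ip_TT m0 mD fL) -(isom_ip (isom_V t) fL (LT _ fL)) /Defs.ip.
  have LVT : L2 (V m t (T_TM m D phi)) by exact: LV (LT _ fL).
  exact: (ae_eq_ip pL' (LV _ fL) LVT LVT (aeS fV) (ae_eq_refl _ _ _)).
have [mN h] : measurable (causal_nbhd t D) /\ \sum_a nsq (ind D (vtr m a phi)) <=
    \sum_a nsq (ind (causal_nbhd t D) (vtr m a (V m t phi))).
  (* [dist] is an infimum over D, so the empty set is treated apart. *)
  have [D0|/eqP/set0P D0] := pselect (D = set0).
    have -> : causal_nbhd t D = set0 by apply/seteqP; split=> // x [y]; rewrite D0.
    split; first exact: measurable0.
    apply: ler_sum => a _; rewrite D0; apply: (@le_trans _ _ 0); last exact: nsq_ge0.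
    rewrite le_eqVlt; apply/orP; left; apply/eqP; rewrite /nsq.
    under eq_Rintegral do rewrite /ind indic0 mul0r csq0.
    by rewrite Rintegral_cst ?mul0r.
  (* For t = 0 the set where [dist] vanishes is the closure of D and may exceed D by positive
     measure; but then the neighbourhood is D itself. *)
  have [->|tn] := eqVneq t 0; last first.
    by split; [exact: measurable_causal|exact: causal_mass].
  have -> : causal_nbhd 0 D = D.
    apply/seteqP; split=> x; last by move=> Dx; exists x => //; rewrite subrr /norm3 dot3E /= !mulr0 !addr0 sqrtr0 normr0.
    move=> [y Dy]; rewrite normr0 => h; have : norm3 (x - y) = 0.
      by apply/eqP; rewrite eq_le h norm3_ge0.
    by move=> /norm3_eq0 /eqP; rewrite subr_eq0 => /eqP ->.
  split; first exact: mD.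
  rewrite (_ : V m 0 phi = phi); first exact: lexx.
  apply: funext => p.
  by rewrite /V mul0r expi0 mul1r.
rewrite /Defs.ip (ip_TT m0 mN pL') lecR; apply: (le_trans h).
apply: ler_sum => a _; rewrite le_eqVlt; apply/orP; left; apply/eqP.
have LVf : L2 (V m t phi) by exact: LV.
apply: ae_eq_nsq; [apply: (L2_indf mN); exact: L2_vtr..|].
have [_ VTE _] := linear_vtr m0 a.
by apply: (ae_imp (VTE _ _ LVf pL' fV)) => x e hx; rewrite /ind (e hx).
Qed.

End Causality.

Theorem mainTheorem16 (R : realType) (m : R) (m_gt0 : 0 < m) :
  [/\ POL (@T_TM R m), finite_POL (@T_TM R m),
      causal_time_evolution m (@T_TM R m) & is_kernel (@T_TM R m) (@t_TM R m)].
Proof.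
split; [exact: POL_T|exact: finite_POL_T|exact: causal_T|exact: kernel_T].
Qed.
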